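(* Suppose $\mu$ is a regular cardinal and $\xi<\mu^+$. If the set \[S=\{\alpha<\mu:\ \alpha\text{ is }\Pi^1_{f^\mu_\xi(\alpha)}\text{-indescribable}\}\] is stationary in $\mu$ (for example, this will occur if $\mu$ is $\Pi^1_{\xi+1}$-indescribable), then there is an $\alpha<\mu$ which is nonisolated in the space $(\mu,\tau_{\xi+1})$.
   Context: Canonical functions. For every regular cardinal $\kappa$ and every ordinal $\xi$ with $\kappa\le\xi<\kappa^+$ fix a bijection $b_{\kappa,\xi}:\kappa\to\xi$, with $b_{\kappa,\kappa}=\mathrm{id}_\kappa$. For $\xi<\kappa^+$ and $\alpha<\kappa$ let $F^\kappa_\xi(\alpha)=\xi$ if $\xi<\kappa$, and $F^\kappa_\xi(\alpha)=b_{\kappa,\xi}[\alpha]$ if $\kappa\le\xi<\kappa^+$. Let $f^\kappa_\xi(\alpha)=\mathrm{ot}(F^\kappa_\xi(\alpha))$ and let $\pi^\kappa_{\xi,\alpha}:F^\kappa_\xi(\alpha)\to f^\kappa_\xi(\alpha)$ be the transitive collapse. Topologies $\tau_\xi$ and operators $d_\xi:P(\mu)\to P(\mu)$ for $\xi<\mu^+$. Let $\mathcal B_0$ consist of $\{0\}$ and all open intervals $(\alpha,\beta)$ with $\alpha<\beta\le\mu$; $\tau_0$ is the topology on $\mu$ generated by $\mathcal B_0$ and $d_0$ is its limit point operator. For $\xi<\mu$: $\mathcal B_{\xi+1}=\mathcal B_\xi\cup\{d_\xi(A):A\subseteq\mu\}$; for limit $\xi<\mu$, $\mathcal B_\xi=\bigcup_{\zeta<\xi}\mathcal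 B_\zeta$; in each case $\tau_\xi$ is the topology on $\mu$ generated by $\mathcal B_\xi$ (as a subbasis) and $d_\xi(A)$ is the set of limit points of $A$ in $(\mu,\tau_\xi)$. For $\mu\le\xi<\mu^+$ and $\alpha<\mu$ let $\mathcal T_\xi(\alpha)$ be the topology on $\mu$ generated by $\mathcal B_\xi(\alpha)=\mathcal B_0\cup\{d_\zeta(A):\zeta\in F^\mu_\xi(\alpha),\ A\subseteq\mu\}$, let $d_\xi(A)=\{\alpha<\mu:\alpha\text{ is a limit point of }A\text{ in the }\mathcal T_\xi(\alpha)\text{ topology}\}$, and let $\tau_\xi=\{U\subseteq\mu:d_\xi(\mu\setminus U)\subseteq\mu\setminus U\}$, which is a topology on $\mu$. Formulas. A formula is $\Pi^1_0$ (equivalently $\Sigma^1_0$) over $V_\kappa$ if it is a first-order formula of set theory (only first-order quantifiers) in which free variables and parameters of two types may occur: first-order ones (ranging over, resp. being, elements of $V_\kappa$) and second-order ones (ranging over, resp. being, subsets of $V_\kappa$). It is $\Pi^1_{\xi+1}$ over $V_\kappa$ if it has the form $\forall X_{k_1}\cdots\forall X_{k_m}\psi$ with $\psi$ a $\Sigma^1_\xi$ formula over $V_\kappa$, and $\Sigma^1_{\xi+1}$ if it has the form $\exists X_{k_1}\cdots\exists X_{k_m}\psi$ with $\psi$ a $\Pi^1_\xi$ formula over $V_\kappa$ ($m\in\omega$; second-order quantifiers). For $\xi$ a limit, a formula with finitely many second-order free variables and finitely many second-order parameters is $\Pi^1_\xi$ over $V_\kappa$ if it has the form $\bigwedge_{\zeta<\xi}\varphi_\zeta$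 with each $\varphi_\zeta$ being $\Pi^1_\zeta$ over $V_\kappa$, and $\Sigma^1_\xi$ if it has the form $\bigvee_{\zeta<\xi}\varphi_\zeta$ with each $\varphi_\zeta$ being $\Sigma^1_\zeta$ over $V_\kappa$. Restriction. For $\varphi$ a $\Pi^1_\xi$ or $\Sigma^1_\xi$ formula over $V_\kappa$, $\xi<\kappa^+$, and $\alpha<\kappa$ regular, $\varphi|^\kappa_\alpha$ is defined by recursion on $\xi$. If $\xi<\kappa$, replace each second-order parameter $A_i$ by $A_i\cap V_\alpha$. If $\xi=\zeta+1\geq\kappa$, the restriction of $\forall\vec X\psi$ is $\forall\vec X(\psi|^\kappa_\alpha)$ and that of $\exists\vec X\psi$ is $\exists\vec X(\psi|^\kappa_\alpha)$. If $\xi\ge\kappa$ is a limit and $\varphi=\bigwedge_{\zeta<\xi}\psi_\zeta$, then $\varphi|^\kappa_\alpha=\bigwedge_{\zeta<f^\kappa_\xi(\alpha)}\psi_{(\pi^\kappa_{\xi,\alpha})^{-1}(\zeta)}|^\kappa_\alpha$, provided $\psi_{(\pi^\kappa_{\xi,\alpha})^{-1}(\zeta)}|^\kappa_\alpha$ is a $\Pi^1_\zeta$ formula over $V_\alpha$ for every $\zeta<f^\kappa_\xi(\alpha)$; otherwise undefined. Similarly for $\Sigma^1_\xi$ with $\bigvee$. Indescribability. For a cardinal $\kappa$ and $\xi<\kappa^+$, $\kappa$ is $\Pi^1_\xi$-indescribable if for every $\Pi^1_\xi$ sentence $\varphi$ over $V_\kappa$ (parameters allowed), if $V_\kappa\models\varphi$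 then there is some $\alpha<\kappa$ with $V_\alpha\models\varphi|^\kappa_\alpha$ (which includes that $\varphi|^\kappa_\alpha$ is defined and is a formula over $V_\alpha$). If $\alpha$ is not a cardinal or $\eta\ge\alpha^+$, $\alpha$ does not count as $\Pi^1_\eta$-indescribable. *)

(* Defs.v *)
From HB Require Import structures.
From mathcomp Require Import all_boot all_order all_algebra.
From mathcomp Require Import all_classical all_reals all_analysis.

Set Implicit Arguments.
Unset Strict Implicit.
Unset Printing Implicit Defensive.

Local Open Scope classical_set_scope.
Local Open Scope quotient_scope.

(* The universe of sets: Aczel trees, branching over the types of a fixed    *)
(* universe, modulo bisimulation.  With choice and excluded middle this is a *)
(* model of (second-order) ZFC with Leibniz equality.                        *)

Inductive tree : Type := Node (I : Type) (f : I -> tree).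

HB.instance Definition _ := gen_eqMixin tree.
HB.instance Definition _ := gen_choiceMixin tree.

Fixpoint bisim (s t : tree) : Prop :=
  match s, t with
  | Node _ f, Node _ g =>
      (forall i, exists j, bisim (f i) (g j)) /\
      (forall j, exists i, bisim (f i) (g j))
  end.

Lemma bisim_refl s : bisim s s.
Proof. by elim: s => I f IH; split=> i; exists i. Qed.

Lemma bisim_sym s t : bisim s t -> bisim t s.
Proof.
elim: s t => I f IH [J g] [fg gf]; split.
  by move=> j; have [i /IH] := gf j; exists i.
by move=> i; have [j /IH] := fg i; exists j.
Qed.

Lemma bisim_trans t s u : bisim s t -> bisim t u -> bisim s u.
Proof.
elim: s t u => I f IH [J g] [K h] [fg gf] [gh hg]; split.
  by move=> i; have [j /IH ij] := fg i; have [k /ij] := gh j; exists k.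
by move=> k; have [j jk] := hg k; have [i /IH ij] := gf j; exists i; exact: ij.
Qed.

Definition bisimb (s t : tree) : bool := `[< bisim s t >].

Lemma bisimb_refl : reflexive bisimb.
Proof. by move=> s; apply/asboolP; exact: bisim_refl. Qed.

Lemma bisimb_sym : symmetric bisimb.
Proof. by move=> s t; apply/asboolP/asboolP; exact: bisim_sym. Qed.

Lemma bisimb_trans : transitive bisimb.
Proof.
move=> t s u /asboolP st /asboolP tu; apply/asboolP.
exact: bisim_trans st tu.
Qed.

Canonical bisim_equiv := EquivRel bisimb bisimb_refl bisimb_sym bisimb_trans.

Definition zfset : Type := {eq_quot bisimb}.
HB.instance Definition _ := gen_eqMixin zfset.
HB.instance Definition _ := gen_choiceMixin zfset.

Definition zpi (t : tree) : zfset := \pi_({eq_quot bisimb}) t.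
Definition zrepr (x : zfset) : tree := repr (x : {eq_quot bisimb}).

Lemma zreprK x : zpi (zrepr x) = x.
Proof. exact: reprK. Qed.

Lemma zpiP s t : zpi s = zpi t <-> bisim s t.
Proof.
split=> [/eqmodP/asboolP //|st].
by apply/eqmodP; apply/asboolP.
Qed.

Lemma bisim_repr_pi t : bisim (zrepr (zpi t)) t.
Proof. by apply/zpiP; rewrite zreprK. Qed.

Definition tree_mem (s t : tree) : Prop :=
  let: Node _ f := t in exists i, bisim s (f i).

Definition zmem (x y : zfset) : Prop := tree_mem (zrepr x) (zrepr y).

Notation "x ∈ y" := (zmem x y) (at level 70, no associativity).

Lemma zmem_node x I (f : I -> tree) :
  x ∈ zpi (Node f) <-> exists i, x = zpi (f i).
Proof.
rewrite /zmem; have := bisim_repr_pi (Node f).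
case: (zrepr _) => J g [gf fg]; split.
- move=> [j xj]; have [i ji] := gf j; exists i.
  by rewrite -(zreprK x); apply/zpiP; exact: bisim_trans xj ji.
- move=> [i ->]; have [j ji] := fg i; exists j.
  by apply: bisim_trans (bisim_repr_pi _) _; exact: bisim_sym.
Qed.

Lemma zfset_ext (x y : zfset) : (forall z, z ∈ x <-> z ∈ y) -> x = y.
Proof.
rewrite -(zreprK x) -(zreprK y).
case: (zrepr x) (zrepr y) => I f [J g] fg; apply/zpiP; split.
  move=> i; have /fg/zmem_node[j /zpiP] : zpi (f i) ∈ zpi (Node f).
    by apply/zmem_node; exists i.
  by exists j.
move=> j; have /fg/zmem_node[i /zpiP ji] : zpi (g j) ∈ zpi (Node g).
  by apply/zmem_node; exists j.
by exists i; exact: bisim_sym.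
Qed.

Lemma zmem_wf : well_founded zmem.
Proof.
move=> x; rewrite -(zreprK x); elim: (zrepr x) => I f IH.
by constructor=> y /zmem_node[i ->]; exact: IH.
Qed.

Definition elts (x : zfset) : set zfset := [set y | y ∈ x].

(* The set {x | P x} when the class P is a set, and an arbitrary value when  *)
(* P is a proper class.                                                      *)
Definition zset (P : set zfset) : zfset :=
  xget (zpi (Node (fun e : False => match e return tree with end)))
       [set x | elts x = P].

Lemma zset_elts x (P : set zfset) : elts x = P -> elts (zset P) = P.
Proof. by move=> xP; rewrite /zset; case: xgetP => [y _ //|/(_ x)]. Qed.

Lemma zset_image x (P : set zfset) (g : zfset -> zfset) :
  P `<=` elts x -> elts (zset (g @` P)) = g @` P.
Proof.
move=> Px; have := zreprK x; case E: (zrepr x) => [I f] xE.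
pose f' (i : {i | P (zpi (f i))}) := zrepr (g (zpi (f (sval i)))).
apply: (@zset_elts (zpi (Node f'))); apply/seteqP; split=> y.
  move=> /zmem_node[[i Pi] ->] /=; rewrite zreprK; by exists (zpi (f i)).
case=> z Pz <-; have := Px _ Pz; rewrite /elts /= -xE => /zmem_node[i zE].
apply/zmem_node; move: Pz; rewrite zE => Pz.
by exists (exist _ i Pz); rewrite /f' /= zreprK.
Qed.

(* Recursion on membership: the value at x depends on the restriction of the *)
(* function to the elements of x (extended by a0 elsewhere).                 *)
Definition mem_rec (A : Type) (a0 : A) (G : zfset -> (zfset -> A) -> A) :
    zfset -> A :=
  Fix zmem_wf (fun _ => A)
    (fun x rec => G x (fun y =>
       if pselect (y ∈ x) is left yx then rec y yx else a0)).

Lemma mem_recE A (a0 : A) G x :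
  mem_rec a0 G x =
  G x (fun y => if `[< y ∈ x >] then mem_rec a0 G y else a0).
Proof.
rewrite {1}/mem_rec Fix_eq; last first.
  move=> {}x g h gh; congr (G x _); apply/funext => y.
  by case: pselect.
congr (G x _); apply/funext => y; rewrite /asbool.
by case: pselect.
Qed.

(* Ordinals (von Neumann) and cardinals (initial ordinals).                  *)

(* Membership is well founded, so linearity makes it a well-order. *)
Definition is_ordinal (x : zfset) : Prop :=
  (forall y z, y ∈ x -> z ∈ y -> z ∈ x) /\
  (forall y z, y ∈ x -> z ∈ x -> [\/ y ∈ z, y = z | z ∈ y]).

Definition ozero : zfset := zset set0.
Definition osucc (x : zfset) : zfset := zset [set y | y ∈ x \/ y = x].
Definition ole (x y : zfset) : Prop := x ∈ y \/ x = y.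

Definition is_limit (x : zfset) : Prop :=
  [/\ is_ordinal x, x <> ozero & forall y, x <> osucc y].

Lemma ozeroP y : ~ y ∈ ozero.
Proof.
suff /zset_elts H : elts (zpi (Node (fun e : False => match e return tree with end))) = set0.
  by move=> h; have : elts ozero y by []; rewrite /ozero H.
by rewrite -subset0 => z /zmem_node[[]].
Qed.

Lemma osuccP x y : y ∈ osucc x <-> y ∈ x \/ y = x.
Proof.
have := zreprK x; case E: (zrepr x) => [I f] xE.
pose f' (i : option I) := if i is Some j then f j else zrepr x.
rewrite /osucc.
suff /zset_elts H : elts (zpi (Node f')) = [set y | y ∈ x \/ y = x].
  have := congr1 (fun A : set zfset => A y) H; rewrite /elts /= => ->; by [].
apply/seteqP; split=> z.
  move=> /zmem_node[[i|] ->] /=; last by right; rewrite zreprK.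
  by left; rewrite -xE; apply/zmem_node; exists i.
case=> [|->]; first by rewrite -xE => /zmem_node[i ->]; apply/zmem_node; exists (Some i).
by apply/zmem_node; exists None; rewrite /= zreprK.
Qed.

Lemma zmem_asym x y : x ∈ y -> ~ y ∈ x.
Proof.
elim/(well_founded_ind zmem_wf): x y => x IH y xy yx; exact: (IH y yx x).
Qed.

Lemma zmem_asym3 x y z : x ∈ y -> y ∈ z -> ~ z ∈ x.
Proof.
elim/(well_founded_ind zmem_wf): x y z => x IH y z xy yz zx; exact: (IH z zx x y).
Qed.

Lemma is_ordinal_in x z : is_ordinal x -> z ∈ x -> is_ordinal z.
Proof.
move=> [t l] zx; split=> [y w yz wy|y w yz wz]; last by apply: l; apply: t; eauto.
have yx := t _ _ zx yz; have wx := t _ _ yx wy.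
by case: (l w z wx zx) => // [wz|zw];
  [subst w; case: (zmem_asym yz wy)|case: (zmem_asym3 yz zw wy)].
Qed.

Definition is_cardinal (k : zfset) : Prop :=
  is_ordinal k /\
  forall a, a ∈ k -> ~ exists g : zfset -> zfset, set_bij (elts a) (elts k) g.

Definition cardinal_succ (k l : zfset) : Prop :=
  [/\ is_cardinal l, k ∈ l & forall m, is_cardinal m -> k ∈ m -> ole l m].

(* xi < k^+ *)
Definition lt_cardinal_succ (k xi : zfset) : Prop :=
  exists2 l, cardinal_succ k l & xi ∈ l.

(* For a cardinal, being a limit ordinal means being infinite. *)
Definition is_regular (k : zfset) : Prop :=
  [/\ is_cardinal k, is_limit k &
      forall a (g : zfset -> zfset), a ∈ k ->
        (forall c, c ∈ a -> g c ∈ k) ->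
        exists2 e, e ∈ k & forall c, c ∈ a -> g c ∈ e].

Definition club (mu : zfset) (C : set zfset) : Prop :=
  [/\ C `<=` elts mu,
      (forall a, a ∈ mu -> exists2 c, C c & a ∈ c) &
      (forall a, a ∈ mu -> is_limit a ->
         (forall e, e ∈ a -> exists c, [/\ C c, e ∈ c & c ∈ a]) -> C a)].

Definition stationary (mu : zfset) (S : set zfset) : Prop :=
  S `<=` elts mu /\ forall C, club mu C -> S `&` C !=set0.

(* V_a is the union of the power sets of the V_e, for e < a. *)
Inductive cumV : zfset -> set zfset :=
| cumV_intro a e x : e ∈ a -> elts x `<=` cumV e -> cumV a x.

(* Canonical functions, relative to a choice b of the bijections             *)
(* b k xi : k -> xi.                                                         *)

Definition canonical_bijections (b : zfset -> zfset -> zfset -> zfset) : Prop :=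
  forall k, is_regular k ->
    (forall xi, ole k xi -> lt_cardinal_succ k xi ->
       set_bij (elts k) (elts xi) (b k xi)) /\
    (forall a, a ∈ k -> b k k a = a).

Definition canF (b : zfset -> zfset -> zfset -> zfset)
    (k xi a : zfset) : set zfset :=
  if `[< xi ∈ k >] then elts xi else b k xi @` elts a.

(* Transitive collapse of a set X of ordinals. *)
Definition collapse (X : set zfset) : zfset -> zfset :=
  mem_rec ozero (fun x p => zset [set p y | y in [set y | y ∈ x /\ X y]]).

Definition order_type (X : set zfset) : zfset := zset (collapse X @` X).

Definition canf b (k xi a : zfset) : zfset := order_type (canF b k xi a).

Definition canpi b (k xi a : zfset) : zfset -> zfset :=
  collapse (canF b k xi a).

Inductive term1 := Var1 of nat | Par1 of zfset.
Inductive term2 := Var2 of nat | Par2 of set zfset.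

Inductive fo_formula :=
| FMem of term1 & term1
| FEq of term1 & term1
| FIn of term1 & term2
| FNot of fo_formula
| FAnd of fo_formula & fo_formula
| FAll of nat & fo_formula.

(* BigAnd xi phi is the conjunction of the phi z for z < xi; the values of   *)
(* phi outside xi are irrelevant.                                            *)
Inductive formula :=
| FO of fo_formula
| All2 of nat & formula
| Ex2 of nat & formula
| BigAnd of zfset & (zfset -> formula)
| BigOr of zfset & (zfset -> formula).

Definition term1_fv (t : term1) : set nat :=
  if t is Var1 n then [set n] else set0.
Definition term1_par (t : term1) : set zfset :=
  if t is Par1 a then [set a] else set0.
Definition term2_fv (t : term2) : set nat :=
  if t is Var2 n then [set n] else set0.
Definition term2_par (t : term2) : set (set zfset) :=
  if t is Par2 A then [set A] else set0.

Fixpoint fo_fv1 (p : fo_formula) : set nat :=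
  match p with
  | FMem s t | FEq s t => term1_fv s `|` term1_fv t
  | FIn s _ => term1_fv s
  | FNot q => fo_fv1 q
  | FAnd q r => fo_fv1 q `|` fo_fv1 r
  | FAll n q => fo_fv1 q `\ n
  end.

Fixpoint fo_fv2 (p : fo_formula) : set nat :=
  match p with
  | FMem _ _ | FEq _ _ => set0
  | FIn _ T => term2_fv T
  | FNot q => fo_fv2 q
  | FAnd q r => fo_fv2 q `|` fo_fv2 r
  | FAll _ q => fo_fv2 q
  end.

Fixpoint fo_par1 (p : fo_formula) : set zfset :=
  match p with
  | FMem s t | FEq s t => term1_par s `|` term1_par t
  | FIn s _ => term1_par s
  | FNot q => fo_par1 q
  | FAnd q r => fo_par1 q `|` fo_par1 r
  | FAll _ q => fo_par1 q
  end.

Fixpoint fo_par2 (p : fo_formula) : set (set zfset) :=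
  match p with
  | FMem _ _ | FEq _ _ => set0
  | FIn _ T => term2_par T
  | FNot q => fo_par2 q
  | FAnd q r => fo_par2 q `|` fo_par2 r
  | FAll _ q => fo_par2 q
  end.

Fixpoint fv1 (p : formula) : set nat :=
  match p with
  | FO q => fo_fv1 q
  | All2 _ q | Ex2 _ q => fv1 q
  | BigAnd xi q | BigOr xi q => \bigcup_(z in elts xi) fv1 (q z)
  end.

Fixpoint fv2 (p : formula) : set nat :=
  match p with
  | FO q => fo_fv2 q
  | All2 n q | Ex2 n q => fv2 q `\ n
  | BigAnd xi q | BigOr xi q => \bigcup_(z in elts xi) fv2 (q z)
  end.

Fixpoint par1 (p : formula) : set zfset :=
  match p with
  | FO q => fo_par1 q
  | All2 _ q | Ex2 _ q => par1 q
  | BigAnd xi q | BigOr xi q => \bigcup_(z in elts xi) par1 (q z)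
  end.

Fixpoint par2 (p : formula) : set (set zfset) :=
  match p with
  | FO q => fo_par2 q
  | All2 _ q | Ex2 _ q => par2 q
  | BigAnd xi q | BigOr xi q => \bigcup_(z in elts xi) par2 (q z)
  end.

Definition sentence (p : formula) : Prop := fv1 p = set0 /\ fv2 p = set0.

Definition formula_over (k : zfset) (p : formula) : Prop :=
  par1 p `<=` cumV k /\ (forall A, par2 p A -> A `<=` cumV k).

Definition term1_val (e1 : nat -> zfset) (t : term1) : zfset :=
  match t with Var1 n => e1 n | Par1 a => a end.
Definition term2_val (e2 : nat -> set zfset) (t : term2) : set zfset :=
  match t with Var2 n => e2 n | Par2 A => A end.

Fixpoint fo_sat (M : set zfset) (e1 : nat -> zfset) (e2 : nat -> set zfset)
    (p : fo_formula) : Prop :=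
  match p with
  | FMem s t => term1_val e1 s ∈ term1_val e1 t
  | FEq s t => term1_val e1 s = term1_val e1 t
  | FIn s T => term2_val e2 T (term1_val e1 s)
  | FNot q => ~ fo_sat M e1 e2 q
  | FAnd q r => fo_sat M e1 e2 q /\ fo_sat M e1 e2 r
  | FAll n q => forall x, M x -> fo_sat M [eta e1 with n |-> x] e2 q
  end.

Fixpoint sat (M : set zfset) (e1 : nat -> zfset) (e2 : nat -> set zfset)
    (p : formula) : Prop :=
  match p with
  | FO q => fo_sat M e1 e2 q
  | All2 n q => forall X, X `<=` M -> sat M e1 [eta e2 with n |-> X] q
  | Ex2 n q => exists2 X, X `<=` M & sat M e1 [eta e2 with n |-> X] q
  | BigAnd xi q => forall z, z ∈ xi -> sat M e1 e2 (q z)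
  | BigOr xi q => exists2 z, z ∈ xi & sat M e1 e2 (q z)
  end.

(* Only used for sentences, whose truth value does not depend on the         *)
(* assignment.                                                               *)
Definition models (a : zfset) (p : formula) : Prop :=
  sat (cumV a) (fun=> ozero) (fun=> set0) p.

(* The Pi^1_xi and Sigma^1_xi formulas over V_k. *)
Inductive is_Pi (k : zfset) : zfset -> formula -> Prop :=
| Pi_zero p : formula_over k (FO p) -> is_Pi k ozero (FO p)
| Pi_succ xi (ns : seq nat) p :
    is_Sigma k xi p -> is_Pi k (osucc xi) (foldr All2 p ns)
| Pi_limit xi p :
    is_limit xi ->
    (forall z, z ∈ xi -> is_Pi k z (p z)) ->
    finite_set (fv2 (BigAnd xi p)) -> finite_set (par2 (BigAnd xi p)) ->
    is_Pi k xi (BigAnd xi p)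
with is_Sigma (k : zfset) : zfset -> formula -> Prop :=
| Sigma_zero p : formula_over k (FO p) -> is_Sigma k ozero (FO p)
| Sigma_succ xi (ns : seq nat) p :
    is_Pi k xi p -> is_Sigma k (osucc xi) (foldr Ex2 p ns)
| Sigma_limit xi p :
    is_limit xi ->
    (forall z, z ∈ xi -> is_Sigma k z (p z)) ->
    finite_set (fv2 (BigOr xi p)) -> finite_set (par2 (BigOr xi p)) ->
    is_Sigma k xi (BigOr xi p).

Definition term2_cap_par2 (M : set zfset) (t : term2) : term2 :=
  match t with Var2 n => Var2 n | Par2 A => Par2 (A `&` M) end.

Fixpoint fo_cap_par2 (M : set zfset) (p : fo_formula) : fo_formula :=
  match p with
  | FMem s t => FMem s t
  | FEq s t => FEq s t
  | FIn s T => FIn s (term2_cap_par2 M T)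
  | FNot q => FNot (fo_cap_par2 M q)
  | FAnd q r => FAnd (fo_cap_par2 M q) (fo_cap_par2 M r)
  | FAll n q => FAll n (fo_cap_par2 M q)
  end.

Fixpoint cap_par2 (M : set zfset) (p : formula) : formula :=
  match p with
  | FO q => FO (fo_cap_par2 M q)
  | All2 n q => All2 n (cap_par2 M q)
  | Ex2 n q => Ex2 n (cap_par2 M q)
  | BigAnd xi q => BigAnd xi (fun z => cap_par2 M (q z))
  | BigOr xi q => BigOr xi (fun z => cap_par2 M (q z))
  end.

(* restr b k a xi p q: the restriction of p, taken as a Pi^1_xi or           *)
(* Sigma^1_xi formula over V_k, to the ordinal a is defined and equal to q.  *)
(* In the limit clauses the inverse of canpi is eliminated by reindexing:    *)
(* z = canpi y runs through canf as y runs through canF.                     *)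
Inductive restr b (k a : zfset) : zfset -> formula -> formula -> Prop :=
| restr_low xi p : xi ∈ k -> restr b k a xi p (cap_par2 (cumV a) p)
| restr_all xi (ns : seq nat) p q :
    is_regular k -> ole k (osucc xi) -> restr b k a xi p q ->
    restr b k a (osucc xi) (foldr All2 p ns) (foldr All2 q ns)
| restr_ex xi (ns : seq nat) p q :
    is_regular k -> ole k (osucc xi) -> restr b k a xi p q ->
    restr b k a (osucc xi) (foldr Ex2 p ns) (foldr Ex2 q ns)
| restr_and xi p q :
    is_regular k -> ole k xi -> is_limit xi ->
    (forall y, canF b k xi a y ->
       restr b k a y (p y) (q (canpi b k xi a y))) ->
    (forall y, canF b k xi a y ->
       is_Pi a (canpi b k xi a y) (q (canpi b k xi a y))) ->
    restr b k a xi (BigAnd xi p) (BigAnd (canf b k xi a) q)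
| restr_or xi p q :
    is_regular k -> ole k xi -> is_limit xi ->
    (forall y, canF b k xi a y ->
       restr b k a y (p y) (q (canpi b k xi a y))) ->
    (forall y, canF b k xi a y ->
       is_Sigma a (canpi b k xi a y) (q (canpi b k xi a y))) ->
    restr b k a xi (BigOr xi p) (BigOr (canf b k xi a) q).

(* Restrictions are only defined to regular a < k. *)
Definition indescribable b (k xi : zfset) : Prop :=
  [/\ is_cardinal k, lt_cardinal_succ k xi &
      forall p, is_Pi k xi p -> sentence p -> models k p ->
        exists a q, [/\ a ∈ k, is_regular a, restr b k a xi p q,
                        formula_over a q & models a q]].

(* T with the topology generated by the subbasis B. *)
Definition generated (T : choiceType) (B : set (set T)) : Type := T.
HB.instance Definition _ (T : choiceType) (B : set (set T)) :=
  Choice.copy (generated B) T.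
HB.instance Definition _ (T : choiceType) (B : set (set T)) :=
  @isSubBaseTopological.Build (generated B) (set T : pointedType) B id.

Definition below (mu : zfset) : choiceType := set_type (elts mu).

Definition B0 (mu : zfset) : set (set (below mu)) :=
  [set [set x : below mu | val x = ozero]] `|`
  [set U | exists c e, [/\ c ∈ e, ole e mu &
                        U = [set x : below mu | c ∈ val x /\ val x ∈ e]]].

(* B_xi for xi < mu, from the operators d_zeta for zeta < xi. *)
Inductive subbasis mu (d : zfset -> set (below mu) -> set (below mu)) :
    zfset -> set (set (below mu)) :=
| subbasis_zero U : B0 U -> subbasis d ozero U
| subbasis_old xi U : subbasis d xi U -> subbasis d (osucc xi) U
| subbasis_new xi A : subbasis d (osucc xi) (d xi A)
| subbasis_limit xi z U :
    is_limit xi -> z ∈ xi -> subbasis d z U -> subbasis d xi U.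

(* B_xi(a) for mu <= xi. *)
Definition local_subbasis b mu
    (d : zfset -> set (below mu) -> set (below mu))
    (xi : zfset) (a : below mu) : set (set (below mu)) :=
  @B0 mu `|` [set U | exists2 z, canF b mu xi (val a) z & exists A, U = d z A].

Definition d_step b mu (xi : zfset)
    (d : zfset -> set (below mu) -> set (below mu))
    (A : set (below mu)) : set (below mu) :=
  if `[< xi ∈ mu >] then limit_point (A : set (generated (subbasis d xi)))
  else [set a | limit_point (A : set (generated (local_subbasis b d xi a))) a].

Definition d_op b mu : zfset -> set (below mu) -> set (below mu) :=
  mem_rec (fun=> set0) (@d_step b mu).

(* The defining equation of the operators d_xi, xi < mu^+. *)
Lemma subbasis_eq mu (d d' : zfset -> set (below mu) -> set (below mu)) xi :
  is_ordinal xi -> (forall z, z ∈ xi -> d z = d' z) -> subbasis d xi `<=` subbasis d' xi.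
Proof.
move=> oxi dd U h; elim: h oxi dd => [V BV|x V _ IH|x A|x z V lx zx _ IH] ox dd.
- exact: subbasis_zero.
- apply: subbasis_old; apply: IH; first by apply: is_ordinal_in ox _; apply/osuccP; right.
  by move=> z zx; apply: dd; apply/osuccP; left.
- rewrite dd; last by apply/osuccP; right.
  exact: subbasis_new.
- apply: (@subbasis_limit _ _ _ z) => //; apply: IH; first exact: is_ordinal_in zx.
  move=> y yz; apply: dd; case: ox => t _; exact: t yz.
Qed.

Lemma d_opE b mu xi : is_ordinal xi ->
  (~ xi ∈ mu -> forall a, a ∈ mu -> canF b mu xi a `<=` elts xi) ->
  @d_op b mu xi = @d_step b mu xi (@d_op b mu).
Proof.
move=> oxi hF; rewrite {1}/d_op mem_recE -/(d_op b (mu:=mu)).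
rewrite /d_step; apply/funext => A; case: (asboolP (xi ∈ mu)) => [xm|/hF xm].
  set B := subbasis _ _; set B' := subbasis _ _.
  suff -> : B = B' by [].
  apply/seteqP; split; apply: subbasis_eq => // z /asboolP zx; by rewrite zx.
apply/seteqP; split=> a /=; set B := local_subbasis _ _ _ _; set B' := local_subbasis _ _ _ _;
 suff -> : B = B' by [].
all: have am : val a ∈ mu by case: a @B @B' => a /= /set_mem.
all: rewrite /B /B' /local_subbasis; congr (_ `|` _); apply/seteqP; split=> U /= [z Fz [A' ->]];
  exists z => //; exists A'; by move: (xm _ am _ Fz) => /asboolP ->.
Qed.

Definition tau b mu (xi : zfset) : set (set (below mu)) :=
  if `[< xi ∈ mu >]
  then [set U | open (U : set (generated (subbasis (@d_op b mu) xi)))]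
  else [set U | @d_op b mu xi (~` U) `<=` ~` U].

Definition nonisolated (T : Type) (opens : set (set T)) (a : T) : Prop :=
  ~ opens [set a].

(* Main.v *)
(* A formula of level below mu^+ is evaluated as a game of transfinite length: a successor level is
   a move (a subset of the universe), a limit level is a choice of a smaller level, and the value
   at level 0 is a combination of statements that the traces of the moves on V_g, for unboundedly
   many g < k, satisfy a relation R.
   Restricting a sentence to alpha amounts to playing the same game inside V_alpha, with levels in
   F^mu_xi(alpha); the levels are named by their codes, the ordinals below mu given by the
   bijection b.

   First part.  The game in which the two players evaluate a relation X given on tuples of traces,
   along the sequence of levels visited, is universal: for every Pi^1_eta formula phi over V_alpha,
   eta = f_xi(alpha), some X makes it equivalent to phi at alpha, and to a restriction of phi at
   the points of a club of alpha that X also carries.  That the truth of the game for X implies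
   its truth at a suitable beta < alpha is a Pi^1_(xi+1) statement about all X.  It holds at mu, as
   the Pi^1_xi game can be played one level higher, so it reflects to some alpha in a given club,
   and there it says that alpha is Pi^1_(f_xi(alpha))-indescribable.

   Second part.  That alpha is a limit point in tau_zeta of finitely many sets, zeta <= xi, is the
   value of such a game of level zeta; at an alpha in S the game reflects below alpha, so that
   alpha is a limit point of mu minus {alpha} in tau_(xi+1). *)
From HB Require Import structures.
From mathcomp Require Import finmap.
From mathcomp Require Import all_boot all_order all_algebra.
From mathcomp Require Import all_classical all_reals all_analysis.
From mathcomp Require Import zify.
From Stdlib Require List.
Require Import Defs.

Set Implicit Arguments.
Unset Strict Implicit.
Unset Printing Implicit Defensive.

Local Open Scope classical_set_scope.
Local Open Scope card_scope.

(** * Sets and ordinals *)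

(** Indescribability of [al] quantifies over infinitary formulas, which are not subsets of V_al.
    What makes a single set [X] suffice is that a first-order statement over V_al holds iff it holds
    of the traces on V_d for almost all [d], so that a formula is determined by the relation of its
    residual first-order formulas on tuples of traces. Two obstacles shape the universal game. The
    club on which the traces decide correctly depends on the moves made; therefore the last move
    also offers test points, and bad test points only harm the player who offers them. And a Pi
    formula of limit level is a conjunction, while one level up a block of universal quantifiers is
    followed by a disjunction, so that idle quantifiers do not raise the level; therefore levels are
    declared by a set and then picked. Clubs are handled as the closure points of a function on
    V_mu. Limits of closure points are closure points, so one first-order clause with a parameter,
    saying that they are unbounded, places the reflecting point in any prescribed club. *)

Definition small (P : set zfset) : Prop := exists x, elts x = P.

Lemma elts_inj x y : elts x = elts y -> x = y.
Proof.
move=> xy; apply: zfset_ext => z.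
by have := congr1 (@^~ z) xy; rewrite /elts /= => ->.
Qed.

Lemma small_elts x : small (elts x). Proof. by exists x. Qed.

Lemma zsetP P : small P -> forall y, y ∈ zset P <-> P y.
Proof.
move=> [x xP] y; have := congr1 (@^~ y) (zset_elts xP).
by rewrite /elts /= => ->.
Qed.

Lemma zset_eltsK x : zset (elts x) = x.
Proof. by apply: elts_inj; exact: (@zset_elts x). Qed.

Lemma small_range (I : Type) (F : I -> zfset) : small (range F).
Proof.
exists (zpi (Node (fun i => zrepr (F i)))); apply/seteqP; split=> y.
  by move=> /zmem_node[i ->]; rewrite zreprK; exists i.
by move=> [i _ <-]; apply/zmem_node; exists i; rewrite zreprK.
Qed.

Lemma elts_range x : exists (I : Type) (F : I -> zfset), elts x = range F.
Proof.
rewrite -(zreprK x); case: (zrepr x) => I f; exists I, (fun i => zpi (f i)).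
apply/seteqP; split=> y; first by move=> /zmem_node[i ->]; exists i.
by move=> [i _ <-]; apply/zmem_node; exists i.
Qed.

Lemma small_sub x (P : set zfset) : P `<=` elts x -> small P.
Proof.
have [I [F ->]] := elts_range x => PF.
suff -> : P = range (fun i : {i | P (F i)} => F (sval i)) by exact: small_range.
apply/seteqP; split=> y.
  move=> Py; have [i _ Fi] := PF _ Py; move: (Py); rewrite -Fi => Pi.
  by exists (exist _ i Pi).
by move=> [[i Pi] _ <-].
Qed.

Lemma small_subset (P Q : set zfset) : small Q -> P `<=` Q -> small P.
Proof. by move=> [x <-]; exact: small_sub. Qed.

Lemma small_image (P : set zfset) (g : zfset -> zfset) : small P -> small (g @` P).
Proof.
move=> [x <-]; have [I [F ->]] := elts_range x.
suff -> : g @` range F = range (fun i => g (F i)) by exact: small_range.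
apply/seteqP; split=> y; first by move=> [z [i _ <-] <-]; exists i.
by move=> [i _ <-]; exists (F i) => //; exists i.
Qed.

(** Read off the representative [zrepr x], the index type becomes a function of the set, so that the
    dependent sum of index types in [small_bigcup] can be formed. *)
Definition tree_index (t : tree) : Type := match t with Node J _ => J end.
Definition tree_child (t : tree) : tree_index t -> zfset :=
  match t with Node _ f => fun i => zpi (f i) end.

Lemma elts_tree x : elts x = range (@tree_child (zrepr x)).
Proof.
rewrite -{1}(zreprK x); case: (zrepr x) => I f /=.
apply/seteqP; split=> y; first by move=> /zmem_node[i ->]; exists i.
by move=> [i _ <-]; apply/zmem_node; exists i.
Qed.

Lemma small_bigcup (P : set zfset) (G : zfset -> set zfset) :
  small P -> (forall y, P y -> small (G y)) -> small (\bigcup_(y in P) G y).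
Proof.
move=> [x <-] sG; have E := elts_tree x.
pose J := {i : tree_index (zrepr x) & tree_index (zrepr (zset (G (tree_child i))))}.
suff -> : \bigcup_(y in elts x) G y =
          range (fun j : J => @tree_child _ (projT2 j)) by exact: small_range.
have key i : G (@tree_child (zrepr x) i) =
             range (@tree_child (zrepr (zset (G (tree_child i))))).
  rewrite -elts_tree; apply/esym; have [|u uE] := sG (@tree_child (zrepr x) i).
    by rewrite E; exists i.
  exact: zset_elts uE.
have keyR i z : range (@tree_child (zrepr (zset (G (@tree_child (zrepr x) i))))) z ->
    G (@tree_child (zrepr x) i) z by rewrite -key.
apply/seteqP; split=> z.
  move=> [y]; rewrite E => -[i _ <-]; rewrite key => -[j _ <-].
  by exists (existT _ i j).
move=> [[i j] _ <-]; exists (@tree_child _ i); first by rewrite E; exists i.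
by apply: keyR; exists j.
Qed.

Lemma small_power x : small [set y | elts y `<=` elts x].
Proof.
have [I [F E]] := elts_range x.
(* By excluded middle the Boolean predicates on the index type give all subsets, and they form a
   type in the same universe. *)
pose G (p : I -> bool) := zset [set F i | i in [set i | p i]].
suff -> : [set y | elts y `<=` elts x] = range G by exact: small_range.
have sG p : small [set F i | i in [set i | p i]].
  by apply: (@small_sub x); rewrite E => z [i _ <-]; exists i.
apply/seteqP; split=> y.
  move=> /= yx; exists (fun i => `[< F i ∈ y >]) => //; apply: elts_inj.
  apply/seteqP; split=> z; first by move=> /(zsetP (sG _))[i /asboolP Fy <-].
  move=> zy; apply/(zsetP (sG _)); move: (yx _ zy); rewrite E => -[i _ Fz].
  by exists i => //=; apply/asboolP; rewrite Fz.
by move=> [p _ <-] z /(zsetP (sG _))[i _ <-]; rewrite E; exists i.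
Qed.

Lemma small_setU (P Q : set zfset) : small P -> small Q -> small (P `|` Q).
Proof.
move=> [x <-] [y <-]; have [I [F ->]] := elts_range x; have [J [G ->]] := elts_range y.
suff -> : range F `|` range G =
   range (fun s : I + J => match s with inl i => F i | inr j => G j end).
  exact: small_range.
apply/seteqP; split=> z; first by case=> -[i _ <-]; [exists (inl i)|exists (inr i)].
by case=> -[i|j] _ <-; [left; exists i|right; exists j].
Qed.

Lemma small_set1 x : small [set x].
Proof.
suff -> : [set x] = range (fun _ : unit => x) by exact: small_range.
by apply/seteqP; split=> y; [move=> ->; exists tt|move=> [_ _ <-]].
Qed.

Definition upair x y : zfset := zset [set z | z = x \/ z = y].

Lemma upairP x y z : z ∈ upair x y <-> z = x \/ z = y.
Proof. by apply: zsetP; exact: (small_setU (small_set1 x) (small_set1 y)). Qed.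

Definition pr x y : zfset := upair (upair x x) (upair x y).

Lemma prP x y z : z ∈ pr x y <->
  (forall w, w ∈ z <-> w = x) \/ (forall w, w ∈ z <-> w = x \/ w = y).
Proof.
rewrite /pr; split.
  move=> /upairP[->|->]; [left|right] => w; rewrite upairP //.
  by split=> [[]|->] //; left.
move=> h; apply/upairP; case: h => h; [left|right]; apply: zfset_ext => w;
  rewrite h upairP //.
by split=> [->|[]] //; left.
Qed.

Lemma pr_inj x y x' y' : pr x y = pr x' y' -> x = x' /\ y = y'.
Proof.
move=> E.
have xx' : x = x'.
  have : upair x x ∈ pr x' y' by rewrite -E; apply/upairP; left.
  move=> /upairP[] e; first by
    (have /upairP[]// : x ∈ upair x' x' by rewrite -e; apply/upairP; left).
  have : x' ∈ upair x x by rewrite e; apply/upairP; left.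
  by move=> /upairP[].
split=> //; subst x'.
have : upair x y ∈ pr x y' by rewrite -E; apply/upairP; right.
move=> /upairP[] e.
  have : y ∈ upair x x by rewrite -e; apply/upairP; right.
  move=> /upairP h; have yx : y = x by case: h.
  subst y; have : upair x y' ∈ pr x x by rewrite E; apply/upairP; right.
  move=> /upairP h'; have {}h' : upair x y' = upair x x by case: h'.
  have : y' ∈ upair x x by rewrite -h'; apply/upairP; right.
  by move=> /upairP[].
have : y ∈ upair x y' by rewrite -e; apply/upairP; right.
move=> /upairP[yx|//]; subst y.
have : y' ∈ upair x x by rewrite e; apply/upairP; right.
by move=> /upairP[].
Qed.

Lemma pr_neq0 x y : pr x y <> ozero.
Proof. by move=> E; apply: (@ozeroP (upair x x)); rewrite -E; apply/upairP; left. Qed.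

Fixpoint lst (l : seq zfset) : zfset :=
  if l is a :: l' then pr a (lst l') else ozero.

Lemma lst_inj : injective lst.
Proof.
elim=> [|a l IH] [|b l'] //=; first by move=> /esym/pr_neq0.
  by move=> /pr_neq0.
by move=> /pr_inj[-> /IH ->].
Qed.

Lemma zmem_irr x : ~ x ∈ x.
Proof. by move=> xx; exact: (zmem_asym xx xx). Qed.

Lemma ord_trans a x y : is_ordinal a -> x ∈ y -> y ∈ a -> x ∈ a.
Proof. by move=> [t _] xy ya; exact: t ya xy. Qed.

Lemma ord_comparable a b : is_ordinal a -> is_ordinal b -> [\/ a ∈ b, a = b | b ∈ a].
Proof.
elim/(well_founded_ind zmem_wf): a b => a IHa b oa.
elim/(well_founded_ind zmem_wf): b => b IHb ob.
have [[y [ya yb]]|h1] := pselect (exists y, y ∈ a /\ (b = y \/ b ∈ y)).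
  by constructor 3; case: yb => [->//|by_]; exact: ord_trans ya.
have [[z [zb za]]|h2] := pselect (exists z, z ∈ b /\ (a = z \/ a ∈ z)).
  by constructor 1; case: za => [->//|az]; exact: ord_trans zb.
constructor 2; apply: zfset_ext => w; split=> hw.
  case: (IHa w hw b (is_ordinal_in oa hw) ob) => //.
    by move=> e; case: h1; exists w; split=> //; left.
  by move=> e; case: h1; exists w; split=> //; right.
case: (IHb w hw (is_ordinal_in ob hw)) => //.
  by move=> e; case: h2; exists w; split=> //; right.
by move=> e; case: h2; exists w; split=> //; left.
Qed.

Lemma ord_of_trans x : (forall y, y ∈ x -> is_ordinal y) ->
  (forall y z, y ∈ x -> z ∈ y -> z ∈ x) -> is_ordinal x.
Proof. by move=> ox tx; split=> // y z yx zx; apply: ord_comparable; exact: ox. Qed.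

Lemma ord_zero : is_ordinal ozero.
Proof. by split=> [y z /ozeroP|y z /ozeroP]. Qed.

Lemma ord_succ x : is_ordinal x -> is_ordinal (osucc x).
Proof.
move=> ox; apply: ord_of_trans => [y /osuccP[/(is_ordinal_in ox)//|->//]|y z].
by move=> /osuccP[yx|->] zy; apply/osuccP; left=> //; exact: ord_trans yx.
Qed.

Lemma osucc_mem x : x ∈ osucc x. Proof. by apply/osuccP; right. Qed.
Lemma osucc_memW x y : y ∈ x -> y ∈ osucc x. Proof. by move=> ?; apply/osuccP; left. Qed.

Lemma osucc_inj x y : osucc x = osucc y -> x = y.
Proof.
move=> E.
have /osuccP[xy|//] : x ∈ osucc y by rewrite -E; exact: osucc_mem.
have /osuccP[yx|//] : y ∈ osucc x by rewrite E; exact: osucc_mem.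
by case: (zmem_asym xy).
Qed.

Lemma osucc_neq0 x : osucc x <> ozero.
Proof. by move=> E; apply: (@ozeroP x); rewrite -E; exact: osucc_mem. Qed.

Lemma osucc_ord x : is_ordinal (osucc x) -> is_ordinal x.
Proof. by move=> /is_ordinal_in; apply; exact: osucc_mem. Qed.

Lemma ord_case x : is_ordinal x ->
  [\/ x = ozero, exists2 y, is_ordinal y & x = osucc y | is_limit x].
Proof.
move=> ox; have [->|x0] := pselect (x = ozero); first by constructor 1.
have [[y E]|xS] := pselect (exists y, x = osucc y).
  by constructor 2; exists y => //; apply: osucc_ord; rewrite -E.
by constructor 3; split=> // y E; apply: xS; exists y.
Qed.

Lemma ord_zero_in x : is_ordinal x -> x <> ozero -> ozero ∈ x.
Proof.
move=> ox x0; case: (ord_comparable ord_zero ox) => // [E|/ozeroP//].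
by case: x0.
Qed.

Lemma ole_or_mem x y : is_ordinal x -> is_ordinal y -> ole x y \/ y ∈ x.
Proof.
by move=> ox oy; case: (ord_comparable ox oy); [left; left|left; right|right].
Qed.

Lemma ole_osucc x y : is_ordinal y -> x ∈ y -> ole (osucc x) y.
Proof.
move=> oy xy; have ox := is_ordinal_in oy xy.
case: (ole_or_mem (ord_succ ox) oy) => // /osuccP[yx|yx].
  by case: (zmem_asym xy).
by subst y; case: (zmem_irr xy).
Qed.

Lemma ole_trans_mem x y z : is_ordinal z -> ole x y -> y ∈ z -> x ∈ z.
Proof. by move=> oz [xy|->//] yz; exact: ord_trans yz. Qed.

Lemma mem_ole_trans x y z : is_ordinal z -> x ∈ y -> ole y z -> x ∈ z.
Proof. by move=> oz xy [yz|<-//]; exact: ord_trans yz. Qed.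

Lemma ole_subset x y : is_ordinal y -> ole x y -> elts x `<=` elts y.
Proof. by move=> oy [xy|->//] z zx; exact: ord_trans xy. Qed.

Lemma subset_ole x y : is_ordinal x -> is_ordinal y -> elts x `<=` elts y -> ole x y.
Proof.
by move=> ox oy xy; case: (ole_or_mem ox oy) => // /xy /zmem_irr.
Qed.

Lemma limit_ord x : is_limit x -> is_ordinal x. Proof. by case. Qed.

Lemma limit_zero x : is_limit x -> ozero ∈ x.
Proof. by case=> ox x0 _; exact: ord_zero_in. Qed.

Lemma limit_succ x y : is_limit x -> y ∈ x -> osucc y ∈ x.
Proof. by case=> ox _ xS yx; case: (ole_osucc ox yx) => // /esym/xS. Qed.

Lemma limit_osucc x : ~ is_limit (osucc x).
Proof. by case=> _ _ /(_ x). Qed.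

Lemma limit_max x y z : is_limit z -> x ∈ z -> y ∈ z ->
  exists w, [/\ w ∈ z, ole x w & ole y w].
Proof.
move=> lz xz yz; have oz := limit_ord lz.
case: (ole_or_mem (is_ordinal_in oz xz) (is_ordinal_in oz yz)) => h.
  by exists y; split=> //; right.
by exists x; split=> //; [right|left].
Qed.

Lemma cumVE a x : cumV a x <-> exists2 e, e ∈ a & elts x `<=` cumV e.
Proof. by split=> [[{}a e {}x ea xe]|[e ea xe]]; [exists e|exact: cumV_intro xe]. Qed.

Lemma cumV_sub a e : elts e `<=` elts a -> cumV e `<=` cumV a.
Proof. by move=> ea x /cumVE[e' /ea e'a xe']; apply/cumVE; exists e'. Qed.

Lemma cumV_mono a e : is_ordinal a -> ole e a -> cumV e `<=` cumV a.
Proof. by move=> oa ea; apply: cumV_sub; exact: ole_subset. Qed.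

Lemma cumV_trans a x y : is_ordinal a -> cumV a x -> y ∈ x -> cumV a y.
Proof.
move=> oa /cumVE[e ea xe] /xe; apply: cumV_mono => //; by left.
Qed.

Lemma cumV_subset a x y : cumV a x -> elts y `<=` elts x -> cumV a y.
Proof. by move=> /cumVE[e ea xe] yx; apply/cumVE; exists e => // z /yx /xe. Qed.

Lemma cumV_ordW a e : e ∈ a -> is_ordinal e -> cumV a e.
Proof.
elim/(well_founded_ind zmem_wf): e a => e IH a ea oe; apply/cumVE; exists e => // y ye.
by apply: IH => //; exact: is_ordinal_in ye.
Qed.

Lemma cumV_ord a e : is_ordinal a -> is_ordinal e -> cumV a e <-> e ∈ a.
Proof.
move=> oa oe; split=> [|ea]; last exact: cumV_ordW.
elim/(well_founded_ind zmem_wf): a e oa oe => a IH e oa oe /cumVE[e' e'a ee'].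
have oe' := is_ordinal_in oa e'a.
suff ee : ole e e' by exact: ole_trans_mem ee e'a.
apply: subset_ole => // y ye; apply: IH => //; last exact: ee'.
exact: is_ordinal_in ye.
Qed.

Lemma small_cumV a : small (cumV a).
Proof.
elim/(well_founded_ind zmem_wf): a => a IH.
suff -> : cumV a = \bigcup_(e in elts a) [set x | elts x `<=` cumV e].
  apply: small_bigcup; first exact: small_elts.
  by move=> e /IH[v <-]; exact: small_power.
by apply/seteqP; split=> x; [move=> /cumVE[e ea xe]; exists e|move=> [e ea xe]; apply/cumVE; exists e].
Qed.

(** The name of the ordinal [a] inside larger levels: a trace on V_a is the intersection with this
    element, so a first-order formula can speak of traces without defining ranks. *)
Definition Vz a : zfset := zset (cumV a).

Lemma Vz_elts a : elts (Vz a) = cumV a.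
Proof. by have [x xE] := small_cumV a; exact: zset_elts xE. Qed.

Lemma VzP a x : x ∈ Vz a <-> cumV a x.
Proof. by rewrite -Vz_elts. Qed.

Lemma Vz_mem a e : e ∈ a -> cumV a (Vz e).
Proof. by move=> ea; apply/cumVE; exists e => //; rewrite Vz_elts. Qed.

Lemma mem_Vz a e : is_ordinal a -> is_ordinal e -> cumV a (Vz e) -> e ∈ a.
Proof.
move=> oa oe /cumVE[e' e'a]; rewrite Vz_elts => h.
have oe' := is_ordinal_in oa e'a.
case: (ole_or_mem oe oe') => [ee'|e'e]; first exact: ole_trans_mem ee' e'a.
have := cumV_ordW e'e oe' => /h /(cumV_ord oe' oe') /zmem_irr //.
Qed.

Lemma Vz_inj a e : is_ordinal a -> is_ordinal e -> Vz a = Vz e -> a = e.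
Proof.
move=> oa oe E; have VE : cumV a = cumV e by rewrite -!Vz_elts E.
case: (ord_comparable oa oe) => // h.
  by have := cumV_ordW h oa; rewrite -VE => /(cumV_ord oa oa)/zmem_irr.
by have := cumV_ordW h oe; rewrite VE => /(cumV_ord oe oe)/zmem_irr.
Qed.

Lemma cumV_limit g x : is_limit g -> cumV g x -> exists2 e, e ∈ g & cumV e x.
Proof.
move=> lg /cumVE[e eg xe]; exists (osucc e); first exact: limit_succ.
by apply/cumVE; exists e => //; exact: osucc_mem.
Qed.

Lemma cumV_limit2 g x y : is_limit g -> cumV g x -> cumV g y ->
  exists e, [/\ e ∈ g, cumV e x & cumV e y].
Proof.
move=> lg /(cumV_limit lg)[e eg xe] /(cumV_limit lg)[e' e'g ye'].
have [w [wg ew e'w]] := limit_max lg eg e'g.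
have ow := is_ordinal_in (limit_ord lg) wg.
by exists w; split=> //; [exact: cumV_mono xe|exact: cumV_mono ye'].
Qed.

Lemma cumV_sup g e x : e ∈ g -> elts x `<=` cumV e -> cumV g x.
Proof. by move=> eg xe; apply/cumVE; exists e. Qed.

Lemma cumV_upair g x y : is_limit g -> cumV g x -> cumV g y -> cumV g (upair x y).
Proof.
move=> lg /(cumV_limit2 lg) h /h[e [eg ex ey]].
by apply: cumV_sup eg _ => z /upairP[->|->].
Qed.

Lemma cumV_pr g x y : is_limit g -> cumV g (pr x y) <-> cumV g x /\ cumV g y.
Proof.
move=> lg; have og := limit_ord lg; split=> [h|[hx hy]].
  have : cumV g (upair x y) by apply: cumV_trans h _ => //; apply/upairP; right.
  by move=> h'; split; apply: cumV_trans h' _ => //; apply/upairP; [left|right].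
by apply: cumV_upair => //; exact: cumV_upair.
Qed.

Lemma cumV_zero g : is_limit g -> cumV g ozero.
Proof. by move=> lg; apply: cumV_ordW; [exact: limit_zero|exact: ord_zero]. Qed.

Lemma cumV_lst g l : is_limit g ->
  cumV g (lst l) <-> (forall a, a \in l -> cumV g a).
Proof.
move=> lg; elim: l => [|a l IH] /=; first by split=> // _; exact: cumV_zero.
rewrite cumV_pr // IH; split.
  by move=> [ha hl] c; rewrite in_cons => /orP[/eqP->//|/hl].
by move=> h; split=> [|c cl]; apply: h; rewrite in_cons ?eqxx // cl orbT.
Qed.

Definition ztag (n : nat) : zfset := lst (nseq n ozero).

Lemma ztag_inj : injective ztag.
Proof. by move=> m n /lst_inj/(congr1 size); rewrite !size_nseq. Qed.

Lemma cumV_ztag g n : is_limit g -> cumV g (ztag n).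
Proof.
move=> lg; apply/cumV_lst => // a; rewrite mem_nseq => /andP[_ /eqP->].
exact: cumV_zero.
Qed.

(** * Closure points *)

(** Replacement for V_k, stated for all sets in V_k and not only for ordinals. With an infinite
    limit below [k] it takes the place of inaccessibility, and cardinal arithmetic is avoided. *)
Definition zbounded k := forall a (g : zfset -> zfset), cumV k a ->
  (forall c, c ∈ a -> g c ∈ k) -> exists2 e, e ∈ k & forall c, c ∈ a -> g c ∈ e.

Definition inacc k :=
  [/\ is_limit k, exists2 e, e ∈ k & is_limit e & zbounded k].

(** Closure is asked on all of V_g because the functions act on codes of pairs, tuples and paths. It
    passes to limits ([clos_limit]), so a sentence can enforce it. *)
Definition clos (h : zfset -> zfset) g := is_limit g /\ forall x, cumV g x -> h x ∈ g.

Definition maps k (h : zfset -> zfset) := forall x, cumV k x -> h x ∈ k.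

(* For k inaccessible: E holds on a club of k. *)
Definition almost k (E : zfset -> Prop) :=
  exists2 h, maps k h & forall g, g ∈ k -> clos h g -> E g.

Lemma inacc_limit k : inacc k -> is_limit k. Proof. by case. Qed.
Lemma inacc_ord k : inacc k -> is_ordinal k.
Proof. by move=> /inacc_limit/limit_ord. Qed.

Lemma almost_mono k (E F : zfset -> Prop) :
  (forall g, g ∈ k -> is_limit g -> E g -> F g) -> almost k E -> almost k F.
Proof. by move=> EF [h hm hE]; exists h => // g gk hg; apply: EF => //; [case: hg|exact: hE]. Qed.

Lemma almost_all k (E : zfset -> Prop) : is_limit k ->
  (forall g, g ∈ k -> is_limit g -> E g) -> almost k E.
Proof.
move=> lk hE; exists (fun=> ozero); first by move=> x _; exact: limit_zero.
by move=> g gk [lg _]; exact: hE.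
Qed.

Lemma almost_const k e : e ∈ k -> almost k (fun g => e ∈ g).
Proof.
by move=> ek; exists (fun=> e) => // g gk [lg /(_ ozero)]; apply; exact: cumV_zero.
Qed.

Lemma almost_constV k x : is_limit k -> cumV k x -> almost k (fun g => cumV g x).
Proof.
move=> lk /(cumV_limit lk)[e ek xe]; apply: almost_mono (almost_const ek).
by move=> g gk lg eg; apply: cumV_mono xe; [exact: limit_ord|left].
Qed.

Definition omax a b := if `[< a ∈ b >] then b else a.

Lemma omax_mem a b c : a ∈ c -> b ∈ c -> omax a b ∈ c.
Proof. by rewrite /omax; case: asboolP. Qed.

Lemma omax_l a b : ole a (omax a b).
Proof. by rewrite /omax; case: asboolP => h; [left|right]. Qed.

Lemma omax_r a b : is_ordinal a -> is_ordinal b -> ole b (omax a b).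
Proof.
rewrite /omax => oa ob; case: asboolP => h; first by right.
by case: (ord_comparable oa ob) => // [->|]; [right|left].
Qed.

Lemma almostI k (E F : zfset -> Prop) : is_limit k -> almost k E -> almost k F ->
  almost k (fun g => E g /\ F g).
Proof.
move=> lk [h hm hE] [h' hm' hF]; have ok := limit_ord lk.
exists (fun x => omax (h x) (h' x)); first by move=> x xk; apply: omax_mem; [exact: hm|exact: hm'].
move=> g gk [lg hg]; have gk' : cumV g `<=` cumV k by apply: cumV_mono => //; left.
have og := limit_ord lg.
split; [apply: hE => //|apply: hF => //]; split=> // x xg; apply: ole_trans_mem (hg _ xg) => //.
  exact: omax_l.
by apply: omax_r; apply: is_ordinal_in ok _; [apply: hm|apply: hm']; exact: gk'.
Qed.

(** Diagonal intersection over the elements of V_k. One function on coded pairs carries the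
    functions of all [x]; a closure point [g] is a limit, so V_g contains the pairs of its elements
    and [g] is closed under the function of each [x] in V_g. *)
Lemma almost_diag k (E : zfset -> zfset -> Prop) : is_limit k ->
  (forall x, cumV k x -> almost k (E x)) ->
  almost k (fun g => forall x, cumV g x -> E x g).
Proof.
move=> lk hE.
have /choice[H HP] : forall x, exists h, cumV k x ->
    maps k h /\ forall g, g ∈ k -> clos h g -> E x g.
  move=> x; have [/hE[h h1 h2]|nx] := pselect (cumV k x); first by exists h.
  by exists (fun=> ozero).
pose h y := if pselect (exists xu : zfset * zfset, y = pr xu.1 xu.2) is left e
  then H (projT1 (cid e)).1 (projT1 (cid e)).2 else ozero.
have hpr x u : h (pr x u) = H x u.
  rewrite /h; case: pselect => [e|[]]; last by exists (x, u).
  by case: cid => -[x' u'] /= /pr_inj[-> ->].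
have ok := limit_ord lk.
exists h.
  move=> y yk; rewrite /h; case: pselect => [e|_]; last exact: limit_zero.
  case: cid => -[x u] /= E'; move: yk; rewrite E' => /(cumV_pr _ _ lk)[xk uk].
  by have [hm _] := HP _ xk; exact: hm.
move=> g gk [lg hg] x xg.
have xk : cumV k x by apply: cumV_mono xg => //; left.
have [_] := HP _ xk; apply=> //; split=> // u ug.
by rewrite -hpr; apply: hg; apply/(cumV_pr _ _ lg).
Qed.

Lemma almost_diag_ord k (E : zfset -> zfset -> Prop) : is_limit k ->
  (forall x, x ∈ k -> almost k (E x)) ->
  almost k (fun g => forall x, x ∈ g -> E x g).
Proof.
move=> lk hE; have ok := limit_ord lk.
have := @almost_diag k (fun x g => x ∈ k -> E x g) lk; case.
  move=> x xk; have [/hE|nx] := pselect (x ∈ k); first by apply: almost_mono.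
  by apply: almost_all.
move=> h hm hE'; exists h => // g gk hg x xg.
have xk := ord_trans ok xg gk.
by apply: (hE' g gk hg) => //; apply: cumV_ordW => //; exact: is_ordinal_in xk.
Qed.

Lemma small_tags : small (range ztag). Proof. exact: small_range. Qed.

Lemma clos_unbounded k h x : inacc k -> maps k h -> cumV k x ->
  exists g, [/\ g ∈ k, cumV g x & clos h g].
Proof.
move=> ik hm xk; have [lk [l lk' ll] bk] := ik; have ok := limit_ord lk.
have /choice[nxt nxtP] : forall e, exists e', e ∈ k ->
    [/\ e' ∈ k, e ∈ e' & forall c, cumV e c -> h c ∈ e'].
  move=> e; have [ek|nek] := pselect (e ∈ k); last by exists e.
  have [|e1 e1k he1] := bk (Vz e) h (Vz_mem ek).
    move=> c /VzP ce; apply: hm; apply: cumV_mono ce => //; by left.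
  have [w [wk e1w ew]] := limit_max lk e1k (limit_succ lk ek).
  have ow := is_ordinal_in ok wk.
  exists w => _; split=> //; first by apply: mem_ole_trans ew => //; exact: osucc_mem.
  by move=> c /VzP/he1 hc; apply: mem_ole_trans e1w.
have [e0 e0k xe0] := cumV_limit lk xk.
pose s n := iter n nxt e0.
have sk n : s n ∈ k by elim: n => //= n IH; have [] := nxtP _ IH.
have sS n : s n ∈ s n.+1 by have [] := nxtP _ (sk n).
(* [zbounded] speaks of elements of V_k, so the sequence [s] is indexed by the set of tags, which
   belongs to V_k because some limit lies below [k]. *)
have [||e1 e1k he1] := bk (zset (range ztag)) (fun t => s (xget 0 [set n | ztag n = t])).
- apply: (@cumV_sup _ l) => // t /(zsetP small_tags)[n _ <-]; exact: cumV_ztag.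
- by move=> c _; exact: sk.
have se1 n : s n ∈ e1.
  have /he1 : ztag n ∈ zset (range ztag) by apply/(zsetP small_tags); exists n.
  by case: xgetP => [m _ /ztag_inj->//|/(_ n)]; case.
have oe1 := is_ordinal_in ok e1k.
pose g := zset [set y | exists n, y ∈ s n].
have gP y : y ∈ g <-> exists n, y ∈ s n.
  apply: zsetP; apply: (@small_sub e1) => z [n zn]; exact: ord_trans (se1 n).
have os n := is_ordinal_in ok (sk n).
have og : is_ordinal g.
  apply: ord_of_trans => [y /gP[n /is_ordinal_in]|y z /gP[n yn] zy]; first exact.
  by apply/gP; exists n; exact: ord_trans yn.
have sg n : s n ∈ g by apply/gP; exists n.+1; exact: sS.
have gk : g ∈ k.
  apply: ole_trans_mem (e1k) => //; apply: subset_ole => // y /gP[n yn].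
  exact: ord_trans (se1 n).
have lg : is_limit g.
  split=> // [E|y E]; first by apply: (@ozeroP (s 0)); rewrite -E.
  have /gP[n yn] : y ∈ g by rewrite E; exact: osucc_mem.
  have := ole_osucc (os n) yn; rewrite -E => -[gs|gs].
    exact: zmem_asym gs (sg n).
  by have := sg n; rewrite -gs => /zmem_irr.
exists g; split=> //.
  by apply: cumV_mono xe0 => //; left; exact: (sg 0).
split=> // y /(cumV_limit lg)[e /gP[n en] ye]; apply/gP; exists n.+1.
have [_ _] := nxtP _ (sk n); apply; apply: cumV_mono ye => //; by left.
Qed.

Lemma almost_unbounded k E x : inacc k -> almost k E -> cumV k x ->
  exists g, [/\ g ∈ k, cumV g x, is_limit g & E g].
Proof.
move=> ik [h hm hE] /(clos_unbounded ik hm)[g [gk xg hg]].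
by exists g; split=> //; [case: hg|exact: hE].
Qed.

Lemma clos_limit h g : is_limit g ->
  (forall x, cumV g x -> exists e, [/\ e ∈ g, cumV e x & clos h e]) -> clos h g.
Proof.
move=> lg hg; split=> // x /hg[e [eg xe [_ he]]].
by apply: ord_trans (he _ xe) eg; exact: limit_ord.
Qed.

Lemma clos_club mu h : inacc mu -> maps mu h -> club mu [set g | g ∈ mu /\ clos h g].
Proof.
move=> im hm; split=> [g []//|a am|a am la hc].
  have [|g [gm ag hg]] := @clos_unbounded mu h a im hm.
    by apply: cumV_ordW => //; exact: is_ordinal_in (inacc_ord im) am.
  exists g => //; move: ag; rewrite cumV_ord //; first by case: hg => /limit_ord.
  exact: is_ordinal_in (inacc_ord im) am.
split=> //; apply: clos_limit => // x /(cumV_limit la)[e ea xe].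
have [c [[cm hc'] ec ca]] := hc _ ea; exists c; split=> //.
by apply: cumV_mono xe; [case: hc' => /limit_ord|left].
Qed.

Lemma inacc_size k a : inacc k -> cumV k a ->
  exists2 th, th ∈ k & exists f : zfset -> zfset, forall c, c ∈ a -> exists2 i, i ∈ th & f i = c.
Proof.
move=> ik ak; have [lk _ bk] := ik; have ok := limit_ord lk.
(* The elements of [a] are enumerated without repetition; the default [a], not being its own
   element, marks exhaustion. If it never occurred below [k], the inverse of [f] would map [a]
   unboundedly into [k]. *)
pose f := mem_rec ozero (fun i r => xget a [set c | c ∈ a /\ forall j, j ∈ i -> r j <> c]).
have fE i : f i = xget a [set c | c ∈ a /\ forall j, j ∈ i -> f j <> c].
  rewrite /f mem_recE; congr xget; apply/seteqP; split=> c /= [ca h]; split=> // j ji.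
    by have := h j ji; case: asboolP.
  by case: asboolP => // _; exact: h.
have [[i [ik' fi]]|nex] := pselect (exists i, i ∈ k /\ f i = a).
  exists i => //; exists f => c ca; apply: contrapT => nc.
  move: fi; rewrite fE; case: xgetP => [y _ [ya _] ya'|/(_ c)].
    by move: ya; rewrite ya' => /zmem_irr.
  by case; split=> // j ji fj; apply: nc; exists j.
have fa i : i ∈ k -> f i ∈ a /\ forall j, j ∈ i -> f j <> f i.
  move=> ik'; have := fE i; case: xgetP => [y _ Py -> //|_ fia].
  by case: nex; exists i.
pose g c := xget ozero [set i | i ∈ k /\ f i = c].
have [|e ek he] := bk a g ak.
  by move=> c _; rewrite /g; case: xgetP => [y _ []//|_]; exact: limit_zero.
have [fea _] := fa e ek; have := he _ fea; rewrite /g.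
case: xgetP => [y _ [yk fy] ye|/(_ e)]; last by case.
by have [_ /(_ y ye)] := fa e ek.
Qed.

(** Regularity bounds functions on ordinals only. At a point closed under the map from sets to
    ordinals that enumerate them, a function on a set in V_g becomes one on an ordinal below [g]. *)
Lemma regular_inacc k : inacc k -> almost k (fun g => is_regular g -> inacc g).
Proof.
move=> ik; have [lk [l lk' ll] bk] := ik; have ok := limit_ord lk.
have /choice[th thP] : forall a, exists t, cumV k a -> t ∈ k /\
    exists f : zfset -> zfset, forall c, c ∈ a -> exists2 i, i ∈ t & f i = c.
  move=> a; have [/(inacc_size ik)[t tk hf]|na] := pselect (cumV k a); first by exists t.
  by exists ozero.
have A : almost k (fun g => forall x, cumV g x -> th x ∈ g).
  by exists th => [x /thP[]//|g gk []].
apply: almost_mono (almostI lk A (almost_const lk')) => g gk lg [hg lg'] [_ _ rg].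
split=> //; first by exists l.
move=> a fn ag hfn; have [|_ [f fP]] := thP a.
  by apply: cumV_mono ag => //; left.
have [|e eg he] := rg (th a) (fun i => if `[< f i ∈ a >] then fn (f i) else ozero) (hg _ ag).
  by move=> c _; case: asboolP => [/hfn//|_]; exact: limit_zero.
exists e => // c ca; have [i it fi] := fP _ ca.
by have := he _ it; rewrite fi; case: asboolP.
Qed.

Lemma regular_limit_inacc mu : is_regular mu ->
  (forall e, e ∈ mu -> exists a, [/\ a ∈ mu, e ∈ a & inacc a]) -> inacc mu.
Proof.
move=> [_ lmu rmu] h; have omu := limit_ord lmu; split=> //.
  by have [a [am _ [la _ _]]] := h _ (limit_zero lmu); exists a.
move=> a fn am hfn; have [e em ae] := cumV_limit lmu am.
have [al [alm eal ial]] := h _ em.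
have aal : cumV al a by apply: cumV_mono ae; [exact: inacc_ord|left].
have [th thal [f fP]] := inacc_size ial aal.
have [||e1 e1m he1] := rmu th (fun i => if `[< f i ∈ a >] then fn (f i) else ozero).
- exact: ord_trans alm.
- by move=> c _; case: asboolP => [/hfn//|_]; exact: limit_zero.
exists e1 => // c ca; have [i it fi] := fP _ ca.
by have := he1 _ it; rewrite fi; case: asboolP.
Qed.

Lemma tail_club mu e : is_limit mu -> e ∈ mu -> club mu [set g | g ∈ mu /\ e ∈ g].
Proof.
move=> lm em; have om := limit_ord lm; split=> [g []//|a am|a am la hc].
  have [w [wm aw ew]] := limit_max lm (limit_succ lm am) (limit_succ lm em).
  have ow := is_ordinal_in om wm.
  exists w; last by apply: mem_ole_trans aw => //; exact: osucc_mem.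
  by split=> //; apply: mem_ole_trans ew => //; exact: osucc_mem.
split=> //; have [c [[_ ec] _ ca]] := hc _ (limit_zero la).
by apply: ord_trans ec ca; exact: limit_ord.
Qed.

(** * Collapse and canonical functions *)

HB.instance Definition _ := isPointed.Build zfset ozero.

Lemma collapse_mem X x z : z ∈ collapse X x <-> exists y, [/\ y ∈ x, X y & collapse X y = z].
Proof.
rewrite {1}/collapse mem_recE -/(collapse X).
rewrite zsetP; last by apply: small_image; apply: (@small_sub x) => y [].
split=> [[y [yx Xy] <-]|[y [yx Xy <-]]]; exists y => //; by case: asboolP.
Qed.

Section Collapse.
Variable X : set zfset.
Hypothesis oX : forall x, X x -> is_ordinal x.

Lemma collapse_ordinal x : is_ordinal x -> is_ordinal (collapse X x).
Proof.
elim/(well_founded_ind zmem_wf): x => x IH ox; apply: ord_of_trans.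
  move=> y /collapse_mem[z [zx Xz <-]]; apply: IH => //; exact: oX.
move=> y z /collapse_mem[u [ux Xu <-]] /collapse_mem[w [wu Xw <-]].
by apply/collapse_mem; exists w; split=> //; exact: ord_trans ux.
Qed.

Lemma collapse_homo x y : X x -> x ∈ y -> collapse X x ∈ collapse X y.
Proof. by move=> Xx xy; apply/collapse_mem; exists x. Qed.

Lemma collapse_inj x y : X x -> X y -> collapse X x = collapse X y -> x = y.
Proof.
move=> Xx Xy E; case: (ord_comparable (oX Xx) (oX Xy)) => // h.
  by have := collapse_homo Xx h; rewrite E => /zmem_irr.
by have := collapse_homo Xy h; rewrite E => /zmem_irr.
Qed.

Lemma collapse_zero x : (forall y, y ∈ x -> ~ X y) -> collapse X x = ozero.
Proof.
move=> h; apply: zfset_ext => z; split=> [|/ozeroP//].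
by move=> /collapse_mem[y [/h]].
Qed.

Lemma collapse_succ x : X x -> collapse X (osucc x) = osucc (collapse X x).
Proof.
move=> Xx; apply: zfset_ext => z; split.
  move=> /collapse_mem[y [/osuccP[yx|->] Xy <-]]; apply/osuccP; last by right.
  by left; exact: collapse_homo.
move=> /osuccP[/collapse_mem[y [yx Xy <-]]|->]; apply: collapse_homo => //.
  exact: osucc_memW.
exact: osucc_mem.
Qed.

Lemma collapse_limit x : is_ordinal x -> (exists2 y, y ∈ x & X y) ->
  (forall y, y ∈ x -> X y -> exists z, [/\ z ∈ x, X z & y ∈ z]) ->
  is_limit (collapse X x).
Proof.
move=> ox [y yx Xy] h; split; first exact: collapse_ordinal.
  by move=> E; apply: (@ozeroP (collapse X y)); rewrite -E; exact: collapse_homo.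
move=> w E; have /collapse_mem[u [ux Xu uw]] : w ∈ collapse X x.
  by rewrite E; exact: osucc_mem.
have [z [zx Xz uz]] := h _ ux Xu.
have := collapse_homo Xz zx; rewrite E => /osuccP[|] h'.
  by have := zmem_asym (collapse_homo Xu uz); rewrite uw; apply.
by have := collapse_homo Xu uz; rewrite uw h' => /zmem_irr.
Qed.

Lemma collapse_id x : is_ordinal x -> elts x `<=` X -> collapse X x = x.
Proof.
elim/(well_founded_ind zmem_wf): x => x IH ox xX; apply: zfset_ext => z.
have key y : y ∈ x -> collapse X y = y.
  move=> yx; apply: IH => //; first exact: is_ordinal_in yx.
  by move=> w wy; apply: xX; exact: ord_trans yx.
split; first by move=> /collapse_mem[y [yx Xy <-]]; rewrite key.
by move=> zx; apply/collapse_mem; exists z; split=> //; [exact: xX|exact: key].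
Qed.

Lemma order_type_collapse x : X `<=` elts x -> order_type X = collapse X x.
Proof.
move=> Xx; apply: zfset_ext => z; rewrite /order_type zsetP; last first.
  exact: small_image (small_sub Xx).
rewrite collapse_mem; split=> [[y Xy <-]|[y [_ Xy <-]]]; exists y => //.
by split=> //; exact: Xx.
Qed.

End Collapse.

Lemma collapse_restr (X Y : set zfset) x :
  is_ordinal x -> (forall y, y ∈ x -> (X y <-> Y y)) -> collapse X x = collapse Y x.
Proof.
elim/(well_founded_ind zmem_wf): x => x IH ox XY.
have key y : y ∈ x -> collapse X y = collapse Y y.
  move=> yx; apply: IH => //; first exact: is_ordinal_in yx.
  by move=> w wy; apply: XY; exact: ord_trans yx.
apply: zfset_ext => z; rewrite !collapse_mem.
by split=> -[y [yx Xy <-]]; exists y; split=> //; rewrite ?key //; apply/XY.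
Qed.

(** * Ordinals below the cardinal successor, and their codes *)

Lemma zfset_min (P : zfset -> Prop) x : P x -> exists2 y, P y & forall z, z ∈ y -> ~ P z.
Proof.
elim/(well_founded_ind zmem_wf): x => x IH Px.
have [[z [zx Pz]]|h] := pselect (exists z, z ∈ x /\ P z); first exact: IH Pz.
by exists x => // z zx Pz; apply: h; exists z.
Qed.

Lemma ltcs_ord k xi : lt_cardinal_succ k xi -> is_ordinal xi.
Proof. by move=> [l [[ol _] _ _]] /(is_ordinal_in ol). Qed.

Lemma ltcs_mem k xi z : lt_cardinal_succ k xi -> z ∈ xi -> lt_cardinal_succ k z.
Proof.
move=> [l [cl kl ll] xl] zx; exists l => //; by apply: ord_trans xl => //; case: cl.
Qed.

(** [mu] provides a cardinal above [k], and the least such is the successor of [k]. Were it at most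
    [xi], then [f] would make it equinumerous with [k]. *)
Lemma ltcs_inj k mu xi (f : zfset -> zfset) : is_cardinal k -> is_cardinal mu -> k ∈ mu ->
  is_ordinal xi -> (forall z, z ∈ xi -> f z ∈ k) ->
  (forall z z', z ∈ xi -> z' ∈ xi -> f z = f z' -> z = z') -> lt_cardinal_succ k xi.
Proof.
move=> ck cmu kmu oxi fk finj.
have [l [cl kl] lmin] := @zfset_min (fun m => is_cardinal m /\ k ∈ m) mu (conj cmu kmu).
have [ol hl] := cl; exists l.
  split=> // m cm km; case: (ole_or_mem ol (proj1 cm)) => // ml.
  by case: (lmin _ ml).
case: (ole_or_mem ol oxi) => // lxi; case: (hl _ kl).
apply/card_set_bijP; rewrite card_eq_le; apply/andP; split.
  by apply: subset_card_le => y yk; exact: ord_trans kl.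
have lx := ole_subset oxi lxi.
have fi : {in elts l &, injective f}.
  by move=> y z; rewrite !inE => yl zl; apply: finj; exact: lx.
apply: card_le_trans (_ : f @` elts l #<= elts k).
  by have := inj_card_eq fi; rewrite card_eq_le => /andP[].
by apply: subset_card_le => y [z zl <-]; apply: fk; exact: lx.
Qed.

Lemma ltcs_succ k xi : is_limit k -> lt_cardinal_succ k xi -> lt_cardinal_succ k (osucc xi).
Proof.
move=> lk [l [cl kl ll] xl]; exists l => //.
have ol : is_ordinal l by case: cl.
case: (ole_osucc ol xl) => // E; exfalso.
have ok := limit_ord lk; have ox := is_ordinal_in ol xl.
have [_ /(_ xi)] := cl; rewrite -E => /(_ (osucc_mem xi)); apply.
have kx : ole k xi by move: kl; rewrite -E => /osuccP.
have kxi z : z ∈ k -> z ∈ xi by move=> zk; apply: mem_ole_trans kx.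
pose small_nat z := exists n, z = iter n osucc ozero.
have omk n : iter n osucc ozero ∈ k.
  by elim: n => [|n IH] /=; [exact: limit_zero|exact: limit_succ].
have iter_inj m n : iter m osucc ozero = iter n osucc ozero -> m = n.
  elim: m n => [|m IH] [|n] //= ; first by move=> /esym/osucc_neq0.
    by move=> /osucc_neq0.
  by move=> /osucc_inj/IH ->.
apply/card_set_bijP; rewrite card_eq_le; apply/andP; split.
  by apply: subset_card_le => y yk; exact: osucc_memW.
(* Hilbert's hotel: [xi] goes to zero and the natural numbers move up by one, so [osucc xi] injects
   into [xi] and is not a cardinal. *)
pose f z := if `[< z = xi >] then ozero else if `[< small_nat z >] then osucc z else z.
have fi : {in elts (osucc xi) &, injective f}.
  move=> y z _ _; rewrite /f.
  case: (asboolP (y = xi)) => [->|yx]; case: (asboolP (z = xi)) => [->|zx] //.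
  - by case: asboolP => [_ /esym/osucc_neq0//|nz e]; case: nz; exists 0.
  - by case: asboolP => [_ /osucc_neq0//|nz e]; case: nz; exists 0.
  - case: (asboolP (small_nat y)) => [[m ->]|ny]; case: (asboolP (small_nat z)) => [[n ->]|nz] //.
    + by move=> /osucc_inj.
    + by move=> e; case: nz; exists m.+1; rewrite -e.
    + by move=> e; case: ny; exists n.+1; rewrite e.
apply: card_le_trans (_ : f @` elts (osucc xi) #<= elts xi).
  by have := inj_card_eq fi; rewrite card_eq_le => /andP[].
apply: subset_card_le => y [z zl <-]; rewrite /f.
case: asboolP => [_|zx]; first by apply: kxi; exact: limit_zero.
case: asboolP => [[n ->]|_]; first by apply: kxi; exact: (omk n.+1).
by case/osuccP: zl.
Qed.

(* The name below k of the level z < xi.  At a good g the set F_ze(g) consists of the z < ze with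
   a code below g, for all levels ze with a code below g, and these codes are closed under
   successors and predecessors. *)
Definition code (b : zfset -> zfset -> zfset -> zfset) k xi z : zfset :=
  if `[< xi ∈ k >] then z else xget ozero [set i | i ∈ k /\ b k xi i = z].

Record good (b : zfset -> zfset -> zfset -> zfset) k xi g : Prop := Good {
  good_top : xi ∈ k -> xi ∈ g;
  good_F : forall ze, ze ∈ xi -> code b k xi ze ∈ g ->
    forall z, canF b k ze g z <-> z ∈ ze /\ code b k xi z ∈ g;
  good_pred : forall d, osucc d ∈ xi -> code b k xi (osucc d) ∈ g -> code b k xi d ∈ g;
  good_predtop : forall d, xi = osucc d -> code b k xi d ∈ g;
  good_succ : forall d, osucc d ∈ xi -> code b k xi d ∈ g -> code b k xi (osucc d) ∈ g;
  good_low : forall z, z ∈ xi -> z ∈ k -> (code b k xi z ∈ g <-> z ∈ g);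
  good_zero : ozero ∈ xi -> code b k xi ozero ∈ g }.

Section Canonical.
Variables (b : zfset -> zfset -> zfset -> zfset) (k : zfset).
Hypotheses (hb : canonical_bijections b) (rk : is_regular k).
Let lk : is_limit k. Proof. by case: rk. Qed.
Let ok : is_ordinal k. Proof. exact: limit_ord. Qed.

Lemma not_mem_ole xi : is_ordinal xi -> ~ xi ∈ k -> ole k xi.
Proof. by move=> ox nx; case: (ole_or_mem ok ox). Qed.

Lemma b_bij xi : lt_cardinal_succ k xi -> ~ xi ∈ k ->
  [/\ forall i, i ∈ k -> b k xi i ∈ xi,
      forall i j, i ∈ k -> j ∈ k -> b k xi i = b k xi j -> i = j &
      forall z, z ∈ xi -> exists2 i, i ∈ k & b k xi i = z].
Proof.
move=> lx nx; have [h _] := hb rk.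
have [h1 h2 h3] := h xi (not_mem_ole (ltcs_ord lx) nx) lx; split=> //.
by move=> i j ik jk; apply: h2; rewrite inE.
Qed.

Lemma code_in xi z : lt_cardinal_succ k xi -> z ∈ xi -> code b k xi z ∈ k.
Proof.
move=> lx zx; rewrite /code; case: asboolP => [xk|nx]; first exact: ord_trans xk.
by case: xgetP => [i _ []//|_]; exact: limit_zero.
Qed.

Lemma codeK xi z : lt_cardinal_succ k xi -> ~ xi ∈ k -> z ∈ xi -> b k xi (code b k xi z) = z.
Proof.
move=> lx nx zx; rewrite /code; case: asboolP => // _.
have [_ _ h] := b_bij lx nx; have [i ik iz] := h z zx.
by case: xgetP => [j _ [] //|/(_ i)]; case.
Qed.

Lemma code_inj xi z z' : lt_cardinal_succ k xi -> z ∈ xi -> z' ∈ xi ->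
  code b k xi z = code b k xi z' -> z = z'.
Proof.
move=> lx zx zx' E; have [xk|nx] := pselect (xi ∈ k).
  by move: E; rewrite /code; case: asboolP.
by rewrite -(codeK lx nx zx) E codeK.
Qed.

Lemma canF_code xi g z : lt_cardinal_succ k xi -> g ∈ k -> (xi ∈ k -> xi ∈ g) ->
  canF b k xi g z <-> z ∈ xi /\ code b k xi z ∈ g.
Proof.
move=> lx gk hg; have og := is_ordinal_in ok gk; rewrite /canF.
case: asboolP => [xk|nx].
  rewrite /code; case: asboolP => // _; split=> [zx|[]//].
  by split=> //; apply: ord_trans zx (hg _).
have [h1 h2 h3] := b_bij lx nx.
have cb i : i ∈ k -> code b k xi (b k xi i) = i.
  by move=> ik; apply: h2 => //; [apply: code_in => //; exact: h1|apply: codeK => //; exact: h1].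
split=> [[i ig <-]|[zx zg]].
  have ik : i ∈ k by exact: ord_trans gk.
  by split; [exact: h1|rewrite cb].
by exists (code b k xi z) => //; exact: codeK.
Qed.

Lemma canF_sub xi g : lt_cardinal_succ k xi -> g ∈ k -> canF b k xi g `<=` elts xi.
Proof.
move=> lx gk z; rewrite /canF; case: asboolP => // nx [i ig <-].
by have [h _ _] := b_bij lx nx; apply: h; exact: ord_trans gk.
Qed.

End Canonical.

(** One half of the fact that two injections of [ze] into [k] cut out the same part of [ze] at
    almost every [g]: each code below [g] determines an element, whose other code is below almost
    every [g], and a diagonal intersection treats all codes at once. *)
Lemma code_agree1 k ze (c1 c2 : zfset -> zfset) : is_limit k ->
  (forall z, z ∈ ze -> c1 z ∈ k) -> (forall z, z ∈ ze -> c2 z ∈ k) ->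
  (forall z z', z ∈ ze -> z' ∈ ze -> c1 z = c1 z' -> z = z') ->
  almost k (fun g => forall z, z ∈ ze -> c1 z ∈ g -> c2 z ∈ g).
Proof.
move=> lk h1 h2 hi.
have A : almost k (fun g => forall i, i ∈ g -> forall z, z ∈ ze -> c1 z = i -> c2 z ∈ g).
  apply: almost_diag_ord => // i ik.
  have [[z [zz zi]]|h] := pselect (exists z, z ∈ ze /\ c1 z = i).
    apply: almost_mono (almost_const (h2 _ zz)) => g gk lg zg z' zz' zi'.
    by rewrite (hi _ _ zz' zz) // zi'.
  by apply: almost_all => // g _ _ z zz zi; case: h; exists z.
by apply: almost_mono A => g gk lg h z zz zg; exact: h zg _ zz _.
Qed.

Lemma code_agree k ze (c1 c2 : zfset -> zfset) : is_limit k ->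
  (forall z, z ∈ ze -> c1 z ∈ k) -> (forall z, z ∈ ze -> c2 z ∈ k) ->
  (forall z z', z ∈ ze -> z' ∈ ze -> c1 z = c1 z' -> z = z') ->
  (forall z z', z ∈ ze -> z' ∈ ze -> c2 z = c2 z' -> z = z') ->
  almost k (fun g => forall z, z ∈ ze -> (c1 z ∈ g <-> c2 z ∈ g)).
Proof.
move=> lk h1 h2 i1 i2.
apply: almost_mono (almostI lk (code_agree1 lk h1 h2 i1) (code_agree1 lk h2 h1 i2)).
by move=> g gk lg [A B] z zz; split; [exact: A|exact: B].
Qed.

Section GoodCanonical.
Variables (b : zfset -> zfset -> zfset -> zfset) (k : zfset).
Hypotheses (hb : canonical_bijections b) (rk : is_regular k).
Let lk : is_limit k. Proof. by case: rk. Qed.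
Let ok : is_ordinal k. Proof. exact: limit_ord. Qed.

Lemma good_canF xi g z : lt_cardinal_succ k xi -> g ∈ k -> good b k xi g ->
  canF b k xi g z <-> z ∈ xi /\ code b k xi z ∈ g.
Proof. by move=> lx gk hg; apply: canF_code => //; exact: (good_top hg). Qed.

Lemma good_canF_in xi g ze z : lt_cardinal_succ k xi -> g ∈ k -> good b k xi g ->
  ze = xi \/ ze ∈ xi /\ code b k xi ze ∈ g ->
  canF b k ze g z <-> z ∈ ze /\ code b k xi z ∈ g.
Proof.
by move=> lx gk hg [->|[zx zg]]; [exact: good_canF|apply: (good_F hg)].
Qed.

Lemma almost_code (xi : zfset) (Q : zfset -> Prop) (p q : zfset -> zfset) :
  lt_cardinal_succ k xi ->
  (forall d, Q d -> p d ∈ xi /\ q d ∈ xi) -> (forall d d', p d = p d' -> d = d') ->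
  almost k (fun g => forall d, Q d -> code b k xi (p d) ∈ g -> code b k xi (q d) ∈ g).
Proof.
move=> lx hQ pinj.
have A : almost k (fun g => forall i, i ∈ g -> forall d, Q d ->
    code b k xi (p d) = i -> code b k xi (q d) ∈ g).
  apply: almost_diag_ord => // i ik.
  have [[d [Qd di]]|h] := pselect (exists d, Q d /\ code b k xi (p d) = i).
    have [pd qd] := hQ _ Qd.
    apply: almost_mono (almost_const (code_in b rk lx qd)) => g gk lg zg d' Qd' di'.
    have [pd' qd'] := hQ _ Qd'.
    suff -> : d' = d by [].
    by apply: pinj; apply: (code_inj hb rk lx pd' pd); rewrite di'.
  by apply: almost_all => // g _ _ z zz zi; case: h; exists z.
by apply: almost_mono A => g gk lg h d Qd zg; exact: h zg _ Qd _.
Qed.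

(** Most clauses ask that codes below [g] carry other codes, which they determine, below [g]; since
    codes are injective this is a diagonal intersection. The clause on [canF] compares the
    bijections of [ze] and of [xi] through [code_agree]. *)
Lemma almost_good xi : lt_cardinal_succ k xi -> almost k (good b k xi).
Proof.
move=> lx; have ox := ltcs_ord lx.
have A0 : almost k (fun g => xi ∈ k -> xi ∈ g).
  have [xk|nx] := pselect (xi ∈ k); last by apply: almost_all.
  by apply: almost_mono (almost_const xk).
have A1 : almost k (fun g => forall i, i ∈ g -> forall ze, ze ∈ xi -> code b k xi ze = i ->
    forall z, canF b k ze g z <-> z ∈ ze /\ code b k xi z ∈ g).
  apply: almost_diag_ord => // i ik.
  have [[ze [zx zi]]|h] := pselect (exists ze, ze ∈ xi /\ code b k xi ze = i); last first.
    by apply: almost_all => // g _ _ z zz zi; case: h; exists z.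
  have lz := ltcs_mem lx zx.
  have C0 : almost k (fun g => ze ∈ k -> ze ∈ g).
    have [xk|nx] := pselect (ze ∈ k); last by apply: almost_all.
    by apply: almost_mono (almost_const xk).
  have sub z : z ∈ ze -> z ∈ xi by move=> zz; exact: ord_trans zx.
  have C1 : almost k (fun g => forall z, z ∈ ze -> (code b k ze z ∈ g <-> code b k xi z ∈ g)).
    apply: code_agree => // [z|z|z z'|z z'].
    - exact: code_in.
    - by move=> /sub; exact: code_in.
    - exact: code_inj.
    - by move=> /sub z1 /sub z2; exact: code_inj.
  apply: almost_mono (almostI lk C0 C1) => g gk lg [h0 h1] ze' zx' zi' z.
  have -> : ze' = ze by apply: (code_inj hb rk lx zx' zx); rewrite zi'.
  by rewrite canF_code //; split=> -[zz zg]; split=> //; apply/h1.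
have A2 : almost k (fun g => forall d, osucc d ∈ xi ->
    code b k xi (osucc d) ∈ g -> code b k xi d ∈ g).
  apply: (@almost_code xi _ osucc id) => // [d sd|d d']; last exact: osucc_inj.
  by split=> //; apply: ord_trans sd => //; exact: osucc_mem.
have A3 : almost k (fun g => forall d, xi = osucc d -> code b k xi d ∈ g).
  have [[d E]|h] := pselect (exists d, xi = osucc d); last first.
    by apply: almost_all => // g _ _ d E; case: h; exists d.
  have dx : d ∈ xi by rewrite E; exact: osucc_mem.
  apply: almost_mono (almost_const (code_in b rk lx dx)) => g _ _ hg d' E'.
  by rewrite (@osucc_inj d' d) // -E -E'.
have A4 : almost k (fun g => forall d, osucc d ∈ xi ->
    code b k xi d ∈ g -> code b k xi (osucc d) ∈ g).
  apply: (@almost_code xi _ id osucc) => // d sd.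
  by split=> //; apply: ord_trans sd => //; exact: osucc_mem.
have A5 : almost k (fun g => forall z, z ∈ xi -> z ∈ k -> (code b k xi z ∈ g <-> z ∈ g)).
  have [ze [zk zx zE]] : exists ze, [/\ forall z, z ∈ ze -> z ∈ k,
     forall z, z ∈ ze -> z ∈ xi & forall z, z ∈ xi -> z ∈ k -> z ∈ ze].
    have [xk|/(not_mem_ole rk ox) kx] := pselect (xi ∈ k).
      by exists xi; split=> // z zx; exact: ord_trans xk.
    by exists k; split=> // z zk; apply: mem_ole_trans kx.
  have := @code_agree k ze (code b k xi) id lk; case.
  - by move=> z /zx; exact: code_in.
  - by move=> z /zk.
  - by move=> z z' /zx h1 /zx h2; exact: code_inj.
  - by [].
  by move=> h hm hE; exists h => // g gk hg z zx' zk'; exact: hE gk hg _ (zE _ zx' zk').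
have A6 : almost k (fun g => ozero ∈ xi -> code b k xi ozero ∈ g).
  have [zx|nz] := pselect (ozero ∈ xi); last by apply: almost_all.
  by apply: almost_mono (almost_const (code_in b rk lx zx)).
have B := almostI lk A0 (almostI lk A1 (almostI lk A2 (almostI lk A3
  (almostI lk A4 (almostI lk A5 A6))))).
apply: almost_mono B => g gk lg [h0 [h1 [h2 [h3 [h4 [h5 h6]]]]]].
by split=> // ze zx zg; exact: h1 zg _ zx _.
Qed.

End GoodCanonical.

(* F_xi(al) together with xi. *)
Definition dom b mu Xi xi al ze : Prop :=
  ze = xi \/ ze ∈ xi /\ code b mu Xi ze ∈ al.

Lemma dom_mono b mu Xi xi al be ze : is_ordinal al -> be ∈ al ->
  dom b mu Xi xi be ze -> dom b mu Xi xi al ze.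
Proof. by move=> oa ba [->|[zx zb]]; [left|right; split=> //; exact: ord_trans ba]. Qed.

(** * Coherence of the canonical functions of [mu] and of [al] *)

Section Coherence.
Variables (b : zfset -> zfset -> zfset -> zfset) (mu Xi xi al : zfset).
Hypotheses (hb : canonical_bijections b) (rmu : is_regular mu).
Hypotheses (lXi : lt_cardinal_succ mu Xi) (alm : al ∈ mu) (gal : good b mu Xi al).
Hypothesis hxi : dom b mu Xi Xi al xi.

Let omu : is_ordinal mu. Proof. by case: rmu => _ /limit_ord. Qed.
Let oal : is_ordinal al. Proof. exact: is_ordinal_in alm. Qed.
Let oXi : is_ordinal Xi. Proof. exact: ltcs_ord lXi. Qed.

Lemma dom_ord : is_ordinal xi.
Proof. by case: hxi => [->//|[/(is_ordinal_in oXi)]]. Qed.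

Lemma xi_sub z : z ∈ xi -> z ∈ Xi.
Proof. by case: hxi => [->//|[xX _] zx]; exact: ord_trans xX. Qed.

Lemma dom_Xi ze : dom b mu Xi xi al ze -> dom b mu Xi Xi al ze.
Proof. by case=> [->//|[/xi_sub zx zal]]; right. Qed.

Lemma dom_canF ze z : dom b mu Xi xi al ze ->
  canF b mu ze al z <-> z ∈ ze /\ code b mu Xi z ∈ al.
Proof. by move=> /dom_Xi; exact: good_canF_in. Qed.

Lemma dom_in ze z : dom b mu Xi xi al ze -> canF b mu ze al z -> dom b mu Xi xi al z.
Proof.
move=> dz /(dom_canF _ dz)[zz za]; right; split=> //.
by case: dz => [<-//|[zx _]]; exact: ord_trans dom_ord zz zx.
Qed.

Local Notation X := (canF b mu xi al).
Local Notation pi := (collapse X).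

Lemma X_P z : X z <-> z ∈ xi /\ code b mu Xi z ∈ al.
Proof. by apply: dom_canF; left. Qed.

Lemma X_ord z : X z -> is_ordinal z.
Proof. by move=> /X_P[/(is_ordinal_in dom_ord)]. Qed.

Lemma dom_X z : dom b mu Xi xi al z -> z = xi \/ X z.
Proof. by move=> [->|h]; [left|right; apply/X_P]. Qed.

Lemma canf_pi : canf b mu xi al = pi xi.
Proof. by apply: order_type_collapse => z /X_P[]. Qed.

Lemma pi_zero : pi ozero = ozero.
Proof. by apply: collapse_zero => y /ozeroP. Qed.

Lemma pi_inj z z' : dom b mu Xi xi al z -> dom b mu Xi xi al z' -> pi z = pi z' -> z = z'.
Proof.
move=> /dom_X[->|Xz] /dom_X[->|Xz'] //.
- by move=> E; have /(collapse_homo Xz') := proj1 (proj1 (X_P _) Xz'); rewrite E => /zmem_irr.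
- by move=> E; have /(collapse_homo Xz) := proj1 (proj1 (X_P _) Xz); rewrite E => /zmem_irr.
- exact: collapse_inj X_ord _ _ Xz Xz'.
Qed.

Lemma dom_succ d : dom b mu Xi xi al (osucc d) -> X d.
Proof.
case=> [E|[dx da]]; apply/X_P.
  split; first by rewrite -E; exact: osucc_mem.
  case: hxi => [E'|[xX xa]]; first by apply: (good_predtop gal); rewrite E.
  by subst xi; apply: (good_pred gal) xX xa.
split; first by apply: ord_trans dom_ord _ dx; exact: osucc_mem.
by apply: (good_pred gal) (xi_sub dx) da.
Qed.

Lemma pi_succ d : dom b mu Xi xi al (osucc d) -> pi (osucc d) = osucc (pi d).
Proof. by move=> /dom_succ/collapse_succ. Qed.

Lemma dom_limit_succ la z : dom b mu Xi xi al la -> is_limit la ->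
  canF b mu la al z -> canF b mu la al (osucc z).
Proof.
move=> dl ll /(dom_canF _ dl)[zl za]; apply/(dom_canF _ dl).
have sz := limit_succ ll zl; split=> //; apply: (good_succ gal) za.
apply: xi_sub; case: dl => [<-//|[lx _]]; exact: ord_trans dom_ord sz lx.
Qed.

Lemma dom_limit_zero la : dom b mu Xi xi al la -> is_limit la -> canF b mu la al ozero.
Proof.
move=> dl ll; apply/(dom_canF _ dl); have lz := limit_zero ll; split=> //.
apply: (good_zero gal); apply: xi_sub.
case: dl => [<-//|[lx _]]; exact: ord_trans dom_ord lz lx.
Qed.

Lemma pi_elts ze z' : dom b mu Xi xi al ze ->
  z' ∈ pi ze <-> exists2 z, canF b mu ze al z & pi z = z'.
Proof.
move=> dz; rewrite collapse_mem; split.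
  move=> [y [yz Xy yz']]; exists y => //; apply/(dom_canF _ dz).
  by split=> //; case/X_P: Xy.
move=> [z Fz zz']; exists z; split=> //; first by case/(dom_canF _ dz): Fz.
have [E|//] := dom_X (dom_in dz Fz); subst z.
have [/mem_ole_trans h _] := proj1 (dom_canF _ dz) Fz.
case: dz => [E|[zx _]]; first by move: Fz; rewrite E => /X_P[/zmem_irr].
by case: (@zmem_irr xi); apply: h dom_ord _; left.
Qed.

Lemma pi_limit la : dom b mu Xi xi al la -> is_limit la -> is_limit (pi la).
Proof.
move=> dl ll; have XF z : canF b mu la al z -> z ∈ la /\ X z.
  move=> Fz; have [zl za] := proj1 (dom_canF _ dl) Fz; split=> //; apply/X_P.
  by split=> //; case: dl => [<-//|[lx _]]; exact: ord_trans dom_ord zl lx.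
apply: collapse_limit; first exact: X_ord.
- exact: limit_ord.
- by exists ozero; have [] := XF _ (dom_limit_zero dl ll).
move=> y yl /X_P[_ ya]; exists (osucc y).
have Fy : canF b mu la al y by apply/(dom_canF _ dl).
by have [h1 h2] := XF _ (dom_limit_succ dl ll Fy); split=> //; exact: osucc_mem.
Qed.

Definition pinv z' := xget ozero [set z | dom b mu Xi xi al z /\ pi z = z'].

Lemma pinvK z : dom b mu Xi xi al z -> pinv (pi z) = z.
Proof.
move=> dz; rewrite /pinv; case: xgetP => [y _ [dy /pi_inj]|/(_ z)]; first exact.
by case.
Qed.

Lemma pi_top_elt z' : z' ∈ pi xi -> exists2 z, X z & pi z = z'.
Proof. by move=> /pi_elts h; have [|z zF zz] := h; [left|exists z]. Qed.

Lemma pinv_code z' : z' ∈ pi xi -> code b mu Xi (pinv z') ∈ al.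
Proof.
move=> /pi_top_elt[z Xz <-]; rewrite pinvK; first by case/X_P: Xz.
by right; apply/X_P.
Qed.

Lemma pinv_code_inj z z' : z ∈ pi xi -> z' ∈ pi xi ->
  code b mu Xi (pinv z) = code b mu Xi (pinv z') -> z = z'.
Proof.
move=> /pi_top_elt[y Xy <-] /pi_top_elt[y' Xy' <-].
have [yx yal] := proj1 (X_P _) Xy; have [yx' yal'] := proj1 (X_P _) Xy'.
rewrite !pinvK; try by right.
by move=> /(code_inj hb rmu lXi (xi_sub yx) (xi_sub yx')) ->.
Qed.

(** The codes of the inverse collapse inject f_xi(al) into [al]. *)
Lemma pi_top_ltcs : is_cardinal al -> lt_cardinal_succ al (pi xi).
Proof.
move=> cal; apply: (@ltcs_inj al mu (pi xi) (fun z => code b mu Xi (pinv z))) => //.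
- by case: rmu.
- by apply: collapse_ordinal; [exact: X_ord|exact: dom_ord].
- exact: pinv_code.
- exact: pinv_code_inj.
Qed.

(** A level below f_xi(al) has two names below [al]: its code through the bijection of [al], and the
    code, through that of [mu], of the level it collapses. Both namings are injective, so they
    select the same levels at almost all [be]. *)
Lemma almost_code_pi : is_regular al -> lt_cardinal_succ al (pi xi) -> almost al (good b mu Xi) ->
  almost al (fun be => [/\ good b mu Xi be, dom b mu Xi Xi be xi, good b al (pi xi) be &
    forall z, X z -> (code b al (pi xi) (pi z) ∈ be <-> code b mu Xi z ∈ be)]).
Proof.
move=> ral leta hgood; have [_ lal _] := ral.
have A : almost al (fun be => forall z', z' ∈ pi xi ->
    (code b al (pi xi) z' ∈ be <-> code b mu Xi (pinv z') ∈ be)).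
  apply: code_agree => // [z||z z'|z z'].
  - exact: code_in.
  - exact: pinv_code.
  - exact: code_inj.
  - exact: pinv_code_inj.
have H : almost al (fun be => dom b mu Xi Xi be xi).
  case: hxi => [->|[xX xa]]; first by apply: almost_all => // *; left.
  by apply: almost_mono (almost_const xa) => be _ _ h; right.
apply: almost_mono (almostI lal A (almostI lal hgood (almostI lal H (almost_good hb ral leta)))).
move=> be beal lbe [hA [gbe [hxib gbe']]]; split=> // z Xz.
rewrite hA; first by rewrite pinvK //; right; apply/X_P.
by apply/pi_elts; [left|exists z].
Qed.

(* The canonical functions of mu and of al agree, up to the collapse, at almost all be < al. *)
Lemma almost_coherent : is_regular al -> lt_cardinal_succ al (pi xi) ->
  almost al (good b mu Xi) ->
  almost al (fun be => forall ze, dom b mu Xi xi be ze -> dom b al (pi xi) (pi xi) be (pi ze) /\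
    forall z', canF b al (pi ze) be z' <-> exists2 z, canF b mu ze be z & pi z = z').
Proof.
move=> ral leta hgood.
apply: almost_mono (almost_code_pi ral leta hgood) => be beal lbe [gbe hxib gbe' cpi] ze dze.
have bemu : be ∈ mu by exact: ord_trans alm.
have dzea : dom b mu Xi xi al ze by apply: dom_mono dze.
have Fmu z : canF b mu ze be z <-> z ∈ ze /\ code b mu Xi z ∈ be.
  apply: good_canF_in => //; case: dze => [->|[zx zb]]; first exact: hxib.
  by right; split=> //; exact: xi_sub.
have dpi : dom b al (pi xi) (pi xi) be (pi ze).
  case: dze => [->|[zx zb]]; first by left.
  have Xze : X ze by apply/X_P; split=> //; exact: ord_trans beal.
  by right; split; [exact: collapse_homo|apply/(cpi _ Xze)].
split=> // z'; rewrite (@good_canF_in b al hb ral (pi xi) be (pi ze) z' leta beal gbe') //.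
have XF z : z ∈ ze -> code b mu Xi z ∈ be -> X z.
  move=> zz zb; apply/X_P; split; last exact: ord_trans beal.
  by case: dze => [<-//|[zx _]]; exact: ord_trans dom_ord zz zx.
split.
  move=> [/pi_elts h]; have [z Fz <-] := h dzea => zb.
  have [zz za] := proj1 (dom_canF _ dzea) Fz.
  exists z => //; apply/Fmu; split=> //; apply/cpi => //; apply/X_P; split=> //.
  by case: dze => [<-//|[zx _]]; exact: ord_trans dom_ord zz zx.
move=> [z /Fmu[zz zb] <-]; split; last by apply/cpi => //; exact: XF.
by apply/pi_elts => //; exists z => //; apply/(dom_canF _ dzea); split=> //; exact: ord_trans beal.
Qed.

End Coherence.

(** * Games and formulas of transfinite level *)

Definition env := nat -> set zfset.
Definition upd (e : env) n X : env := [eta e with n |-> X].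

Fixpoint blk (M : set zfset) (pol : bool) (ns : seq nat) (e : env) (K : env -> Prop) : Prop :=
  if ns is n :: ns' then
    if pol then forall X, X `<=` M -> blk M pol ns' (upd e n X) K
    else exists2 X, X `<=` M & blk M pol ns' (upd e n X) K
  else K e.

Definition envM (M : set zfset) (e : env) := forall n, e n `<=` M.

Lemma envM_upd M e n X : envM M e -> X `<=` M -> envM M (upd e n X).
Proof. by move=> he hX m; rewrite /upd /=; case: eqP. Qed.

Lemma blk_ext M pol ns e (K K' : env -> Prop) : envM M e ->
  (forall e, envM M e -> (K e <-> K' e)) -> blk M pol ns e K <-> blk M pol ns e K'.
Proof.
move=> he KK; elim: ns e he => [|n ns IH] e he /=; first exact: KK.
by case: pol IH => IH; split; [move=> h X XM; apply/IH; [exact: envM_upd|exact: h] ..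
  | move=> [X XM h]; exists X => //; apply/IH => //; exact: envM_upd
  | move=> [X XM h]; exists X => //; apply/IH => //; exact: envM_upd].
Qed.

Definition opred x := xget ozero [set y | x = osucc y].

Lemma opredK y : opred (osucc y) = y.
Proof. by rewrite /opred; case: xgetP => [z _ /osucc_inj//|/(_ y)]; case. Qed.

Definition quant (pol : bool) := if pol then All2 else Ex2.
Definition bigc (pol : bool) := if pol then BigAnd else BigOr.

(* A machine generates a formula of any level from a state, given the leaves at level 0: ns is the
   block of quantified variables at a successor level and nx the next state, li the state after
   the choice of a conjunct or disjunct at a limit level.  The Boolean is true for Pi formulas.
   The formula is sk, and ev is its value when the conjuncts and disjuncts of level la are
   restricted to O la, the second-order quantifiers to subsets of M and the leaves are L. *)
Record machine (St : Type) := Machine {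
  ns : bool -> zfset -> St -> seq nat;
  nx : bool -> zfset -> St -> St;
  li : bool -> zfset -> zfset -> St -> St }.

Definition ev St (m : machine St) (O : zfset -> set zfset) (M : set zfset)
    (L : bool -> St -> env -> Prop) : zfset -> bool -> St -> env -> Prop :=
  mem_rec (fun _ _ _ => False) (fun ze r pol st e =>
    if `[< ze = ozero >] then L pol st e else
    if `[< exists y, ze = osucc y >] then
      blk M pol (ns m pol (opred ze) st) e
        (fun e' => r (opred ze) (~~ pol) (nx m pol (opred ze) st) e')
    else if pol then forall z, z ∈ ze -> O ze z -> r z pol (li m pol ze z st) e
    else exists z, [/\ z ∈ ze, O ze z & r z pol (li m pol ze z st) e]).

Definition dummy_fo := FEq (Var1 0) (Var1 0).

Definition sk St (m : machine St) (leaf : bool -> St -> fo_formula) :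
    zfset -> bool -> St -> formula :=
  mem_rec (fun _ _ => FO dummy_fo) (fun ze r pol st =>
    if `[< ze = ozero >] then FO (leaf pol st) else
    if `[< exists y, ze = osucc y >] then
      foldr (quant pol) (r (opred ze) (~~ pol) (nx m pol (opred ze) st)) (ns m pol (opred ze) st)
    else bigc pol ze (fun z => r z pol (li m pol ze z st))).

Section Machine.
Variables (St : Type) (m : machine St).

Section Ev.
Variables (O : zfset -> set zfset) (M : set zfset) (L : bool -> St -> env -> Prop).
Notation E := (ev m O M L).

Lemma ev0 pol st e : E ozero pol st e <-> L pol st e.
Proof. by rewrite /ev mem_recE; case: asboolP. Qed.

Lemma evS d pol st e : E (osucc d) pol st e <->
  blk M pol (ns m pol d st) e (fun e' => E d (~~ pol) (nx m pol d st) e').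
Proof.
rewrite {1}/ev mem_recE -/(ev m O M L); case: asboolP => [/osucc_neq0//|_].
case: asboolP => [_|[]]; last by exists d.
by rewrite opredK; case: asboolP => // h; case: h; exact: osucc_mem.
Qed.

Lemma evLt la st e : is_limit la ->
  E la true st e <-> forall z, z ∈ la -> O la z -> E z true (li m true la z st) e.
Proof.
move=> [_ l0 lS]; rewrite {1}/ev mem_recE -/(ev m O M L); case: asboolP => // _.
case: asboolP => [[y /lS]//|_].
by split=> h z zl; have := h z zl; case: asboolP.
Qed.

Lemma evLf la st e : is_limit la ->
  E la false st e <-> exists z, [/\ z ∈ la, O la z & E z false (li m false la z st) e].
Proof.
move=> [_ l0 lS]; rewrite {1}/ev mem_recE -/(ev m O M L); case: asboolP => // _.
case: asboolP => [[y /lS]//|_].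
split=> [[z [zl Oz]]|[z [zl Oz h]]]; last by exists z; split=> //; case: asboolP.
by case: asboolP => // _ h; exists z.
Qed.

End Ev.

Section Sk.
Variable leaf : bool -> St -> fo_formula.
Notation S := (sk m leaf).

Lemma sk0 pol st : S ozero pol st = FO (leaf pol st).
Proof. by rewrite /sk mem_recE; case: asboolP. Qed.

Lemma skS d pol st : S (osucc d) pol st =
  foldr (quant pol) (S d (~~ pol) (nx m pol d st)) (ns m pol d st).
Proof.
rewrite {1}/sk mem_recE -/(sk m leaf); case: asboolP => [/osucc_neq0//|_].
case: asboolP => [_|[]]; last by exists d.
by rewrite opredK; case: asboolP => // h; case: h; exact: osucc_mem.
Qed.

Lemma skL la pol st : is_limit la -> exists2 f, S la pol st = bigc pol la f &
  forall z, z ∈ la -> f z = S z pol (li m pol la z st).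
Proof.
move=> [_ l0 lS]; rewrite {1}/sk mem_recE -/(sk m leaf); case: asboolP => // _.
case: asboolP => [[y /lS]//|_].
exists (fun z => (if `[< z ∈ la >] then sk m leaf z else (fun _ _ => FO dummy_fo)) pol
  (li m pol la z st)) => // z zl.
by rewrite asboolT.
Qed.

End Sk.
End Machine.

Lemma ord_ind (P : zfset -> Prop) :
  P ozero -> (forall d, is_ordinal d -> P d -> P (osucc d)) ->
  (forall la, is_limit la -> (forall z, z ∈ la -> P z) -> P la) ->
  forall ze, is_ordinal ze -> P ze.
Proof.
move=> h0 hS hL ze; elim/(well_founded_ind zmem_wf): ze => ze IH oz.
case: (ord_case oz) => [->//|[d od E]|lz].
  by rewrite E; apply: hS => //; apply: IH => //; rewrite E; exact: osucc_mem.
by apply: hL => // z zz; apply: IH => //; exact: is_ordinal_in zz.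
Qed.

Lemma sat_quant M e1 pol ns p e :
  sat M e1 e (foldr (quant pol) p ns) <-> blk M pol ns e (fun e' => sat M e1 e' p).
Proof.
elim: ns e => [|n ns IH] e //=; case: pol IH => IH /=.
  by split=> h X XM; apply/IH; exact: h.
by split=> -[X XM h]; exists X => //; apply/IH.
Qed.

Lemma sat_sk St (m : machine St) leaf M e1 ze pol st e : is_ordinal ze -> envM M e ->
  sat M e1 e (sk m leaf ze pol st) <->
  ev m (fun ze => elts ze) M (fun pol st e => fo_sat M e1 e (leaf pol st)) ze pol st e.
Proof.
move=> oz; elim/ord_ind: ze / oz pol st e => [|d od IH|la ll IH] pol st e he.
- by rewrite sk0 ev0.
- by rewrite skS evS sat_quant; apply: blk_ext => // e' he'; exact: IH.
have [f -> fP] := skL m leaf pol st ll; case: pol fP => fP /=.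
  rewrite evLt //; split=> h z zl.
    by move=> _; apply/IH => //; rewrite -fP //; exact: h.
  by rewrite fP //; apply/IH => //; exact: h.
rewrite evLf //; split=> [[z zl h]|[z [zl _ h]]]; exists z => //.
  by split=> //; apply/IH => //; rewrite -fP.
by rewrite fP //; apply/IH.
Qed.

Lemma ev_iso St (m m' : machine St) O O' M L L' (h : zfset -> zfset) (Dm : zfset -> Prop) :
  (forall ze, Dm ze -> is_ordinal ze) ->
  h ozero = ozero ->
  (forall d, Dm (osucc d) -> Dm d /\ h (osucc d) = osucc (h d)) ->
  (forall la, Dm la -> is_limit la -> is_limit (h la)) ->
  (forall la z, Dm la -> is_limit la -> O la z -> z ∈ la -> Dm z /\ h z ∈ h la) ->
  (forall la, Dm la -> is_limit la -> forall z', z' ∈ h la ->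
     (O' (h la) z' <-> exists z, [/\ O la z, z ∈ la & h z = z'])) ->
  (forall pol d st, Dm (osucc d) ->
     ns m' pol (h d) st = ns m pol d st /\ nx m' pol (h d) st = nx m pol d st) ->
  (forall pol la z st, Dm la -> is_limit la -> O la z -> z ∈ la ->
     li m' pol (h la) (h z) st = li m pol la z st) ->
  (forall pol st e, envM M e -> (L pol st e <-> L' pol st e)) ->
  forall ze pol st e, Dm ze -> envM M e ->
    ev m' O' M L' (h ze) pol st e <-> ev m O M L ze pol st e.
Proof.
move=> Do h0 hS hL hDm hO hns hli hLL ze pol st e Dz.
have oz := Do _ Dz; elim/ord_ind: ze / oz Dz pol st e => [|d od IH|la ll IH] Dz pol st e he.
- by rewrite h0 !ev0; apply: iff_sym; exact: hLL.
- have [Dd ->] := hS _ Dz; rewrite !evS; have [-> ->] := hns pol _ st Dz.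
  by apply: blk_ext => // e' he'; exact: IH.
have hla := hL _ Dz ll; case: pol.
  rewrite !evLt //; split=> H z zl Oz.
    have [Dmz hz] := hDm _ _ Dz ll Oz zl.
    apply/IH => //; rewrite -(hli true) //; apply: H => //.
    by apply/hO => //; exists z.
  have [y [Oy yl E]] := proj1 (hO _ Dz ll _ zl) Oz.
  have [Dmy hy] := hDm _ _ Dz ll Oy yl.
  by rewrite -E hli //; apply/IH => //; exact: H.
rewrite !evLf //; split=> -[z [zl Oz H]].
  have [y [Oy yl E]] := proj1 (hO _ Dz ll _ zl) Oz.
  have [Dmy hy] := hDm _ _ Dz ll Oy yl.
  by exists y; split=> //; apply/IH => //; rewrite -(hli false) // E.
have [Dmz hz] := hDm _ _ Dz ll Oz zl.
exists (h z); split=> //; first by apply/hO => //; exists z.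
by rewrite hli //; apply/IH.
Qed.

Lemma ev_ext St (m : machine St) (O O' : zfset -> set zfset) M L L' top ze pol st e :
  is_ordinal top -> (forall la z, ole la top -> z ∈ la -> (O la z <-> O' la z)) ->
  (forall pol st e, envM M e -> (L pol st e <-> L' pol st e)) -> ole ze top -> envM M e ->
  ev m O' M L' ze pol st e <-> ev m O M L ze pol st e.
Proof.
move=> ot hO hL zt he.
apply: (@ev_iso St m m O O' M L L' id (fun ze => ole ze top)) => //.
- by move=> y [/(is_ordinal_in ot)|->].
- by move=> d sd; split=> //; left; apply: mem_ole_trans sd => //; exact: osucc_mem.
- by move=> la z lt _ _ zl; split=> //; left; apply: mem_ole_trans lt.
- move=> la lt _ z zl; rewrite -hO //; split=> [Oz|[y [Oy _ <-]]//].
  by exists z.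
Qed.

(** [restr] treats a formula of level below [k] in one step, whereas [Rel] descends into it. That no
    limit node exceeds the level of the formula makes the two agree there ([Rel_low]). *)
Fixpoint lvl (p : formula) (ze : zfset) : Prop :=
  match p with
  | FO _ => True
  | All2 _ q | Ex2 _ q => lvl q ze
  | BigAnd la f | BigOr la f =>
      [/\ is_limit la, ole la ze & forall z, z ∈ la -> lvl (f z) z]
  end.

(** * Restriction of game sentences *)

Section Restriction.
Variables (b : zfset -> zfset -> zfset -> zfset) (k a : zfset).

(* The structural content of restr, which does not depend on how blocks of
   quantifiers are split. *)
Fixpoint Rel (p q : formula) : Prop :=
  match p with
  | FO r => q = FO (fo_cap_par2 (cumV a) r)
  | All2 n p' => exists2 q', q = All2 n q' & Rel p' q'
  | Ex2 n p' => exists2 q', q = Ex2 n q' & Rel p' q'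
  | BigAnd la f =>
      if `[< la ∈ k >] then q = cap_par2 (cumV a) (BigAnd la f) else
      exists2 g, q = BigAnd (canf b k la a) g &
        forall y, canF b k la a y -> Rel (f y) (g (canpi b k la a y))
  | BigOr la f =>
      if `[< la ∈ k >] then q = cap_par2 (cumV a) (BigOr la f) else
      exists2 g, q = BigOr (canf b k la a) g &
        forall y, canF b k la a y -> Rel (f y) (g (canpi b k la a y))
  end.

Hypothesis ok : is_ordinal k.

Lemma Rel_low p ze : lvl p ze -> ze ∈ k -> Rel p (cap_par2 (cumV a) p).
Proof.
elim: p => [r|n p IH|n p IH|la f IH|la f IH] //=.
- by move=> h1 h2; exists (cap_par2 (cumV a) p) => //; exact: IH.
- by move=> h1 h2; exists (cap_par2 (cumV a) p) => //; exact: IH.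
- by move=> [_ lz _] zk; case: asboolP => // -[]; exact: ole_trans_mem lz zk.
- by move=> [_ lz _] zk; case: asboolP => // -[]; exact: ole_trans_mem lz zk.
Qed.

Lemma lvl_pred p ze : lvl p (osucc ze) -> lvl p ze.
Proof.
elim: p => //= la f IH [ll lz h]; split=> //; case: lz => [/osuccP//|E];
  by move: ll; rewrite E => /limit_osucc.
Qed.

Lemma lvl_quant pol ns p ze : lvl (foldr (quant pol) p ns) ze <-> lvl p ze.
Proof. by elim: ns => //= n ns IH; case: pol IH. Qed.

Lemma Rel_quant pol ns p q : Rel (foldr (quant pol) p ns) q <->
  exists2 q', q = foldr (quant pol) q' ns & Rel p q'.
Proof.
elim: ns q => [|n ns IH] q /=; first by split=> [h|[q' ->]//]; exists q.
case: pol IH => IH /=; split.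
- by move=> [q1 -> /IH[q' -> h]]; exists q'.
- by move=> [q' -> h]; eexists; first reflexivity; apply/IH; exists q'.
- by move=> [q1 -> /IH[q' -> h]]; exists q'.
- by move=> [q' -> h]; eexists; first reflexivity; apply/IH; exists q'.
Qed.

Hypotheses (hb : canonical_bijections b) (ak : a ∈ k).

Lemma restr_Rel ze p q : restr b k a ze p q -> lt_cardinal_succ k ze -> lvl p ze -> Rel p q.
Proof.
elim=> {ze p q}.
- by move=> xi p xk _ /Rel_low; apply.
- move=> xi ns p q rk kx _ IH lx /(@lvl_quant true) lp.
  apply/(Rel_quant true); exists q => //; apply: IH; last exact: lvl_pred.
  by apply: ltcs_mem lx _; exact: osucc_mem.
- move=> xi ns p q rk kx _ IH lx /(@lvl_quant false) lp.
  apply/(Rel_quant false); exists q => //; apply: IH; last exact: lvl_pred.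
  by apply: ltcs_mem lx _; exact: osucc_mem.
- move=> xi p q rk kx lxi _ IH _ lx /= [_ _ lp].
  case: asboolP => [xk|_]; first by case: (@zmem_irr xi); exact: mem_ole_trans (ltcs_ord lx) xk kx.
  exists q => // y Fy; have yx := canF_sub hb rk lx ak Fy.
  by apply: IH => //; [exact: ltcs_mem yx|exact: lp].
- move=> xi p q rk kx lxi _ IH _ lx /= [_ _ lp].
  case: asboolP => [xk|_]; first by case: (@zmem_irr xi); exact: mem_ole_trans (ltcs_ord lx) xk kx.
  exists q => // y Fy; have yx := canF_sub hb rk lx ak Fy.
  by apply: IH => //; [exact: ltcs_mem yx|exact: lp].
Qed.

Lemma canf_elts la z : canF b k la a `<=` elts la ->
  z ∈ canf b k la a <-> exists2 y, canF b k la a y & canpi b k la a y = z.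
Proof.
move=> sub; rewrite /canf /order_type zsetP //.
exact: small_image (small_sub sub).
Qed.

Lemma lvl_sk St (m : machine St) leaf ze pol st : is_ordinal ze -> lvl (sk m leaf ze pol st) ze.
Proof.
move=> oz; elim/ord_ind: ze / oz pol st => [|d od IH|la ll IH] pol st.
- by rewrite sk0.
- rewrite skS; apply/lvl_quant.
  move: (IH (~~ pol) (nx m pol d st)).
  elim: (sk _ _ _ _ _) => //= la f _ [l1 l2 l3]; split=> //; left; apply/osuccP; exact: l2.
have [f -> fP] := skL m leaf pol st ll.
by case: pol fP => fP; split; try (by []); try (by right); move=> z zl; rewrite fP //; exact: IH.
Qed.

(** The restriction of a game sentence is the same game with the choices at level [ze] confined to
    F_ze(a): reindexing by the collapse renames the conjuncts that are kept and does nothing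
    else. *)
Lemma Rel_sk St (m : machine St) leaf M e1 ze pol st q e :
  is_regular k -> lt_cardinal_succ k ze -> envM M e ->
  Rel (sk m leaf ze pol st) q ->
  sat M e1 e q <->
  ev m (fun ze => canF b k ze a) M
    (fun pol st e => fo_sat M e1 e (fo_cap_par2 (cumV a) (leaf pol st))) ze pol st e.
Proof.
move=> rk lz; have oz := ltcs_ord lz.
elim/ord_ind: ze / oz lz pol st q e => [|d od IH|la ll IH] lz pol st q e he.
- by rewrite sk0 ev0 /= => ->.
- rewrite skS evS Rel_quant => -[q' -> hq]; rewrite sat_quant; apply: blk_ext => // e' he'.
  by apply: IH => //; apply: ltcs_mem lz _; exact: osucc_mem.
have [f -> fP] := skL m leaf pol st ll.
have low : la ∈ k -> forall z, z ∈ la -> Rel (sk m leaf z pol (li m pol la z st))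
    (cap_par2 (cumV a) (f z)).
  move=> lk z zl; rewrite fP //; apply: (@Rel_low _ z); last exact: ord_trans lk.
  by apply: lvl_sk; exact: is_ordinal_in (limit_ord ll) zl.
have sub := canF_sub hb rk lz ak.
have Fl : la ∈ k -> canF b k la a = elts la by move=> lk; rewrite /canF asboolT.
case: pol fP low => fP low /=; case: asboolP => lk.
- move=> -> /=; rewrite evLt //; rewrite Fl //; split=> h z zl.
    by move=> _; apply/(IH z zl (ltcs_mem lz zl) true _ _ e he (low lk z zl)); exact: h.
  by apply/(IH z zl (ltcs_mem lz zl) true _ _ e he (low lk z zl)); exact: h.
- move=> [g -> hg] /=; rewrite evLt //; split=> h z.
    move=> zl Fz; have hgz := hg _ Fz; rewrite fP // in hgz.
    apply/(IH z zl (ltcs_mem lz zl) true _ _ e he hgz); apply: h.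
    by apply/canf_elts => //; exists z.
  move=> /(canf_elts _ sub)[y Fy <-]; have yl := sub _ Fy.
  have hgy := hg _ Fy; rewrite fP // in hgy.
  by apply/(IH y yl (ltcs_mem lz yl) true _ _ e he hgy); exact: h.
- move=> -> /=; rewrite evLf //; rewrite Fl //; split=> [[z zl h]|[z [zl _ h]]].
    exists z; split=> //.
    by apply/(IH z zl (ltcs_mem lz zl) false _ _ e he (low lk z zl)); exact: h.
  exists z => //.
  by apply/(IH z zl (ltcs_mem lz zl) false _ _ e he (low lk z zl)); exact: h.
- move=> [g -> hg] /=; rewrite evLf //; split.
    move=> [z /(canf_elts _ sub)[y Fy <-]] h; have yl := sub _ Fy.
    have hgy := hg _ Fy; rewrite fP // in hgy.
    exists y; split=> //.
    by apply/(IH y yl (ltcs_mem lz yl) false _ _ e he hgy); exact: h.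
  move=> [z [zl Fz h]]; have hgz := hg _ Fz; rewrite fP // in hgz.
  exists (canpi b k la a z); first by apply/canf_elts => //; exists z.
  by apply/(IH z zl (ltcs_mem lz zl) false _ _ e he hgz).
Qed.

Lemma restr_sk St (m : machine St) leaf M e1 ze pol st q e :
  is_regular k -> lt_cardinal_succ k ze -> envM M e ->
  restr b k a ze (sk m leaf ze pol st) q ->
  sat M e1 e q <->
  ev m (fun ze => canF b k ze a) M
    (fun pol st e => fo_sat M e1 e (fo_cap_par2 (cumV a) (leaf pol st))) ze pol st e.
Proof.
move=> rk lz he /restr_Rel h; apply: Rel_sk => //; apply: h => //.
by apply: lvl_sk; exact: ltcs_ord lz.
Qed.

End Restriction.

(** * Game sentences are Pi or Sigma of their level *)

Section SkPi.
Variables (St : Type) (m : machine St) (leaf : bool -> St -> fo_formula).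
Variables (k : zfset) (Par : set (set zfset)) (inv : zfset -> bool -> St -> Prop) (nv : St -> nat).
Hypothesis fP : finite_set Par.
Hypothesis inv_leaf : forall pol st, inv ozero pol st ->
  [/\ formula_over k (FO (leaf pol st)), fo_fv1 (leaf pol st) = set0,
      (forall v, fo_fv2 (leaf pol st) v -> v < nv st) & fo_par2 (leaf pol st) `<=` Par].
Hypothesis inv_nx : forall pol d st, inv (osucc d) pol st ->
  inv d (~~ pol) (nx m pol d st) /\
  (forall v, v < nv (nx m pol d st) -> v < nv st \/ v \in ns m pol d st).
Hypothesis inv_li : forall pol la z st, is_limit la -> z ∈ la -> inv la pol st ->
  inv z pol (li m pol la z st) /\ nv (li m pol la z st) <= nv st.

Lemma fv2_quant pol ns p v : fv2 (foldr (quant pol) p ns) v -> fv2 p v /\ v \notin ns.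
Proof.
elim: ns => [|n ns IH] //=; case: pol IH => IH /= [/IH[h1 h2] h3];
  by split=> //; rewrite in_cons negb_or h2 andbT; apply/eqP.
Qed.

Lemma fv1_quant pol ns p : fv1 (foldr (quant pol) p ns) = fv1 p.
Proof. by elim: ns => //= n ns IH; case: pol IH. Qed.

Lemma par2_quant pol ns p : par2 (foldr (quant pol) p ns) = par2 p.
Proof. by elim: ns => //= n ns IH; case: pol IH. Qed.

Lemma par1_quant pol ns p : par1 (foldr (quant pol) p ns) = par1 p.
Proof. by elim: ns => //= n ns IH; case: pol IH. Qed.

Lemma sk_free ze pol st : is_ordinal ze -> inv ze pol st ->
  [/\ fv1 (sk m leaf ze pol st) = set0,
      (forall v, fv2 (sk m leaf ze pol st) v -> v < nv st) &
      par2 (sk m leaf ze pol st) `<=` Par].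
Proof.
move=> oz; elim/ord_ind: ze / oz pol st => [|d od IH|la ll IH] pol st hi.
- by rewrite sk0; have [] := inv_leaf hi.
- rewrite skS fv1_quant par2_quant.
  have [hi' hv] := inv_nx hi; have [h1 h2 h3] := IH _ _ hi'; split=> // v /fv2_quant[/h2/hv].
  by case=> // ->.
have [f -> fE] := skL m leaf pol st ll.
have H z : z ∈ la -> [/\ fv1 (f z) = set0, (forall v, fv2 (f z) v -> v < nv st) & par2 (f z) `<=` Par].
  move=> zl; rewrite fE //; have [hi' hn] := inv_li ll zl hi.
  have [h1 h2 h3] := IH z zl _ _ hi'; split=> // v /h2 h; exact: leq_trans hn.
by case: pol {hi fE} => /=; split;
  [rewrite -subset0 => v [z zl]; have [-> _ _] := H z zl
  |move=> v [z zl]; have [_ h _] := H z zl; exact: h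
  |move=> A [z zl]; have [_ _ h] := H z zl; exact: h
  |rewrite -subset0 => v [z zl]; have [-> _ _] := H z zl
  |move=> v [z zl]; have [_ h _] := H z zl; exact: h
  |move=> A [z zl]; have [_ _ h] := H z zl; exact: h].
Qed.

Lemma sk_Pi ze pol st : is_ordinal ze -> inv ze pol st ->
  (if pol then is_Pi else is_Sigma) k ze (sk m leaf ze pol st).
Proof.
move=> oz; elim/ord_ind: ze / oz pol st => [|d od IH|la ll IH] pol st hi.
- by rewrite sk0; have [h _ _ _] := inv_leaf hi; move: h; case: (pol) => h; [exact: Pi_zero|exact: Sigma_zero].
- rewrite skS; have [hi' _] := inv_nx hi; have := IH _ _ hi'.
  by case: (pol) => /= h; [exact: Pi_succ|exact: Sigma_succ].
have [f E fE] := skL m leaf pol st ll.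
have [_ h2 h3] := sk_free (limit_ord ll) hi.
have fin2 : finite_set (fv2 (bigc pol la f)).
  by rewrite -E; apply: sub_finite_set (finite_II (nv st)) => v /h2.
have finp : finite_set (par2 (bigc pol la f)) by rewrite -E; apply: sub_finite_set fP.
have H z : z ∈ la -> (if pol then is_Pi else is_Sigma) k z (f z).
  by move=> zl; rewrite fE //; have [hi' _] := inv_li ll zl hi; exact: IH.
rewrite E; move: fin2 finp H => {E fE h2 h3 hi}; case: pol => /= f2 fp H.
  exact: Pi_limit.
exact: Sigma_limit.
Qed.

End SkPi.

(** * First-order values of games *)

Definition FEx n q := FNot (FAll n (FNot q)).
Definition FOr p q := FNot (FAnd (FNot p) (FNot q)).
Definition FIff p q := FAnd (FNot (FAnd p (FNot q))) (FNot (FAnd q (FNot p))).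

Lemma sat_FAll M e1 e2 n q :
  fo_sat M e1 e2 (FAll n q) <-> forall x, M x -> fo_sat M [eta e1 with n |-> x] e2 q.
Proof. by []. Qed.

Lemma sat_FAnd M e1 e2 p q :
  fo_sat M e1 e2 (FAnd p q) <-> fo_sat M e1 e2 p /\ fo_sat M e1 e2 q.
Proof. by []. Qed.

Lemma sat_FEx M e1 e2 n q :
  fo_sat M e1 e2 (FEx n q) <-> exists2 x, M x & fo_sat M [eta e1 with n |-> x] e2 q.
Proof.
rewrite /FEx /=; split=> [h|[x Mx h] /(_ x Mx)//].
by apply: contrapT => h'; apply: h => x Mx hx; apply: h'; exists x.
Qed.

Lemma sat_FOr M e1 e2 p q :
  fo_sat M e1 e2 (FOr p q) <-> fo_sat M e1 e2 p \/ fo_sat M e1 e2 q.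
Proof.
rewrite /FOr /=; split; last by case=> h [].
by move=> h; apply: contrapT => /not_orP.
Qed.

Lemma sat_FIff M e1 e2 p q :
  fo_sat M e1 e2 (FIff p q) <-> (fo_sat M e1 e2 p <-> fo_sat M e1 e2 q).
Proof.
rewrite /FIff /=; split=> [[h1 h2]|[h1 h2]]; last by split=> -[] h; apply; auto.
by split=> h; apply: contrapT => h'; [apply: h1|apply: h2].
Qed.

Lemma fo_sat_ext M r e1 e1' e2 e2' :
  (forall v, fo_fv1 r v -> e1 v = e1' v) -> (forall v, fo_fv2 r v -> e2 v = e2' v) ->
  fo_sat M e1 e2 r <-> fo_sat M e1' e2' r.
Proof.
have t1 t e e' : (forall v, term1_fv t v -> e v = e' v) -> term1_val e t = term1_val e' t.
  by case: t => //= n; apply.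
have t2 t e e' : (forall v, term2_fv t v -> e v = e' v) -> term2_val e t = term2_val e' t.
  by case: t => //= n; apply.
elim: r e1 e1' => [s t|s t|s t|q IH|q IHq r IHr|n q IH] e1 e1' /= h1 h2.
- by rewrite (t1 s e1 e1') ?(t1 t e1 e1') // => v hv; apply: h1; [right|left].
- by rewrite (t1 s e1 e1') ?(t1 t e1 e1') // => v hv; apply: h1; [right|left].
- by rewrite (t1 s e1 e1') ?(t2 t e2 e2').
- by have := IH _ _ h1 h2 => ->.
- rewrite (IHq e1 e1') ?(IHr e1 e1') // => v hv;
    by [apply: h1; right|apply: h2; right|apply: h1; left|apply: h2; left].
have E x : fo_sat M [eta e1 with n |-> x] e2 q <-> fo_sat M [eta e1' with n |-> x] e2' q.
  by apply: IH => v hv /=; [case: eqP => // nv; exact: h1|exact: h2].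
by split=> h x Mx; apply/E; exact: h.
Qed.

Lemma fo_cap_fv2 M r : fo_fv2 (fo_cap_par2 M r) = fo_fv2 r.
Proof. by elim: r => //= [s [n|A]//|q -> r ->]. Qed.

Lemma fo_cap_fv1 M r : fo_fv1 (fo_cap_par2 M r) = fo_fv1 r.
Proof. by elim: r => //= [q -> r ->//|n q ->]. Qed.

Lemma fo_cap_par1 M r : fo_par1 (fo_cap_par2 M r) = fo_par1 r.
Proof. by elim: r => //= [q -> r ->]. Qed.

Inductive item := IV | IC of zfset | IS of term2.

Definition ival (v : zfset) (e2 : env) (it : item) : zfset :=
  match it with
  | IV => v
  | IC c => c
  | IS t => zset (elts v `&` term2_val e2 t)
  end.

(** The index [n] manages the variables: the tested object is in [n], its components are in the next
    two, and bound variables lie above. In [Fat] the variable 1 holds [v] throughout, hence the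
    condition [1 < n] in [sat_Flst]. *)
Definition Fpair n := FAll n.+3 (FIff (FMem (Var1 n.+3) (Var1 n))
  (FOr (FAll n.+4 (FIff (FMem (Var1 n.+4) (Var1 n.+3)) (FEq (Var1 n.+4) (Var1 n.+1))))
       (FAll n.+4 (FIff (FMem (Var1 n.+4) (Var1 n.+3))
          (FOr (FEq (Var1 n.+4) (Var1 n.+1)) (FEq (Var1 n.+4) (Var1 n.+2))))))).

Definition Fitem n it :=
  match it with
  | IV => FEq (Var1 n) (Var1 1)
  | IC c => FEq (Var1 n) (Par1 c)
  | IS t => FAll n.+2 (FIff (FMem (Var1 n.+2) (Var1 n))
              (FAnd (FMem (Var1 n.+2) (Var1 1)) (FIn (Var1 n.+2) t)))
  end.

Fixpoint Flst n its :=
  if its is it :: its' then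
    FEx n.+1 (FEx n.+2 (FAnd (Fpair n) (FAnd (Fitem n.+1 it) (Flst n.+2 its'))))
  else FAll n.+1 (FNot (FMem (Var1 n.+1) (Var1 n))).

(* For unboundedly many v, the tuple of v and the values of the items at v is in P; with
   P = codeR R, v ranges over the Vz g. *)
Definition Fat (P : set zfset) its :=
  FAll 0 (FEx 1 (FEx 2 (FAnd (FMem (Var1 0) (Var1 1))
    (FAnd (FIn (Var1 2) (Par2 P)) (Flst 2 (IV :: its)))))).

Definition icap M it := if it is IS t then IS (term2_cap_par2 M t) else it.

Lemma fo_cap_Fat M P its : fo_cap_par2 M (Fat P its) = Fat (P `&` M) (map (icap M) its).
Proof.
rewrite /Fat /=; have E n l : fo_cap_par2 M (Flst n l) = Flst n (map (icap M) l).
  elim: l n => [|it l IH] n //=; rewrite IH; by case: it.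
by rewrite E.
Qed.

(** Any relation on traces whatever, second-order truth included, becomes a parameter. Intersecting
    it with V_a leaves the same relation at [a], so a leaf keeps its meaning under restriction. *)
Definition codeR (R : zfset -> seq zfset -> Prop) : set zfset :=
  [set t | exists g vals, [/\ is_ordinal g, t = lst (Vz g :: vals) & R g vals]].

Definition atR (R : zfset -> seq zfset -> Prop) its (k : zfset) (e2 : env) : Prop :=
  forall x, cumV k x -> exists g, [/\ g ∈ k, cumV g x & R g (map (ival (Vz g) e2) its)].

Section AtSat.
Variables (k : zfset).
Hypothesis lk : is_limit k.
Let ok := limit_ord lk.
Notation M := (cumV k).

Lemma sat_Fpair e1 e2 n : M (e1 n) -> M (e1 n.+1) -> M (e1 n.+2) ->
  fo_sat M e1 e2 (Fpair n) <-> e1 n = pr (e1 n.+1) (e1 n.+2).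
Proof.
move=> Mt Ma Mu.
have key z : M z -> fo_sat M [eta e1 with n.+3 |-> z] e2
  (FOr (FAll n.+4 (FIff (FMem (Var1 n.+4) (Var1 n.+3)) (FEq (Var1 n.+4) (Var1 n.+1))))
       (FAll n.+4 (FIff (FMem (Var1 n.+4) (Var1 n.+3))
          (FOr (FEq (Var1 n.+4) (Var1 n.+1)) (FEq (Var1 n.+4) (Var1 n.+2)))))) <->
  z ∈ pr (e1 n.+1) (e1 n.+2).
  move=> Mz; rewrite sat_FOr !sat_FAll prP.
  have E1 : n.+3 == n.+4 = false by apply/eqP; lia.
  have E2 : n.+1 == n.+4 = false by apply/eqP; lia.
  have E3 : n.+2 == n.+4 = false by apply/eqP; lia.
  have E4 : n.+1 == n.+3 = false by apply/eqP; lia.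
  have E5 : n.+2 == n.+3 = false by apply/eqP; lia.
  split=> -[h|h]; [left|right|left|right].
  - move=> w; split=> hw.
      have Mw : M w by exact: cumV_trans hw.
      by have := h w Mw; rewrite sat_FIff /= !eqxx E1 E2 E4 => <-.
    have Mw : M w by rewrite hw.
    by have := h w Mw; rewrite sat_FIff /= !eqxx E1 E2 E4 => ->.
  - move=> w; split=> hw.
      have Mw : M w by exact: cumV_trans hw.
      by have := h w Mw; rewrite sat_FIff sat_FOr /= !eqxx E1 E2 ?E3 ?E4 E5 => <-.
    have Mw : M w by case: hw => ->.
    by have := h w Mw; rewrite sat_FIff sat_FOr /= !eqxx E1 E2 ?E3 ?E4 E5 => ->.
  - by move=> w Mw; rewrite sat_FIff /= !eqxx E1 E2 E4.
  - by move=> w Mw; rewrite sat_FIff sat_FOr /= !eqxx E1 E2 ?E3 ?E4 E5.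
have E0 : n == n.+3 = false by apply/eqP; lia.
rewrite /Fpair sat_FAll; split.
  move=> h; apply: zfset_ext => z; split=> hz.
    have Mz : M z by exact: cumV_trans hz.
    by have := h z Mz; rewrite sat_FIff (key z Mz) /= !eqxx E0 => <-.
  have Mz : M z.
    apply: cumV_trans hz => //; exact/cumV_pr.
  by have := h z Mz; rewrite sat_FIff (key z Mz) /= !eqxx E0 => ->.
by move=> E z Mz; rewrite sat_FIff (key z Mz) /= !eqxx E0 E.
Qed.

Lemma sat_Flst e1 e2 n its : 1 < n -> M (e1 n) -> M (e1 1) ->
  fo_sat M e1 e2 (Flst n its) <-> e1 n = lst (map (ival (e1 1) e2) its).
Proof.
elim: its n e1 => [|it its IH] n e1 n1 Mt Mv.
  have E0 : n == n.+1 = false by apply/eqP; lia.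
  rewrite /= eqxx E0; split=> [h|-> x Mx]; last exact: ozeroP.
  apply: zfset_ext => z; split=> [hz|/ozeroP//].
  have Mz : M z by exact: cumV_trans hz.
  by case: (h z Mz).
have E0 : n == n.+1 = false by apply/eqP; lia.
have E1 : n == n.+2 = false by apply/eqP; lia.
have E2 : n.+1 == n.+2 = false by apply/eqP; lia.
have E3 : 1 == n.+1 = false by apply/eqP; lia.
have E4 : 1 == n.+2 = false by apply/eqP; lia.
have key a u : M a -> M u ->
  fo_sat M [eta [eta e1 with n.+1 |-> a] with n.+2 |-> u] e2
    (FAnd (Fpair n) (FAnd (Fitem n.+1 it) (Flst n.+2 its))) <->
  e1 n = pr a u /\ a = ival (e1 1) e2 it /\ u = lst (map (ival (e1 1) e2) its).
  move=> Ma Mu; set f := (X in fo_sat M X); rewrite !sat_FAnd.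
  have f1 : f 1 = e1 1 by rewrite /f /= ?E3 ?E4.
  have fn : f n = e1 n by rewrite /f /= E0 E1.
  have fa : f n.+1 = a by rewrite /f /= E2 eqxx.
  have fu : f n.+2 = u by rewrite /f /= eqxx.
  rewrite sat_Fpair ?fn ?fa ?fu // IH ?f1 ?fu //.
  suff -> : fo_sat M f e2 (Fitem n.+1 it) <-> a = ival (e1 1) e2 it by [].
  case: it {f1 fn fu} => [|c|t]; rewrite /Fitem ?/ival.
  - by rewrite /= fa /f /= ?E3 ?E4.
  - by rewrite /= fa.
  have F1 : 1 == n.+3 = false by apply/eqP; lia.
  have F2 : n.+1 == n.+3 = false by apply/eqP; lia.
  have F3 w : [eta f with n.+3 |-> w] n.+3 = w by rewrite /= eqxx.
  have F4 w : [eta f with n.+3 |-> w] n.+1 = a by rewrite /= ?F2 ?fa.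
  have F5 w : [eta f with n.+3 |-> w] 1 = e1 1 by rewrite /= ?F1 /f /= ?E3 ?E4.
  have sm : small (elts (e1 1) `&` term2_val e2 t) by apply: (@small_sub (e1 1)) => z [].
  have keyz w : fo_sat M [eta f with n.+3 |-> w] e2
     (FIff (FMem (Var1 n.+3) (Var1 n.+1)) (FAnd (FMem (Var1 n.+3) (Var1 1)) (FIn (Var1 n.+3) t)))
     <-> (w ∈ a <-> w ∈ e1 1 /\ term2_val e2 t w).
    by rewrite sat_FIff; rewrite /fo_sat /term1_val F3 F4 F5.
  rewrite sat_FAll; split.
    move=> h; apply: zfset_ext => z; rewrite zsetP //; split=> hz.
      have Mz : M z by exact: cumV_trans hz.
      by have /keyz := h z Mz; move=> [/(_ hz)].
    have Mz : M z by apply: cumV_trans (proj1 hz).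
    by have /keyz := h z Mz; move=> [_]; apply.
  by move=> Ea w Mw; apply/keyz; rewrite {1}Ea zsetP.
rewrite -[Flst _ _]/(FEx n.+1 (FEx n.+2 (FAnd (Fpair n) (FAnd (Fitem n.+1 it) (Flst n.+2 its))))) sat_FEx.
rewrite [X in _ <-> X]/=; split.
  by move=> [a Ma] /sat_FEx[u Mu /(key _ _ Ma Mu)[-> [-> ->]]].
move=> E; move: (Mt); rewrite E => /(cumV_pr _ _ lk)[Ma Mu].
by exists (ival (e1 1) e2 it) => //; apply/sat_FEx; eexists; first exact: Mu; apply/key.
Qed.

Lemma sat_Fat e1 e2 P R its :
  (forall t, M t -> (P t <-> codeR R t)) -> (forall c, List.In (IC c) its -> M c) ->
  fo_sat M e1 e2 (Fat P its) <-> atR R its k e2.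
Proof.
move=> hP hc; rewrite /Fat /atR sat_FAll.
have key x v t : M x -> M v -> M t ->
  fo_sat M [eta [eta [eta e1 with 0 |-> x] with 1 |-> v] with 2 |-> t] e2
    (FAnd (FMem (Var1 0) (Var1 1)) (FAnd (FIn (Var1 2) (Par2 P)) (Flst 2 (IV :: its)))) <->
  [/\ x ∈ v, P t & t = lst (v :: map (ival v e2) its)].
  move=> Mx Mv Mt; have := @sat_Flst [eta [eta [eta e1 with 0 |-> x] with 1 |-> v] with 2 |-> t]
    e2 2 (IV :: its) isT Mt Mv.
  move=> H; split; first by move=> [h1 [h2 /H h3]].
  by move=> [h1 h2 h3]; split=> //; split=> //; apply/H.
split=> h x Mx.
  have /sat_FEx[v Mv] := h x Mx; move=> /sat_FEx[t Mt /(key _ _ _ Mx Mv Mt)[xv Pt E]].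
  have /hP := Mt; rewrite E => /iffLR; rewrite -E => /(_ Pt)[g [vals [og]]].
  rewrite E => /lst_inj[Ev Es] Rg; exists g; split.
  - by apply: (mem_Vz ok) => //; rewrite -Ev.
  - by rewrite -VzP -Ev.
  - by rewrite -Ev Es.
have [g [gk xg Rg]] := h x Mx; have og := is_ordinal_in ok gk.
have Mv : M (Vz g) by exact: Vz_mem.
apply/sat_FEx; exists (Vz g) => //.
have Mt : M (lst (Vz g :: map (ival (Vz g) e2) its)).
  apply/cumV_lst => // a; rewrite in_cons => /orP[/eqP->//|].
  elim: its hc {h Rg key} => [|it its IH] // hc; rewrite in_cons => /orP[/eqP->|]; last first.
    by apply: IH => c hcc; apply: hc; right.
  case: it hc => [|c|t] hc //=; first by apply: hc; left.
  apply: cumV_subset Mv _ => z; rewrite /elts /= zsetP; first by case.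
  by apply: (@small_sub (Vz g)) => y [].
apply/sat_FEx; eexists; first exact: Mt.
apply/key => //; split=> //; first exact/VzP.
by apply/hP => //; exists g, (map (ival (Vz g) e2) its).
Qed.

End AtSat.

(** The entries of a tuple are traces on V_g with [g] below [k], and these do not change when the
    parameters are intersected with V_k. *)
Lemma sat_cap_Fat e1 e2 kk k R its : is_limit k -> cumV k `<=` cumV kk ->
  (forall c, List.In (IC c) its -> cumV k c) ->
  fo_sat (cumV k) e1 e2 (fo_cap_par2 (cumV k) (Fat (codeR R `&` cumV kk) its)) <-> atR R its k e2.
Proof.
move=> lk kkk hc; rewrite fo_cap_Fat (@sat_Fat k lk _ _ _ R); first 1 last.
- by move=> t kt; split=> [[[]]//|h]; split=> //; split=> //; exact: kkk.
- move=> c hc'; apply: hc; elim: its hc' => [//|it l IH] /=.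
  by case=> [|/IH]; [case: it => //= c' ->; left|right].
have ok := limit_ord lk.
have E g : g ∈ k -> map (ival (Vz g) e2) (map (icap (cumV k)) its) = map (ival (Vz g) e2) its.
  move=> gk; rewrite -map_comp; apply: eq_map => -[|c|[n|A]] //=.
  congr zset; apply/seteqP; split=> z [h1 h2]; first by case: h2.
  split=> //; split=> //; apply: cumV_mono (_ : ole g k) _ _ => //; first by left.
  exact/VzP.
split=> h x kx; have [g [gk xg Rg]] := h x kx; exists g; split=> //; last by rewrite E.
by rewrite -E.
Qed.

Definition item_fv2 it := if it is IS t then term2_fv t else set0.
Definition item_par2 it := if it is IS t then term2_par t else set0.

Lemma Fpair_fv1 n v : fo_fv1 (Fpair n) v -> [\/ v = n, v = n.+1 | v = n.+2].
Proof.
rewrite /= /setD /setU /set1 /mkset => h.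
have : v = n \/ v = n.+1 \/ v = n.+2 by tauto.
by case=> [->|[->|->]]; [constructor 1|constructor 2|constructor 3].
Qed.

Lemma Fitem_fv1 n it v : fo_fv1 (Fitem n it) v -> v = 1 \/ v = n.
Proof. by case: it => [|c|t]; rewrite /= /setD /setU /set1 /set0 /mkset => h; tauto. Qed.

Lemma Flst_fv1 n l v : fo_fv1 (Flst n l) v -> v = 1 \/ v = n.
Proof.
elim: l n => [|it l IH] n.
  by rewrite /= /setD /setU /set1 /mkset => h; tauto.
rewrite [Flst _ _]/= /FEx; rewrite [fo_fv1 _]/= -/(fo_fv1 (Fpair n)).
rewrite /setD /setU /mkset -/(fo_fv1 _) => -[[h nv] nv'].
case: h => [/Fpair_fv1[]//|]; first by move=> ->; right.
by case=> [/Fitem_fv1|/IH] []; auto.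
Qed.

Lemma Fat_fv1 P its : fo_fv1 (Fat P its) = set0.
Proof.
rewrite -subset0 => v; rewrite /Fat /FEx.
move: (Flst 2 _) (@Flst_fv1 2 (IV :: its) v) => F H.
by rewrite [fo_fv1 _]/= /setD /setU /set1 /set0 /mkset => h; tauto.
Qed.

Lemma Fat_fv2 P its v : fo_fv2 (Fat P its) v -> exists2 it, List.In it its & item_fv2 it v.
Proof.
have H n l : fo_fv2 (Flst n l) v -> exists2 it, List.In it l & item_fv2 it v.
  elim: l n => [|it l IH] n //=; rewrite /setU /mkset => -[|[|/IH[it' h1 h2]]].
  - by tauto.
  - case: it => [|c|t] //= h; exists (IS t) => //=; [by left|].
    by move: h; rewrite /setU /set0 /mkset; tauto.
  - by exists it' => //; right.
rewrite /Fat /FEx; move: (Flst 2 _) (H 2 (IV :: its)) => F HF.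
rewrite [fo_fv2 _]/= /setU /set0 /mkset => h; have {h} : fo_fv2 F v by tauto.
by move=> /HF[it /= [<-//|h1] h2]; exists it.
Qed.

Lemma Fat_par1 P its a : fo_par1 (Fat P its) a -> List.In (IC a) its.
Proof.
have H n l : fo_par1 (Flst n l) a -> List.In (IC a) l.
  elim: l n => [|it l IH] n /=; first by rewrite /setU /set0 /mkset; tauto.
  rewrite /setU /mkset => -[|[|/IH h]]; last by right.
  - by tauto.
  - by case: it => [|c|t]; rewrite /= /setU /set0 /set1 /mkset => h; left; [tauto|by case: h => [[]|->]|tauto].
rewrite /Fat /FEx; move: (Flst 2 _) (H 2 (IV :: its)) => F HF.
rewrite [fo_par1 _]/= /setU /set0 /mkset => h; have {h} : fo_par1 F a by tauto.
by move=> /HF /= [].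
Qed.

Lemma Fat_par2 P its A : fo_par2 (Fat P its) A ->
  A = P \/ exists2 it, List.In it its & item_par2 it A.
Proof.
have H n l : fo_par2 (Flst n l) A -> exists2 it, List.In it l & item_par2 it A.
  elim: l n => [|it l IH] n //=; rewrite /setU /mkset => -[|[|/IH[it' h1 h2]]].
  - by tauto.
  - case: it => [|c|t] //= h; exists (IS t) => //=; [by left|].
    by move: h; rewrite /setU /set0 /mkset; tauto.
  - by exists it' => //; right.
rewrite /Fat /FEx; move: (Flst 2 _) (H 2 (IV :: its)) => F HF.
rewrite [fo_par2 _]/= /setU /set0 /set1 /mkset => h.
have {h} : A = P \/ fo_par2 F A by tauto.
by case=> [->|/HF[it /= [<-//|h1] h2]]; [left|right; exists it].
Qed.

Lemma FOr_cap M p q : fo_cap_par2 M (FOr p q) = FOr (fo_cap_par2 M p) (fo_cap_par2 M q).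
Proof. by []. Qed.

(* A well-formed leaf over V_k with second-order parameters in Par and
   second-order variables below n. *)
Record wf_fo (k : zfset) (Par : set (set zfset)) (n : nat) (r : fo_formula) : Prop := WfFo {
  wf_fv1 : fo_fv1 r = set0;
  wf_fv2 : forall v, fo_fv2 r v -> v < n;
  wf_par1 : fo_par1 r `<=` cumV k;
  wf_par2 : fo_par2 r `<=` Par }.

Lemma wf_mono k Par n n' r : n <= n' -> wf_fo k Par n r -> wf_fo k Par n' r.
Proof. by move=> nn [h1 h2 h3 h4]; split=> // v /h2 h; exact: leq_trans nn. Qed.

Lemma wf_FAnd k Par n p q : wf_fo k Par n p -> wf_fo k Par n q -> wf_fo k Par n (FAnd p q).
Proof.
move=> [h1 h2 h3 h4] [h1' h2' h3' h4']; split=> /=.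
- by rewrite h1 h1' setU0.
- by move=> v [/h2|/h2'].
- by move=> v [/h3|/h3'].
- by move=> v [/h4|/h4'].
Qed.

Lemma wf_FNot k Par n p : wf_fo k Par n p -> wf_fo k Par n (FNot p).
Proof. by case. Qed.

Lemma wf_FOr k Par n p q : wf_fo k Par n p -> wf_fo k Par n q -> wf_fo k Par n (FOr p q).
Proof. by move=> hp hq; apply: wf_FNot; apply: wf_FAnd; exact: wf_FNot. Qed.

Definition wf_item k (Par : set (set zfset)) n it :=
  match it with
  | IV => True
  | IC c => cumV k c
  | IS (Var2 v) => v < n
  | IS (Par2 A) => Par A
  end.

Lemma wf_Fat (k : zfset) (Par : set (set zfset)) n P its : Par P ->
  (forall it, List.In it its -> wf_item k Par n it) -> wf_fo k Par n (Fat P its).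
Proof.
move=> hP h; split.
- exact: Fat_fv1.
- by move=> v /Fat_fv2[it /h]; case: it => //= -[m|A] //= h' ->.
- by move=> a /Fat_par1/h.
- by move=> A /Fat_par2[->//|[it /h]]; case: it => //= -[m|B] //= h' ->.
Qed.

Lemma wf_formula_over k Par n r : (forall A, Par A -> A `<=` cumV k) ->
  wf_fo k Par n r -> formula_over k (FO r).
Proof. by move=> hP [_ _ h3 h4]; split=> //= A /h4/hP. Qed.

Lemma cap_quant N pol ns p :
  cap_par2 N (foldr (quant pol) p ns) = foldr (quant pol) (cap_par2 N p) ns.
Proof. by elim: ns => //= n ns <-; case: pol. Qed.

Lemma sat_cap_sk St (m : machine St) leaf M N e1 ze pol st e : is_ordinal ze -> envM M e ->
  sat M e1 e (cap_par2 N (sk m leaf ze pol st)) <->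
  ev m (fun ze => elts ze) M (fun pol st e => fo_sat M e1 e (fo_cap_par2 N (leaf pol st)))
    ze pol st e.
Proof.
move=> oz; elim/ord_ind: ze / oz pol st e => [|d od IH|la ll IH] pol st e he.
- by rewrite sk0 ev0.
- by rewrite skS evS cap_quant sat_quant; apply: blk_ext => // e' he'; exact: IH.
have [f -> fP] := skL m leaf pol st ll; case: pol fP => fP /=.
  rewrite evLt //; split=> h z zl.
    by move=> _; apply/IH => //; rewrite -fP //; exact: h.
  by rewrite fP //; apply/IH => //; exact: h.
rewrite evLf //; split=> [[z zl h]|[z [zl _ h]]]; exists z => //.
  by split=> //; apply/IH => //; rewrite -fP.
by rewrite fP //; apply/IH.
Qed.

Lemma mem_ole_F x y : x ∈ y -> ~ ole y x.
Proof. by move=> xy [/(zmem_asym xy)//|E]; move: xy; rewrite E => /zmem_irr. Qed.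

Lemma restr_lowE b k a ze p q : restr b k a ze p q ->
  (ze ∈ k /\ q = cap_par2 (cumV a) p) \/ (~ ze ∈ k /\ is_regular k).
Proof.
case.
- by move=> xi p' xk; left.
- by move=> xi ns p' q' rk kx _; right; split=> // /mem_ole_F.
- by move=> xi ns p' q' rk kx _; right; split=> // /mem_ole_F.
- by move=> xi p' q' rk kx _ _ _; right; split=> // /mem_ole_F.
- by move=> xi p' q' rk kx _ _ _; right; split=> // /mem_ole_F.
Qed.

(** * First-order reflection and inaccessibility *)

Definition const_machine : machine unit :=
  Machine (fun _ _ _ => [::]) (fun _ _ => id) (fun _ _ _ => id).

Lemma ev_const O M (K : Prop) L ze pol st e : is_ordinal ze ->
  (forall la, is_limit la -> ole la ze -> exists2 z, z ∈ la & O la z) ->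
  (forall pol st, L pol st e <-> K) -> ev const_machine O M L ze pol st e <-> K.
Proof.
move=> oz; elim/ord_ind: ze / oz pol st => [|d od IH|la ll IH] pol st hO hL.
- by rewrite ev0.
- by rewrite evS /=; apply: IH => // la ll ld; apply: hO => //; left; exact/osuccP.
have [z0 z0l Oz0] := hO la ll (or_intror erefl).
have H z pol' st' : z ∈ la -> ev const_machine O M L z pol' st' e <-> K.
  move=> zl; apply: IH => // la' ll' lz'; apply: hO => //; left.
  exact: ole_trans_mem (limit_ord ll) lz' zl.
case: pol.
  rewrite evLt //; split=> [h|hK z zl _]; last exact/H.
  by apply/(H z0 true (li const_machine true la z0 st) z0l); exact: h.
rewrite evLf //; split=> [[z [zl _ /H]]|hK]; first exact.
by exists z0; split=> //; apply/H.
Qed.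

Lemma const_Pi k r n : fo_fv1 r = set0 -> fo_fv2 r = set0 -> formula_over k (FO r) ->
  finite_set (fo_par2 r) -> is_ordinal n ->
  is_Pi k n (sk const_machine (fun _ _ => r) n true tt) /\
  sentence (sk const_machine (fun _ _ => r) n true tt).
Proof.
move=> h1 h2 hk fin on.
pose inv (ze : zfset) (pol : bool) (st : unit) := True.
have A1 : forall (pol : bool) (st : unit), inv ozero pol st ->
  [/\ formula_over k (FO r), fo_fv1 r = set0,
      (forall v, fo_fv2 r v -> v < 0) & fo_par2 r `<=` fo_par2 r].
  by move=> _ _ _; split=> // v; rewrite h2.
have A2 : forall pol d st, inv (osucc d) pol st -> inv d (~~ pol) (nx const_machine pol d st) /\
  (forall v, v < 0 -> v < 0 \/ v \in ns const_machine pol d st) by move=> *; split.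
have A3 : forall pol la z st, is_limit la -> z ∈ la -> inv la pol st ->
  inv z pol (li const_machine pol la z st) /\ 0 <= 0 by [].
split.
  exact: (@sk_Pi _ const_machine (fun _ _ => r) k (fo_par2 r) inv (fun=> 0) fin A1 A2 A3 n true tt on I).
have [h3 h4 _] := @sk_free _ const_machine (fun _ _ => r) k (fo_par2 r) inv (fun=> 0) A1 A2 A3 n true tt on I.
by split=> //; rewrite -subset0 => v /h4.
Qed.

Section IndescribableFO.
Variables (b : zfset -> zfset -> zfset -> zfset) (k eta : zfset).
Hypotheses (hb : canonical_bijections b) (ind : indescribable b k eta).
Let ok : is_ordinal k. Proof. by case: ind => -[]. Qed.

(** The sentence is padded to level [eta] by empty quantifier blocks and constant conjunctions and
    disjunctions. The padding preserves its value as long as no limit level loses all its members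
    under restriction. *)
Lemma indescribable_FO r : fo_fv1 r = set0 -> fo_fv2 r = set0 -> formula_over k (FO r) ->
  finite_set (fo_par2 r) -> fo_sat (cumV k) (fun=> ozero) (fun=> set0) r ->
  exists a, [/\ a ∈ k, is_regular a &
    fo_sat (cumV a) (fun=> ozero) (fun=> set0) (fo_cap_par2 (cumV a) r)].
Proof.
move=> h1 h2 hk fin hr; have [ck le hI] := ind; have oe := ltcs_ord le.
have [hPi hS] := const_Pi h1 h2 hk fin oe.
have e0 M : envM M (fun=> set0) by move=> n x [].

have hz la : is_limit la -> ole la eta -> exists2 z, z ∈ la & elts la z.
  by move=> /limit_zero; exists ozero.
have [|a [q [ak ra hq _ hm]]] := hI _ hPi hS.
  rewrite /models sat_sk //.
  by apply/(@ev_const _ _ (fo_sat (cumV k) (fun=> ozero) (fun=> set0) r)).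
exists a; split=> //; have oa := is_ordinal_in ok ak; move: hm; rewrite /models.
case: (restr_lowE hq) => [[ek ->]|[nek rk]].
  rewrite sat_cap_sk //.
  by rewrite (@ev_const _ _ (fo_sat (cumV a) (fun=> ozero) (fun=> set0) (fo_cap_par2 (cumV a) r))).
rewrite (restr_sk ok hb ak (fun=> ozero) rk le (e0 _) hq).
rewrite (@ev_const _ _ (fo_sat (cumV a) (fun=> ozero) (fun=> set0) (fo_cap_par2 (cumV a) r))) //.
move=> la ll lle.
have lla : lt_cardinal_succ k la by case: lle => [/(ltcs_mem le)//|->].
have [_ la' _] := ra; have sub := canF_sub hb rk lla ak.
have [lk|nlk] := pselect (la ∈ k).
  by exists ozero; [exact: limit_zero|rewrite /canF asboolT //; exact: limit_zero].
have F0 : canF b k la a (b k la ozero).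
  by rewrite /canF asboolF //; exists ozero => //; exact: limit_zero.
by exists (b k la ozero) => //; exact: sub.
Qed.

Lemma indescribable_inacc : inacc k.
Proof.
have f0 A : finite_set (set0 : set (set A)) by exact: finite_set0.
have [] := @indescribable_FO (FAll 0 (FEq (Var1 0) (Var1 0))).
- by rewrite /= -subset0 => v; rewrite /setD /setU /set1 /mkset; tauto.
- by rewrite /= ?setU0.
- by split=> /=; rewrite ?setU0 //.
- by rewrite /= ?setU0.
- by [].
move=> l [lk [_ ll _] _].
have lim : is_limit k.
  case: (ord_case ok) => [E|[d od E]|//].
    by move: lk; rewrite E => /ozeroP.
  (* If [k] were the successor of [d], a sentence naming [d] would reflect to an ordinal strictly
     between [d] and its successor. *)
  exfalso; have [] := @indescribable_FO (FEx 0 (FEq (Var1 0) (Par1 d))).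
  - by rewrite /= -subset0 => v; rewrite /setD /setU /set1 /set0 /mkset; tauto.
  - by rewrite /= ?setU0.
  - split=> /=; rewrite ?setU0 // set0U => x ->.
    by apply: cumV_ordW => //; rewrite E; exact: osucc_mem.
  - by rewrite /= ?setU0.
  - apply/sat_FEx; exists d => //; apply: cumV_ordW => //; rewrite E; exact: osucc_mem.
  move=> a [ak [_ la _] /sat_FEx[x ax /= xd]]; subst x.
  have da : d ∈ a by move/(cumV_ord (limit_ord la) od): ax.
  by move: ak; rewrite E => /osuccP[/(zmem_asym da)//|E']; move: da; rewrite E' => /zmem_irr.
split=> //; first by exists l.
(* The sentence only says that each [c] in [a] belongs to some element of [G]. As the inner pair
   contains [a], it cannot be an element of [a], so [c] in [p c'] forces [c = c']. *)
move=> a g ak hg; pose p c := upair c (upair a (g c)).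
have pk c : c ∈ a -> cumV k (p c).
  move=> ca; have ck : cumV k c by exact: cumV_trans ca.
  do 2!apply: cumV_upair => //; apply: cumV_ordW; first exact: hg.
  exact: is_ordinal_in (hg _ ca).
pose G := [set p c | c in elts a].
pose r := FAnd (FEx 0 (FEq (Var1 0) (Par1 a)))
  (FAll 0 (FOr (FNot (FMem (Var1 0) (Par1 a)))
     (FEx 1 (FAnd (FIn (Var1 1) (Par2 G)) (FMem (Var1 0) (Var1 1)))))).
have [] := @indescribable_FO r.
- by rewrite /= -subset0 => v; rewrite /setD /setU /set1 /set0 /mkset; tauto.
- by rewrite /= !setU0.
- split=> /=; first by move=> x; rewrite /setU /set0 /set1 /mkset => h; have -> : x = a by tauto.
  move=> A; rewrite /setU /set0 /set1 /mkset => h; have -> : A = G by tauto.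
  by move=> x [c ca <-]; exact: pk.
- by rewrite /= !setU0 !set0U; exact: finite_set1.
- split; first by apply/sat_FEx; exists a.
  move=> c ck; apply/sat_FOr; have [ca|nca] := pselect (c ∈ a); last by left.
  right; apply/sat_FEx; exists (p c); first exact: pk.
  by split; [exists c|apply/upairP; left].
pose body P := FOr (FNot (FMem (Var1 0) (Par1 a)))
     (FEx 1 (FAnd (FIn (Var1 1) (Par2 P)) (FMem (Var1 0) (Var1 1)))).
move=> e [ek [_ le _] hsat].
have /sat_FAnd[/sat_FEx[x ax /= xa] h] : fo_sat (cumV e) (fun=> ozero) (fun=> set0)
  (FAnd (FEx 0 (FEq (Var1 0) (Par1 a))) (FAll 0 (body (G `&` cumV e)))) := hsat.
subst x; exists e => // c ca.
have ce : cumV e c by apply: cumV_trans ca => //; exact: limit_ord.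
have [y [[[c' c'a E] ey] cy]] : exists y, (G y /\ cumV e y) /\ c ∈ y.
  apply: contrapT => nx; apply: (h c ce); split=> [nc|nh]; first exact: nc.
  by apply: nh => y _ hy; apply: nx; exists y.
subst y; move: cy => /upairP[E|E]; last first.
  have aE : a ∈ c by rewrite E; apply/upairP; left.
  by case: (zmem_asym ca aE).
subst c'; have oe := limit_ord le.
have h1 : cumV e (upair a (g c)) by apply: cumV_trans ey _ => //; apply/upairP; right.
have h2 : cumV e (g c) by apply: cumV_trans h1 _ => //; apply/upairP; right.
by apply/(cumV_ord oe) => //; exact: is_ordinal_in (hg _ ca).
Qed.

End IndescribableFO.

(** A sentence over V_al has collapsed ordinals as levels, while the machines name levels by their
    codes in [Xi]; [g] will be the inverse of the collapse. *)
Definition reidx (g : zfset -> zfset) St (m : machine St) : machine St :=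
  Machine (fun pol d st => ns m pol (g d) st) (fun pol d st => nx m pol (g d) st)
    (fun pol la z st => li m pol (g la) (g z) st).

Lemma canF_limit_inh b k la a : canonical_bijections b -> is_regular k ->
  lt_cardinal_succ k la -> a ∈ k -> is_limit a -> is_limit la ->
  exists2 z, z ∈ la & canF b k la a z.
Proof.
move=> hb rk lla ak la' ll; have sub := canF_sub hb rk lla ak.
have [lk|nlk] := pselect (la ∈ k).
  by exists ozero; [exact: limit_zero|rewrite /canF asboolT //; exact: limit_zero].
have F0 : canF b k la a (b k la ozero).
  by rewrite /canF asboolF //; exists ozero => //; exact: limit_zero.
by exists (b k la ozero) => //; exact: sub.
Qed.

Lemma sat_cap_id k p M e1 e : (forall A, par2 p A -> A `<=` cumV k) ->
  sat M e1 e (cap_par2 (cumV k) p) <-> sat M e1 e p.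
Proof.
elim: p e => [r|n p IH|n p IH|la f IH|la f IH] e h /=.
- suff -> : fo_cap_par2 (cumV k) r = r by [].
  elim: r h => //= [s [n|A] h|q IH h|q IHq r IHr h|n q IH h].
  + by [].
  + by rewrite /= (setIidl (h A erefl)).
  + by rewrite IH.
  + by rewrite IHq ?IHr // => A hA; apply: h; [right|left].
  + by rewrite IH.
- by split=> H X XM; apply/IH => //; exact: H.
- by split=> -[X XM H]; exists X => //; apply/IH.
- by split=> H z zl; (apply/IH; [move=> A hA; apply: h; exists z|exact: H]).
- by split=> -[z zl H]; exists z => //; (apply/IH; [move=> A hA; apply: h; exists z|exact: H]).
Qed.

(** * Games along the collapse *)

Section Transfer.
Variables (b : zfset -> zfset -> zfset -> zfset) (mu Xi xi al : zfset).
Hypotheses (hb : canonical_bijections b) (rmu : is_regular mu).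
Hypotheses (lXi : lt_cardinal_succ mu Xi) (alm : al ∈ mu) (gal : good b mu Xi al).
Hypothesis hxi : dom b mu Xi Xi al xi.
Let omu : is_ordinal mu. Proof. by case: rmu => _ /limit_ord. Qed.
Let oal : is_ordinal al. Proof. exact: is_ordinal_in alm. Qed.
Let oxi : is_ordinal xi. Proof. exact: dom_ord lXi hxi. Qed.
Notation pi := (collapse (canF b mu xi al)).
Notation pin := (pinv b mu Xi xi al).

Lemma dom_ordinal a ze : dom b mu Xi xi a ze -> is_ordinal ze.
Proof. by case=> [->//|[/(is_ordinal_in oxi)]]. Qed.

(** Over V_al itself nothing is restricted: the levels below f_xi(al) are exactly the collapses of
    the levels in F_xi(al). *)
Lemma ev_top St (m : machine St) M L ze pol st e : dom b mu Xi xi al ze -> envM M e ->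
  ev (reidx pin m) (fun ze => elts ze) M L (pi ze) pol st e <->
  ev m (fun ze => canF b mu ze al) M L ze pol st e.
Proof.
move=> hze he; apply: (@ev_iso _ m _ _ _ M L L pi (dom b mu Xi xi al)) => //.
- exact: dom_ordinal.
- exact: pi_zero.
- move=> d hd; have Xd := dom_succ hb rmu lXi alm gal hxi hd.
  split; last exact: (pi_succ hb rmu lXi alm gal hxi hd).
  by right; apply/(X_P hb rmu lXi alm gal hxi).
- by move=> la hla; exact: (pi_limit hb rmu lXi alm gal hxi).
- move=> la z hla ll Fz zl; have hz := dom_in hb rmu lXi alm gal hxi hla Fz.
  by split=> //; apply/(pi_elts hb rmu lXi alm gal hxi) => //; exists z.
- move=> la hla ll z' hz'; split=> [_|_]; last exact: hz'.
  have [z Fz E] := proj1 (pi_elts hb rmu lXi alm gal hxi z' hla) hz'.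
  by exists z; split=> //; case/(dom_canF hb rmu lXi alm gal hxi z hla): Fz.
- move=> pl d st' hd; have Xd := dom_succ hb rmu lXi alm gal hxi hd.
  have hd' : dom b mu Xi xi al d by right; apply/(X_P hb rmu lXi alm gal hxi).
  by rewrite /reidx /= (pinvK hb rmu lXi alm gal hxi hd').
- move=> pl la z st' hla ll Fz zl; have hz := dom_in hb rmu lXi alm gal hxi hla Fz.
  by rewrite /reidx /= !(pinvK hb rmu lXi alm gal hxi).
Qed.

Variable be : zfset.
Hypotheses (beal : be ∈ al) (gbe : good b mu Xi be) (hxib : dom b mu Xi Xi be xi).
Hypothesis coh : forall ze, dom b mu Xi xi be ze -> forall z',
  canF b al (pi ze) be z' <-> exists2 z, canF b mu ze be z & pi z = z'.
Let bem : be ∈ mu. Proof. exact: (ord_trans omu beal alm). Qed.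

(** Restriction to [be] keeps the levels selected by the canonical functions of [al]. By [coh] they
    are the collapses of those selected by the canonical functions of [mu], so the restricted game
    is the game at [be] as seen from [mu]. *)
Lemma ev_below St (m : machine St) M L ze pol st e : dom b mu Xi xi be ze -> envM M e ->
  ev (reidx pin m) (fun ze => canF b al ze be) M L (pi ze) pol st e <->
  ev m (fun ze => canF b mu ze be) M L ze pol st e.
Proof.
move=> hze he.
have up z : dom b mu Xi xi be z -> dom b mu Xi xi al z by exact: dom_mono oal beal.
have pk z : dom b mu Xi xi be z -> pin (pi z) = z.
  by move=> /up; exact: (pinvK hb rmu lXi alm gal hxi).
have dsucc d : dom b mu Xi xi be (osucc d) -> dom b mu Xi xi be d.
  move=> hd; have Xd := dom_succ hb rmu lXi bem gbe hxib hd.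
  by right; apply/(X_P hb rmu lXi bem gbe hxib).
have din la z : dom b mu Xi xi be la -> canF b mu la be z -> z ∈ la -> dom b mu Xi xi be z /\ pi z ∈ pi la.
  move=> hla Fz zl; have hz := dom_in hb rmu lXi bem gbe hxib hla Fz.
  split=> //; apply: collapse_homo => //.
  have [E|//] := dom_X hb rmu lXi alm gal hxi (up _ hz); exfalso; subst z.
  by case: hla => [E|[lx _]]; [move: zl; rewrite E => /zmem_irr|exact: (zmem_asym zl lx)].
apply: (@ev_iso _ m _ _ _ M L L pi (dom b mu Xi xi be)) => //.
- exact: dom_ordinal.
- exact: pi_zero.
- by move=> d hd; split; [exact: dsucc|exact: (pi_succ hb rmu lXi alm gal hxi (up _ hd))].
- by move=> la hla; exact: (pi_limit hb rmu lXi alm gal hxi (up _ hla)).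
- by move=> la z hla ll Fz zl; exact: din.
- move=> la hla ll z' hz'; rewrite coh //; split=> [[z Fz E]|[z [Fz zl E]]]; exists z => //.
  by split=> //; case/(dom_canF hb rmu lXi bem gbe hxib z hla): Fz.
- by move=> pl d st' hd; rewrite /reidx /= pk //; exact: dsucc.
- by move=> pl la z st' hla ll Fz zl; rewrite /reidx /= !pk //; case: (din _ _ hla Fz zl).
Qed.

End Transfer.

(** * Limit points *)

Lemma InP (T : eqType) (x : T) (s : seq T) : List.In x s <-> x \in s.
Proof.
elim: s => //= y s IH; rewrite in_cons; split=> [[->|/IH ->]|/orP[/eqP->|/IH]].
- by rewrite eqxx.
- by rewrite orbT.
- by left.
- by right.
Qed.

Lemma generated_nbhs (T : choiceType) (B : set (set T)) (a : T) (U : set T) :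
  nbhs (a : generated B) (U : set (generated B)) <->
  exists Us : seq (set T), (forall V, List.In V Us -> B V /\ V a) /\
    (forall x, (forall V, List.In V Us -> V x) -> U x).
Proof.
split.
  rewrite nbhsE => -[W [hW Wa] WU].
  have [D1 sD1 E] : exists2 D0 : set (set T), (D0 `<=` finI_from B id) &
    (\bigcup_(i in D0) i = W) by exact: hW.
  move: Wa; rewrite -E => -[A DA0 Aa].
  have [DA sDA AE] := sD1 _ DA0.
  exists (enum_fset DA); split=> [V VA|x hx].
    have VA' : V \in DA by exact/InP.
    split; first by have /set_mem := sDA _ VA'.
    by move: Aa; rewrite -AE; apply.
  apply: WU; rewrite -E; exists A => //; rewrite -AE => V /= VA; apply: hx.
  exact/InP.
move=> [Us [hUs hU]].
have : nbhs (a : generated B) ([set x | forall V, List.In V Us -> V x] : set (generated B)).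
  elim: Us hUs {hU} => [|V l IH] h.
    by have -> : [set x : T | forall V, List.In V [::] -> V x] = setT;
      [by rewrite -subTset => x _ V|exact: filterT].
  have -> : [set x : T | forall V', List.In V' (V :: l) -> V' x] =
            V `&` [set x | forall V, List.In V l -> V x].
    apply/seteqP; split=> x /=.
      by move=> hx; split=> [|V' V'l]; apply: hx; [left|right].
    by move=> [Vx hx] V' [<-//|]; exact: hx.
  apply: filterI; last by apply: IH => V' V'l; apply: h; right.
  have [BV Va] : B V /\ V a by apply: h; left.
  rewrite nbhsE; exists V => //; split=> //.
  exists [set V]; last by rewrite bigcup_set1.
  by move=> W ->; exact: finI_from1.
apply: filterS => x; exact: hU.
Qed.

Lemma subbasisE mu (d : zfset -> set (below mu) -> set (below mu)) ze : is_ordinal ze ->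
  subbasis d ze = @B0 mu `|` [set U | exists2 z, z ∈ ze & exists A, U = d z A].
Proof.
move=> oz; apply/seteqP; split=> U.
  elim=> {ze oz U} [U|xi U _ [|[z zx UE]]|xi A|xi z U ll zx _ [|[y yz UE]]].
  - by left.
  - by left.
  - by right; exists z => //; exact: osucc_memW.
  - by right; exists xi; [exact: osucc_mem|exists A].
  - by left.
  - by right; exists y => //; apply: ord_trans zx => //; exact: limit_ord.
elim/ord_ind: ze / oz => [|d' od IH|la ll IH] [BU|[z zx UE]].
- exact: subbasis_zero.
- by case: (ozeroP zx).
- by apply: subbasis_old; apply: IH; left.
- case/osuccP: zx => [zd|E]; first by apply: subbasis_old; apply: IH; right; exists z.
  by case: UE => A ->; rewrite E; exact: subbasis_new.
- by apply: (@subbasis_limit _ _ _ ozero) => //; [exact: limit_zero|apply: IH; [exact: limit_zero|left]].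
- apply: (@subbasis_limit _ _ _ (osucc z)) => //; first exact: limit_succ.
  by apply: IH; [exact: limit_succ|right; exists z => //; exact: osucc_mem].
Qed.

Section Derived.
Variables (b : zfset -> zfset -> zfset -> zfset) (mu : zfset).
Hypotheses (hb : canonical_bijections b) (rmu : is_regular mu).
Let lmu : is_limit mu. Proof. by case: rmu. Qed.
Let omu : is_ordinal mu. Proof. exact: limit_ord. Qed.
Notation T := (below mu).
Notation dop := (@d_op b mu).

(** For [ze] below [mu] the set [canF] is [ze] itself, so by [subbasisE] this covers both clauses of
    [d_step]. *)
Definition SB ze (a : T) : set (set T) :=
  @B0 mu `|` [set U | exists2 z, canF b mu ze (val a) z & exists A, U = dop z A].

Lemma val_in (a : T) : val a ∈ mu.
Proof. by case: a => x /= /set_mem. Qed.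

Definition mkbelow x (h : x ∈ mu) : T := exist _ x (mem_set h).

Lemma dop_limit_point ze (A : set T) (a : T) : lt_cardinal_succ mu ze ->
  dop ze A a <-> limit_point (A : set (generated (SB ze a))) a.
Proof.
move=> lz; have oz := ltcs_ord lz.
have F am : am ∈ mu -> canF b mu ze am `<=` elts ze by exact: canF_sub.
rewrite (d_opE oz (fun _ => F)).
rewrite /d_step; case: asboolP => // zm.
suff -> : subbasis dop ze = SB ze a by [].
rewrite subbasisE // /SB /canF asboolT //.
Qed.

Lemma dopP ze (A : set T) (a : T) : lt_cardinal_succ mu ze ->
  dop ze A a <-> forall Us : seq (set T), (forall V, List.In V Us -> SB ze a V /\ V a) ->
    exists y, [/\ y <> a, A y & forall V, List.In V Us -> V y].
Proof.
move=> lz; rewrite dop_limit_point //; split.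
  move=> h Us hUs.
  have /h[y [/eqP ya Ay Uy]] : nbhs (a : generated (SB ze a))
     ([set x | forall V, List.In V Us -> V x] : set (generated (SB ze a))).
    by apply/generated_nbhs; exists Us.
  by exists y.
move=> h U /generated_nbhs[Us [hUs hU]].
have [y [ya Ay Uy]] := h Us hUs.
by exists y; split=> //; [apply/eqP|exact: hU].
Qed.

(** Derived sets of arbitrary classes of ordinals, which frees the games from the subtype
    [below mu]. *)
Definition dd ze (B : set zfset) al : Prop :=
  exists a : T, val a = al /\ dop ze [set x | B (val x)] a.

Definition vals (A : set T) : set zfset := [set x | exists2 a, A a & val a = x].

Lemma dop_dd ze (A : set T) a : dop ze A a <-> dd ze (vals A) (val a).
Proof.
have E : [set x | vals A (val x)] = A.
  by apply/seteqP; split=> x; [move=> [y Ay /val_inj <-]|move=> Ax; exists x].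
split; first by move=> h; exists a; rewrite E.
by move=> [a' [/val_inj ->]]; rewrite E.
Qed.

Lemma dd_val ze B (a : T) : dd ze B (val a) <-> dop ze [set x | B (val x)] a.
Proof. by split=> [[a' [/val_inj->]]//|h]; exists a. Qed.

Lemma dd_mono ze (B B' : set zfset) al : lt_cardinal_succ mu ze -> B `<=` B' ->
  dd ze B al -> dd ze B' al.
Proof.
move=> lz BB [a [E h]]; exists a; split=> //; apply/dopP => // Us hUs.
have [y [ya By Uy]] := proj1 (dopP _ _ lz) h Us hUs.
by exists y; split=> //; exact: BB.
Qed.

Lemma B0_interval c e : c ∈ e -> ole e mu -> @B0 mu [set x : T | c ∈ val x /\ val x ∈ e].
Proof. by move=> ce em; right; exists c, e. Qed.

Lemma dd_local ze (B : set zfset) al : lt_cardinal_succ mu ze ->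
  dd ze B al -> dd ze (B `&` elts al) al.
Proof.
move=> lz [a [E h]]; exists a; split=> //; apply/dopP => // Us hUs.
have am : al ∈ mu by rewrite -E; exact: val_in.
have oa := is_ordinal_in omu am.
(* Zero is isolated at every level. Elsewhere an interval ending in [osucc al] confines the
   witnesses to points below [al]. *)
have [a0|a0] := pselect (al = ozero).
  have [|y [ya _ Uy]] := proj1 (dopP _ _ lz) h [:: [set x : T | val x = ozero]].
    by move=> V /= [<-|//]; split; [left; left|rewrite /= E a0].
  case: ya; apply: val_inj; rewrite E a0.
  by have := Uy [set x : T | val x = ozero] (or_introl erefl).
have [|y [ya By Uy]] := proj1 (dopP _ _ lz) h
    ([set x : T | ozero ∈ val x /\ val x ∈ osucc al] :: Us).
  have za := ord_zero_in oa a0.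
  move=> V /= [<-|/hUs//]; split.
    by left; apply: B0_interval; [exact: osucc_memW|exact: ole_osucc].
  by rewrite /= E; split=> //; exact: osucc_mem.
exists y; split=> //; last by move=> V hV; apply: Uy; right.
split=> //; have [_ /osuccP[//|ya']] := Uy [set x : T | ozero ∈ val x /\ val x ∈ osucc al] (or_introl erefl).
by case: ya; apply: val_inj; rewrite E.
Qed.

(** The combinatorial form of limit points: near a limit ordinal finitely many intervals amount to
    one lower bound [g], and all other subbasic sets are derived sets, listed as pairs of a level
    and a set. *)
Lemma ddP ze B al : lt_cardinal_succ mu ze -> al ∈ mu -> is_limit al ->
  dd ze B al <-> forall g (l : seq (zfset * set zfset)), g ∈ al ->
    (forall p, List.In p l -> canF b mu ze al p.1 /\ dd p.1 p.2 al) ->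
    exists be, [/\ be ∈ al, g ∈ be, B be & forall p, List.In p l -> dd p.1 p.2 be].
Proof.
move=> lz am la; have oa := limit_ord la; pose a := mkbelow am.
have Ea : val a = al by [].
rewrite -{1}Ea dd_val dopP //; split.
  move=> h g l gal hl.
  have [|y [ya By Uy]] := h ([set x : T | g ∈ val x /\ val x ∈ osucc al] ::
      List.map (fun p => dop p.1 [set x | p.2 (val x)]) l).
    move=> V /= [<-|/List.in_map_iff[p [<- pl]]].
      split; first by left; apply: B0_interval; [exact: osucc_memW|exact: ole_osucc].
      by split=> //; exact: osucc_mem.
    have [h1 h2] := hl _ pl; split; last exact/dd_val.
    by right; exists p.1 => //; eexists.
  exists (val y).
  have [gy /osuccP[ya'|ya']] := Uy [set x : T | g ∈ val x /\ val x ∈ osucc al] (or_introl erefl);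
    last first.
    by case: ya; apply: val_inj.
  split=> // p pl; apply/dd_val; apply: Uy; right; apply/List.in_map_iff.
  by exists p.
move=> h Us hUs.
have [g [l [gal hl hy]]] : exists g (l : seq (zfset * set zfset)), [/\ g ∈ al,
    (forall p, List.In p l -> canF b mu ze al p.1 /\ dd p.1 p.2 al) &
    forall y : T, g ∈ val y -> val y ∈ al -> (forall p, List.In p l -> dd p.1 p.2 (val y)) ->
      forall V, List.In V Us -> V y].
  elim: Us hUs => [|V Us IH] hUs.
    by exists ozero, [::]; split=> //; exact: limit_zero.
  have [|g [l [gal hl hy]]] := IH; first by move=> W hW; apply: hUs; right.
  have [SV Va] : SB ze a V /\ V a by apply: hUs; left.
  case: SV => [[VE|[c [e [ce em VE]]]]|[z Fz [A VE]]].
  - by move: Va; rewrite VE /= => E; case: la => _ /(_ E).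
  - move: Va; rewrite VE /= => -[cal ale].
    have [w [wal cw gw]] := limit_max la cal gal.
    have oe : is_ordinal e by case: em => [/(is_ordinal_in omu)|->].
    exists w, l; split=> // y wy ya hly W.
    have oy : is_ordinal (val y) by exact: is_ordinal_in ya.
    move=> /= [<-|hW]; last by apply: hy => //; exact: ole_trans_mem gw wy.
    by split; [exact: ole_trans_mem cw wy|exact: ord_trans ale].
  - exists g, ((z, vals A) :: l); split=> //.
      by move=> p /= [<-/=|/hl//]; split=> //; rewrite -Ea; apply/dop_dd; rewrite -VE.
    move=> y gy ya hly W /= [<-|hW]; last by apply: hy => // p pl; apply: hly; right.
    by rewrite VE; apply/dop_dd; apply: (hly (z, vals A)); left.
have [be [bal gb Bb hlb]] := h g l gal hl.
have bm : be ∈ mu by exact: (ord_trans omu bal am).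
exists (mkbelow bm); split=> //; last by apply: hy.
by move=> E; have := congr1 val E => /= E'; move: bal; rewrite E' => /zmem_irr.
Qed.

End Derived.

(** * Limit points as games *)

Definition sec (t : zfset) (X : set zfset) : set zfset := [set x | X (pr t x)].

(* A move is a set of pairs with first component a tag; the tag 0 is reserved for the header of
   the move, and reading it is total, with a junk value when it is not unique. *)
Definition thez (Y : set zfset) : zfset :=
  if `[< exists x, Y = [set x] >] then xget ozero Y else ozero.

Lemma thez1 x : thez [set x] = x.
Proof.
rewrite /thez asboolT; last by exists x.
by case: xgetP => [y _ ->//|/(_ x)]; case.
Qed.

Lemma thez_in Y : thez Y = ozero \/ Y (thez Y).
Proof.
rewrite /thez; case: asboolP => [[x ->]|_]; last by left.
by right; case: xgetP => [y _ //|/(_ x)]; case.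
Qed.

(** Because of the junk value, the reading depends on a small part of [X]: the value when it is
    unique, and two distinct candidates when it is not. Every trace that contains this part reads
    the same. *)
Lemma thez_stable k t X : is_limit k -> X `<=` cumV k ->
  exists2 x0, cumV k x0 & forall g, is_ordinal g -> cumV g x0 ->
    thez (sec t (X `&` cumV g)) = thez (sec t X).
Proof.
move=> lk Xk; have [[H XH]|none] := pselect (exists H, sec t X H); last first.
  exists ozero; first exact: cumV_zero.
  move=> g _ _; congr thez; apply/seteqP; split=> x; first by case.
  by move=> h; case: none; exists x.
have [[H' [XH' HH]]|one] := pselect (exists H', sec t X H' /\ H' <> H); last first.
  exists (pr t H); first exact: Xk.
  move=> g _ hg; congr thez; apply/seteqP; split=> x; first by case.
  move=> h; split=> //; have -> // : x = H.
  by apply: contrapT => xH; apply: one; exists x.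
exists (upair (pr t H) (pr t H')); first by apply: cumV_upair => //; exact: Xk.
move=> g og hg.
have g1 : cumV g (pr t H) by apply: cumV_trans hg _ => //; apply/upairP; left.
have g2 : cumV g (pr t H') by apply: cumV_trans hg _ => //; apply/upairP; right.
rewrite /thez !asboolF //.
  by move=> [x E]; apply: HH; rewrite E in XH XH'; rewrite XH XH'.
move=> [x E]; apply: HH.
have E1 : sec t (X `&` cumV g) H by [].
have E2 : sec t (X `&` cumV g) H' by [].
by rewrite E in E1 E2; rewrite E1 E2.
Qed.

(** The codes of the claimed levels, the index of the challenged claim of the previous move, and the
    lower bound of the challenge. *)
Definition header : Type := (seq zfset * nat * zfset)%type.

Definition hcode (h : header) : zfset := pr (pr h.2 (ztag h.1.2)) (lst h.1.1).

Lemma hcode_inj : injective hcode.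
Proof.
move=> [[cs k] g] [[cs' k'] g'] /pr_inj[/pr_inj[/= -> /ztag_inj ->]].
by move=> /= /lst_inj ->.
Qed.

Definition hdec (H : zfset) : header := xget ([::], 0, ozero) [set h | hcode h = H].

Lemma hdecK h : hdec (hcode h) = h.
Proof. by rewrite /hdec; case: xgetP => [h' _ /hcode_inj//|/(_ h)]; case. Qed.

Definition hdr (X : set zfset) : header := hdec (thez (sec (ztag 0) X)).
Definition body (j : nat) (X : set zfset) : set zfset := sec (ztag j.+1) X.

Definition move_of (h : header) (Bs : nat -> set zfset) : set zfset :=
  [set x | x = pr (ztag 0) (hcode h) \/ exists j e, x = pr (ztag j.+1) e /\ Bs j e].

Lemma hdr_move h Bs : hdr (move_of h Bs) = h.
Proof.
rewrite /hdr; have -> : sec (ztag 0) (move_of h Bs) = [set hcode h].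
  apply/seteqP; split=> x; last by move=> ->; left.
  by case=> [/pr_inj[_ ->]//|[j [e [/pr_inj[/ztag_inj]]]]].
by rewrite thez1 hdecK.
Qed.

Lemma body_move h Bs j : body j (move_of h Bs) = Bs j.
Proof.
apply/seteqP; split=> x; last by move=> h1; right; exists j, x.
by case=> [/pr_inj[/ztag_inj]//|[j' [e [/pr_inj[/ztag_inj[->] ->]]]]].
Qed.

Lemma hdr_stable k X : is_limit k -> X `<=` cumV k ->
  exists2 x0, cumV k x0 & forall g, is_ordinal g -> cumV g x0 -> hdr (X `&` cumV g) = hdr X.
Proof.
move=> lk Xk; have [x0 kx0 h] := thez_stable (ztag 0) lk Xk.
by exists x0 => // g og gx0; rewrite /hdr h.
Qed.

Lemma hdr_V k X : is_limit k -> X `<=` cumV k ->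
  cumV k (hdr X).2 /\ (forall i, i \in (hdr X).1.1 -> cumV k i).
Proof.
move=> lk Xk; have ok := limit_ord lk; rewrite /hdr /hdec; case: xgetP => [h _ E|_] /=; last first.
  by split=> //; exact: cumV_zero.
have : cumV k (hcode h).
  rewrite E; case: (thez_in (sec (ztag 0) X)) => [->|/Xk]; first exact: cumV_zero.
  by move=> /(cumV_pr _ _ lk)[].
by move=> /(cumV_pr _ _ lk)[/(cumV_pr _ _ lk)[h1 _] /(cumV_lst _ lk)].
Qed.

Lemma body_mono j (X Y : set zfset) : X `<=` Y -> body j X `<=` body j Y.
Proof. by move=> XY x; exact: XY. Qed.

(** A header is read at every level of the game, also below the levels it names; a claimed level is
    cut down to the current one. *)
Definition omin z ze := if `[< z ∈ ze >] then z else ze.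

Lemma omin_l z ze : z ∈ ze -> omin z ze = z. Proof. by rewrite /omin; case: asboolP. Qed.
Lemma omin_r z ze : ~ z ∈ ze -> omin z ze = ze. Proof. by rewrite /omin; case: asboolP. Qed.

(** * Limit points unfolded level by level *)

Section Semantics.
Variables (b : zfset -> zfset -> zfset -> zfset) (mu xi : zfset).
Hypotheses (hb : canonical_bijections b) (rmu : is_regular mu).
Let Xi := osucc xi.
Hypothesis lXi : lt_cardinal_succ mu Xi.
Let lmu : is_limit mu. Proof. by case: rmu. Qed.
Let omu : is_ordinal mu. Proof. exact: limit_ord. Qed.
Let oXi : is_ordinal Xi. Proof. exact: ltcs_ord lXi. Qed.
Notation c := (code b mu Xi).
Notation dd := (@dd b mu).

(** Headers are arbitrary; a code that names no level counts as a code of zero. *)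
Definition lev i := xget ozero [set z | z ∈ Xi /\ c z = i].

Lemma lev_code z : z ∈ Xi -> lev (c z) = z.
Proof.
move=> zX; rewrite /lev; case: xgetP => [y _ [yX /(code_inj hb rmu lXi yX zX)]//|/(_ z)].
by case.
Qed.

(* In the game of level ze at al, the move X claims that al is a limit point, in the topology of
   the level given by its header, of each of the bodies of X. *)
Definition Pd ze al X : Prop := forall j, j < size (hdr X).1.1 ->
  dd (omin (lev (nth ozero (hdr X).1.1 j)) ze) (body j X) al.

(* The first-order part of the game at g: Y challenges X at the index (hdr Y).1.2 and the
   lower bound (hdr Y).2. *)
Definition FOs g de (X Y : set zfset) : Prop :=
  (hdr Y).1.2 < size (hdr X).1.1 -> is_ordinal (hdr Y).2 ->
  (forall j, j < size (hdr Y).1.1 -> omin (lev (nth ozero (hdr Y).1.1 j)) de ∈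
     omin (lev (nth ozero (hdr X).1.1 (hdr Y).1.2)) (osucc de)) ->
  exists be, [/\ be ∈ g, (hdr Y).2 ∈ be, body (hdr Y).1.2 X be &
    forall j, j < size (hdr Y).1.1 ->
      dd (omin (lev (nth ozero (hdr Y).1.1 j)) de) (body j Y) be].

(** At level zero the neighbourhoods are intervals, and a claim says that the body is unbounded. *)
Definition P0s g X : Prop := forall j, j < size (hdr X).1.1 ->
  forall e, e ∈ g -> exists e', [/\ e' ∈ g, e ∈ e' & body j X e'].

Section AtAl.
Variable al : zfset.
Hypotheses (alm : al ∈ mu) (ial : inacc al) (gal : good b mu Xi al).
Let lal : is_limit al. Proof. exact: inacc_limit. Qed.
Let oal : is_ordinal al. Proof. exact: limit_ord. Qed.

Definition inF z := z ∈ Xi /\ c z ∈ al.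

Lemma inF_canF ze z : inF ze -> canF b mu ze al z <-> z ∈ ze /\ inF z.
Proof.
move=> [zX za]; rewrite (good_F gal zX za); split=> [[zz zc]|[zz [_ zc]]]; split=> //.
by split=> //; exact: ord_trans zX.
Qed.

Lemma inF_ltcs ze : inF ze -> lt_cardinal_succ mu ze.
Proof. by move=> [/(ltcs_mem lXi)]. Qed.

Lemma inF_pred d : inF (osucc d) -> inF d.
Proof.
move=> [dX da]; split; first by apply: ord_trans dX => //; exact: osucc_mem.
exact: (good_pred gal) dX da.
Qed.

Lemma lev_inF X j : X `<=` cumV al -> j < size (hdr X).1.1 -> inF (lev (nth ozero (hdr X).1.1 j)).
Proof.
move=> Xa hj; have [_ h] := hdr_V lal Xa.
have ha := h _ (mem_nth ozero hj).
have zX : ozero ∈ Xi by apply: ord_zero_in => //; exact: osucc_neq0.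
have z0 : inF ozero by split=> //; exact: (good_zero gal).
rewrite /lev; case: xgetP => [z _ [zX' zE]|_] //; split=> //.
apply/(cumV_ord oal); last by rewrite zE.
by apply: is_ordinal_in omu _; exact: code_in.
Qed.

Lemma omin_inF z ze : inF z -> inF ze -> inF (omin z ze).
Proof. by rewrite /omin; case: asboolP. Qed.

(** A lower level has fewer derived sets among its neighbourhoods. *)
Lemma dd_level ze ze' B : inF ze -> inF ze' -> ole ze' ze -> dd ze B al -> dd ze' B al.
Proof.
move=> hz hz' le; rewrite !ddP //; try exact: inF_ltcs.
move=> h g l gal' hl; apply: h => // p pl; have [h1 h2] := hl p pl; split=> //.
have [h3 h4] := proj1 (inF_canF _ hz') h1; apply/inF_canF => //; split=> //.
by case: hz => zX _; apply: mem_ole_trans le => //; exact: is_ordinal_in zX.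
Qed.

Lemma Pd_zero X : X `<=` cumV al -> inF ozero -> Pd ozero al X <-> P0s al X.
Proof.
move=> Xa h0.
have E j : dd (omin (lev (nth ozero (hdr X).1.1 j)) ozero) (body j X) al <->
  forall e, e ∈ al -> exists e', [/\ e' ∈ al, e ∈ e' & body j X e'].
  rewrite omin_r; last exact: ozeroP.
  rewrite ddP //; last exact: inF_ltcs.
  split=> [h e ea|h e l ea hl].
    by have [||be [h1 h2 h3 _]] := h e [::] => //; exists be.
  have [e' [h1 h2 h3]] := h e ea; exists e'; split=> // p pl.
  by have [/(inF_canF _ h0)[/ozeroP]] := hl p pl.
by split=> h j hj; have := h j hj; rewrite E.
Qed.

(** A neighbourhood at level [osucc d] is given by finitely many derived sets of levels at most [d]
    that contain [al]. A move [Y] claims such a family; either the claim is false, or the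
    first-order part yields a point in all its members. *)
Lemma Pd_succ d X : X `<=` cumV al -> inF (osucc d) ->
  Pd (osucc d) al X <-> forall Y, Y `<=` cumV al -> FOs al d X Y \/ ~ Pd d al Y.
Proof.
move=> Xa hd; have hd' := inF_pred hd; split.
  move=> hP Y Ya; have [hY|] := pselect (Pd d al Y); last by right.
  left=> hk oe hc; have [Ve _] := hdr_V lal Ya.
  have hl := omin_inF (lev_inF Xa hk) hd.
  pose l := [seq (omin (lev (nth ozero (hdr Y).1.1 j)) d, body j Y) | j <- iota 0 (size (hdr Y).1.1)].
  have inl j : j < size (hdr Y).1.1 ->
    List.In (omin (lev (nth ozero (hdr Y).1.1 j)) d, body j Y) l.
    move=> hj; apply/InP; apply/mapP; exists j => //; by rewrite mem_iota.
  have := proj1 (ddP hb rmu _ (inF_ltcs hl) alm lal) (hP _ hk) (hdr Y).2 l.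
  case.
  - exact/(cumV_ord oal).
  - move=> p /InP/mapP[j]; rewrite mem_iota => /andP[_ hj] ->; split; last exact: hY.
    apply/inF_canF => //; split; first exact: hc.
    by apply: omin_inF => //; exact: lev_inF.
  move=> be [h1 h2 h3 h4]; exists be; split=> // j hj.
  exact: h4 (inl _ hj).
move=> h j hj; have hl := omin_inF (lev_inF Xa hj) hd.
apply/(ddP hb rmu _ (inF_ltcs hl) alm lal) => g l ga hp.
have hp1 p : List.In p l -> [/\ p.1 ∈ omin (lev (nth ozero (hdr X).1.1 j)) (osucc d), inF p.1,
    omin p.1 d = p.1 & dd p.1 p.2 al].
  move=> pl; have [/(inF_canF _ hl)[h1 h2] h3] := hp p pl; split=> //.
  have : p.1 ∈ osucc d.
    move: h1; rewrite /omin; case: asboolP => // zd h1.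
    by apply: ord_trans zd => //; case: hd => /(is_ordinal_in oXi).
  by move=> /osuccP[/omin_l//|->]; rewrite omin_r //; exact: zmem_irr.
(* The family [l] as a move that challenges the claim [j]. Its bodies are cut down to [al] in order
   to fit into V_al; [dd_local] keeps the claims true and [dd_mono] undoes the cut for the point
   found. *)
pose cs' := [seq c p.1 | p <- l].
pose Bs j' := (nth (ozero, set0) l j').2 `&` elts al.
pose Y := move_of (cs', j, g) Bs.
have og := is_ordinal_in oal ga.
have Ya : Y `<=` cumV al.
  move=> x [->|[j' [e [-> [_ ea]]]]]; apply/(cumV_pr _ _ lal); split; try exact: cumV_ztag.
    apply/(cumV_pr _ _ lal); split.
      by apply/(cumV_pr _ _ lal); split; [exact: cumV_ordW|exact: cumV_ztag].
    apply/(cumV_lst _ lal) => a /mapP[p /InP/hp1[_ [pX pa] _ _] ->].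
    by apply: cumV_ordW => //; exact: is_ordinal_in pa.
  by apply: cumV_ordW => //; exact: is_ordinal_in ea.
have nthl j' : j' < size l -> List.In (nth (ozero, set0) l j') l.
  by move=> hj'; apply/InP; exact: mem_nth.
have hY : hdr Y = (cs', j, g) by exact: hdr_move.
have levY j' : j' < size l -> lev (nth ozero cs' j') = (nth (ozero, set0) l j').1.
  move=> hj'; rewrite (nth_map (ozero, set0)) // lev_code //.
  by have [_ [] ] := hp1 _ (nthl _ hj').
case: (h Y Ya); last first.
  case; move=> j'; rewrite hY /= size_map => hj'; rewrite levY // body_move.
  have [h1 h2 h3 h4] := hp1 _ (nthl _ hj'); rewrite h3.
  exact: (dd_local hb rmu (inF_ltcs h2) h4).
rewrite /FOs hY /= size_map => /(_ hj og); case.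
  by move=> j' hj'; rewrite levY //; have [h1 h2 -> h4] := hp1 _ (nthl _ hj').
move=> be [h1 h2 h3 h4]; exists be; split=> // p pl.
have /InP pl' := pl.
have hj' : index p l < size l by rewrite index_mem.
have := h4 _ hj'; rewrite levY // body_move /Bs nth_index //.
have [q1 q2 -> q4] := hp1 _ pl.
by apply: (dd_mono hb rmu (inF_ltcs q2)) => x [].
Qed.

Lemma Pd_limit la X : X `<=` cumV al -> inF la -> is_limit la ->
  Pd la al X <-> forall d, d ∈ la -> canF b mu la al d -> Pd d al X.
Proof.
move=> Xa hla ll; have ola := limit_ord ll; split.
  move=> h d dl /(inF_canF _ hla)[_ hd] j hj.
  have hz := lev_inF Xa hj; set z := lev _ in hz *.
  apply: dd_level (h j hj); [exact: omin_inF|exact: omin_inF|].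
  rewrite -/z /omin; case: asboolP => zd; case: asboolP => zl.
  - by right.
  - by case: zl; exact: ord_trans dl.
  - by case: (ole_or_mem (is_ordinal_in ola dl) (is_ordinal_in ola zl)).
  - by left.
move=> h j hj; have hz := lev_inF Xa hj.
have [zl|zl] := pselect (lev (nth ozero (hdr X).1.1 j) ∈ la).
  rewrite omin_l //; have := h _ zl (proj2 (inF_canF _ hla) (conj zl hz)) j hj.
  by rewrite omin_r //; exact: zmem_irr.
rewrite omin_r //; apply/(ddP hb rmu _ (inF_ltcs hla) alm lal) => g l ga hp.
(* A neighbourhood involves finitely many levels below the limit [la], so it is already one at some
   smaller level [d] of the game. *)
have [d [dl hd hdl]] : exists d, [/\ d ∈ la, inF d & forall p, List.In p l -> p.1 ∈ d].
  elim: l hp => [|p l IH] hp.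
    exists ozero; split=> //; first exact: limit_zero.
    split; first by apply: ord_zero_in => //; exact: osucc_neq0.
    by apply: (good_zero gal); apply: ord_zero_in => //; exact: osucc_neq0.
  have [|d [dl hd hdl]] := IH; first by move=> q ql; apply: hp; right.
  have [|/(inF_canF _ hla)[pl hp1] _] := hp p; first by left.
  have [w [wl dw pw hw]] : exists w, [/\ w ∈ la, ole d w, p.1 ∈ w & inF w].
    have od := is_ordinal_in ola dl; have op := is_ordinal_in ola pl.
    case: (ole_or_mem od op) => hdp; last by exists d; split=> //; right.
    exists (osucc p.1); split=> //; first exact: limit_succ.
    - by left; apply/osuccP.
    - exact: osucc_mem.
    have sX : osucc p.1 ∈ Xi by apply: ord_trans (proj1 hla) => //; exact: limit_succ.
    by split=> //; apply: (good_succ gal) => //; case: hp1.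
  have ow := is_ordinal_in ola wl.
  exists w; split=> // q /= [<-//|ql]; apply: mem_ole_trans dw => //; exact: hdl.
have := h _ dl (proj2 (inF_canF _ hla) (conj dl hd)) j hj.
rewrite omin_r; last by move=> zd; apply: zl; exact: ord_trans dl.
move=> /(ddP hb rmu _ (inF_ltcs hd) alm lal)/(_ g l ga); apply=> p pl.
have [h1 h2] := hp p pl; split=> //; apply/inF_canF => //; split; first exact: hdl.
by have [] := proj1 (inF_canF _ hla) h1.
Qed.

(** The statement over V_al is traded for its instances on traces: headers are stable, a witness
    [be] is below all larger [g], and by [dd_local] the claims at [be] depend only on the part of
    the move below [be]. *)
Lemma FOs_at d X Y : X `<=` cumV al -> Y `<=` cumV al -> inF d ->
  (forall x, cumV al x -> exists g, [/\ g ∈ al, cumV g x & FOs g d (X `&` cumV g) (Y `&` cumV g)]) <->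
  FOs al d X Y.
Proof.
move=> Xa Ya hd.
have [x0 ax0 hX] := hdr_stable lal Xa; have [y0 ay0 hY] := hdr_stable lal Ya.
have lY j : j < size (hdr Y).1.1 -> lt_cardinal_succ mu (omin (lev (nth ozero (hdr Y).1.1 j)) d).
  by move=> hj; apply: inF_ltcs; apply: omin_inF => //; exact: lev_inF.
split.
  move=> h hk oe hc.
  have /h[g [ga gxy]] : cumV al (upair x0 y0) by exact: cumV_upair.
  have og := is_ordinal_in oal ga.
  have gx : cumV g x0 by apply: cumV_trans gxy _ => //; apply/upairP; left.
  have gy : cumV g y0 by apply: cumV_trans gxy _ => //; apply/upairP; right.
  rewrite /FOs hX // hY // => /(_ hk oe hc)[be [h1 h2 h3 h4]].
  exists be; split=> //.
  - exact: ord_trans ga.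
  - by apply: body_mono h3 => y [].
  - by move=> j hj; apply: dd_mono (h4 j hj) => //; [exact: lY|apply: body_mono => y []].
move=> h x ax.
have key : exists x1, cumV al x1 /\ forall g, g ∈ al -> is_limit g -> cumV g x1 ->
    FOs g d (X `&` cumV g) (Y `&` cumV g).
  have [[hk oe hc]|no] := pselect [/\ (hdr Y).1.2 < size (hdr X).1.1, is_ordinal (hdr Y).2 &
      (forall j, j < size (hdr Y).1.1 -> omin (lev (nth ozero (hdr Y).1.1 j)) d ∈
         omin (lev (nth ozero (hdr X).1.1 (hdr Y).1.2)) (osucc d))]; last first.
    exists (lst [:: x0; y0]); split.
      by apply/(cumV_lst _ lal) => a; rewrite !inE => /orP[]/eqP->.
    move=> g ga lg /(cumV_lst _ lg) hg; have og := limit_ord lg.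
    rewrite /FOs hX ?hY //; try (by apply: hg; rewrite !inE eqxx ?orbT).
    by move=> hk oe hc; case: no.
  have [be [h1 h2 h3 h4]] := h hk oe hc.
  have obe := is_ordinal_in oal h1.
  exists (lst [:: x0; y0; be]); split.
    apply/(cumV_lst _ lal) => a; rewrite !inE => /orP[/eqP->//|/orP[]/eqP->//].
    exact: cumV_ordW.
  move=> g ga lg /(cumV_lst _ lg) hg; have og := limit_ord lg.
  rewrite /FOs hX ?hY //; try (by apply: hg; rewrite !inE eqxx ?orbT).
  have gbe : be ∈ g by apply/(cumV_ord og obe)/hg; rewrite !inE eqxx ?orbT.
  move=> _ _ _; exists be; split=> //.
    by split=> //; apply/(cumV_pr _ _ lg); split; [exact: cumV_ztag|exact: cumV_ordW].
  move=> j hj; apply: dd_mono (dd_local hb rmu (lY j hj) (h4 j hj)) => //; first exact: lY.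
  move=> y [Yy ybe]; split=> //; apply/(cumV_pr _ _ lg); split; first exact: cumV_ztag.
  apply: cumV_ordW; last exact: is_ordinal_in ybe.
  exact: ord_trans ybe gbe.
have [x1 [ax1 hx1]] := key.
have T : almost al (fun=> True) by exact: almost_all.
have [g [ga gx lg _]] := almost_unbounded ial T (cumV_upair lal ax ax1).
have og := limit_ord lg; exists g; split=> //.
  by apply: cumV_trans gx _ => //; apply/upairP; left.
by apply: hx1 => //; apply: cumV_trans gx _ => //; apply/upairP; right.
Qed.

Lemma almost_fin n (Q : nat -> zfset -> Prop) : (forall j, j < n -> almost al (Q j)) ->
  almost al (fun g => forall j, j < n -> Q j g).
Proof.
elim: n => [|n IH] h; first exact: almost_all.
have A := IH (fun j hj => h j (ltnW hj)).
apply: almost_mono (almostI lal (h n (ltnSn n)) A) => g _ _ [h1 h2] j.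
by rewrite ltnS leq_eqVlt => /orP[/eqP->|/h2].
Qed.

(** Here every lower bound asks for its own witness, so [g] has to be closed under the choice of
    witnesses, which is a diagonal intersection. *)
Lemma P0s_at X : X `<=` cumV al ->
  (forall x, cumV al x -> exists g, [/\ g ∈ al, cumV g x & P0s g (X `&` cumV g)]) <-> P0s al X.
Proof.
move=> Xa; have [x0 ax0 hX] := hdr_stable lal Xa; split.
  move=> h j hj e ea; have oe := is_ordinal_in oal ea.
  have /h[g [ga gx]] : cumV al (upair x0 e) by apply: cumV_upair => //; exact: cumV_ordW.
  have og := is_ordinal_in oal ga.
  rewrite /P0s hX; [|by []|by apply: cumV_trans gx _ => //; apply/upairP; left].
  move=> /(_ j hj e); case.
    by apply/(cumV_ord og oe); apply: cumV_trans gx _ => //; apply/upairP; right.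
  move=> e' [h1 h2 h3]; exists e'; split=> //; first exact: ord_trans ga.
  by apply: body_mono h3 => y [].
move=> h x ax.
have A : almost al (fun g => forall e, e ∈ g -> forall j, j < size (hdr X).1.1 ->
    exists e', [/\ e' ∈ g, e ∈ e' & body j X e']).
  apply: almost_diag_ord => // e ea; apply: almost_fin => j hj.
  have [e' [h1 h2 h3]] := h j hj e ea.
  by apply: almost_mono (almost_const h1) => g _ _ h'; exists e'.
have [g [ga gx lg hg]] := almost_unbounded ial A (cumV_upair lal ax ax0).
have og := limit_ord lg; exists g; split=> //.
  by apply: cumV_trans gx _ => //; apply/upairP; left.
rewrite /P0s hX; [|by []|by apply: cumV_trans gx _ => //; apply/upairP; right].
move=> j hj e eg; have [e' [h1 h2 h3]] := hg e eg j hj; exists e'; split=> //.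
split=> //; apply/(cumV_pr _ _ lg); split; first exact: cumV_ztag.
by apply: cumV_ordW => //; exact: is_ordinal_in h1.
Qed.

End AtAl.
End Semantics.

Lemma ival_elts k v e (t : term2) : is_ordinal k -> v ∈ k ->
  elts (ival (Vz v) e (IS t)) = term2_val e (term2_cap_par2 (cumV k) t) `&` cumV v.
Proof.
move=> ok vk /=.
rewrite (@zset_elts (zset (elts (Vz v) `&` term2_val e t)) (elts (Vz v) `&` term2_val e t)).
  rewrite Vz_elts; case: t => [n|A] /=; first by rewrite setIC.
  apply/seteqP; split=> x [h1 h2]; first by split=> //; split=> //; apply: cumV_mono h1 => //; left.
  by case: h1.
apply/seteqP; split=> x.
  by rewrite /elts /= zsetP //; apply: (@small_sub (Vz v)) => y [].
by move=> h; rewrite /elts /= zsetP //; apply: (@small_sub (Vz v)) => y [].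
Qed.

Definition FFalse := FNot (FAll 0 (FEq (Var1 0) (Var1 0))).

Lemma wf_FFalse k Par n : wf_fo k Par n FFalse.
Proof.
split; rewrite /= ?setU0 //.
rewrite -subset0 => v; rewrite /setD /setU /set1 /set0 /mkset; tauto.
Qed.

Lemma sat_FFalse M e1 e2 : ~ fo_sat M e1 e2 FFalse. Proof. by move=> /=; apply. Qed.

Lemma sat_FNot M e1 e2 p : fo_sat M e1 e2 (FNot p) <-> ~ fo_sat M e1 e2 p.
Proof. by []. Qed.

Lemma cap_FAnd M p q : fo_cap_par2 M (FAnd p q) = FAnd (fo_cap_par2 M p) (fo_cap_par2 M q).
Proof. by []. Qed.

Lemma cap_FNot M p : fo_cap_par2 M (FNot p) = FNot (fo_cap_par2 M p).
Proof. by []. Qed.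

(** * The machine of the limit-point game *)

Section Game.
Variables (b : zfset -> zfset -> zfset -> zfset) (mu xi : zfset).
Let Xi := osucc xi.
Variable k : zfset.
Notation c := (code b mu Xi).

Definition Rfo (g : zfset) (vs : seq zfset) : Prop :=
  exists i x y, vs = [:: i; x; y] /\ FOs b mu xi g (lev b mu xi i) (elts x) (elts y).
Definition Rp0 (g : zfset) (vs : seq zfset) : Prop :=
  exists x, vs = [:: x] /\ P0s g (elts x).

Definition Pfo := codeR Rfo `&` cumV k.
Definition Pp0 := codeR Rp0 `&` cumV k.
Definition Ffo d X Y := Fat Pfo [:: IC (c d); IS X; IS Y].
Definition Fp0 X := Fat Pp0 [:: IS X].

(* A state (n, X, p, q) of the game records the number of moves, the last move and two formulas;
   the value of the game is (P /\ p) \/ q, where P speaks about X. *)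
Definition gstate : Type := (nat * term2 * fo_formula * fo_formula)%type.

(** By [Pd_succ] a Pi step asks for every [Y] that [FOs] holds or [Pd] fails of [Y]: the first
    disjunct joins [q], and the second is the same kind of statement about [Y] with the polarity
    changed. At a Sigma step, dually, the negation of [FOs] joins [p]. *)
Definition gmachine : machine gstate := Machine
  (fun _ _ st => [:: st.1.1.1])
  (fun pol d st => let: (n, X, p, q) := st in
     if pol then (n.+1, Var2 n, p, FOr (FAnd (Ffo d X (Var2 n)) p) q)
     else (n.+1, Var2 n, FAnd (FNot (Ffo d X (Var2 n))) p, q))
  (fun _ _ _ => id).

Definition gleaf (pol : bool) (st : gstate) : fo_formula :=
  let: (n, X, p, q) := st in FOr (FAnd (if pol then Fp0 X else FNot (Fp0 X)) p) q.

Definition gwf (Par : set (set zfset)) (st : gstate) : Prop :=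
  let: (n, X, p, q) := st in
  [/\ wf_item k Par n (IS X), wf_fo k Par n p & wf_fo k Par n q].

Definition gvar (st : gstate) := st.1.1.1.

Lemma wf_Ffo Par n d X Y : Par Pfo -> cumV k (c d) -> wf_item k Par n (IS X) ->
  wf_item k Par n (IS Y) -> wf_fo k Par n (Ffo d X Y).
Proof. by move=> h1 h2 h3 h4; apply: wf_Fat => // it /= [<-|[<-|[<-|]]]. Qed.

Lemma wf_item_mono Par n n' it : n <= n' -> wf_item k Par n it -> wf_item k Par n' it.
Proof. by case: it => [|c'|[m|A]] //= nn h; exact: leq_trans nn. Qed.

Lemma gwf_nx Par pol d st : Par Pfo -> cumV k (c d) -> gwf Par st -> gwf Par (nx gmachine pol d st).
Proof.
case: st => [[[n X] p] q] hP hc [h1 h2 h3].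
have h1' := wf_item_mono (leqnSn n) h1.
have h2' := wf_mono (leqnSn n) h2; have h3' := wf_mono (leqnSn n) h3.
have hF : wf_fo k Par n.+1 (Ffo d X (Var2 n)) by apply: wf_Ffo => //=.
case: pol => /=; split=> //; first by apply: wf_FOr => //; exact: wf_FAnd.
by apply: wf_FAnd => //; exact: wf_FNot.
Qed.

Lemma gwf_leaf Par pol st : Par Pp0 -> gwf Par st -> wf_fo k Par (gvar st) (gleaf pol st).
Proof.
case: st => [[[n X] p] q] hP [h1 h2 h3] /=; apply: wf_FOr => //; apply: wf_FAnd => //.
have hF : wf_fo k Par n (Fp0 X) by apply: wf_Fat => // it /= [<-|].
by case: pol => //; exact: wf_FNot.
Qed.

Definition gfv (st : gstate) : Prop :=
  [/\ forall v, term2_fv st.1.1.2 v -> v < gvar st,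
      forall v, fo_fv2 st.1.2 v -> v < gvar st & forall v, fo_fv2 st.2 v -> v < gvar st].

Lemma Ffo_fv2 d X Y v : fo_fv2 (Ffo d X Y) v -> term2_fv X v \/ term2_fv Y v.
Proof. by move=> /Fat_fv2[it /= [<-//|[<-|[<-|//]]]] h; [left|right]. Qed.

Lemma gfv_nx pol d st : gfv st -> gfv (nx gmachine pol d st).
Proof.
case: st => [[[n X] p] q]; rewrite /gfv /gvar /= => -[h1 h2 h3].
have hF v : fo_fv2 (Ffo d X (Var2 n)) v -> v < n.+1.
  by move=> /Ffo_fv2[/h1 hv|->//]; exact: ltnW.
by case: pol; split=> v /=; [move=> ->|move=> /h2 /ltnW|move=> [[/hF|/h2 /ltnW]|/h3 /ltnW]
  |move=> ->|move=> [/hF|/h2 /ltnW]|move=> /h3 /ltnW].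
Qed.

Lemma upd_sat a e1 e n Y r : (forall v, fo_fv2 r v -> v < n) ->
  fo_sat (cumV a) e1 (upd e n Y) (fo_cap_par2 (cumV a) r) <->
  fo_sat (cumV a) e1 e (fo_cap_par2 (cumV a) r).
Proof.
move=> hr; apply: fo_sat_ext => // v; rewrite fo_cap_fv2 => /hr hv.
by rewrite /upd /= ltn_eqF.
Qed.

(** A true game has a true leaf, and a true leaf gives [p] or [q]. This applies at a point not yet
    known to be good, where the conditions stored in [p] are to be read off first. *)
Lemma ev_accumulators (g : zfset -> zfset) O a e1 ze pol st e : is_ordinal ze ->
  (forall la, is_limit la -> ole la ze -> exists2 z, z ∈ la & O la z) ->
  gfv st ->
  ev (reidx g gmachine) O (cumV a)
    (fun pol st e => fo_sat (cumV a) e1 e (fo_cap_par2 (cumV a) (gleaf pol st))) ze pol st e ->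
  fo_sat (cumV a) e1 e (fo_cap_par2 (cumV a) st.1.2) \/
  fo_sat (cumV a) e1 e (fo_cap_par2 (cumV a) st.2).
Proof.
move=> oz hO; elim/ord_ind: ze / oz hO pol st e => [|d od IH|la ll IH] hO pol st e hst.
- case: st hst => [[[n X] p] q] _; rewrite ev0 /gleaf FOr_cap sat_FOr.
  by move=> [|h]; [rewrite cap_FAnd sat_FAnd => -[_ h]; left|right].
- have hst' := gfv_nx pol (g d) hst; rewrite evS.
  have hO' la : is_limit la -> ole la d -> exists2 z, z ∈ la & O la z.
    by move=> ll ld; apply: hO => //; left; exact/osuccP.
  have {}IH := IH hO' (~~ pol) (nx (reidx g gmachine) pol d st).
  case: st hst hst' IH => [[[n X] p] q] [_ /= hp hq] hst' IH.
  have key Y : let st' := nx (reidx g gmachine) pol d (n, X, p, q) in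
     fo_sat (cumV a) e1 (upd e n Y) (fo_cap_par2 (cumV a) st'.1.2) \/
     fo_sat (cumV a) e1 (upd e n Y) (fo_cap_par2 (cumV a) st'.2) ->
     fo_sat (cumV a) e1 e (fo_cap_par2 (cumV a) p) \/
     fo_sat (cumV a) e1 e (fo_cap_par2 (cumV a) q).
    rewrite /reidx /gmachine; case: (pol); cbn [nx fst snd].
      rewrite FOr_cap sat_FOr cap_FAnd sat_FAnd (@upd_sat a e1 e n Y p hp) (@upd_sat a e1 e n Y q hq).
      by case=> [|[[_]|]] h; [left|left|right].
    by rewrite cap_FAnd sat_FAnd (@upd_sat a e1 e n Y p hp) (@upd_sat a e1 e n Y q hq); case=> [[_]|] h; [left|right].
  case: pol IH hst' key => IH hst' key.
    by move=> /(_ set0 (sub0set _)) /(IH _ hst')/key.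
  by move=> [Y _ /(IH _ hst')/key].
have [z0 z0l Oz0] := hO la ll (or_intror erefl).
have hO' z : z ∈ la -> forall la', is_limit la' -> ole la' z -> exists2 z, z ∈ la' & O la' z.
  by move=> zl la' ll' lz; apply: hO => //; left; exact: ole_trans_mem (limit_ord ll) lz zl.
case: pol; first by rewrite evLt // => /(_ _ z0l Oz0); apply: (IH _ z0l (hO' _ z0l)).
by rewrite evLf // => -[z [zl _]]; apply: (IH _ zl (hO' _ zl)).
Qed.

Hypotheses (hb : canonical_bijections b) (rmu : is_regular mu).
Hypothesis lXi : lt_cardinal_succ mu Xi.

Section Value.
Variable al : zfset.
Hypotheses (alm : al ∈ mu) (ial : inacc al) (gal : good b mu Xi al).
Hypothesis alk : cumV al `<=` cumV k.
Let lal : is_limit al. Proof. exact: inacc_limit. Qed.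
Let oal : is_ordinal al. Proof. exact: limit_ord. Qed.
Notation cap := (fo_cap_par2 (cumV al)).
Notation inF := (inF b mu xi al).

Lemma sat_Ffo e1 e d X Y : inF d -> envM (cumV al) e ->
  fo_sat (cumV al) e1 e (cap (Ffo d X Y)) <->
  FOs b mu xi al d (term2_val e (term2_cap_par2 (cumV al) X))
    (term2_val e (term2_cap_par2 (cumV al) Y)).
Proof.
move=> hd he; have sub Z : term2_val e (term2_cap_par2 (cumV al) Z) `<=` cumV al.
  by case: Z => [m|A] /=; [exact: he|move=> x []].
rewrite /Ffo /Pfo sat_cap_Fat //; last first.
  move=> i /= [[<-]|[|[|]]] //; apply: cumV_ordW; first by case: hd.
  apply: is_ordinal_in (limit_ord _) (code_in b rmu lXi _); by [case: rmu|case: hd].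
rewrite -(FOs_at hb rmu lXi ial gal) //.
have dX : d ∈ osucc xi by case: hd.
split=> h x ax; have [g [ga gx hg]] := h x ax; exists g; split=> //.
  move: hg => [i [x' [y' [[<- <- <-]]]]].
  by rewrite (lev_code hb rmu lXi) // !(@ival_elts al).
exists (c d), (ival (Vz g) e (IS X)), (ival (Vz g) e (IS Y)); split=> //.
by rewrite (lev_code hb rmu lXi) // !(@ival_elts al).
Qed.

Lemma sat_Fp0 e1 e X : envM (cumV al) e ->
  fo_sat (cumV al) e1 e (cap (Fp0 X)) <-> P0s al (term2_val e (term2_cap_par2 (cumV al) X)).
Proof.
move=> he; have sub Z : term2_val e (term2_cap_par2 (cumV al) Z) `<=` cumV al.
  by case: Z => [m|A] /=; [exact: he|move=> x []].
rewrite /Fp0 /Pp0 sat_cap_Fat //; last by move=> i /= [].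
rewrite -(P0s_at ial) //.
split=> h x ax; have [g [ga gx hg]] := h x ax; exists g; split=> //.
  by move: hg => [x' [[<-]]]; rewrite (@ival_elts al).
by exists (ival (Vz g) e (IS X)); split=> //; rewrite (@ival_elts al).
Qed.

Lemma ev_game e1 ze pol st e : inF ze -> gfv st -> envM (cumV al) e ->
  ev gmachine (fun ze => canF b mu ze al) (cumV al)
    (fun pol st e => fo_sat (cumV al) e1 e (cap (gleaf pol st))) ze pol st e <->
  ((if pol then Pd b mu xi ze al (term2_val e (term2_cap_par2 (cumV al) st.1.1.2))
    else ~ Pd b mu xi ze al (term2_val e (term2_cap_par2 (cumV al) st.1.1.2))) /\
   fo_sat (cumV al) e1 e (cap st.1.2)) \/
  fo_sat (cumV al) e1 e (cap st.2).
Proof.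
have sub e' Z : envM (cumV al) e' -> term2_val e' (term2_cap_par2 (cumV al) Z) `<=` cumV al.
  by case: Z => [m|A] he' /=; [exact: he'|move=> x []].
move=> hze; have oz : is_ordinal ze by case: hze => /(is_ordinal_in (ltcs_ord lXi)).
elim/ord_ind: ze / oz hze pol st e => [|d od IH|la ll IH] hze pol st e hst he.
- rewrite ev0; case: st hst => [[[n X] p] q] _; cbn [fst snd gleaf].
  rewrite FOr_cap sat_FOr cap_FAnd sat_FAnd.
  have PZ := Pd_zero hb rmu lXi alm ial gal (sub e X he) hze.
  by case: pol; rewrite PZ ?cap_FNot ?sat_FNot sat_Fp0.
- have hd := inF_pred lXi gal hze; rewrite evS.
  have hst' := gfv_nx pol d hst.
  case: st hst hst' => [[[n X] p] q]; rewrite {1}/gfv /gvar; cbn [fst snd].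
  move=> [hX hp hq] hst'.
  have PS := Pd_succ hb rmu lXi alm ial gal (sub e X he) hze.
  have key Y : Y `<=` cumV al ->
    ev gmachine (fun ze => canF b mu ze al) (cumV al)
      (fun pol st e => fo_sat (cumV al) e1 e (cap (gleaf pol st))) d (~~ pol)
      (nx gmachine pol d (n, X, p, q)) (upd e n Y) <->
    (if pol then (~ Pd b mu xi d al Y /\ fo_sat (cumV al) e1 e (cap p)) \/
       ((FOs b mu xi al d (term2_val e (term2_cap_par2 (cumV al) X)) Y /\
         fo_sat (cumV al) e1 e (cap p)) \/ fo_sat (cumV al) e1 e (cap q))
     else (Pd b mu xi d al Y /\
        (~ FOs b mu xi al d (term2_val e (term2_cap_par2 (cumV al) X)) Y /\
         fo_sat (cumV al) e1 e (cap p))) \/ fo_sat (cumV al) e1 e (cap q)).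
    move=> Ya; rewrite (IH hd _ _ _ hst'); last exact: envM_upd.
    have hXn : term2_val (upd e n Y) (term2_cap_par2 (cumV al) X) =
               term2_val e (term2_cap_par2 (cumV al) X).
      case: X hX {hst' PS} => [m|A] //= hX; rewrite /upd /= ltn_eqF //.
      exact: hX erefl.
    have hY : term2_val (upd e n Y) (term2_cap_par2 (cumV al) (Var2 n)) = Y.
      by rewrite /= /upd /= eqxx.
    have hF : fo_sat (cumV al) e1 (upd e n Y) (cap (Ffo d X (Var2 n))) <->
        FOs b mu xi al d (term2_val e (term2_cap_par2 (cumV al) X)) Y.
      by rewrite sat_Ffo //; [rewrite hXn hY|exact: envM_upd].
    case: (pol); cbn [nx gmachine fst snd negb]; rewrite hY.
      rewrite FOr_cap sat_FOr cap_FAnd sat_FAnd.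
      by rewrite hF (@upd_sat al e1 e n Y p hp) (@upd_sat al e1 e n Y q hq).
    rewrite cap_FAnd sat_FAnd cap_FNot sat_FNot.
    by rewrite hF (@upd_sat al e1 e n Y p hp) (@upd_sat al e1 e n Y q hq).
  set A := fo_sat _ _ _ (cap p) in key *; set B := fo_sat _ _ _ (cap q) in key *.
  case: pol key {hst' IH} => key; cbn [ns gmachine blk fst snd]; rewrite PS.
    split=> [h|h Y Ya]; last first.
      by apply/(key Y Ya); case: h => [[h hA]|hB]; [case: (h Y Ya) => h'; tauto|tauto].
    have [hB|hB] := pselect B; first by right.
    left; split; last by have /(key _ (sub0set _)) := h set0 (sub0set _); tauto.
    by move=> Y Ya; have /(key Y Ya) := h Y Ya; tauto.
  split=> [[Y Ya /(key Y Ya) h]|].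
    have [hB|hB] := pselect B; first by right.
    by left; case: h => [[hP [hF hA]]|//]; split=> // /(_ Y Ya)[].
  case=> [[/existsNP[Y] /not_implyP[Ya hY] hA]|hB].
    by exists Y => //; apply/(key Y Ya); move: hY => /not_orP[hF /contrapT hP]; left.
  by exists set0 => //; apply/(key _ (sub0set _)); tauto.
case: st hst => [[[n X] p] q] hst; cbn [fst snd].
have PL := Pd_limit hb rmu lXi alm ial gal (sub e X he) hze ll.
have inz z : z ∈ la -> canF b mu la al z -> inF z by move=> zl /(inF_canF lXi gal _ hze)[].
have [z0 z0l Fz0] : exists2 z, z ∈ la & canF b mu la al z.
  exists ozero; first exact: limit_zero.
  have zX : ozero ∈ osucc xi.
    by apply: ord_trans (ltcs_ord lXi) (limit_zero ll) _; case: hze.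
  apply/(inF_canF lXi gal _ hze); split; first exact: limit_zero.
  by split=> //; exact: (good_zero gal).
set A := fo_sat _ _ _ (cap p) in IH *; set B := fo_sat _ _ _ (cap q) in IH *.
have IHz z pol' : z ∈ la -> canF b mu la al z -> _ := fun zl Fz => IH z zl (inz z zl Fz) pol' (n, X, p, q) e hst he.
case: pol.
  rewrite evLt // PL; split=> [h|h z zl Fz].
    have [hB|hB] := pselect B; first by right.
    have h' z : z ∈ la -> canF b mu la al z -> Pd b mu xi z al
        (term2_val e (term2_cap_par2 (cumV al) X)) /\ A.
      by move=> zl Fz; have /(IHz z true zl Fz) := h z zl Fz; case.
    by left; split; [move=> z zl Fz; case: (h' z zl Fz)|case: (h' _ z0l Fz0)].
  apply/(IHz z true zl Fz); case: h => [[h hA]|hB]; [left|by right].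
  by split=> //; exact: h.
rewrite evLf // PL; split=> [[z [zl Fz /(IHz z false zl Fz)]]|].
  by case=> [[h hA]|hB]; [left; split=> // /(_ z zl Fz)|right].
case=> [[/existsNP[z] /not_implyP[zl /not_implyP[Fz h]] hA]|hB].
  by exists z; split=> //; apply/(IHz z false zl Fz); left.
by exists z0; split=> //; apply/(IHz z0 false z0l Fz0); right.
Qed.

End Value.
End Game.

Lemma inacc_regular k : is_cardinal k -> inacc k -> is_regular k.
Proof.
move=> ck [lk _ bk]; split=> // a g ak hg; apply: bk => //.
by apply: cumV_ordW => //; exact: is_ordinal_in (limit_ord lk) ak.
Qed.

Lemma almost_clos k h : maps k h -> almost k (clos h).
Proof. by move=> hm; exists h. Qed.

Lemma clos_maps k h : clos h k -> maps k h.
Proof. by case. Qed.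

(** Used with a property that makes [g] a closure point: when such points are unbounded below a
    limit, the limit is a closure point too. *)
Definition Rclos (E : zfset -> Prop) (g : zfset) (vs : seq zfset) : Prop := vs = [::] /\ E g.

Lemma sat_Rclos k kk E e1 e : is_limit k -> cumV k `<=` cumV kk ->
  fo_sat (cumV k) e1 e (fo_cap_par2 (cumV k) (Fat (codeR (Rclos E) `&` cumV kk) [::])) <->
  forall x, cumV k x -> exists g, [/\ g ∈ k, cumV g x & E g].
Proof.
move=> lk kkk; rewrite sat_cap_Fat //.
by split=> h x kx; have [g [gk gx hg]] := h x kx; exists g; split=> //; case: hg.
Qed.

Definition Fis x := FEx 0 (FEq (Var1 0) (Par1 x)).

Lemma wf_Fis k Par n x : cumV k x -> wf_fo k Par n (Fis x).
Proof.
move=> kx; split; rewrite /= ?setU0 ?set0U //; last by move=> y ->.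
by rewrite -subset0 => v; rewrite /setD /setU /set1 /set0 /mkset; tauto.
Qed.

Lemma sat_Fis M N e1 e x : fo_sat M e1 e (fo_cap_par2 N (Fis x)) <-> M x.
Proof.
rewrite -[fo_cap_par2 N (Fis x)]/(Fis x) sat_FEx /=; split=> [[y My <-]//|Mx].
by exists x.
Qed.

(** * Reflection of limit points *)

Section Nonisolated.
Variables (b : zfset -> zfset -> zfset -> zfset) (mu xi : zfset).
Hypotheses (hb : canonical_bijections b) (rmu : is_regular mu).
Let Xi := osucc xi.
Hypothesis lXi : lt_cardinal_succ mu Xi.
Let lmu : is_limit mu. Proof. by case: rmu. Qed.
Let omu : is_ordinal mu. Proof. exact: limit_ord. Qed.
Let oXi : is_ordinal Xi. Proof. exact: ltcs_ord lXi. Qed.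
Notation c := (code b mu Xi).
Notation ddm := (@dd b mu).

Section Reflect.
Variables (al : zfset) (h : zfset -> zfset).
Hypotheses (alm : al ∈ mu) (ind : indescribable b al (canf b mu xi al)) (hal : clos h al).
Hypothesis hgood : forall g, g ∈ mu -> clos h g -> good b mu Xi g /\ (is_regular g -> inacc g).
Let ial : inacc al. Proof. exact: indescribable_inacc hb ind. Qed.
Let ral : is_regular al. Proof. by apply: inacc_regular => //; case: ind. Qed.
Let lal : is_limit al. Proof. exact: inacc_limit. Qed.
Let oal : is_ordinal al. Proof. exact: limit_ord. Qed.
Let gal : good b mu Xi al. Proof. by case: (hgood alm hal). Qed.

Lemma top_dom a : good b mu Xi a -> dom b mu Xi Xi a xi.
Proof. by move=> ga; right; split; [exact: osucc_mem|exact: (good_predtop ga)]. Qed.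

Lemma top_inF a : good b mu Xi a -> inF b mu xi a xi.
Proof. by move=> ga; split; [exact: osucc_mem|exact: (good_predtop ga)]. Qed.

Let hxi := top_dom gal.
Notation pi := (collapse (canF b mu xi al)).
Notation pin := (pinv b mu Xi xi al).
Let eta := pi xi.

(** The finite family is the content of one move [E0] of the limit-point game of level [xi]. Its
    truth at [al] is a Pi sentence of level f_xi(al), so the indescribability of [al] applies to
    it. *)
Lemma reflect_dd (g0 : zfset) (l : seq (zfset * set zfset)) : g0 ∈ al ->
  (forall p, List.In p l -> inF b mu xi al p.1 /\ ddm p.1 p.2 al) ->
  exists be, [/\ be ∈ al, g0 ∈ be & forall p, List.In p l -> ddm p.1 p.2 be].
Proof.
move=> g0al hl.
have etaE : canf b mu xi al = eta by exact: (canf_pi hb rmu lXi alm gal hxi).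
have [cal leta hI] := ind; rewrite etaE in leta hI.
have oeta := ltcs_ord leta.
have A1 : almost al (good b mu Xi).
  exists h; first exact: clos_maps.
  move=> g gal' hg; have gm : g ∈ mu by exact: ord_trans omu gal' alm.
  by have [] := hgood gm hg.
have [h2 hm2 hcoh] := almost_coherent hb rmu lXi alm gal hxi ral leta A1.
pose E g := clos h g /\ clos h2 g.
pose PD := codeR (Rclos E) `&` cumV al.
pose Bs j := (nth (ozero, set0) l j).2 `&` elts al.
pose E0 := move_of ([seq c p.1 | p <- l], 0, ozero) Bs.
have nthl j : j < size l -> List.In (nth (ozero, set0) l j) l.
  by move=> hj; apply/InP; exact: mem_nth.
have E0al : E0 `<=` cumV al.
  move=> x [->|[j' [e [-> [_ ea]]]]]; apply/(cumV_pr _ _ lal); split; try exact: cumV_ztag.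
    apply/(cumV_pr _ _ lal); split.
      by apply/(cumV_pr _ _ lal); split; [exact: cumV_zero|exact: cumV_ztag].
    apply/(cumV_lst _ lal) => a /mapP[p /InP/hl[[pX pa] _] ->].
    by apply: cumV_ordW => //; exact: is_ordinal_in pa.
  by apply: cumV_ordW => //; exact: is_ordinal_in ea.
have hP k (X : set zfset) : hdr X = ([seq c p.1 | p <- l], 0, ozero) ->
    Pd b mu xi xi k X <-> forall j, j < size l -> ddm (nth (ozero, set0) l j).1 (body j X) k.
  move=> hX; rewrite /Pd hX /= size_map.
  have EE j : j < size l -> omin (lev b mu xi (nth ozero [seq c p.1 | p <- l] j)) xi =
      (nth (ozero, set0) l j).1.
    move=> hj; rewrite (nth_map (ozero, set0)) //.
    have [[pX _] _] := hl _ (nthl _ hj); rewrite (lev_code hb rmu lXi) //.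
    by case/osuccP: pX => [/omin_l//|->]; rewrite omin_r //; exact: zmem_irr.
  by split=> H j hj; have := H j hj; rewrite EE.
pose Par := [set A | A = Pfo b mu xi al \/ (A = Pp0 al \/ (A = PD \/ A = E0))].
have finPar : finite_set Par.
  have -> : Par = [set Pfo b mu xi al] `|` ([set Pp0 al] `|` ([set PD] `|` [set E0])) by [].
  by rewrite !finite_setU; repeat split; exact: finite_set1.
have ParV A : Par A -> A `<=` cumV al.
  by case=> [->|[->|[->|->//]]] x []; try (by []).
(* [E0] challenges nothing, so index and bound are dummies. Naming the header puts it into V_be, so
   that the trace of [E0] on V_be has the same header; naming [g0] puts [g0] below [be]. *)
pose H0 := hcode ([seq c p.1 | p <- l], 0, ozero).
pose p0 := FAnd (Fat PD [::]) (Fis (pr g0 H0)).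
pose st0 : gstate := (0, Par2 E0, p0, FFalse).
have V0 : cumV al (pr g0 H0).
  apply/(cumV_pr _ _ lal); split; first by apply: cumV_ordW => //; exact: is_ordinal_in g0al.
  by have /E0al/(cumV_pr _ _ lal)[] : E0 (pr (ztag 0) H0) by left.
have wf0 : gwf al Par st0.
  split; [by right; right; right| |exact: wf_FFalse].
  apply: wf_FAnd; first by apply: wf_Fat => //; right; right; left.
  exact: wf_Fis.
pose m := reidx pin (gmachine b mu xi al).
pose inv ze (pol : bool) st := ole ze eta /\ gwf al Par st.
have I1 pol st : inv ozero pol st -> [/\ formula_over al (FO (gleaf al pol st)),
    fo_fv1 (gleaf al pol st) = set0, (forall v, fo_fv2 (gleaf al pol st) v -> v < gvar st) &
    fo_par2 (gleaf al pol st) `<=` Par].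
  move=> [_ hst]; have hw := gwf_leaf pol (or_intror (or_introl erefl) : Par (Pp0 al)) hst.
  by split; [exact: wf_formula_over hw|exact: wf_fv1 hw|exact: wf_fv2 hw|exact: wf_par2 hw].
have I2 pol d st : inv (osucc d) pol st -> inv d (~~ pol) (nx m pol d st) /\
    (forall v, v < gvar (nx m pol d st) -> v < gvar st \/ v \in ns m pol d st).
  move=> [de hst]; have de' : d ∈ eta by apply: mem_ole_trans de => //; exact: osucc_mem.
  split; last first.
    case: st {hst} => [[[n X] p] q] v /=.
    have -> : gvar (nx m pol d (n, X, p, q)) = n.+1 by rewrite /m; case: (pol).
    by rewrite ltnS leq_eqVlt inE /gvar /= => /orP[/eqP->|->]; [right|left].
  split; first by left.
  apply: gwf_nx => //; first by left.
  have cd := pinv_code hb rmu lXi alm gal hxi de'.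
  by apply: cumV_ordW => //; exact: is_ordinal_in cd.
have I3 pol la z st : is_limit la -> z ∈ la -> inv la pol st ->
    inv z pol (li m pol la z st) /\ gvar (li m pol la z st) <= gvar st.
  by move=> ll zl [le hst]; split=> //; split=> //; left; exact: mem_ole_trans le.
have inv0 : inv eta true st0 by split=> //; right.
have hPi := sk_Pi finPar I1 I2 I3 oeta inv0.
have [hf1 hf2 hf3] := sk_free I1 I2 I3 oeta inv0.
set phi := sk m _ eta true st0 in hPi hf1 hf2 hf3.
have hS : sentence phi by split=> //; rewrite -subset0 => v /hf2.
have e0M M : envM M (fun=> set0) by move=> n x [].
have gfv0 : gfv st0.
  by have [h1 h2' h3] := wf0; split=> v; [case|exact: (wf_fv2 h2')|exact: (wf_fv2 h3)].
have hm : models al phi.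
  rewrite /models -(@sat_cap_id al); last by move=> A /hf3/ParV.
  rewrite sat_cap_sk //.
  have := ev_top hb rmu lXi alm gal hxi (gmachine b mu xi al)
    (fun pol st e => fo_sat (cumV al) (fun=> ozero) e (fo_cap_par2 (cumV al) (gleaf al pol st)))
    true st0 (or_introl erefl : dom b mu Xi xi al xi) (e0M (cumV al)).
  move=> /iffRL; apply.
  rewrite (@ev_game b mu xi al hb rmu lXi al) //; last exact: top_inF.
  left; split.
    have -> : term2_val (fun=> set0) (term2_cap_par2 (cumV al) st0.1.1.2) = E0.
      by rewrite /= setIidl.
    rewrite hP; last exact: hdr_move.
    move=> j hj; have [q1 q2] := hl _ (nthl _ hj).
    rewrite body_move; apply: (dd_local hb rmu _ q2).
    exact: (inF_ltcs lXi q1).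
  rewrite /st0 cap_FAnd sat_FAnd sat_Fis (sat_Rclos _ _ _ lal) //; split.
    move=> x ax; have A : almost al E.
      by apply: almostI => //; apply: almost_clos => //; exact: clos_maps.
    by have [g [gal' gx _ Eg]] := almost_unbounded ial A ax; exists g.
  exact: V0.
have [be [q [beal rbe hq _ hmq]]] := hI _ hPi hS hm.
have [_ lbe _] := rbe; have obe := limit_ord lbe.
have bem : be ∈ mu by exact: ord_trans omu beal alm.
have sub : cumV be `<=` cumV al by apply: cumV_mono => //; left.
move: hmq; rewrite /models (restr_sk oal hb beal (fun=> ozero) ral leta (e0M _) hq) => hev.
(* At first only the side condition [p0] is extracted. It makes [be] a closure point of [h] and
   [h2], hence good and coherent, and only then can the game at [be] be evaluated. *)
have [hp0|/sat_FFalse//] : fo_sat (cumV be) (fun=> ozero) (fun=> set0) (fo_cap_par2 (cumV be) p0) \/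
    fo_sat (cumV be) (fun=> ozero) (fun=> set0) (fo_cap_par2 (cumV be) FFalse).
  apply: (ev_accumulators oeta _ gfv0 hev) => la ll lle.
  have lla : lt_cardinal_succ al la by case: lle => [/(ltcs_mem leta)//|->].
  exact: canF_limit_inh.
move: hp0; rewrite /p0 cap_FAnd sat_FAnd sat_Fis (sat_Rclos _ _ _ lbe) // => -[hE hg0].
have hbe : clos h be.
  apply: clos_limit => // x /hE[g [gb gx [h1 _]]]; by exists g.
have hbe2 : clos h2 be.
  apply: clos_limit => // x /hE[g [gb gx [_ h1]]]; by exists g.
have [gbe ibe] := hgood bem hbe; have {}ibe := ibe rbe.
have hxib := top_dom gbe.
have coh ze (hze : dom b mu Xi xi be ze) := proj2 (hcoh be beal hbe2 ze hze).
have := ev_below hb rmu lXi alm gal hxi beal gbe hxib coh (gmachine b mu xi al)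
    (fun pol st e => fo_sat (cumV be) (fun=> ozero) e (fo_cap_par2 (cumV be) (gleaf al pol st)))
    true st0 (or_introl erefl : dom b mu Xi xi be xi) (e0M (cumV be)).
move=> /iffLR/(_ hev).
rewrite (@ev_game b mu xi al hb rmu lXi be) //; last exact: top_inF.
case=> [[hPd _]|/sat_FFalse//].
move: hg0 => /(cumV_pr _ _ lbe)[hg0 hH0].
have E0b : hdr (E0 `&` cumV be) = ([seq c p.1 | p <- l], 0, ozero).
  rewrite /hdr; have -> : sec (ztag 0) (E0 `&` cumV be) = [set H0].
    apply/seteqP; split=> x.
      by case=> -[/pr_inj[_ ->]//|[j [e [/pr_inj[/ztag_inj]]]]].
    move=> ->; split; first by left.
    by apply/(cumV_pr _ _ lbe); split=> //; exact: cumV_ztag.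
  by rewrite thez1 hdecK.
exists be; split=> //.
  by apply/(cumV_ord obe) => //; exact: is_ordinal_in g0al.
move=> p pl; have /InP pl' := pl.
have hj : index p l < size l by rewrite index_mem.
have [q1 q2] := hl _ pl.
move: hPd; rewrite hP; last by rewrite -[RHS]E0b /st0 /=; congr hdr; apply/seteqP; split=> x [].
move=> /(_ _ hj); rewrite nth_index //; apply: dd_mono => //; first exact: (inF_ltcs lXi q1).
move=> x; rewrite /body /sec /= => -[h1 _].
have : body (index p l) E0 x by [].
by rewrite body_move /Bs nth_index // => -[].
Qed.

End Reflect.

Lemma stationary_nonisolated :
  stationary mu [set a | a ∈ mu /\ indescribable b a (canf b mu xi a)] ->
  exists a : below mu, nonisolated (tau b Xi) a.
Proof.
move=> [_ hst].
(* By stationarity the regular [mu] is a limit of indescribable ordinals, and these are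
   inaccessible. *)
have imu : inacc mu.
  apply: regular_limit_inacc => // e em.
  have [a [[am ia] [_ ea]]] := hst _ (tail_club lmu em).
  by exists a; split=> //; exact: indescribable_inacc hb ia.
have [h hm hgood] := almostI lmu (almost_good hb rmu lXi) (regular_inacc imu).
have [al [[alm ind] [_ hal]]] := hst _ (clos_club imu hm).
have ial : inacc al := indescribable_inacc hb ind.
have lal := inacc_limit ial.
have [gal _] := hgood _ alm hal.
pose a := mkbelow alm; exists a.
(* A neighbourhood of [al] at level [Xi] involves derived sets of levels at most [xi], and
   [reflect_dd] finds a smaller point in all of them. *)
have lim : d_op b Xi (~` [set a]) a.
  have := @dd_val b mu Xi [set x | x ∈ mu /\ x <> al] a.
  have -> : [set x : below mu | [set x | x ∈ mu /\ x <> al] (val x)] = ~` [set a].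
    apply/seteqP; split=> x /=; first by move=> [_ xa] E; apply: xa; rewrite E.
    by move=> xa; split; [exact: val_in|move=> E; apply: xa; apply: val_inj].
  move=> /iffLR; apply; apply/(ddP hb rmu _ lXi alm lal) => g l gal' hp.
  have [p /hp[Fp dp]|be [beal gb hbe]] := reflect_dd alm ind hal hgood gal' (l := l).
    by split=> //; exact: proj1 (good_canF hb rmu _ lXi alm gal) Fp.
  exists be; split=> //; split; first exact: ord_trans omu beal alm.
  by move=> E; move: beal; rewrite E => /zmem_irr.
rewrite /nonisolated /tau; case: asboolP => [Xm|_]; last first.
  by move=> /(_ a lim); apply.
move=> oa; move: lim; rewrite d_opE //.
rewrite /d_step asboolT // => /(_ [set a]); case.
  by rewrite nbhsE; exists [set a].
by move=> y [/eqP ya _ /ya].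
Qed.

End Nonisolated.

(** * The universal game *)

(* The pure game with one move per level: s lists the levels visited, the latest first, Z the
   moves, the earliest first, and W is the value at level 0. *)
Definition gm (O : zfset -> set zfset) (M : set zfset)
    (W : bool -> seq zfset -> seq (set zfset) -> Prop) :
    zfset -> bool -> seq zfset -> seq (set zfset) -> Prop :=
  mem_rec (fun _ _ _ => False) (fun ze r pol s Z =>
    if `[< ze = ozero >] then W pol s Z else
    if `[< exists y, ze = osucc y >] then
      if pol then forall Y, Y `<=` M -> r (opred ze) (~~ pol) (opred ze :: s) (rcons Z Y)
      else exists2 Y, Y `<=` M & r (opred ze) (~~ pol) (opred ze :: s) (rcons Z Y)
    else if pol then forall z, z ∈ ze -> O ze z -> r z pol (z :: s) Z
    else exists z, [/\ z ∈ ze, O ze z & r z pol (z :: s) Z]).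

Section Gm.
Variables (O : zfset -> set zfset) (M : set zfset)
  (W : bool -> seq zfset -> seq (set zfset) -> Prop).
Notation G := (gm O M W).

Lemma gm0 pol s Z : G ozero pol s Z <-> W pol s Z.
Proof. by rewrite /gm mem_recE; case: asboolP. Qed.

Lemma gmS d pol s Z : G (osucc d) pol s Z <->
  if pol then forall Y, Y `<=` M -> G d false (d :: s) (rcons Z Y)
  else exists2 Y, Y `<=` M & G d true (d :: s) (rcons Z Y).
Proof.
rewrite {1}/gm mem_recE -/(gm O M W); case: asboolP => [/osucc_neq0//|_].
case: asboolP => [_|[]]; last by exists d.
by rewrite opredK; case: asboolP => [_|[]]; [case: pol|exact: osucc_mem].
Qed.

Lemma gmLt la s Z : is_limit la ->
  G la true s Z <-> forall z, z ∈ la -> O la z -> G z true (z :: s) Z.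
Proof.
move=> [_ l0 lS]; rewrite {1}/gm mem_recE -/(gm O M W); case: asboolP => // _.
case: asboolP => [[y /lS]//|_].
by split=> h z zl; have := h z zl; case: asboolP.
Qed.

Lemma gmLf la s Z : is_limit la ->
  G la false s Z <-> exists z, [/\ z ∈ la, O la z & G z false (z :: s) Z].
Proof.
move=> [_ l0 lS]; rewrite {1}/gm mem_recE -/(gm O M W); case: asboolP => // _.
case: asboolP => [[y /lS]//|_].
split=> [[z [zl Oz]]|[z [zl Oz h]]]; last by exists z; split=> //; case: asboolP.
by case: asboolP => // _ h; exists z.
Qed.

End Gm.

(* D is the set of levels of a game played at be. *)
Record frame (b : zfset -> zfset -> zfset -> zfset) (mu Xi be : zfset)
    (O : zfset -> set zfset) (D : set zfset) : Prop := Frame {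
  fr_ord : forall z, D z -> is_ordinal z;
  fr_code : forall z, D z -> z ∈ Xi /\ cumV be (code b mu Xi z);
  fr_succ : forall d, D (osucc d) -> D d;
  fr_lim : forall la z, D la -> is_limit la -> z ∈ la -> O la z -> D z;
  fr_lim0 : forall la, D la -> is_limit la -> O la ozero;
  fr_limS : forall la z, D la -> is_limit la -> z ∈ la -> (O la (osucc z) <-> O la z);
  fr_O : forall la z, D la -> is_limit la -> z ∈ la -> cumV be (code b mu Xi z) -> O la z }.

Section Frames.
Variables (b : zfset -> zfset -> zfset -> zfset) (mu xi : zfset).
Let Xi := osucc xi.
Hypotheses (hb : canonical_bijections b) (rmu : is_regular mu).
Hypothesis lXi : lt_cardinal_succ mu Xi.
Let lmu : is_limit mu. Proof. by case: rmu. Qed.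
Let omu : is_ordinal mu. Proof. exact: limit_ord. Qed.
Let oXi : is_ordinal Xi. Proof. exact: ltcs_ord lXi. Qed.

Lemma frame_top : frame b mu Xi mu (fun ze => elts ze) (elts Xi).
Proof.
split=> [z|z zX|d dX|la z lX ll zl _|la _ /limit_zero//||].
- exact: is_ordinal_in.
- split=> //; have h := code_in b rmu lXi zX.
  by apply: cumV_ordW => //; exact: is_ordinal_in h.
- by apply: ord_trans dX => //; exact: osucc_mem.
- exact: ord_trans lX.
- by move=> la z _ ll zl; split=> _ //; exact: limit_succ.
by [].
Qed.

Lemma frame_good be : be ∈ mu -> good b mu Xi be ->
  frame b mu Xi be (fun ze => canF b mu ze be) (dom b mu Xi xi be).
Proof.
move=> bem gbe; have obe := is_ordinal_in omu bem.
have hxi : dom b mu Xi Xi be xi.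
  by right; split; [exact: osucc_mem|exact: (good_predtop gbe)].
split.
- by move=> z [->|[zx _]]; [exact: osucc_ord oXi|exact: is_ordinal_in (osucc_ord oXi) zx].
- move=> z hz; have [zX zb] : z ∈ Xi /\ code b mu Xi z ∈ be.
    case: hz => [->|[zx zb]]; last by split=> //; exact: osucc_memW.
    by split; [exact: osucc_mem|exact: (good_predtop gbe)].
  by split=> //; apply: cumV_ordW => //; exact: is_ordinal_in zb.
- move=> d /(dom_succ hb rmu lXi bem gbe hxi) h; right.
  exact/(X_P hb rmu lXi bem gbe hxi).
- by move=> la z hla ll zl Oz; exact: (dom_in hb rmu lXi bem gbe hxi hla Oz).
- by move=> la hla ll; exact: (dom_limit_zero hb rmu lXi bem gbe hxi hla ll).
- move=> la z hla ll zl; split; last exact: (dom_limit_succ hb rmu lXi bem gbe hxi hla ll).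
  move=> h; have [sl sb] := proj1 (dom_canF hb rmu lXi bem gbe hxi _ hla) h.
  apply/(dom_canF hb rmu lXi bem gbe hxi _ hla); split=> //.
  apply: (good_pred gbe) sb; apply: osucc_memW.
  by case: hla => [<-//|[lx _]]; exact: ord_trans (osucc_ord oXi) sl lx.
move=> la z hla ll zl hz; apply/(dom_canF hb rmu lXi bem gbe hxi _ hla); split=> //.
apply/(cumV_ord obe) => //; apply: is_ordinal_in omu _; apply: code_in => //.
by apply: osucc_memW; case: hla => [<-//|[lx _]]; exact: ord_trans (osucc_ord oXi) zl lx.
Qed.

End Frames.

Definition unbD (g : zfset) (X : set zfset) : Prop :=
  forall e, e ∈ g -> exists e', [/\ e' ∈ g, e ∈ e' & sec (ztag 1) X e'].

Definition cut (d : zfset) (X : set zfset) : zfset := zset (X `&` cumV d).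

Lemma cut_elts d X : elts (cut d X) = X `&` cumV d.
Proof.
rewrite /cut; apply: (@zset_elts (zset (X `&` cumV d))); apply/seteqP; split=> x.
  by rewrite /elts /= zsetP //; apply: (small_subset (small_cumV d)) => y [].
by move=> h; rewrite /elts /= zsetP //; apply: (small_subset (small_cumV d)) => y [].
Qed.

Definition tup (d pc : zfset) (Ys : seq (set zfset)) : zfset :=
  lst (Vz d :: pc :: map (cut d) Ys).

(* X codes the relation of those t with pr (ztag 0) t in X; the last move also offers a set of
   ordinals, and the relation is tested at its limit points. *)
Definition chk (s : Prop) (be pc : zfset) (X : set zfset) (Ys : seq (set zfset)) : Prop :=
  exists d, [/\ d ∈ be, is_limit d, cumV d pc, unbD d (last X Ys) &
    (X (pr (ztag 0) (tup d pc Ys)) <-> s)].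

(** The player who moved last offers the test points. He wins if they are unbounded and the relation
    decides for him at every limit of them that sees the path. With [pol] true this is the
    existential player, or [X] itself when no move was made. *)
Definition Wsem (c : zfset -> zfset) (be : zfset) (pol : bool) (p : seq zfset)
    (Z : seq (set zfset)) : Prop :=
  let X := head set0 Z in let Ys := behead Z in let pc := lst (map c p) in
  if pol then unbD be (last X Ys) /\ ~ chk False be pc X Ys
  else ~ unbD be (last X Ys) \/ chk True be pc X Ys.

Section Leaf.
Variables (c : zfset -> zfset) (k : zfset).

Definition RD (g : zfset) (vs : seq zfset) : Prop := exists x, vs = [:: x] /\ unbD g (elts x).

Definition Rchk (s : Prop) (g : zfset) (vs : seq zfset) : Prop :=
  exists pc x xs, [/\ vs = pc :: x :: xs & exists d,
    [/\ d ∈ g, [/\ is_limit d, cumV d pc & unbD d (last (elts x) (map elts xs))],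
     cumV g (pr (ztag 0) (tup d pc (map elts xs))) &
     (elts x (pr (ztag 0) (tup d pc (map elts xs))) <-> s)]].

Definition Funb X := Fat (codeR RD `&` cumV k) [:: IS X].
Definition Fchk s p ts := Fat (codeR (Rchk s) `&` cumV k) (IC (lst (map c p)) :: map IS ts).

Definition uleaf (pol : bool) (p : seq zfset) (ts : seq term2) : fo_formula :=
  let l := last (Par2 set0) ts in
  if pol then FAnd (Funb l) (FNot (Fchk False p ts)) else FOr (FNot (Funb l)) (Fchk True p ts).

Definition tval be (e : env) t := term2_val e (term2_cap_par2 (cumV be) t).

Section Sem.
Variable be : zfset.
Hypotheses (ibe : inacc be) (bek : cumV be `<=` cumV k).
Let lbe : is_limit be. Proof. exact: inacc_limit. Qed.
Let obe : is_ordinal be. Proof. exact: limit_ord. Qed.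
Notation cap := (fo_cap_par2 (cumV be)).

Lemma tval_sub e t : envM (cumV be) e -> tval be e t `<=` cumV be.
Proof. by case: t => [m|A] he; rewrite /tval /=; [exact: he|move=> x []]. Qed.

Lemma sat_Funb e1 e X : envM (cumV be) e ->
  fo_sat (cumV be) e1 e (cap (Funb X)) <-> unbD be (tval be e X).
Proof.
move=> he; have sub := tval_sub (t := X) he.
rewrite /Funb sat_cap_Fat //; last by move=> i /= [].
split=> h.
  move=> e0 e0b; have oe0 := is_ordinal_in obe e0b.
  have [g [gb gx [x [[<-] hx]]]] := h e0 (cumV_ordW e0b oe0).
  have og := is_ordinal_in obe gb.
  have [e' [h1 h2 h3]] := hx e0 (proj1 (cumV_ord og oe0) gx).
  move: h3; rewrite (@ival_elts be) // => -[h3 _].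
  by exists e'; split=> //; exact: ord_trans gb.
move=> x bx.
have A : almost be (fun g => unbD g (tval be e X)).
  apply: almost_diag_ord => // e0 e0b; have [e' [h1 h2 h3]] := h e0 e0b.
  by apply: almost_mono (almost_const h1) => g _ _ h'; exists e'.
have [g [gb gx lg hg]] := almost_unbounded ibe A bx.
exists g; split=> //; exists (ival (Vz g) e (IS X)); split=> // e0 e0g.
have [e' [h1 h2 h3]] := hg e0 e0g; exists e'; split=> //.
rewrite (@ival_elts be) //; split=> //; apply/(cumV_pr _ _ lg); split; first exact: cumV_ztag.
by apply: cumV_ordW => //; apply: is_ordinal_in h1; exact: limit_ord.
Qed.

(** A successful test is visible in the traces on V_g as soon as V_g contains the test point and the
    coded tuple, and conversely it persists from a trace to the whole moves. *)
Lemma sat_Fchk e1 e s p ts X Ys : envM (cumV be) e -> cumV be (lst (map c p)) ->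
  map (tval be e) ts = X :: Ys ->
  fo_sat (cumV be) e1 e (cap (Fchk s p ts)) <-> chk s be (lst (map c p)) X Ys.
Proof.
move=> he hp hts; rewrite /Fchk sat_cap_Fat //; last first.
  move=> i /= [[<-]//|]; elim: ts {hts} => //= t ts IH [//|]; exact: IH.
have valE g : g ∈ be -> map elts (map (ival (Vz g) e) (map IS ts)) =
    map (fun Y => Y `&` cumV g) (X :: Ys).
  move=> gb; rewrite -hts -!map_comp; apply: eq_map => t /=.
  by rewrite (@ival_elts be).
have cutE d g : d ∈ g -> is_ordinal g -> map (cut d) (map (fun Y => Y `&` cumV g) Ys) = map (cut d) Ys.
  move=> dg og; rewrite -map_comp; apply: eq_map => Y /=; congr zset.
  apply/seteqP; split=> x [h1 h2]; first by case: h1.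
  by split=> //; split=> //; apply: cumV_mono h2 => //; left.
have lastE g : last (X `&` cumV g) (map (fun Y => Y `&` cumV g) Ys) = last X Ys `&` cumV g.
  by rewrite (last_map (fun Y => Y `&` cumV g)).
split=> h.
  have [g [gb gp [pc [x [xs [[<- E] [d [dg [ld dp hd] gt hx]]]]]]]] := h _ hp.
  have og := is_ordinal_in obe gb.
  have := valE g gb; rewrite E /= => -[Ex Exs].
  move: hd gt hx; rewrite Ex Exs lastE /tup cutE // => hd gt hx.
  exists d; split=> //; first exact: ord_trans gb.
    by move=> e0 e0d; have [e' [h1 h2 [h3 _]]] := hd e0 e0d; exists e'.
  by rewrite -hx; split=> [h'|[]//]; split.
move=> y by_.
have [d [db ld dp hd hx]] := h.
have tb : cumV be (pr (ztag 0) (tup d (lst (map c p)) Ys)).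
  apply/(cumV_pr _ _ lbe); split; first exact: cumV_ztag.
  apply/(cumV_lst _ lbe) => a; rewrite !in_cons => /orP[/eqP->|/orP[/eqP->//|]]; first exact: Vz_mem.
  move=> /mapP[Y _ ->]; apply: cumV_subset (Vz_mem db) _; rewrite cut_elts Vz_elts.
  by move=> z [].
have T : almost be (fun=> True) by exact: almost_all.
have Vb : cumV be (lst [:: y; pr (ztag 0) (tup d (lst (map c p)) Ys); d]).
  apply/(cumV_lst _ lbe) => a; rewrite !inE => /orP[/eqP->//|/orP[/eqP->//|/eqP->]].
  by apply: cumV_ordW => //; exact: limit_ord.
have [g [gb gx lg _]] := almost_unbounded ibe T Vb.
have og := limit_ord lg; move: gx => /(cumV_lst _ lg) gx.
have dg : d ∈ g by apply/(cumV_ord og (limit_ord ld))/gx; rewrite !inE eqxx ?orbT.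
exists g; split=> //; first by apply: gx; rewrite !inE eqxx.
case: ts hts valE => [//|t ts] hts valE.
exists (lst (map c p)), (ival (Vz g) e (IS t)), (map (ival (Vz g) e) (map IS ts)).
split=> //; have := valE g gb => /= -[Ex Exs]; rewrite Ex Exs lastE.
have gt : cumV g (pr (ztag 0) (tup d (lst (map c p)) Ys)) by apply: gx; rewrite !inE eqxx ?orbT.
exists d; rewrite /tup cutE //; split=> //.
  split=> // e0 e0d; have [e' [h1 h2 h3]] := hd e0 e0d; exists e'; split=> //; split=> //.
  apply/(cumV_pr _ _ lg); split; first exact: cumV_ztag.
  apply: cumV_ordW; first exact: ord_trans dg.
  by apply: is_ordinal_in h1; exact: limit_ord.
by rewrite -hx; split=> [[]//|h']; split.
Qed.

Lemma sat_uleaf e1 e pol p ts : envM (cumV be) e -> cumV be (lst (map c p)) -> ts <> [::] ->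
  fo_sat (cumV be) e1 e (cap (uleaf pol p ts)) <-> Wsem c be pol p (map (tval be e) ts).
Proof.
move=> he hp; case: ts => [//|t ts] _.
have hl : tval be e (last (Par2 set0) (t :: ts)) = last (tval be e t) (map (tval be e) ts).
  by rewrite /= (last_map (tval be e)).
have hc s := @sat_Fchk e1 e s p (t :: ts) (tval be e t) (map (tval be e) ts) he hp erefl.
rewrite /Wsem /uleaf; cbn [map head behead]; case: pol.
  by rewrite cap_FAnd sat_FAnd cap_FNot sat_FNot sat_Funb // hl hc.
by rewrite FOr_cap sat_FOr cap_FNot sat_FNot sat_Funb // hl hc.
Qed.

End Sem.

Lemma wf_uleaf Par n pol p ts : Par (codeR RD `&` cumV k) -> Par (codeR (Rchk False) `&` cumV k) ->
  Par (codeR (Rchk True) `&` cumV k) -> cumV k (lst (map c p)) -> ts <> [::] ->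
  (forall t, List.In t ts -> wf_item k Par n (IS t)) -> wf_fo k Par n (uleaf pol p ts).
Proof.
move=> h1 h2 h3 h4 h5 h6.
have hits it : List.In it (IC (lst (map c p)) :: map IS ts) -> wf_item k Par n it.
  move=> /= [<-//|]; elim: ts h6 {h5} => //= t ts IH h6 [<-|]; first by apply: h6; left.
  by apply: IH => t' ht'; apply: h6; right.
have hlast : wf_item k Par n (IS (last (Par2 set0) ts)).
  apply: h6; case: ts h5 {hits} => // t ts _ /=.
  by elim: ts t => [|t' ts IH] t /=; [left|right; exact: IH].
have hu : wf_fo k Par n (Funb (last (Par2 set0) ts)) by apply: wf_Fat => // it [<-|].
have hF : wf_fo k Par n (Fchk False p ts) by apply: wf_Fat => // it; exact: hits.
have hT : wf_fo k Par n (Fchk True p ts) by apply: wf_Fat => // it; exact: hits.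
by rewrite /uleaf; case: pol; [apply: wf_FAnd => //; exact: wf_FNot|apply: wf_FOr => //; exact: wf_FNot].
Qed.

End Leaf.

(** A true game has a play ending in a true leaf: the empty set serves as an arbitrary move, and no
    limit level is empty. Conditions put into every leaf therefore hold at the reflecting point. *)
Lemma ev_leaf_imp St (m : machine St) O M L (K : Prop) ze pol st e : is_ordinal ze ->
  (forall la, is_limit la -> ole la ze -> exists2 z, z ∈ la & O la z) ->
  (forall pol st e, envM M e -> L pol st e -> K) -> envM M e -> ev m O M L ze pol st e -> K.
Proof.
move=> oz hO hL; elim/ord_ind: ze / oz hO pol st e => [|d od IH|la ll IH] hO pol st e he.
- by rewrite ev0; exact: hL.
- rewrite evS; have {}IH := IH _ (~~ pol) (nx m pol d st).
  have hO' la : is_limit la -> ole la d -> exists2 z, z ∈ la & O la z.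
    by move=> ll ld; apply: hO => //; left; exact/osuccP.
  elim: (ns m pol d st) e he => [|n l IHl] e he /=; first exact: IH.
  case: (pol) IHl => IHl.
    by move=> /(_ set0 (sub0set _)); apply: IHl; apply: envM_upd => //; exact: sub0set.
  by move=> [X XM]; apply: IHl; exact: envM_upd.
have [z0 z0l Oz0] := hO la ll (or_intror erefl).
have hO' z : z ∈ la -> forall la', is_limit la' -> ole la' z -> exists2 z, z ∈ la' & O la' z.
  by move=> zl la' ll' lz; apply: hO => //; left; exact: ole_trans_mem (limit_ord ll) lz zl.
case: pol; first by rewrite evLt // => /(_ _ z0l Oz0); apply: (IH _ z0l (hO' _ z0l)).
by rewrite evLf // => -[z [zl _]]; apply: (IH _ zl (hO' _ zl)).
Qed.

Definition ustate : Type := (nat * seq term2 * seq zfset)%type.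

(** No variable is used twice, so that all earlier moves remain available to the leaf. *)
Definition umach : machine ustate := Machine
  (fun _ _ st => [:: st.1.1])
  (fun _ d st => (st.1.1.+1, rcons st.1.2 (Var2 st.1.1), d :: st.2))
  (fun _ _ z st => (st.1.1, st.1.2, z :: st.2)).

Definition tvars n (ts : seq term2) := forall t v, List.In t ts -> term2_fv t v -> v < n.

Lemma In_rcons T (x t : T) l : List.In t (rcons l x) -> List.In t l \/ t = x.
Proof. by elim: l => [|a l IH] /= [->|]; auto; move=> /IH[]; auto. Qed.

Lemma tvars_rcons n ts : tvars n ts -> tvars n.+1 (rcons ts (Var2 n)).
Proof. move=> h t v ht hv; case: (In_rcons ht) => [ht'|E]; first by apply: ltnW; exact: h ht' hv.
by move: hv; rewrite E => /= ->. Qed.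

Lemma tvarsS n ts : tvars n ts -> tvars n.+1 ts.
Proof. by move=> h t v ht hv; apply: ltnW; exact: h ht hv. Qed.

Lemma tval_upd be e n Y ts : tvars n ts -> map (tval be (upd e n Y)) ts = map (tval be e) ts.
Proof.
elim: ts => //= t ts IH h; rewrite IH; last by move=> t' v ht; apply: h; right.
congr cons; case: t h => [m|A] //= h; rewrite /tval /= /upd /= ltn_eqF //.
by apply: (h (Var2 m)); [left|].
Qed.

Lemma tval_new be e n Y ts : tvars n ts ->
  map (tval be (upd e n Y)) (rcons ts (Var2 n)) = rcons (map (tval be e) ts) Y.
Proof. by move=> h; rewrite map_rcons tval_upd // /tval /= /upd /= eqxx. Qed.

Lemma rcons_neq0 T (l : seq T) x : rcons l x <> [::]. Proof. by case: l. Qed.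

Section Umach.
Variables (b : zfset -> zfset -> zfset -> zfset) (mu Xi be : zfset).
Variables (O : zfset -> set zfset) (D : set zfset) (fr : frame b mu Xi be O D).
Notation M := (cumV be).
Notation inD p := (forall z, z \in p -> D z).

Lemma inD_cons z p : D z -> inD p -> inD (z :: p).
Proof. by move=> Dz hp y; rewrite in_cons => /orP[/eqP->|/hp]. Qed.

Lemma ev_umach W L :
  (forall pol n ts p e, envM M e -> tvars n ts -> inD p -> ts <> [::] ->
     L pol (n, ts, p) e <-> W pol p (map (tval be e) ts)) ->
  forall ze pol n ts p e, D ze -> tvars n ts -> inD p -> ts <> [::] -> envM M e ->
  ev umach O M L ze pol (n, ts, p) e <-> gm O M W ze pol p (map (tval be e) ts).
Proof.
move=> hL ze pol n ts p e Dz; have oz := fr_ord fr Dz.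
elim/ord_ind: ze / oz Dz pol n ts p e => [|d od IH|la ll IH] Dz pol n ts p e hn hp hts he.
- by rewrite ev0 gm0; exact: hL.
- have Dd := fr_succ fr Dz.
  have key Y : Y `<=` M -> ev umach O M L d (~~ pol) (n.+1, rcons ts (Var2 n), d :: p) (upd e n Y) <->
      gm O M W d (~~ pol) (d :: p) (rcons (map (tval be e) ts) Y).
    move=> YM; rewrite -(@tval_new be e n Y ts hn); apply: IH => //.
    + exact: tvars_rcons.
    + exact: inD_cons.
    + exact: rcons_neq0.
    + exact: envM_upd.
  rewrite evS gmS; case: pol key => key /=.
    by split=> h Y YM; apply/key => //; exact: h.
  by split=> -[Y YM h]; exists Y => //; apply/key.
have IHz z pol' : z ∈ la -> O la z -> _ := fun zl Oz =>
  IH z zl (fr_lim fr Dz ll zl Oz) pol' n ts (z :: p) e hn (inD_cons (fr_lim fr Dz ll zl Oz) hp) hts he.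
case: pol.
  by rewrite evLt // gmLt //; split=> h z zl Oz; apply/(IHz z true zl Oz); exact: h.
by rewrite evLf // gmLf //; split=> -[z [zl Oz h]]; exists z; split=> //; apply/(IHz z false zl Oz).
Qed.

(** Exchanging the players negates the game. The disjunct [B] is fixed during the play and passes
    through every level, since no level is empty of moves or choices. *)
Lemma gm_dual W W' X (B : Prop) :
  (forall pol p Z, W' pol p (X :: Z) <-> ~ W (~~ pol) p (X :: Z) \/ B) -> forall ze pol p Z, D ze ->
  gm O M W' ze pol p (X :: Z) <-> ~ gm O M W ze (~~ pol) p (X :: Z) \/ B.
Proof.
move=> hW ze pol p Z Dz; have oz := fr_ord fr Dz.
elim/ord_ind: ze / oz Dz pol p Z => [|d od IH|la ll IH] Dz pol p Z.
- by rewrite !gm0.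
- have Dd := fr_succ fr Dz; rewrite !gmS; case: pol => /=; split.
  + move=> h; have [hB|nB] := pselect B; [by right|left] => -[Y YM].
    by have /(IH Dd)[] := h Y YM.
  + by move=> h Y YM; apply/(IH Dd); case: h => [h|]; [left=> hY; apply: h; exists Y|right].
  + by move=> [Y YM /(IH Dd)[h|h]]; [left=> h'; apply: h; exact: h' YM|right].
  + case=> [/existsNP[Y] /not_implyP[YM h]|hB]; first by exists Y => //; apply/(IH Dd); left.
    by exists set0; [exact: sub0set|apply/(IH Dd); right].
have Dl z : z ∈ la -> O la z -> D z by exact: (fr_lim fr Dz ll).
case: pol => /=; rewrite ?(gmLt _ _ _ _ _ ll) ?(gmLf _ _ _ _ _ ll); split.
- move=> h; have [hB|nB] := pselect B; [by right|left] => -[z [zl Oz]].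
  by have /(IH z zl (Dl z zl Oz))[] := h z zl Oz.
- move=> h z zl Oz; apply/(IH z zl (Dl z zl Oz)).
  by case: h => [h|]; [left=> hz; apply: h; exists z|right].
- by move=> [z [zl Oz /(IH z zl (Dl z zl Oz))[h|h]]]; [left=> h'; apply: h; exact: h'|right].
case=> [/existsNP[z] /not_implyP[zl /not_implyP[Oz h]]|hB].
  by exists z; split=> //; apply/(IH z zl (Dl z zl Oz)); left.
have z0 := limit_zero ll; have O0 := fr_lim0 fr Dz ll.
by exists ozero; split=> //; apply/(IH _ z0 (Dl _ z0 O0)); right.
Qed.

End Umach.

(** * Playing one level higher *)

(* Playing a game one level higher.  At a limit la the player to choose declares a level through a
   set Y, and the opponent picks osucc (osucc z), where z is the level that is meant; a wrong pick
   loses.  The formulas p, q of a state mean that its value is (value of the game /\ p) \/ q. *)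
Inductive lstate :=
| LPlay of nat & seq term2 & seq zfset & fo_formula & fo_formula
| LPick of nat & seq term2 & seq zfset & fo_formula & fo_formula
| LSkip of nat & seq term2 & seq zfset & fo_formula & fo_formula
| LEnd of nat & fo_formula.

Section Lift.
Variables (b : zfset -> zfset -> zfset -> zfset) (mu xi k : zfset).
Let Xi := osucc xi.
Notation c := (code b mu Xi).
Notation uleaf := (uleaf c k).

(** A pick is right if the declaration contains its code, or if the declaration contains no code of
    a level below the limit coded by [j]; in the latter case every pick is right. *)
Definition Rright (g : zfset) (vs : seq zfset) : Prop := exists i j y,
  vs = [:: i; j; y] /\ ((exists z, z ∈ lev b mu xi j /\ c z ∈ y) -> i ∈ y).

Definition Fright z la v := Fat (codeR Rright `&` cumV k) [:: IC (c z); IC (c la); IS (Var2 v)].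

Definition lns (pol : bool) (d : zfset) st :=
  if st is LPlay n _ _ _ _ then [:: n] else [::].

Definition lnx (pol : bool) (d : zfset) st :=
  match st with
  | LPlay n ts s p q =>
      if `[< d = ozero >] then LEnd n.+1 (FOr (FAnd (uleaf pol s ts) p) q)
      else if `[< exists y, d = osucc y >] then LPlay n.+1 (rcons ts (Var2 n)) (opred d :: s) p q
      else LPick n.+1 ts s p q
  | LSkip n ts s p q => LPlay n ts s p q
  | _ => st
  end.

(** Of the two successors in a pick, one is spent by the empty block of [LSkip], which hands the
    turn back, and the other is the level by which the game is lifted. The declaring move is the
    variable [n.-1]. Any other pick ends the game against the picker. *)
Definition lli (pol : bool) (la z : zfset) st :=
  if st is LPick n ts s p q then
    if `[< exists y, z = osucc (osucc y) >] then
      let y := opred (opred z) in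
      if pol then LSkip n ts (y :: s) p (FOr (FAnd (FNot (Fright y la n.-1)) p) q)
      else LSkip n ts (y :: s) (FAnd (Fright y la n.-1) p) q
    else LEnd n (if pol then FOr p q else q)
  else st.

Definition lmach := Machine lns lnx lli.

Definition lleaf (pol : bool) st := if st is LEnd _ f then f else FFalse.

Definition fvars n r := forall v, fo_fv2 r v -> v < n.

Lemma fvarsS n r : fvars n r -> fvars n.+1 r.
Proof. by move=> h v hv; apply: ltnW; exact: h. Qed.

Lemma fvars_right z la n : fvars n.+1 (Fright z la n).
Proof. by move=> v /Fat_fv2[it /= [<-//|[<-//|[<-/= ->|]]]]. Qed.

Section Sem.
Variables (be : zfset) (O : zfset -> set zfset) (D : set zfset) (fr : frame b mu Xi be O D).
Hypotheses (hb : canonical_bijections b) (rmu : is_regular mu).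
Hypothesis lXi : lt_cardinal_succ mu Xi.
Hypotheses (ibe : inacc be) (bek : cumV be `<=` cumV k).
Let lbe : is_limit be. Proof. exact: inacc_limit. Qed.
Let obe : is_ordinal be. Proof. exact: limit_ord. Qed.
Notation M := (cumV be).
Notation cap := (fo_cap_par2 M).
Notation inD p := (forall z, z \in p -> D z).
Variable e1 : nat -> zfset.
Notation E := (ev lmach O M (fun pol st e => fo_sat M e1 e (cap (lleaf pol st)))).
Notation G := (gm O M (Wsem c be)).

Lemma inD_lst s : inD s -> M (lst (map c s)).
Proof. by move=> h; apply/(cumV_lst _ lbe) => a /mapP[z /h/(fr_code fr)[_ hz] ->]. Qed.

Lemma sat_Fright e z la v : envM M e -> D z -> D la ->
  fo_sat M e1 e (cap (Fright z la v)) <-> ((exists z', z' ∈ la /\ e v (c z')) -> e v (c z)).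
Proof.
move=> he Dz Dla; have [zX hz] := fr_code fr Dz; have [laX hla] := fr_code fr Dla.
rewrite /Fright sat_cap_Fat //; last by move=> i /= [[<-]//|[[<-]//|[]]].
have valE g : g ∈ be -> elts (ival (Vz g) e (IS (Var2 v))) = e v `&` cumV g.
  by move=> gb; rewrite (@ival_elts be).
split.
  move=> h [z' [zl hz']]; have [g [gb gx [i [j [y [[<- <- Ey] hR]]]]]] := h _ (he _ _ hz').
  have : c z ∈ y.
    apply: hR; exists z'; rewrite (lev_code hb rmu lXi laX); split=> //.
    by have : elts y (c z') by rewrite -Ey valE.
  by move=> hy; have : elts y (c z) by []; rewrite -Ey valE // => -[].
move=> h x bx; have [g [gb gx gz]] := cumV_limit2 lbe bx hz.
exists g; split=> //; exists (c z), (c la), (ival (Vz g) e (IS (Var2 v))); split=> //.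
rewrite (lev_code hb rmu lXi laX) => -[z' [zl hz']].
suff : elts (ival (Vz g) e (IS (Var2 v))) (c z) by [].
have : elts (ival (Vz g) e (IS (Var2 v))) (c z') by [].
by rewrite valE // => -[h1 _]; split=> //; apply: h; exists z'.
Qed.

Lemma ev_LEnd ze pol n f e : D ze -> E ze pol (LEnd n f) e <-> fo_sat M e1 e (cap f).
Proof.
move=> Dz; have oz := fr_ord fr Dz; elim/ord_ind: ze / oz Dz pol => [|d od IH|la ll IH] Dz pol.
- by rewrite ev0.
- by rewrite evS /=; apply: IH; exact: (fr_succ fr Dz).
have IHz z pol' zl Oz := IH z zl (fr_lim fr Dz ll zl Oz) pol'.
have z0 := limit_zero ll; have O0 := fr_lim0 fr Dz ll.
case: pol.
  rewrite evLt //; split=> [h|h z zl Oz]; last exact/(IHz z true zl Oz).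
  exact/(IHz _ true z0 O0)/(h _ z0 O0).
rewrite evLf //; split=> [[z [zl Oz /(IHz z false zl Oz)]]//|h].
by exists ozero; split=> //; apply/(IHz _ false z0 O0).
Qed.

(** The extra level is passed on at successors and spent on an idle move at zero. One level above a
    limit, a block of the right player comes before a choice by the wrong one; so the choice is
    announced in the block, and the other player can only confirm it. *)
Lemma ev_lift ze pol n ts s p q e : D ze -> tvars n ts -> fvars n p -> fvars n q -> inD s ->
  ts <> [::] -> envM M e ->
  E (osucc ze) pol (LPlay n ts s p q) e <->
  (G ze pol s (map (tval be e) ts) /\ fo_sat M e1 e (cap p)) \/ fo_sat M e1 e (cap q).
Proof.
move=> Dz; have oz := fr_ord fr Dz.
elim/ord_ind: ze / oz Dz pol n ts s p q e => [|d od IH|la ll IH] Dz pol n ts s p q e hn hp hq hs hts he;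
  rewrite evS.
- have key Y : Y `<=` M -> E ozero (~~ pol) (lnx pol ozero (LPlay n ts s p q)) (upd e n Y) <->
    (G ozero pol s (map (tval be e) ts) /\ fo_sat M e1 e (cap p)) \/ fo_sat M e1 e (cap q).
    move=> YM; rewrite ev0 /lnx asboolT // /lleaf FOr_cap sat_FOr cap_FAnd sat_FAnd gm0.
    rewrite (@upd_sat be e1 e n Y p hp) (@upd_sat be e1 e n Y q hq).
    by rewrite sat_uleaf //; [rewrite tval_upd|exact: envM_upd|exact: inD_lst].
  case: pol key => key /=; first by split=> [h|h Y YM]; [apply/(key _ (sub0set _)); exact: h|apply/key].
  by split=> [[Y YM /key]|h]; [exact|exists set0; [exact: sub0set|exact/(key _ (sub0set _))]].
- have Dd := fr_succ fr Dz.
  have key Y : Y `<=` M -> E (osucc d) (~~ pol) (lnx pol (osucc d) (LPlay n ts s p q)) (upd e n Y) <->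
    (G d (~~ pol) (d :: s) (rcons (map (tval be e) ts) Y) /\ fo_sat M e1 e (cap p)) \/ fo_sat M e1 e (cap q).
    move=> YM; rewrite /lnx asboolF; last exact: osucc_neq0.
    rewrite asboolT; last by exists d.
    rewrite opredK -(@upd_sat be e1 e n Y p hp) -(@upd_sat be e1 e n Y q hq).
    rewrite -(@tval_new be e n Y ts hn); apply: IH => //.
    + exact: tvars_rcons.
    + exact: fvarsS.
    + exact: fvarsS.
    + exact: inD_cons.
    + exact: rcons_neq0.
    + exact: envM_upd.
  rewrite gmS; set A := fo_sat _ _ _ (cap p) in key *; set B := fo_sat _ _ _ (cap q) in key *.
  case: pol key => key /=; split.
  + move=> h; have [hB|nB] := pselect B; [by right|left; split].
      by move=> Y YM; have /(key Y YM)[[]|] := h Y YM.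
    by have /(key _ (sub0set _))[[]|] := h _ (sub0set _).
  + by move=> h Y YM; apply/(key Y YM); case: h => [[h hA]|]; [left; split=> //; exact: h|right].
  + by move=> [Y YM /(key Y YM)[[h hA]|]]; [left; split=> //; exists Y|right].
  + case=> [[[Y YM h] hA]|hB]; first by exists Y => //; apply/(key Y YM); left.
    by exists set0; [exact: sub0set|apply/(key _ (sub0set _)); right].
have [_ l0 lS] := ll.
have Dl z : z ∈ la -> O la z -> D z by exact: (fr_lim fr Dz ll).
set A := fo_sat _ _ _ (cap p); set B := fo_sat _ _ _ (cap q).
have bad Y z : Y `<=` M -> z ∈ la -> O la z -> ~ (exists y, z = osucc (osucc y)) ->
    E z (~~ pol) (lli (~~ pol) la z (LPick n.+1 ts s p q)) (upd e n Y) <-> (if pol then B else A \/ B).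
  move=> YM zl Oz hz; rewrite /lli asboolF // (ev_LEnd _ _ _ _ (Dl z zl Oz)).
  case: (pol); cbn [negb]; first by rewrite (@upd_sat be e1 e n Y q hq).
  by rewrite FOr_cap sat_FOr (@upd_sat be e1 e n Y p hp) (@upd_sat be e1 e n Y q hq).
have succl z : z ∈ la -> O la z -> osucc z ∈ la /\ O la (osucc z).
  by move=> zl Oz; split; [exact: limit_succ|apply/(fr_limS fr)].
have pick Y z : Y `<=` M -> z ∈ la -> O la z ->
    E (osucc (osucc z)) (~~ pol) (lli (~~ pol) la (osucc (osucc z)) (LPick n.+1 ts s p q)) (upd e n Y) <->
    let R := (exists z', z' ∈ la /\ Y (c z')) -> Y (c z) in
    let g := G z pol (z :: s) (map (tval be e) ts) in
    if pol then (g /\ (R /\ A)) \/ B else (g /\ A) \/ ((~ R /\ A) \/ B).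
  move=> YM zl Oz; have Dz' := Dl z zl Oz.
  rewrite /lli asboolT; last by exists z.
  rewrite !opredK; case: pol {bad} => /=; rewrite evS /= (IH z zl Dz' _ n.+1 ts) //.
  all: try exact: tvarsS.
  all: try exact: fvarsS.
  all: try exact: inD_cons.
  all: try exact: envM_upd.
  + rewrite cap_FAnd sat_FAnd tval_upd // (@upd_sat be e1 e n Y p hp) (@upd_sat be e1 e n Y q hq).
    by rewrite sat_Fright //; [rewrite /upd /= eqxx|exact: envM_upd].
  + by move=> v [h|h]; [exact: (fvars_right h)|apply: ltnW; exact: hp].
  + rewrite FOr_cap sat_FOr cap_FAnd sat_FAnd cap_FNot sat_FNot tval_upd //.
    rewrite (@upd_sat be e1 e n Y p hp) (@upd_sat be e1 e n Y q hq).
    by rewrite sat_Fright //; [rewrite /upd /= eqxx|exact: envM_upd].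
  + by move=> v [[h|h]|h]; [exact: (fvars_right h)|apply: ltnW; exact: hp|apply: ltnW; exact: hq].
have nxE : lnx pol la (LPlay n ts s p q) = LPick n.+1 ts s p q.
  by rewrite /lnx asboolF // asboolF // => -[y /lS].
have back z : osucc (osucc z) ∈ la -> O la (osucc (osucc z)) -> z ∈ la /\ O la z.
  move=> zl Oz; have sl : osucc z ∈ la by apply: ord_trans zl; [exact: limit_ord|exact: osucc_mem].
  have zl' : z ∈ la by apply: ord_trans sl; [exact: limit_ord|exact: osucc_mem].
  by split=> //; apply/(fr_limS fr Dz ll zl')/(fr_limS fr Dz ll sl).
have Mc z : z ∈ la -> O la z -> [set c z] `<=` M.
  by move=> zl Oz x ->; case: (fr_code fr (Dl z zl Oz)).
have cinj z z' : z ∈ la -> O la z -> z' ∈ la -> O la z' -> c z = c z' -> z = z'.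
  move=> zl Oz zl' Oz'; have [zX _] := fr_code fr (Dl z zl Oz).
  by have [zX' _] := fr_code fr (Dl z' zl' Oz'); exact: (code_inj hb rmu lXi).
(* Every declaration leaves a right pick: a declared level, or zero if none is declared. *)
have meant Y : Y `<=` M -> exists z, [/\ z ∈ la, O la z &
    (exists z', z' ∈ la /\ Y (c z')) -> Y (c z)].
  move=> YM; have [[z' [zl hz]]|h] := pselect (exists z', z' ∈ la /\ Y (c z')).
    by exists z'; split=> //; apply: (fr_O fr) => //; exact: YM.
  by exists ozero; split=> //; [exact: limit_zero|exact: (fr_lim0 fr)].
have z0 := limit_zero ll; have O0 := fr_lim0 fr Dz ll.
rewrite /lmach; cbn [nx ns]; rewrite nxE.
case: pol bad pick {nxE} => /= bad pick; rewrite ?(gmLt _ _ _ _ _ ll) ?(gmLf _ _ _ _ _ ll); split.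
- move=> h; have [hB|nB] := pselect B; [by right|left].
  suff H z : z ∈ la -> O la z -> G z true (z :: s) (map (tval be e) ts) /\ A.
    by split; [move=> z zl Oz; case: (H z zl Oz)|case: (H _ z0 O0)].
  (* Against the declaration of the single code of [z] the only right pick is [z], as codes are
     injective. *)
  move=> zl Oz; have /(@evLf _ lmach O M _ _ _ _ ll)[z' [zl' Oz']] := h _ (Mc z zl Oz).
  have [[y E']|hz] := pselect (exists y, z' = osucc (osucc y)); last by move/(bad _ _ (Mc z zl Oz) zl' Oz' hz).
  subst z'; have [yl Oy] := back _ zl' Oz'.
  move=> /(pick _ _ (Mc z zl Oz) yl Oy)[|//] [hg [hR hA]].
  suff -> : z = y by [].
  by apply: cinj => //; apply/esym; apply: hR; exists z.
- move=> h Y YM; apply/(@evLf _ lmach O M _ _ _ _ ll).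
  have [z [zl Oz hR]] := meant Y YM.
  have [sl Os] := succl z zl Oz; have [ssl Oss] := succl _ sl Os.
  exists (osucc (osucc z)); split=> //; apply/(pick _ _ YM zl Oz).
  by case: h => [[h hA]|hB]; [left; split=> //; exact: h|right].
- move=> [Y YM] /(@evLt _ lmach O M _ _ _ _ ll) h.
  have [z [zl Oz hR]] := meant Y YM.
  have [sl Os] := succl z zl Oz; have [ssl Oss] := succl _ sl Os.
  have /(pick _ _ YM zl Oz)[[hg hA]|[[//]|hB]] := h _ ssl Oss; last by right.
  by left; split=> //; exists z.
case=> [[[z [zl Oz hg]] hA]|hB].
  exists [set c z]; first exact: Mc.
  apply/(@evLt _ lmach O M _ _ _ _ ll) => z' zl' Oz'.
  have [[y E']|hz] := pselect (exists y, z' = osucc (osucc y)); last first.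
    by apply/(bad _ _ (Mc z zl Oz) zl' Oz' hz); left.
  subst z'; have [yl Oy] := back _ zl' Oz'.
  apply/(pick _ _ (Mc z zl Oz) yl Oy).
  have [E'|ne] := pselect (z = y); first by left; rewrite -E'.
  right; left; split=> // hR; apply: ne; apply: cinj => //; apply/esym.
  by apply: hR; exists z.
exists set0; first exact: sub0set.
apply/(@evLt _ lmach O M _ _ _ _ ll) => z' zl' Oz'.
have [[y E']|hz] := pselect (exists y, z' = osucc (osucc y)); last first.
  by apply/(bad _ _ (sub0set _) zl' Oz' hz); right.
subst z'; have [yl Oy] := back _ zl' Oz'.
by apply/(pick _ _ (sub0set _) yl Oy); right; right.
Qed.

End Sem.
End Lift.

Lemma club_almost mu C : is_limit mu -> club mu C -> almost mu C.
Proof.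
move=> lmu [Cmu unbC closC].
exists (fun x => xget ozero [set e | C e /\ x ∈ e]).
  by move=> x _; case: xgetP => [y _ [/Cmu]//|_]; exact: limit_zero.
move=> g gm [lg hg]; apply: closC => // e eg.
have := hg e (cumV_ordW eg (is_ordinal_in (limit_ord lg) eg)).
have [d Cd ed] := unbC e (ord_trans (limit_ord lmu) eg gm).
by case: xgetP => [y _ [Cy ey] yg|/(_ d)]; [exists y|case].
Qed.

(** * Reflecting the universal statement from [mu] *)

Section Reflection.
Variables (b : zfset -> zfset -> zfset -> zfset) (mu xi : zfset).
Hypotheses (hb : canonical_bijections b) (rmu : is_regular mu).
Let Xi := osucc xi.
Hypothesis lXi : lt_cardinal_succ mu Xi.
Hypothesis ind : indescribable b mu Xi.
Let lmu : is_limit mu. Proof. by case: rmu. Qed.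
Let omu : is_ordinal mu. Proof. exact: limit_ord. Qed.
Let oXi : is_ordinal Xi. Proof. exact: ltcs_ord lXi. Qed.
Let imu : inacc mu. Proof. exact: indescribable_inacc hb ind. Qed.
Notation c := (code b mu Xi).
Notation V := (cumV mu).
Variable h : zfset -> zfset.
Hypothesis hm : maps mu h.
Hypothesis hgood : forall g, g ∈ mu -> clos h g -> good b mu Xi g /\ (is_regular g -> inacc g).

Definition gm_at (O : zfset -> set zfset) g X := gm O (cumV g) (Wsem c g) xi true [:: xi] [:: X].

Lemma V_code z : z ∈ Xi -> V (c z).
Proof.
by move=> zX; have h1 := code_in b rmu lXi zX; apply: cumV_ordW => //; exact: is_ordinal_in h1.
Qed.

Lemma dom_xi g : dom b mu Xi xi g xi. Proof. by left. Qed.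

Definition upar (P : set zfset) (A : set (set zfset)) : set (set zfset) :=
  [set Q | Q = P \/ Q = codeR RD `&` V \/ Q = codeR (Rchk False) `&` V \/
    Q = codeR (Rchk True) `&` V \/ Q = codeR (Rright b mu xi) `&` V \/ A Q].

Lemma upar_finite P A : finite_set A -> finite_set (upar P A).
Proof.
move=> fA; have -> : upar P A = [set P] `|` ([set codeR RD `&` V] `|` ([set codeR (Rchk False) `&` V] `|`
   ([set codeR (Rchk True) `&` V] `|` ([set codeR (Rright b mu xi) `&` V] `|` A)))) by [].
by rewrite !finite_setU; repeat split => //; exact: finite_set1.
Qed.

Lemma canF_inh be : be ∈ mu -> is_limit be -> forall la, is_limit la -> ole la Xi ->
  exists2 z, z ∈ la & canF b mu la be z.
Proof.
move=> bem lbe la ll lle; have lla : lt_cardinal_succ mu la by case: lle => [/(ltcs_mem lXi)//|->].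
exact: canF_limit_inh.
Qed.

Lemma upar_V P A : P `<=` V -> (forall Q, A Q -> Q `<=` V) -> forall Q, upar P A Q -> Q `<=` V.
Proof. by move=> hP hA Q [->//|[->|[->|[->|[->|/hA//]]]]] x []. Qed.

Section Lifted.
Variables (X0 : set zfset) (x0 : zfset).
Hypotheses (X0V : X0 `<=` V) (x0V : V x0).

Let PC := codeR (Rclos (clos h)) `&` V.
Let Par := upar PC [set X0].
Let a0 := FAnd (Fat PC [::]) (FAnd (Funb mu (Par2 X0)) (Fis x0)).
Let leaf (pol : bool) st := FAnd a0 (lleaf pol st).
Let m := lmach b mu xi mu.

Let wf5 n (ts : seq term2) (s : seq zfset) p q :=
  [/\ forall t, List.In t ts -> wf_item mu Par n (IS t), ts <> [::], V (lst (map c s)),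
      wf_fo mu Par n p & wf_fo mu Par n q].

Let wf st := match st with
  | LPlay n ts s p q => wf5 n ts s p q
  | LSkip n ts s p q => wf5 n ts s p q
  | LPick n ts s p q => 0 < n /\ wf5 n ts s p q
  | LEnd n f => wf_fo mu Par n f
  end.

Let nvar st := match st with
  | LPlay n _ _ _ _ | LSkip n _ _ _ _ | LPick n _ _ _ _ | LEnd n _ => n end.

Let inv ze (pol : bool) st := ole ze Xi /\ wf st.

Let ParV A : Par A -> A `<=` V.
Proof. by apply: upar_V => [x []//|Q ->]. Qed.

Lemma wf5S n ts s p q : wf5 n ts s p q -> wf5 n.+1 ts s p q.
Proof.
move=> [h1 h2 h3 h4 h5]; split=> //; try exact: wf_mono (leqnSn n) _.
by move=> t /h1; exact: wf_item_mono.
Qed.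

Lemma V_path z s : z ∈ Xi -> V (lst (map c s)) -> V (lst (map c (z :: s))).
Proof. by move=> zX hs; apply/(cumV_pr _ _ lmu); split=> //; exact: V_code. Qed.

Lemma wf_a0 n : wf_fo mu Par n a0.
Proof.
apply: wf_FAnd; first by apply: wf_Fat => //; left.
apply: wf_FAnd; last exact: wf_Fis.
apply: wf_Fat; first by right; left.
by move=> it [<-|//] /=; do 5 right.
Qed.

Lemma lift_leaf pol st : inv ozero pol st -> wf_fo mu Par (nvar st) (leaf pol st).
Proof.
move=> [_ hst]; apply: wf_FAnd; first exact: wf_a0.
by case: st hst => //= *; exact: wf_FFalse.
Qed.

Lemma lift_nx pol d st : inv (osucc d) pol st ->
  inv d (~~ pol) (nx m pol d st) /\
  (forall v, v < nvar (nx m pol d st) -> v < nvar st \/ v \in ns m pol d st).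
Proof.
move=> [de hst]; have de' : d ∈ Xi by apply: mem_ole_trans de => //; exact: osucc_mem.
case: st hst => [n ts s p q|n ts s p q|n ts s p q|n f] hst.
- have hv v : v < n.+1 -> v < n \/ v \in [:: n].
    by rewrite ltnS leq_eqVlt inE => /orP[->|]; [right|left].
  have [h1 h2 h3 h4 h5] := wf5S hst.
  rewrite /m /lmach; cbn [nx ns lnx]; case: asboolP => [_|d0].
    split; [split; first by left|exact: hv].
    apply: wf_FOr => //; apply: wf_FAnd => //; apply: wf_uleaf => //.
    + by right; left.
    + by right; right; left.
    + by right; right; right; left.
  case: asboolP => [[y E]|nS]; last by split; [split; [left|]|exact: hv].
  split; [split; first by left|exact: hv]; subst d; rewrite opredK; split=> //.
  + by move=> t ht; case: (In_rcons ht) => [/h1//|->] /=.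
  + exact: rcons_neq0.
  + by apply: V_path => //; apply: ord_trans de' => //; exact: osucc_mem.
- by split=> [|v]; [split; [left|]|left].
- by split=> [|v]; [split; [left|]|left].
- by split=> [|v]; [split; [left|]|left].
Qed.

Lemma lift_li pol la z st : is_limit la -> z ∈ la -> inv la pol st ->
  inv z pol (li m pol la z st) /\ nvar (li m pol la z st) <= nvar st.
Proof.
move=> ll zl [le hst]; have zX : z ∈ Xi by exact: mem_ole_trans le.
have laX : la ∈ Xi by case: le => // E; move: ll; rewrite E => /limit_osucc.
case: st hst => [n ts s p q|n ts s p q|n ts s p q|n f] hst.
- by split; [split; [left|]|].
- case: hst => [n0 [h1 h2 h3 h4 h5]].
  rewrite /m /lmach; cbn [li lli]; case: asboolP => [[y E]|_]; last first.
    split; [split; first by left|by []].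
    by case: (pol) => //; exact: wf_FOr.
  subst z; rewrite !opredK.
  have yX : y ∈ Xi.
    by apply: ord_trans zX => //; apply: osucc_memW; exact: osucc_mem.
  have hF : wf_fo mu Par n (Fright b mu xi mu y la n.-1).
    apply: wf_Fat; first by right; right; right; right; left.
    move=> it /= [<-|[<-|[<-|//]]]; [exact: V_code|exact: V_code|by rewrite /= prednK].
  have hs := V_path yX h3.
  case: (pol); split=> //; (split; first by left); split=> //.
    by apply: wf_FOr => //; apply: wf_FAnd => //; exact: wf_FNot.
  exact: wf_FAnd.
- by split; [split; [left|]|].
- by split; [split; [left|]|].
Qed.

(** By [ev_lift] the truth of the game of level [xi] for [X0] is a Pi sentence of level [osucc xi],
    to which the indescribability of [mu] applies. Closure under [h], unbounded test points and the
    membership of [x0] are attached to every leaf. *)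
Lemma lifted_reflect : unbD mu X0 -> gm_at (fun ze => elts ze) mu X0 ->
  exists be, [/\ be ∈ mu, cumV be x0, is_regular be, clos h be &
    unbD be X0 /\ gm_at (fun ze => canF b mu ze be) be (X0 `&` cumV be)].
Proof.
move=> hunb hgm; pose st0 := LPlay 0 [:: Par2 X0] [:: xi] (FNot FFalse) FFalse.
have hx : V (lst [seq c i | i <- [:: xi]]).
  by apply: (@V_path xi [::]); [exact: osucc_mem|exact: cumV_zero].
have inv0 : inv Xi true st0.
  split; first by right.
  split=> //; [by move=> t [<-|//]; do 5 right|exact/wf_FNot/wf_FFalse|exact: wf_FFalse].
have I1 pol st : inv ozero pol st -> [/\ formula_over mu (FO (leaf pol st)),
    fo_fv1 (leaf pol st) = set0, (forall v, fo_fv2 (leaf pol st) v -> v < nvar st) &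
    fo_par2 (leaf pol st) `<=` Par].
  move=> /lift_leaf hw.
  by split; [exact: wf_formula_over hw|exact: wf_fv1 hw|exact: wf_fv2 hw|exact: wf_par2 hw].
have fP : finite_set Par by apply: upar_finite; exact: finite_set1.
have hPi := sk_Pi fP I1 lift_nx lift_li oXi inv0.
have [hf1 hf2 hf3] := sk_free I1 lift_nx lift_li oXi inv0.
set phi := sk m _ Xi true st0 in hPi hf1 hf2 hf3.
have hS : sentence phi by split=> //; rewrite -subset0 => v /hf2.
have e0M M : envM M (fun=> set0) by move=> n x [].
have sT e1 e M : fo_sat M e1 e (fo_cap_par2 M (FNot FFalse)) by move=> /sat_FFalse.
have nF e1 e M : ~ fo_sat M e1 e (fo_cap_par2 M FFalse) by move=> /sat_FFalse.
have main be O D : frame b mu Xi be O D -> D xi -> inacc be -> cumV be `<=` V ->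
    ev m O (cumV be) (fun pol st e => fo_sat (cumV be) (fun=> ozero) e
      (fo_cap_par2 (cumV be) (lleaf pol st))) Xi true st0 (fun=> set0) <->
    gm_at O be (X0 `&` cumV be).
  move=> fr Dxi ib bV; rewrite (@ev_lift b mu xi mu be O D fr hb rmu lXi ib bV (fun=> ozero) xi true) //.
  - split=> [[[hg _]|/nF//]|hg]; first exact: hg.
    by left; split=> //; exact: sT.
  - by move=> t v [<-|//].
  - by move=> z; rewrite inE => /eqP->.
have hM : models mu phi.
  rewrite /models -(@sat_cap_id mu); last by move=> A /hf3/ParV.
  rewrite sat_cap_sk //.
  have A0 e : envM V e -> fo_sat V (fun=> ozero) e (fo_cap_par2 V a0).
    move=> he; rewrite cap_FAnd sat_FAnd cap_FAnd sat_FAnd sat_Fis (sat_Rclos _ _ _ lmu) //.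
    split; first by move=> x /(clos_unbounded imu hm).
    split=> //; apply/(sat_Funb imu (@subset_refl _ _) _ _ he).
    by rewrite /tval /= setIidl.
  have hgm' : gm_at (fun ze => elts ze) mu (X0 `&` V) by rewrite setIidl.
  have hev := iffRL (main mu _ _ (frame_top b rmu lXi) (osucc_mem xi) imu (@subset_refl _ _)) hgm'.
  apply: (iffLR (@ev_ext _ m _ _ V _ _ Xi Xi true st0 (fun=> set0) oXi _ _ (or_intror erefl) (e0M _)) hev) => //.
  move=> pol st e he; rewrite /leaf cap_FAnd sat_FAnd.
  by split=> [[]//|h1]; split=> //; exact: A0.
have [_ _ hI] := ind; have [be [q [bem rbe hq _ hmq]]] := hI _ hPi hS hM.
have [_ lbe _] := rbe; have obe := limit_ord lbe.
have sub : cumV be `<=` V by apply: cumV_mono => //; left.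
move: hmq; rewrite /models (restr_sk omu hb bem (fun=> ozero) rmu lXi (e0M _) hq) => hev.
have hinh := canF_inh bem lbe.
have hbe : clos h be.
  apply: (ev_leaf_imp oXi hinh _ (e0M _) hev) => pol st e he.
  rewrite /leaf cap_FAnd sat_FAnd cap_FAnd sat_FAnd (sat_Rclos _ _ _ lbe) // => -[[h1 _] _].
  by apply: clos_limit => // x /h1.
have [gbe ibe] := hgood bem hbe; have {}ibe := ibe rbe.
have [hu hx0] : unbD be (X0 `&` cumV be) /\ cumV be x0.
  apply: (ev_leaf_imp oXi hinh _ (e0M _) hev) => pol st e he.
  rewrite /leaf !cap_FAnd !sat_FAnd sat_Fis => -[[_ [h1 h2]] _]; split=> //.
  by move: h1; rewrite (sat_Funb ibe sub _ _ he).
exists be; split=> //; split.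
  by move=> e /hu[e' [h1 h2 [h3 _]]]; exists e'.
apply/(main be _ _ (frame_good hb rmu lXi bem gbe)) => //; first exact: dom_xi.
apply: (iffLR (@ev_ext _ m _ _ (cumV be) _ _ Xi Xi true st0 (fun=> set0) oXi _ _ (or_intror erefl) (e0M _)) hev) => //.
move=> pol st e he; rewrite /leaf cap_FAnd sat_FAnd.
split=> [h2|[]//]; split=> //.
rewrite !cap_FAnd !sat_FAnd sat_Fis (sat_Rclos _ _ _ lbe) //; split.
  by move=> x bx; apply: (clos_unbounded ibe) => //; exact: clos_maps.
by split=> //; apply/(sat_Funb ibe sub _ _ he).
Qed.

End Lifted.

Definition reflects g X := exists be, [/\ be ∈ g, is_regular be, clos h be, unbD be X &
  gm_at (fun ze => canF b mu ze be) be (X `&` cumV be)].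

(** Truth of the game at [g] is second-order over V_g, but over V_mu it is a relation on traces and
    enters as a parameter. Thus the conclusion that [X] reflects costs no second-order
    quantifier. *)
Definition Rrefl (g : zfset) (vs : seq zfset) : Prop := exists x, [/\ vs = [:: x], is_regular g,
  clos h g, unbD g (elts x) & gm_at (fun ze => canF b mu ze g) g (elts x)].

Section Universal.
Variable C : set zfset.
Hypothesis clubC : club mu C.

Let E g := clos h g /\ C g.
Let PC := codeR (Rclos E) `&` V.
Let PR := codeR Rrefl `&` V.
Let Par := upar PC [set PR].
Let a0 := Fat PC [::].
Let b0 t := FOr (FNot (Funb mu t)) (Fat PR [:: IS t]).
(** The dual of the universal game, with the disjunct that [X] has bounded test points or reflects
    carried to the leaves as in [gm_dual]. The conjunct [a0] takes care of the clubs. *)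
Let leaf (pol : bool) (st : ustate) :=
  FAnd a0 (FOr (FNot (uleaf c mu (~~ pol) st.2 st.1.2)) (b0 (head (Par2 set0) st.1.2))).

Let inv ze (pol : bool) (st : ustate) := [/\ ole ze Xi,
  forall t, List.In t st.1.2 -> wf_item mu Par st.1.1 (IS t),
  ze = Xi \/ st.1.2 <> [::] & V (lst (map c st.2))].

Let nvar (st : ustate) := st.1.1.

Let ParV A : Par A -> A `<=` V.
Proof. by apply: upar_V => [x []//|Q ->] x []. Qed.

Let univ_leaf pol st : inv ozero pol st -> wf_fo mu Par (nvar st) (leaf pol st).
Proof.
case: st => [[n ts] s] [_ /= h1 h2 h3]; have {h2} hts : ts <> [::].
  by case: h2 => // /esym/osucc_neq0.
rewrite /nvar /leaf; cbn [fst snd].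
have hhd : wf_item mu Par n (IS (head (Par2 set0) ts)).
  by apply: h1; case: ts hts => // t ts _; left.
apply: wf_FAnd; first by apply: wf_Fat => //; left.
apply: wf_FOr.
  apply: wf_FNot; apply: wf_uleaf => //; [by right; left|by right; right; left|].
  by right; right; right; left.
apply: wf_FOr; last by apply: wf_Fat => [|it [<-|//]]; [do 5 right|].
by apply: wf_FNot; apply: wf_Fat => [|it [<-|//]]; [right; left|].
Qed.

Let univ_nx pol d st : inv (osucc d) pol st ->
  inv d (~~ pol) (nx umach pol d st) /\
  (forall v, v < nvar (nx umach pol d st) -> v < nvar st \/ v \in ns umach pol d st).
Proof.
case: st => [[n ts] s] [/= de h1 h2 h3].
have de' : d ∈ Xi by apply: mem_ole_trans de => //; exact: osucc_mem.
split; last by move=> v; rewrite /nvar /= ltnS leq_eqVlt inE => /orP[->|]; [right|left].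
split=> /=; [by left| |by right; exact: rcons_neq0|exact: V_path].
move=> t ht; case: (In_rcons ht) => [ht'|->]; last exact: ltnSn.
by have := @wf_item_mono mu Par n n.+1 (IS t) (leqnSn n) (h1 _ ht').
Qed.

Let univ_li pol la z st : is_limit la -> z ∈ la -> inv la pol st ->
  inv z pol (li umach pol la z st) /\ nvar (li umach pol la z st) <= nvar st.
Proof.
case: st => [[n ts] s] ll zl [/= le h1 h2 h3]; have zX : z ∈ Xi by exact: mem_ole_trans le.
split=> //; split=> //=; [by left| |exact: V_path].
by right; case: h2 => // E'; move: ll; rewrite E' => /limit_osucc.
Qed.

Lemma universal_reflect : exists al, [/\ C al, is_regular al, clos h al &
  forall X, X `<=` cumV al -> unbD al X -> gm_at (fun ze => canF b mu ze al) al X -> reflects al X].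
Proof.
(* The first block, at level [osucc xi], quantifies [X] and puts [xi] on the path, so every leaf
   sees at least one move. *)
pose st0 : ustate := (0, [::], [::]).
have inv0 : inv Xi true st0.
  by split=> //; [right|left|exact: cumV_zero].
have I1 pol st : inv ozero pol st -> [/\ formula_over mu (FO (leaf pol st)),
    fo_fv1 (leaf pol st) = set0, (forall v, fo_fv2 (leaf pol st) v -> v < nvar st) &
    fo_par2 (leaf pol st) `<=` Par].
  move=> /univ_leaf hw.
  by split; [exact: wf_formula_over hw|exact: wf_fv1 hw|exact: wf_fv2 hw|exact: wf_par2 hw].
have fP : finite_set Par by apply: upar_finite; exact: finite_set1.
have hPi := sk_Pi fP I1 univ_nx univ_li oXi inv0.
have [hf1 hf2 hf3] := sk_free I1 univ_nx univ_li oXi inv0.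
set phi := sk umach _ Xi true st0 in hPi hf1 hf2 hf3.
have hS : sentence phi by split=> //; rewrite -subset0 => v /hf2.
have e0M M : envM M (fun=> set0) by move=> n x [].
pose R be X := forall x, cumV be x -> exists g, [/\ g ∈ be, cumV g x & Rrefl g [:: zset (X `&` cumV g)]].
have main be O D : frame b mu Xi be O D -> D xi -> inacc be -> cumV be `<=` V ->
    (forall e, envM (cumV be) e -> fo_sat (cumV be) (fun=> ozero) e (fo_cap_par2 (cumV be) a0)) ->
    ev umach O (cumV be) (fun pol st e => fo_sat (cumV be) (fun=> ozero) e
      (fo_cap_par2 (cumV be) (leaf pol st))) Xi true st0 (fun=> set0) <->
    forall X, X `<=` cumV be -> unbD be X -> gm_at O be X -> R be X.
  move=> fr Dxi ib bV A0; have lb := inacc_limit ib.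
  pose B X := ~ unbD be X \/ R be X.
  pose W' pol (p : seq zfset) Z := ~ Wsem c be (~~ pol) p Z \/ B (head set0 Z).
  have hW pol n ts p e : envM (cumV be) e -> tvars n ts -> (forall z, z \in p -> D z) -> ts <> [::] ->
      fo_sat (cumV be) (fun=> ozero) e (fo_cap_par2 (cumV be) (leaf pol (n, ts, p))) <->
      W' pol p (map (tval be e) ts).
    move=> he hn hp hts; rewrite /leaf; cbn [fst snd].
    rewrite cap_FAnd sat_FAnd /b0 !FOr_cap !sat_FOr !cap_FNot !sat_FNot.
    rewrite sat_uleaf //; last exact: (inD_lst fr ib hp).
    rewrite (sat_Funb ib bV _ _ he) (@sat_cap_Fat _ _ mu be Rrefl) //; last by move=> i [].
    rewrite /W' /B; have -> : head set0 [seq tval be e i | i <- ts] = tval be e (head (Par2 set0) ts).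
      by case: (ts) hts.
    set t := head (Par2 set0) ts; set X := tval be e t.
    have E' : atR Rrefl [:: IS t] be e <-> R be X.
      split=> H x bx; have [g [gb gx hg]] := H x bx; exists g; split=> //;
        have EE : ival (Vz g) e (IS t) = zset (X `&` cumV g).
      + by rewrite -[LHS]zset_eltsK (@ival_elts be) //; exact: limit_ord.
      + by rewrite -EE.
      + by rewrite -[LHS]zset_eltsK (@ival_elts be) //; exact: limit_ord.
      + by rewrite -[map _ _]/[:: ival (Vz g) e (IS t)] EE.
    by rewrite E'; split=> [[]//|H]; split=> //; exact: A0.
  rewrite evS /=.
  have key X : X `<=` cumV be ->
    ev umach O (cumV be) (fun pol st e => fo_sat (cumV be) (fun=> ozero) e
      (fo_cap_par2 (cumV be) (leaf pol st))) xi false (1, [:: Var2 0], [:: xi]) (upd (fun=> set0) 0 X) <->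
    (unbD be X -> gm_at O be X -> R be X).
    move=> XV; rewrite (ev_umach fr hW) //.
    - have -> : [seq tval be (upd (fun=> set0) 0 X) i | i <- [:: Var2 0]] = [:: X].
        by rewrite /= /tval /= /upd /=.
      rewrite (@gm_dual _ _ _ _ _ _ fr (Wsem c be) W' X (B X)) // /gm_at /B /=; split.
        by case=> [h1 _ h2|[h1 h2|//]]; [case: (h1 h2)|case: (h1 h2)].
      move=> H; have [hu|hu] := pselect (unbD be X); last by right; left.
      by have [hg|hg] := pselect (gm O (cumV be) (Wsem c be) xi true [:: xi] [:: X]);
        [right; right; exact: H|left].
    - by move=> t v [<-|//] /= ->.
    - by move=> z; rewrite inE => /eqP->.
    - exact: envM_upd.
  by split=> H X XV; apply/key => //; exact: H.
have hM : models mu phi.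
  rewrite /models -(@sat_cap_id mu); last by move=> A /hf3/ParV.
  rewrite sat_cap_sk //.
  apply/(main mu _ _ (frame_top b rmu lXi) (osucc_mem xi) imu) => //.
    move=> e he; rewrite (sat_Rclos _ _ _ lmu) // => x bx.
    have A := almostI lmu (almost_clos hm) (club_almost lmu clubC).
    by have [g [h1 h2 _ h3]] := almost_unbounded imu A bx; exists g.
  (* At [mu] the statement is true: [lifted_reflect] gives points of reflection above any [x]. *)
  move=> X XV hu hg x bx.
  have [be [bem bx' rbe hbe [hu' hg']]] := lifted_reflect XV bx hu hg.
  exists be; split=> //; exists (zset (X `&` cumV be)).
  have EE : elts (zset (X `&` cumV be)) = X `&` cumV be by exact: cut_elts.
  rewrite EE; split=> //; move=> e /hu'[e' [h1 h2 h3]]; exists e'; split=> //; split=> //.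
  have [_ lbe _] := rbe; apply/(cumV_pr _ _ lbe); split; first exact: cumV_ztag.
  by apply: cumV_ordW => //; apply: is_ordinal_in h1; exact: limit_ord.
have [_ _ hI] := ind; have [al [q [alm ral hq _ hmq]]] := hI _ hPi hS hM.
have [_ lal _] := ral; have oal := limit_ord lal.
have sub : cumV al `<=` V by apply: cumV_mono => //; left.
move: hmq; rewrite /models (restr_sk omu hb alm (fun=> ozero) rmu lXi (e0M _) hq) => hev.
have hinh := canF_inh alm lal.
have hE : forall x, cumV al x -> exists g, [/\ g ∈ al, cumV g x & E g].
  apply: (ev_leaf_imp oXi hinh _ (e0M _) hev) => pol st e he.
  by rewrite /leaf cap_FAnd sat_FAnd (sat_Rclos _ _ _ lal) // => -[].
have hal : clos h al by apply: clos_limit => // x /hE[g [h1 h2 [h3 _]]]; exists g.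
have [gal ial] := hgood alm hal; have {}ial := ial ral.
exists al; split=> //.
  have [_ _ hC] := clubC; apply: hC => // e ea; have oe := is_ordinal_in oal ea.
  have [g [ga /(cumV_ord (is_ordinal_in oal ga) oe) ge [_ Cg]]] := hE _ (cumV_ordW ea oe).
  by exists g.
have A0 e : envM (cumV al) e -> fo_sat (cumV al) (fun=> ozero) e (fo_cap_par2 (cumV al) a0).
  by move=> he; rewrite (sat_Rclos _ _ _ lal).
move=> X XV hu hg.
have := iffLR (main al _ _ (frame_good hb rmu lXi alm gal) (dom_xi al) ial sub A0) hev X XV hu hg.
move=> /(_ _ (cumV_zero lal))[g [ga _ [x [[<-] rg hgg]]]].
rewrite cut_elts => hu' hg'; exists g; split=> //.
by move=> e /hu'[e' [h1 h2 [h3 _]]]; exists e'.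
Qed.

End Universal.
End Reflection.

(** * Honest moves *)

(* The section at tag 0 of a move codes a relation, the section at tag 1 is the set of test points
   it offers, and the sections at tags i + 2 are the values of a block of quantifiers. *)
Definition dec (Y : set zfset) : nat -> set zfset := fun i => sec (ztag i.+2) Y.
Definition capV (d : zfset) (Y : set zfset) := Y `&` cumV d.

Lemma dec_cap d Y : is_limit d -> dec (capV d Y) = fun i => capV d (dec Y i).
Proof.
move=> ld; apply/funext => i; apply/seteqP; split=> x.
  by move=> [h1 /(cumV_pr _ _ ld)[_ h2]].
by move=> [h1 h2]; split=> //; apply/(cumV_pr _ _ ld); split=> //; exact: cumV_ztag.
Qed.

Lemma gm_map O M T (f : set zfset -> T) W :
  (forall pol s Z Z', map f Z = map f Z' -> W pol s Z -> W pol s Z') ->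
  forall ze pol s Z Z', is_ordinal ze -> map f Z = map f Z' ->
  gm O M W ze pol s Z -> gm O M W ze pol s Z'.
Proof.
move=> hW ze pol s Z Z' oz; elim/ord_ind: ze / oz pol s Z Z' => [|d od IH|la ll IH] pol s Z Z' hZ.
- by rewrite !gm0; exact: hW.
- have hY Y : map f (rcons Z Y) = map f (rcons Z' Y) by rewrite !map_rcons hZ.
  rewrite !gmS; case: pol => [h Y YM|[Y YM h]]; first by apply: IH (hY Y) (h Y YM).
  by exists Y => //; apply: IH (hY Y) h.
case: pol; rewrite ?(gmLt _ _ _ _ _ ll) ?(gmLf _ _ _ _ _ ll).
  by move=> h z zl Oz; apply: IH (h z zl Oz).
by move=> [z [zl Oz h]]; exists z; split=> //; apply: IH h.
Qed.

Lemma unbD_almost be X : inacc be -> unbD be X -> almost be (fun g => unbD g X).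
Proof.
move=> ib h; apply: almost_diag_ord; first exact: inacc_limit.
move=> e0 e0b; have [e' [h1 h2 h3]] := h e0 e0b.
by apply: almost_mono (almost_const h1) => g _ _ h'; exists e'.
Qed.

Section Honest.
Variables (b : zfset -> zfset -> zfset -> zfset) (mu Xi be : zfset).
Variables (O : zfset -> set zfset) (D : set zfset) (fr : frame b mu Xi be O D).
Hypothesis ibe : inacc be.
Let lbe : is_limit be. Proof. exact: inacc_limit. Qed.
Let obe : is_ordinal be. Proof. exact: limit_ord. Qed.
Notation c := (code b mu Xi).
Notation M := (cumV be).
Notation inD s := (forall z, z \in s -> D z).
Variable Tr : zfset -> seq zfset -> seq (nat -> set zfset) -> Prop.
Variable X : set zfset.

Definition agree (d : zfset) (Ys : seq (set zfset)) := forall s, inD s -> cumV d (lst (map c s)) ->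
  (Tr d s (map dec (map (capV d) Ys)) <-> Tr be s (map dec Ys)).

Hypothesis agreeP : forall Ys, (forall Y, Y \in Ys -> Y `<=` M) -> almost be (agree^~ Ys).
Hypothesis codesX : forall d s Ys, d ∈ be -> is_limit d -> inD s -> cumV d (lst (map c s)) ->
  X (pr (ztag 0) (tup d (lst (map c s)) Ys)) <-> Tr d s (map dec (map (capV d) Ys)).

Definition honest Ys := unbD be (last X Ys) /\
  forall d, d ∈ be -> is_limit d -> unbD d (last X Ys) -> agree d Ys.

Lemma agree_dec d Ys Ys' : is_limit d -> map dec Ys = map dec Ys' -> agree d Ys -> agree d Ys'.
Proof.
move=> ld E h s hs hp; rewrite -E -(h s hs hp).
have H Zs : map dec (map (capV d) Zs) = map (fun f i => capV d (f i)) (map dec Zs).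
  by rewrite -!map_comp; apply: eq_map => Y /=; exact: dec_cap.
by rewrite !H E.
Qed.

(** Only the section at tag 1 is exchanged, for the closure points of a function that witnesses
    agreement. The quantified values do not change, and a limit of the new test points is again a
    closure point. *)
Lemma honest_move Ys Y : (forall Y, Y \in Ys -> Y `<=` M) -> Y `<=` M ->
  exists Y', [/\ Y' `<=` M, map dec (rcons Ys Y) = map dec (rcons Ys Y'),
    sec (ztag 0) Y' = sec (ztag 0) Y & honest (rcons Ys Y')].
Proof.
move=> hYs hY; have [h hm hag] : almost be (agree^~ (rcons Ys Y)).
  by apply: agreeP => Y'; rewrite mem_rcons in_cons => /orP[/eqP->|/hYs].
pose Y' := [set x | (Y x /\ forall a, x <> pr (ztag 1) a) \/
  exists e, [/\ x = pr (ztag 1) e, e ∈ be & clos h e]].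
have dY i : i <> 1 -> sec (ztag i) Y' = sec (ztag i) Y.
  move=> i1; apply/seteqP; split=> x; first by case=> [[]|[e [/pr_inj[/ztag_inj]]]].
  by move=> hx; left; split=> // a /pr_inj[/ztag_inj].
have E : map dec (rcons Ys Y) = map dec (rcons Ys Y').
  by rewrite !map_rcons; congr rcons; apply/funext => i; rewrite /dec dY.
have cY e : sec (ztag 1) Y' e -> e ∈ be /\ clos h e.
  by case=> [[_ /(_ e)]//|[e' [/pr_inj[_ ->]]]].
exists Y'; split=> //.
- move=> x [[/hY]//|[e [-> eb _]]]; apply/(cumV_pr _ _ lbe); split; first exact: cumV_ztag.
  by apply: cumV_ordW => //; exact: is_ordinal_in eb.
- exact: dY.
split; rewrite last_rcons.
  move=> e eb; have oe := is_ordinal_in obe eb.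
  have [g [gb /(cumV_ord (is_ordinal_in obe gb) oe) eg hg]] := clos_unbounded ibe hm (cumV_ordW eb oe).
  by exists g; split=> //; right; exists g.
move=> d db ld hd; apply: (agree_dec ld E); apply: hag => //.
apply: clos_limit => // x /(cumV_limit ld)[e ed ex].
have [e' [e'd ee' /cY[_ he']]] := hd e ed; exists e'; split=> //.
by apply: cumV_mono ex => //; [apply: is_ordinal_in e'd; exact: limit_ord|left].
Qed.

Lemma inD_path s : inD s -> M (lst (map c s)).
Proof. by move=> h; apply/(cumV_lst _ lbe) => a /mapP[z /h/(fr_code fr)[_ hz] ->]. Qed.

(** The limits of an unbounded set of offered points contain a club, which meets the club of points
    of agreement. *)
Lemma test_point s Ys : inD s -> (forall Y, Y \in Ys -> Y `<=` M) -> unbD be (last X Ys) ->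
  exists d, [/\ d ∈ be, is_limit d, cumV d (lst (map c s)), unbD d (last X Ys) &
    X (pr (ztag 0) (tup d (lst (map c s)) Ys)) <-> Tr be s (map dec Ys)].
Proof.
move=> hs hYs hu; have A := almostI lbe (unbD_almost ibe hu) (agreeP hYs).
have [d [db hp ld [h1 h2]]] := almost_unbounded ibe A (inD_path hs).
by exists d; split=> //; rewrite codesX //; exact: h2.
Qed.

Definition WT (pol : bool) (s : seq zfset) (Z : seq (set zfset)) := Tr be s (map dec (behead Z)).

Definition dir (pol : bool) (P Q : Prop) := if pol then P -> Q else Q -> P.

Lemma Wsem_dir pol s Ys : inD s -> (forall Y, Y \in Ys -> Y `<=` M) ->
  dir pol (Wsem c be pol s (X :: Ys)) (WT pol s (X :: Ys)) /\
  (honest Ys -> dir (~~ pol) (Wsem c be pol s (X :: Ys)) (WT pol s (X :: Ys))).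
Proof.
move=> hs hYs; rewrite /WT /Wsem /=.
have hX d : d ∈ be -> is_limit d -> cumV d (lst (map c s)) -> unbD d (last X Ys) -> honest Ys ->
    X (pr (ztag 0) (tup d (lst (map c s)) Ys)) <-> Tr be s (map dec Ys).
  by move=> db ld hp hd [_ hh]; rewrite codesX //; exact: (hh d db ld hd s hs hp).
case: pol => /=; split.
- move=> [hu hc]; apply: contrapT => nT; apply: hc.
  by have [d [h1 h2 h3 h4 h5]] := test_point hs hYs hu; exists d; split=> //; rewrite h5.
- move=> hh hT; split; first by case: hh.
  by move=> [d [h1 h2 h3 h4 h5]]; apply/h5/(hX d h1 h2 h3 h4 hh).
- move=> hT; have [hu|hu] := pselect (unbD be (last X Ys)); [right|by left].
  by have [d [h1 h2 h3 h4 h5]] := test_point hs hYs hu; exists d; split=> //; rewrite h5.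
move=> hh [h|[d [h1 h2 h3 h4 h5]]]; first by case: h; case: hh.
by apply/(hX d h1 h2 h3 h4 hh)/h5.
Qed.

Lemma gm_WT_dec ze pol s Ys Ys' : is_ordinal ze -> map dec Ys = map dec Ys' ->
  gm O M WT ze pol s (X :: Ys) -> gm O M WT ze pol s (X :: Ys').
Proof.
move=> oz E; apply: (@gm_map _ _ _ dec) => //=; last by rewrite E.
by move=> pol' s' [|Z0 Z] [|Z0' Z'] //= [_]; rewrite /WT /= => ->.
Qed.

(* The value of the universal game differs from the truth WT only to the disadvantage of the
   player who moved last, and not at all if he offered a club of points of agreement. *)
Lemma gm_honest ze pol s Ys : D ze -> inD s -> (forall Y, Y \in Ys -> Y `<=` M) ->
  dir pol (gm O M (Wsem c be) ze pol s (X :: Ys)) (gm O M WT ze pol s (X :: Ys)) /\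
  (honest Ys -> dir (~~ pol) (gm O M (Wsem c be) ze pol s (X :: Ys)) (gm O M WT ze pol s (X :: Ys))).
Proof.
move=> Dz; have oz := fr_ord fr Dz.
elim/ord_ind: ze / oz Dz pol s Ys => [|d od IH|la ll IH] Dz pol s Ys hs hYs.
- by have := Wsem_dir pol hs hYs; case: pol => /=; rewrite !gm0.
- have Dd := fr_succ fr Dz; have hs' : inD (d :: s) by exact: inD_cons.
  have hYs' Y : Y `<=` M -> forall Y', Y' \in rcons Ys Y -> Y' `<=` M.
    by move=> YM Y'; rewrite mem_rcons in_cons => /orP[/eqP->|/hYs].
  have IHd pol' Y YM := IH Dd pol' (d :: s) (rcons Ys Y) hs' (hYs' Y YM).
  case: pol => /=; rewrite !gmS /=; split.
  (* A move is replaced by an honest one with the same quantified values, which are all that truth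
     depends on ([gm_WT_dec]). *)
  + move=> h Y YM; have [Y' [Y'M E _ hh]] := honest_move hYs YM.
    apply: (@gm_WT_dec _ _ _ _ _ od (esym E)).
    by have [_ /(_ hh) H] := IHd false Y' Y'M; apply: H; exact: h.
  + move=> _ h Y YM; have [H _] := IHd false Y YM; apply: H; exact: h.
  + move=> [Y YM h]; have [Y' [Y'M E _ hh]] := honest_move hYs YM.
    exists Y' => //; have [_ /(_ hh) H] := IHd true Y' Y'M; apply: H.
    exact: (@gm_WT_dec _ _ _ _ _ od E h).
  + by move=> _ [Y YM h]; exists Y => //; have [H _] := IHd true Y YM; apply: H.
have Dl z : z ∈ la -> O la z -> D z by exact: (fr_lim fr Dz ll).
have IHz pol' z zl Oz := IH z zl (Dl z zl Oz) pol' (z :: s) Ys (inD_cons (Dl z zl Oz) hs) hYs.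
case: pol => /=; rewrite ?(gmLt _ _ _ _ _ ll) ?(gmLf _ _ _ _ _ ll); split.
- by move=> h z zl Oz; have [H _] := IHz true z zl Oz; apply: H; exact: h.
- by move=> hh h z zl Oz; have [_ /(_ hh) H] := IHz true z zl Oz; apply: H; exact: h.
- by move=> [z [zl Oz h]]; exists z; split=> //; have [H _] := IHz false z zl Oz; apply: H.
by move=> hh [z [zl Oz h]]; exists z; split=> //; have [_ /(_ hh) H] := IHz false z zl Oz; apply: H.
Qed.

End Honest.

(** * Games for arbitrary formulas *)

HB.instance Definition _ := gen_eqMixin formula.
HB.instance Definition _ := gen_choiceMixin formula.

(** * Elementary levels *)

Section Elementary.
Variable k : zfset.
Hypothesis ik : inacc k.
Let lk : is_limit k. Proof. exact: inacc_limit. Qed.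
Let ok : is_ordinal k. Proof. exact: limit_ord. Qed.
Variable e2 : env.

Definition elementary r d := fo_par1 r `<=` cumV d /\
  forall e1, (forall v, cumV d (e1 v)) ->
  (fo_sat (cumV d) e1 (fun v => capV d (e2 v)) (fo_cap_par2 (cumV d) r) <->
   fo_sat (cumV k) e1 e2 (fo_cap_par2 (cumV k) r)).

Lemma term1_almost s : term1_par s `<=` cumV k -> almost k (fun d => term1_par s `<=` cumV d).
Proof.
case: s => [v|a] h; first by apply: almost_all => // d _ _ x [].
by apply: almost_mono (almost_constV lk (h a erefl)) => d _ _ hd x ->.
Qed.

Fixpoint fo_bound (r : fo_formula) : nat :=
  let t1 t := if t is Var1 n then n.+1 else 0 in
  match r with
  | FMem s t | FEq s t => maxn (t1 s) (t1 t)
  | FIn s _ => t1 s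
  | FNot q => fo_bound q
  | FAnd q r => maxn (fo_bound q) (fo_bound r)
  | FAll n q => fo_bound q
  end.

Lemma fo_boundP r v : fo_fv1 r v -> v < fo_bound r.
Proof.
elim: r => //= [s t|s t|s t|q IHq r IHr|n q IH].
- by case: s t => [n|a] [m|a'] /= [] // ->; rewrite leq_max ltnSn ?orbT.
- by case: s t => [n|a] [m|a'] /= [] // ->; rewrite leq_max ltnSn ?orbT.
- by case: s => [n|a] //= ->.
- by rewrite leq_max => -[/IHq ->|/IHr ->]; rewrite ?orbT.
- by case=> /IH.
Qed.

(* Loewenheim-Skolem: the Skolem functions of r are coded by a function of finite tuples. *)
Lemma almost_elementary r : fo_par1 r `<=` cumV k -> almost k (elementary r).
Proof.
elim: r => [s t|s t|s t|q IH|q IHq r IHr|n q IH] hp.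
- have hs : term1_par s `<=` cumV k by move=> x hx; apply: hp; left.
  have ht : term1_par t `<=` cumV k by move=> x hx; apply: hp; right.
  apply: almost_mono (almostI lk (term1_almost hs) (term1_almost ht)) => d _ _ [h1 h2].
  by split=> [x [/h1|/h2]|].
- have hs : term1_par s `<=` cumV k by move=> x hx; apply: hp; left.
  have ht : term1_par t `<=` cumV k by move=> x hx; apply: hp; right.
  apply: almost_mono (almostI lk (term1_almost hs) (term1_almost ht)) => d _ _ [h1 h2].
  by split=> [x [/h1|/h2]|].
- apply: almost_mono (term1_almost hp) => d dk ld hd; split=> // e1 he1.
  have hv : cumV d (term1_val e1 s) by case: s hd {hp} => [v|a] hd //=; exact: hd.
  have hv' : cumV k (term1_val e1 s) by apply: cumV_mono hv => //; left.
  case: t {hp} => [v|A] /=; first by split=> [[]//|h]; split.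
  by split=> -[h _]; split.
- apply: almost_mono (IH hp) => d _ _ [h1 h2]; split=> // e1 he1 /=.
  by split=> h /(h2 e1 he1).
- have hq : fo_par1 q `<=` cumV k by move=> x hx; apply: hp; left.
  have hr : fo_par1 r `<=` cumV k by move=> x hx; apply: hp; right.
  apply: almost_mono (almostI lk (IHq hq) (IHr hr)) => d _ _ [[h1 h2] [h3 h4]].
  split=> [x [/h1|/h3]//|e1 he1] /=.
  by split=> -[/(h2 e1 he1) h5 /(h4 e1 he1) h6].
(* Only the variables below [N] matter, so a finite list of values, coded by an element of V_d,
   replaces the assignment. *)
pose N := maxn n.+1 (fo_bound q).
pose env_of l : nat -> zfset := fun v => nth ozero l v.
pose P l x := cumV k x /\ ~ fo_sat (cumV k) [eta env_of l with n |-> x] e2 (fo_cap_par2 (cumV k) q).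
have W : almost k (fun d => forall t, cumV d t -> forall l, t = lst l -> (exists x, P l x) ->
    exists2 x, cumV d x & P l x).
  apply: almost_diag => // t kt.
  have [[l [x [E hx]]]|h] := pselect (exists l x, t = lst l /\ P l x); last first.
    by apply: almost_all => // d _ _ l E [x hx]; case: h; exists l, x.
  apply: almost_mono (almost_constV lk (proj1 hx)) => d _ _ dx l' E' _.
  by exists x => //; rewrite (@lst_inj l' l) // -E -E'.
apply: almost_mono (almostI lk (IH hp) W) => d dk ld [[h1 h2] hW]; split=> // e1 he1 /=.
have sub : cumV d `<=` cumV k by apply: cumV_mono => //; left.
have upd1 x : cumV d x -> forall v, cumV d ([eta e1 with n |-> x] v).
  by move=> dx v /=; case: eqP.
split=> h x; last by move=> dx; apply/(h2 _ (upd1 x dx)); apply: h; exact: sub.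
move=> kx; apply: contrapT => hx.
pose l := map e1 (iota 0 N).
have dl : cumV d (lst l) by apply/(cumV_lst _ ld) => a /mapP[v _ ->].
have lE y : fo_sat (cumV k) [eta env_of l with n |-> y] e2 (fo_cap_par2 (cumV k) q) <->
    fo_sat (cumV k) [eta e1 with n |-> y] e2 (fo_cap_par2 (cumV k) q).
  apply: fo_sat_ext => // v; rewrite fo_cap_fv1 => /fo_boundP hv /=; case: eqP => // _.
  have vN : v < N by rewrite leq_max hv orbT.
  by rewrite /env_of /l (nth_map 0) ?size_iota // nth_iota.
have [|y dy [ky hy]] := hW _ dl l erefl.
  by exists x; split=> // /lE.
by apply: hy; apply/lE/(h2 _ (upd1 y dy)); exact: h.
Qed.

End Elementary.

(** * Arbitrary Pi and Sigma formulas *)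

Definition PiSig k (pol : bool) := if pol then is_Pi k else is_Sigma k.

Lemma PiSig_case k pol z p : PiSig k pol z p -> [\/
  z = ozero /\ exists2 r, p = FO r & formula_over k (FO r),
  exists d ns q, [/\ z = osucc d, p = foldr (quant pol) q ns & PiSig k (~~ pol) d q] |
  is_limit z /\ exists f, [/\ p = bigc pol z f, forall y, y ∈ z -> PiSig k pol y (f y),
    finite_set (fv2 p) & finite_set (par2 p)]].
Proof.
by case: pol => -[{}p h|d ns q h|{}z f h1 h2 h3 h4]; [constructor 1; split=> //; exists p
  |constructor 2; exists d, ns, q|constructor 3; split=> //; exists f
  |constructor 1; split=> //; exists p
  |constructor 2; exists d, ns, q|constructor 3; split=> //; exists f].
Qed.

Lemma PiSig_zero k pol p : PiSig k pol ozero p -> exists2 r, p = FO r & formula_over k (FO r).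
Proof.
by case/PiSig_case => [[_ //]|[d [ns [q [/esym/osucc_neq0]]]]|[[_ z0]]].
Qed.

Lemma PiSig_succ k pol d p : PiSig k pol (osucc d) p ->
  exists ns q, p = foldr (quant pol) q ns /\ PiSig k (~~ pol) d q.
Proof.
case/PiSig_case => [[/osucc_neq0//]|[d' [ns [q [/osucc_inj <- -> h]]]]|[/limit_osucc]//].
by exists ns, q.
Qed.

Lemma PiSig_limit k pol la p : is_limit la -> PiSig k pol la p ->
  exists f, [/\ p = bigc pol la f, forall y, y ∈ la -> PiSig k pol y (f y),
    finite_set (fv2 p) & finite_set (par2 p)].
Proof.
move=> ll /PiSig_case[[E]|[d' [ns [q [E]]]]|[_]//].
  by case: ll => _ /(_ E).
by move: ll; rewrite E => /limit_osucc.
Qed.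

Lemma PiSig_over k pol z p : PiSig k pol z p -> is_ordinal z -> formula_over k p.
Proof.
move=> h oz; elim/ord_ind: z / oz pol p h => [|d od IH|la ll IH] pol p.
- by move=> /PiSig_zero[r ->].
- move=> /PiSig_succ[ns [q [-> /IH[h1 h2]]]].
  by split; rewrite ?par1_quant ?par2_quant.
move=> /(PiSig_limit ll)[f [-> hf _ _]].
have H z : z ∈ la -> formula_over k (f z) by move=> zl; exact: IH (hf z zl).
by case: pol {hf}; split=> /= [x [z /H[h1 _] /h1]|A [z /H[_ h2] /h2]].
Qed.

Lemma par1_cap M p : par1 (cap_par2 M p) = par1 p.
Proof.
elim: p => [r|n p IH|n p IH|la f IH|la f IH] //=; first exact: fo_cap_par1.
  by apply: eq_bigcupr => z _; exact: IH.
by apply: eq_bigcupr => z _; exact: IH.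
Qed.

Lemma fv2_cap M p : fv2 (cap_par2 M p) = fv2 p.
Proof.
elim: p => [r|n p IH|n p IH|la f IH|la f IH] //=; rewrite ?IH //; first exact: fo_cap_fv2.
  by apply: eq_bigcupr => z _; exact: IH.
by apply: eq_bigcupr => z _; exact: IH.
Qed.

Lemma fo_par2_cap M r : fo_par2 (fo_cap_par2 M r) `<=` (fun A => A `&` M) @` fo_par2 r.
Proof.
elim: r => [s t|s t|s [n|A]|q IH|q IHq r IHr|n q IH] //= B.
- by move=> ->; exists A.
- by case=> [/IHq|/IHr] [A hA <-]; exists A => //; [left|right].
Qed.

Lemma par2_cap M p : par2 (cap_par2 M p) `<=` (fun A => A `&` M) @` par2 p.
Proof.
elim: p => [r|n p IH|n p IH|la f IH|la f IH] //=; first exact: fo_par2_cap.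
  by move=> B [z zl /IH[A hA <-]]; exists A => //; exists z.
by move=> B [z zl /IH[A hA <-]]; exists A => //; exists z.
Qed.

Lemma finite_cap M (P Q : set (set zfset)) : Q `<=` (fun A => A `&` M) @` P ->
  finite_set P -> finite_set Q.
Proof. by move=> h fP; apply: sub_finite_set h _; exact: finite_image. Qed.

Lemma PiSig_cap k a pol z p : is_ordinal z -> PiSig k pol z p -> par1 p `<=` cumV a ->
  PiSig a pol z (cap_par2 (cumV a) p).
Proof.
move=> oz; elim/ord_ind: z / oz pol p => [|d od IH|la ll IH] pol p.
- move=> /PiSig_zero[r -> _] hr; have H : formula_over a (cap_par2 (cumV a) (FO r)).
    split; first by rewrite par1_cap.
    by move=> A /par2_cap[B _ <-] x [].
  by case: pol; [exact: Pi_zero|exact: Sigma_zero].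
- move=> /PiSig_succ[ns [q [-> hq]]]; rewrite par1_quant cap_quant => /(IH _ _ hq).
  by case: (pol) => /= h; [exact: Pi_succ|exact: Sigma_succ].
move=> /(PiSig_limit ll)[f [-> hf f2 fp]] hp.
have H z : z ∈ la -> PiSig a pol z (cap_par2 (cumV a) (f z)).
  by move=> zl; apply: IH => //; [exact: hf|]; move=> x hx; apply: hp; case: (pol); exists z.
have f2' : finite_set (fv2 (cap_par2 (cumV a) (bigc pol la f))) by rewrite fv2_cap.
have fp' := finite_cap (@par2_cap (cumV a) (bigc pol la f)) fp.
by move: H f2' fp'; case: (pol) => /= H f2' fp'; [exact: Pi_limit|exact: Sigma_limit].
Qed.

(** Restriction leaves first-order parameters in place, so they have to lie in the smaller V_be. A
    formula of level below [k] branches only over elements of [k], and [zbounded] bounds its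
    parameters. *)
Lemma PiSig_par1 k pol z p : inacc k -> z ∈ k -> PiSig k pol z p ->
  exists2 g, g ∈ k & par1 p `<=` cumV g.
Proof.
move=> ik; have lk := inacc_limit ik; have ok := limit_ord lk.
move=> zk; have oz := is_ordinal_in ok zk.
elim/ord_ind: z / oz zk pol p => [|d od IH|la ll IH] zk pol p.
- move=> /PiSig_zero[r -> [hr _]]; move: hr => /= hr.
  have A : almost k (fun g => fo_par1 r `<=` cumV g).
    by apply: almost_mono (@almost_elementary k ik (fun=> set0) r hr) => g _ _ [].
  by have [g [gk _ _ hg]] := almost_unbounded ik A (cumV_zero lk); exists g.
- have dk : d ∈ k by apply: ord_trans zk => //; exact: osucc_mem.
  by move=> /PiSig_succ[ns [q [-> /(IH dk)[g gk hg]]]]; exists g => //; rewrite par1_quant.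
move=> /(PiSig_limit ll)[f [-> hf _ _]].
have /choice[g hg] : forall z, exists g, z ∈ la -> g ∈ k /\ par1 (f z) `<=` cumV g.
  move=> z; have [zl|nz] := pselect (z ∈ la); last by exists ozero.
  by have [g g1 g2] := IH z zl (ord_trans ok zl zk) pol _ (hf z zl); exists g.
have [_ _ bk] := ik; have [|e ek he] := bk la g (cumV_ordW zk (limit_ord ll)).
  by move=> z /hg[].
exists e => //; have oe := is_ordinal_in ok ek.
have H z : z ∈ la -> par1 (f z) `<=` cumV e.
  by move=> zl x hx; have [_ h] := hg z zl; apply: cumV_mono (h _ hx) => //; left; exact: he.
by case: pol {hf IH} => /= x [z /H h /h].
Qed.

Fixpoint upds (e : env) (l : seq nat) (f : nat -> set zfset) : env :=
  if l is n :: l' then upds (upd e n (f 0)) l' (fun i => f i.+1) else e.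

Lemma upds_cap d e l f :
  upds (fun v => capV d (e v)) l (fun i => capV d (f i)) = fun v => capV d (upds e l f v).
Proof.
elim: l e f => //= n l IH e f; rewrite -IH; congr upds.
by apply/funext => v; rewrite /upd /=; case: eqP.
Qed.

Lemma dec_onto k f : is_limit k -> (forall i, f i `<=` cumV k) -> exists2 Y, Y `<=` cumV k & dec Y = f.
Proof.
move=> lk hf; exists [set x | exists i a, x = pr (ztag i.+2) a /\ f i a].
  by move=> x [i [a [-> /hf ha]]]; apply/(cumV_pr _ _ lk); split=> //; exact: cumV_ztag.
apply/funext => i; apply/seteqP; split=> x; last by move=> h; exists i, x.
by move=> [j [a [/pr_inj[/ztag_inj[<-] <-]]]].
Qed.

Lemma dec_sub k Y i : is_limit k -> Y `<=` cumV k -> dec Y i `<=` cumV k.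
Proof. by move=> lk h x /h /(cumV_pr _ _ lk)[]. Qed.

(** A block of any length is a single move whose sections are the values of its variables. This is
    why the universal game has one move per successor level. *)
Lemma blk_dec k pol l e K : is_limit k -> blk (cumV k) pol l e K <->
  if pol then forall Y, Y `<=` cumV k -> K (upds e l (dec Y))
  else exists2 Y, Y `<=` cumV k & K (upds e l (dec Y)).
Proof.
move=> lk.
have H : blk (cumV k) pol l e K <->
    if pol then forall f, (forall i, f i `<=` cumV k) -> K (upds e l f)
    else exists2 f, (forall i, f i `<=` cumV k) & K (upds e l f).
  elim: l e => [|n l IH] e /=.
    case: pol; first by split=> [h f _ //|h]; apply: (h (fun=> set0)) => i x [].
    by split=> [h|[]//]; exists (fun=> set0) => // i x [].
  case: pol IH => IH; split.
  - by move=> h f hf; have /IH/(_ (fun i => f i.+1)) := h _ (hf 0); apply => i; exact: hf.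
  - move=> h X XM; apply/IH => f hf.
    by apply: (h (fun i => if i is j.+1 then f j else X)) => -[|i] //; exact: hf.
  - move=> [X XM /IH[f hf h]].
    by exists (fun i => if i is j.+1 then f j else X) => // -[|i] //; exact: hf.
  - by move=> [f hf h]; exists (f 0) => //; apply/IH; exists (fun i => f i.+1).
rewrite H; case: pol {H} => /=; split.
- by move=> h Y YM; apply: h => i; exact: dec_sub.
- by move=> h f hf; have [Y YM <-] := dec_onto lk hf; exact: h.
- by move=> [f hf]; have [Y YM <-] := dec_onto lk hf; exists Y.
- by move=> [Y YM h]; exists (dec Y) => // i; exact: dec_sub.
Qed.

Definition sub_at (p : formula) z := match p with BigAnd _ f | BigOr _ f => f z | _ => p end.

(** * Residual formulas along a path *)

Section Residual.
Variables (b : zfset -> zfset -> zfset -> zfset) (mu xi al : zfset) (phi : formula).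
Let Xi := osucc xi.
Notation c := (code b mu Xi).
Notation pi := (collapse (canF b mu xi al)).

(* The block of quantifiers of a formula of successor level is not unique. *)
Definition strip (pol : bool) d p : seq nat * formula :=
  xget ([::], p) [set q | p = foldr (quant pol) q.2 q.1 /\ PiSig al (~~ pol) d q.2].

Lemma stripP pol d p : PiSig al pol (osucc d) p ->
  p = foldr (quant pol) (strip pol d p).2 (strip pol d p).1 /\ PiSig al (~~ pol) d (strip pol d p).2.
Proof.
move=> /PiSig_succ[l [q h]]; rewrite /strip; case: xgetP => [[l' q'] _ //|/(_ (l, q))].
by case.
Qed.

(* The residual formula of phi after a play along the path s, with the player to move and the
   number of moves made; en gives the values of its variables. *)
Fixpoint tp (s : seq zfset) : bool * formula * nat :=
  if s is z :: s' then
    if s' is ze :: _ then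
      let: (pol, p, j) := tp s' in
      if `[< exists y, ze = osucc y >] then (~~ pol, (strip pol (pi (opred ze)) p).2, j.+1)
      else (pol, sub_at p (pi z), j)
    else (true, phi, 0)
  else (true, phi, 0).

Fixpoint en (s : seq zfset) (fs : seq (nat -> set zfset)) : env :=
  if s is z :: s' then
    if s' is ze :: _ then
      let: (pol, p, j) := tp s' in
      if `[< exists y, ze = osucc y >] then
        upds (en s' fs) (strip pol (pi (opred ze)) p).1 (nth (fun=> set0) fs j)
      else en s' fs
    else fun=> set0
  else fun=> set0.

Lemma tp_cons z ze s : tp (z :: ze :: s) =
  let: (pol, p, j) := tp (ze :: s) in
  if `[< exists y, ze = osucc y >] then (~~ pol, (strip pol (pi (opred ze)) p).2, j.+1)
  else (pol, sub_at p (pi z), j).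
Proof. by []. Qed.

Lemma en_cons z ze s fs : en (z :: ze :: s) fs =
  let: (pol, p, j) := tp (ze :: s) in
  if `[< exists y, ze = osucc y >] then
    upds (en (ze :: s) fs) (strip pol (pi (opred ze)) p).1 (nth (fun=> set0) fs j)
  else en (ze :: s) fs.
Proof. by []. Qed.

Lemma tp_succ d s pol p j : tp (osucc d :: s) = (pol, p, j) ->
  tp (d :: osucc d :: s) = (~~ pol, (strip pol (pi d) p).2, j.+1) /\
  forall fs, en (d :: osucc d :: s) fs =
    upds (en (osucc d :: s) fs) (strip pol (pi d) p).1 (nth (fun=> set0) fs j).
Proof.
move=> E; have A : `[< exists y, osucc d = osucc y >] by apply/asboolP; exists d.
by rewrite tp_cons E A opredK; split=> // fs; rewrite en_cons E A opredK.
Qed.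

Lemma tp_limit z la s pol p j : is_limit la -> tp (la :: s) = (pol, p, j) ->
  tp (z :: la :: s) = (pol, sub_at p (pi z), j) /\ forall fs, en (z :: la :: s) fs = en (la :: s) fs.
Proof.
move=> [_ _ lS] E; have A : `[< exists y, la = osucc y >] = false by apply/asboolF => -[y /lS].
by rewrite tp_cons E A; split=> // fs; rewrite en_cons E A.
Qed.

Lemma en_rcons s fs f : (tp s).2 <= size fs -> en s (rcons fs f) = en s fs.
Proof.
elim: s => // z [|ze s] IH; first by [].
rewrite tp_cons !en_cons; case E: (tp (ze :: s)) IH => [[pol p] j] IH.
case: asboolP => _; cbn [snd] => hj; last exact: IH.
by rewrite IH ?(ltnW hj) // nth_rcons hj.
Qed.

Lemma en_cap d s fs : en s (map (fun f i => capV d (f i)) fs) = fun v => capV d (en s fs v).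
Proof.
have E0 : (fun=> set0) = (fun v : nat => capV d set0).
  by apply/funext => v; rewrite /capV set0I.
elim: s => // z [|ze s] IH; first exact: E0.
rewrite !en_cons; case E: (tp (ze :: s)) => [[pol p] j].
case: asboolP => _; last exact: IH.
rewrite IH; have [hj|hj] := ltnP j (size fs); last first.
  rewrite !nth_default ?size_map // {1}E0; exact: (upds_cap d _ _ (fun=> set0)).
by rewrite (nth_map (fun=> set0)) //; exact: upds_cap.
Qed.

(** With the clause on parameters, agreement at almost all [d] holds for every path: if the
    parameters are not all in V_k, both sides are false. *)
Definition Tr (d : zfset) (s : seq zfset) (fs : seq (nat -> set zfset)) : Prop :=
  if (tp s).1.2 is FO r then fo_par1 r `<=` cumV d /\
    fo_sat (cumV d) (fun=> ozero) (en s fs) (fo_cap_par2 (cumV d) r)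
  else False.

Lemma Tr_almost k s Ys : inacc k ->
  almost k (fun d => Tr d s (map dec (map (capV d) Ys)) <-> Tr k s (map dec Ys)).
Proof.
move=> ik; have lk := inacc_limit ik; rewrite /Tr.
case: (tp s).1.2 => [r|n q|n q|la f|la f]; try by apply: almost_all.
have H d : is_limit d -> en s (map dec (map (capV d) Ys)) = fun v => capV d (en s (map dec Ys) v).
  move=> ld; rewrite -en_cap -!map_comp; congr en; apply: eq_map => Y /=; exact: dec_cap.
have [hr|hr] := pselect (fo_par1 r `<=` cumV k); last first.
  apply: almost_all => // d dk ld; split=> -[h _]; case: hr => //.
  by move=> x /h; apply: cumV_mono; [exact: limit_ord|left].
apply: almost_mono (almost_elementary ik (en s (map dec Ys)) hr) => d dk ld [h1 h2].
rewrite H // -h2; last by move=> _; exact: cumV_zero.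
by split=> -[_ h].
Qed.

Section Paths.
Hypotheses (hb : canonical_bijections b) (rmu : is_regular mu).
Hypothesis lXi : lt_cardinal_succ mu Xi.

Lemma path_inj s s' : (forall z, z \in s -> z ∈ Xi) -> (forall z, z \in s' -> z ∈ Xi) ->
  lst (map c s) = lst (map c s') -> s = s'.
Proof.
move=> h h' /lst_inj; elim: s s' h h' => [|z s IH] [|z' s'] //= h h' [E1 E2].
congr cons; last by apply: IH => // y hy; [apply: h|apply: h']; rewrite in_cons hy orbT.
by apply: (code_inj hb rmu lXi) E1; [apply: h|apply: h']; rewrite mem_head.
Qed.

(** A path is determined by its code, so the clubs for the single paths are met by a diagonal
    intersection over the codes in V_d. *)
Lemma almost_agree k O D Ys : inacc k -> frame b mu Xi k O D -> almost k (fun d => agree b mu Xi k D Tr d Ys).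
Proof.
move=> ik fr; have lk := inacc_limit ik.
have DX s : (forall z, z \in s -> D z) -> forall z, z \in s -> z ∈ Xi.
  by move=> h z /h /(fr_code fr)[].
have A : almost k (fun d => forall x, cumV d x -> forall s, (forall z, z \in s -> D z) ->
    lst (map c s) = x -> (Tr d s (map dec (map (capV d) Ys)) <-> Tr k s (map dec Ys))).
  apply: almost_diag => // x kx.
  have [[s [hs E]]|h] := pselect (exists s, (forall z, z \in s -> D z) /\ lst (map c s) = x); last first.
    by apply: almost_all => // d _ _ s hs E; case: h; exists s.
  apply: almost_mono (Tr_almost s Ys ik) => d _ _ h s' hs' E'.
  by rewrite (@path_inj s' s) //; [exact: DX|exact: DX|rewrite E'].
by apply: almost_mono A => d _ _ h s hs hp; exact: (h _ hp).
Qed.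

End Paths.

Section SatCap.
Variables (k : zfset) (O : zfset -> set zfset) (D : set zfset) (X : set zfset).
Hypotheses (lk : is_limit k) (Do : forall ze, D ze -> is_ordinal ze).
Hypothesis (pi0 : pi ozero = ozero).
Hypothesis DS : forall d, D (osucc d) -> D d /\ pi (osucc d) = osucc (pi d).
Hypothesis DL : forall la z, D la -> is_limit la -> z ∈ la -> O la z -> D z.
Hypothesis piL : forall la, D la -> is_limit la -> is_limit (pi la) /\
  forall z', z' ∈ pi la <-> exists z, [/\ z ∈ la, O la z & pi z = z'].
Notation M := (cumV k).
Notation W := (WT k Tr).

(** Each step of the play is one step in evaluating the formula: the player and the residual formula
    stay in phase because [tp] changes the polarity exactly at successor levels, and [j] counts the
    moves used by [en]. *)
Lemma sat_cap_gm ze s pol p Ys : D ze -> tp (ze :: s) = (pol, p, size Ys) ->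
  PiSig al pol (pi ze) p -> par1 p `<=` M ->
  sat M (fun=> ozero) (en (ze :: s) (map dec Ys)) (cap_par2 M p) <->
  gm O M W ze pol (ze :: s) (X :: Ys).
Proof.
move=> Dz; have oz := Do Dz.
elim/ord_ind: ze / oz Dz s pol p Ys => [|d od IH|la ll IH] Dz s pol p Ys E hp hpar.
- rewrite gm0 /WT /Tr E /=; move: hp hpar; rewrite pi0 => /PiSig_zero[r -> _] /= hr.
  by split=> [h|[]//]; split.
- have [Dd piS] := DS Dz; rewrite piS in hp.
  have [E1 E2] := tp_succ E; have [Ep hq] := stripP hp.
  have hparq : par1 (strip pol (pi d) p).2 `<=` M by rewrite -(par1_quant pol (strip pol (pi d) p).1) -Ep.
  have key Y : sat M (fun=> ozero)
       (upds (en (osucc d :: s) (map dec Ys)) (strip pol (pi d) p).1 (dec Y))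
       (cap_par2 M (strip pol (pi d) p).2) <->
      gm O M W d (~~ pol) (d :: osucc d :: s) (X :: rcons Ys Y).
    rewrite -(IH Dd (osucc d :: s) (~~ pol) (strip pol (pi d) p).2 (rcons Ys Y)) //; last by rewrite E1 size_rcons.
    rewrite E2 map_rcons nth_rcons size_map ltnn eqxx en_rcons //.
    by rewrite E size_map.
  rewrite gmS {1}Ep cap_quant sat_quant blk_dec //.
  case: (pol) key => /= key; first by split=> h Y YM; apply/key; exact: h.
  by split=> -[Y YM h]; exists Y => //; apply/key.
have [lpi piE] := piL Dz ll.
have [f [Ep hf _ _]] := PiSig_limit lpi hp.
have key z : z ∈ la -> O la z ->
    sat M (fun=> ozero) (en (la :: s) (map dec Ys)) (cap_par2 M (f (pi z))) <->
    gm O M W z pol (z :: la :: s) (X :: Ys).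
  move=> zl Oz; have [E1 E2] := tp_limit z ll E.
  have zpi : pi z ∈ pi la by apply/piE; exists z.
  have Ef : sub_at p (pi z) = f (pi z) by rewrite Ep; case: (pol).
  rewrite -(IH z zl (DL Dz ll zl Oz) (la :: s) pol (f (pi z))) ?E2 //.
  - by rewrite E1 Ef.
  - exact: hf.
  - by move=> x hx; apply: hpar; rewrite Ep; case: (pol); exists (pi z).
rewrite {1}Ep; case: (pol) key => key /=.
  rewrite (gmLt _ _ _ _ _ ll); split.
    by move=> h z zl Oz; apply/key => //; apply: h; apply/piE; exists z.
  by move=> h z' /piE[z [zl Oz <-]]; apply/key => //; exact: h.
rewrite (gmLf _ _ _ _ _ ll); split.
  by move=> [z' /piE[z [zl Oz <-]] h]; exists z; split=> //; apply/key.
by move=> [z [zl Oz h]]; exists (pi z); [apply/piE; exists z|apply/key].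
Qed.

End SatCap.
End Residual.

(** * Restriction of an arbitrary formula *)

Section Restrict.
Variables (b : zfset -> zfset -> zfset -> zfset) (mu xi al be : zfset) (phi : formula).
Hypotheses (hb : canonical_bijections b) (rmu : is_regular mu).
Let Xi := osucc xi.
Notation c := (code b mu Xi).
Notation pi := (collapse (canF b mu xi al)).
Let eta := pi xi.
Notation rho := (collapse (canF b al eta be)).
Hypothesis lXi : lt_cardinal_succ mu Xi.
Hypotheses (alm : al ∈ mu) (gal : good b mu Xi al) (hxia : dom b mu Xi Xi al xi).
Hypotheses (ral : is_regular al) (leta : lt_cardinal_succ al eta).
Hypotheses (beal : be ∈ al) (lbe : is_limit be) (gbe : good b mu Xi be) (gbe' : good b al eta be).
Hypothesis hxib : dom b mu Xi Xi be xi.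
Notation D := (dom b mu Xi xi be).
Hypothesis coh : forall ze, D ze -> dom b al eta eta be (pi ze) /\
  forall z', canF b al (pi ze) be z' <-> exists2 z, canF b mu ze be z & pi z = z'.
Notation inD s := (forall z, z \in s -> D z).
Notation T := (tp b mu xi al phi).
Hypothesis hlow : forall s ze pol p j, inD (ze :: s) -> T (ze :: s) = (pol, p, j) ->
  PiSig al pol (pi ze) p -> pi ze ∈ al -> par1 p `<=` cumV be.
Let omu : is_ordinal mu. Proof. by case: rmu => _ /limit_ord. Qed.
Let oal : is_ordinal al. Proof. exact: is_ordinal_in alm. Qed.
Let obe : is_ordinal be. Proof. exact: limit_ord. Qed.
Let bem : be ∈ mu. Proof. exact: ord_trans omu beal alm. Qed.
Let heta : dom b al eta eta be eta. Proof. by left. Qed.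
Let oeta : is_ordinal eta. Proof. exact: ltcs_ord leta. Qed.
Notation E1 := (fun=> ozero : zfset).

Let Dal ze : D ze -> dom b mu Xi xi al ze. Proof. exact: dom_mono. Qed.

Let DO ze : D ze -> is_ordinal ze. Proof. exact: (dom_ordinal lXi hxib). Qed.

Let DP ze : D ze -> is_ordinal (pi ze).
Proof. by move=> /coh[[->|[/(is_ordinal_in oeta)]]]. Qed.

Let DS d : D (osucc d) -> D d /\ pi (osucc d) = osucc (pi d).
Proof.
move=> hd; split; last exact: (pi_succ hb rmu lXi alm gal hxia (Dal hd)).
by right; apply/(X_P hb rmu lXi bem gbe hxib); exact: (dom_succ hb rmu lXi bem gbe hxib hd).
Qed.

Let DL la z : D la -> z ∈ la -> canF b mu la be z -> D z /\ pi z ∈ pi la.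
Proof.
move=> hla zl Fz; have hz := dom_in hb rmu lXi bem gbe hxib hla Fz; split=> //.
apply/(pi_elts hb rmu lXi alm gal hxia _ (Dal hla)); exists z => //.
apply/(dom_canF hb rmu lXi alm gal hxia z (Dal hla)); split=> //.
have [_ h] := proj1 (dom_canF hb rmu lXi bem gbe hxib z hla) Fz.
exact: ord_trans h beal.
Qed.

Let canF_mem la z : D la -> canF b mu la be z -> z ∈ la.
Proof. by move=> hla /(dom_canF hb rmu lXi bem gbe hxib z hla)[]. Qed.

(** A level below [al] with a code below [be] lies below [be] itself, and so do its elements, hence
    the collapse fixes it. This matches the clause of [restr] that keeps such levels. *)
Lemma rho_low y : dom b al eta eta be y -> y ∈ al -> rho y = y.
Proof.
move=> hy yal; have oy := is_ordinal_in oal yal.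
have ybe : y ∈ be.
  case: hy => [E|[ye yb]]; last exact/(good_low gbe' ye yal).
  by rewrite E; apply: (good_top gbe'); rewrite -E.
apply: collapse_id => // z zy; apply/(X_P hb ral leta beal gbe' heta).
have ze : z ∈ eta by case: hy => [<-//|[ye _]]; exact: ord_trans ye.
by split=> //; apply/(good_low gbe' ze); [exact: ord_trans yal|exact: ord_trans ybe].
Qed.

Lemma canpi_rho la y : dom b al eta eta be la -> canF b al la be y -> canpi b al la be y = rho y.
Proof.
move=> hla Fy; have [yl yb] := proj1 (dom_canF hb ral leta beal gbe' heta y hla) Fy.
have ola : is_ordinal la by case: hla => [->//|[/(is_ordinal_in oeta)]].
apply: collapse_restr; first exact: is_ordinal_in yl.
move=> w wy; rewrite (dom_canF hb ral leta beal gbe' heta w hla) (X_P hb ral leta beal gbe' heta).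
have wl : w ∈ la by exact: ord_trans yl.
by split=> -[_ h]; split=> //; case: hla => [<-//|[le _]]; exact: ord_trans le.
Qed.

Lemma canf_rho la : dom b al eta eta be la -> canf b al la be = rho la.
Proof.
move=> hla; apply: zfset_ext => w; rewrite (pi_elts hb ral leta beal gbe' heta w hla).
rewrite canf_elts; last by move=> z /(dom_canF hb ral leta beal gbe' heta z hla)[].
by split=> -[y Fy <-]; exists y; rewrite // canpi_rho.
Qed.

Variable X : set zfset.
Notation G := (gm (fun ze => canF b mu ze be) (cumV be) (WT be (Tr b mu xi al phi))).
Notation e s Ys := (en b mu xi al phi s (map dec Ys)).

Lemma sat_low ze s pol p Ys : D ze -> inD s -> pi ze ∈ al -> T (ze :: s) = (pol, p, size Ys) ->
  PiSig al pol (pi ze) p ->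
  sat (cumV be) E1 (e (ze :: s) Ys) (cap_par2 (cumV be) p) <-> G ze pol (ze :: s) (X :: Ys).
Proof.
move=> Dz hs zal Et hp; apply: (@sat_cap_gm b mu xi al phi be _ (fun z => D z /\ pi z ∈ al)) => //.
- by move=> z [/DO].
- exact: pi_zero.
- move=> d [hd pd]; have [Dd E] := DS hd; split=> //; split=> //.
  by apply: ord_trans pd => //; rewrite E; exact: osucc_mem.
- move=> la z [hla pla] ll zl Fz; have [Dz' pz] := DL hla zl Fz; split=> //.
  exact: ord_trans pla.
- move=> la [hla pla] ll; split; first exact: (pi_limit hb rmu lXi alm gal hxia (Dal hla) ll).
  move=> z'; have := proj2 (coh hla) z'; rewrite /canF asboolT // => -[h1 h2]; split.
    by move=> /h1[z Fz Ez]; exists z; split=> //; exact: canF_mem Fz.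
  by move=> [z [_ Fz Ez]]; apply: h2; exists z.
- by apply: hlow Et hp zal => z; rewrite in_cons => /orP[/eqP->|/hs].
Qed.

(** A restriction may be undefined, so [q] is built together with the proof that it has the right
    class; the bounds on [fv2] and [par2] serve the finiteness provisos at limits. Its truth is
    compared directly with the game at [be]. *)
Lemma restr_exists ze s pol p j : D ze -> inD s -> T (ze :: s) = (pol, p, j) ->
  PiSig al pol (pi ze) p ->
  exists q, [/\ restr b al be (pi ze) p q, PiSig be pol (rho (pi ze)) q,
    fv2 q `<=` fv2 p, par2 q `<=` (fun A => A `&` cumV be) @` par2 p &
    forall Ys, size Ys = j ->
      (sat (cumV be) E1 (e (ze :: s) Ys) q <-> G ze pol (ze :: s) (X :: Ys))].
Proof.
move=> Dz; have oz := DO Dz.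
have low ze' s' pol' p' j' : D ze' -> inD s' -> T (ze' :: s') = (pol', p', j') ->
    PiSig al pol' (pi ze') p' -> pi ze' ∈ al ->
    exists q, [/\ restr b al be (pi ze') p' q, PiSig be pol' (rho (pi ze')) q,
      fv2 q `<=` fv2 p', par2 q `<=` (fun A => A `&` cumV be) @` par2 p' &
      forall Ys, size Ys = j' ->
        (sat (cumV be) E1 (e (ze' :: s') Ys) q <-> G ze' pol' (ze' :: s') (X :: Ys))].
  move=> Dz' hs' Et hp zal; exists (cap_par2 (cumV be) p'); split.
  - exact: restr_low.
  - rewrite rho_low //; last by case: (coh Dz').
    apply: (@PiSig_cap al) => //; first exact: DP.
    by apply: hlow Et hp zal => z; rewrite in_cons => /orP[/eqP->|/hs'].
  - by rewrite fv2_cap.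
  - exact: par2_cap.
  - by move=> Ys hj; apply: sat_low => //; rewrite hj.
elim/ord_ind: ze / oz Dz s pol p j => [|d od IH|la ll IH] Dz s pol p j hs Et hp.
- apply: (low _ _ _ _ _ Dz hs Et hp); rewrite pi_zero; apply: limit_zero; by case: ral.
- have [zal|nzal] := pselect (pi (osucc d) ∈ al); first exact: (low _ _ _ _ _ Dz hs Et hp zal).
  have [Dd piS] := DS Dz; rewrite piS in hp nzal *.
  have kx := not_mem_ole ral (ord_succ (DP Dd)) nzal.
  have [T1 T2] := tp_succ Et; have [Ep hq] := stripP hp.
  move: (strip al pol (pi d) p).1 (strip al pol (pi d) p).2 T1 T2 Ep hq => l r T1 T2 Ep hq.
  have hs' : inD (osucc d :: s) by move=> z; rewrite in_cons => /orP[/eqP->|/hs].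
  have [q [q1 q2 q3 q4 q5]] := IH Dd (osucc d :: s) _ _ _ hs' T1 hq.
  exists (foldr (quant pol) q l); split=> //.
  + rewrite Ep; case: (pol) q1; [exact: restr_all|exact: restr_ex].
  + have Xd : canF b al eta be (pi d).
      apply: (dom_succ hb ral leta beal gbe' heta); rewrite -piS; by case: (coh Dz).
    rewrite collapse_succ //; case: (pol) q2 => /= q2; [exact: Pi_succ|exact: Sigma_succ].
  + move=> v; rewrite Ep; have hF r' : fv2 (foldr (quant pol) r' l) = fv2 r' `\` [set v | v \in l].
      elim: (l) => [|n l' IHl] /=; first by apply/seteqP; split=> x /=; [split|case].
      have -> : fv2 (quant pol n (foldr (quant pol) r' l')) = fv2 (foldr (quant pol) r' l') `\ n by case: (pol).
      rewrite IHl; apply/seteqP; split=> x /=; rewrite in_cons.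
        by move=> [[h1 h2] h3]; split=> // /orP[/eqP|].
      by move=> [h1 h2]; split; [split=> // h3; apply: h2; rewrite h3 orbT|move=> h3; apply: h2; rewrite h3 eqxx].
    by rewrite !hF => -[h1 h2]; split=> //; exact: q3.
  + by rewrite Ep !par2_quant.
  + move=> Ys hj; have key Y : sat (cumV be) E1 (upds (e (osucc d :: s) Ys) l (dec Y)) q <->
        G d (~~ pol) (d :: osucc d :: s) (X :: rcons Ys Y).
      rewrite -q5; last by rewrite size_rcons hj.
      rewrite T2 map_rcons nth_rcons size_map hj ltnn eqxx en_rcons //.
      by rewrite Et size_map hj.
    rewrite gmS sat_quant blk_dec //; case: (pol) key => /= key.
      by split=> h Y YM; apply/key; exact: h.
    by split=> -[Y YM h]; exists Y => //; apply/key.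
have [zal|nzal] := pselect (pi la ∈ al); first exact: (low _ _ _ _ _ Dz hs Et hp zal).
have kx := not_mem_ole ral (DP Dz) nzal.
have lpi := pi_limit hb rmu lXi alm gal hxia (Dal Dz) ll.
have [f [Ep hf f2 fp]] := PiSig_limit lpi hp.
have [dpi cohla] := coh Dz.
have hs' : inD (la :: s) by move=> z; rewrite in_cons => /orP[/eqP->|/hs].
have fvf y : y ∈ pi la -> fv2 (f y) `<=` fv2 p by rewrite Ep => yl x hx; case: (pol); exists y.
have parf y : y ∈ pi la -> par2 (f y) `<=` par2 p by rewrite Ep => yl x hx; case: (pol); exists y.
pose Q y q := [/\ restr b al be y (f y) q, PiSig be pol (rho y) q,
    fv2 q `<=` fv2 p, par2 q `<=` (fun A => A `&` cumV be) @` par2 p &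
    forall z, z ∈ la -> canF b mu la be z -> pi z = y -> forall Ys, size Ys = j ->
      (sat (cumV be) E1 (e (la :: s) Ys) q <-> G z pol (z :: la :: s) (X :: Ys))].
(* The restricted conjuncts may be chosen by [y] rather than by [z], because [pi] is injective on
   the levels of the game. *)
have /choice[qf qfP] : forall y, exists q, canF b al (pi la) be y -> Q y q.
  move=> y; have [/cohla[z Fz Ey]|nF] := pselect (canF b al (pi la) be y); last by exists p.
  have zl := canF_mem Dz Fz; have [Dz' zpi] := DL Dz zl Fz.
  have [T1 T2] := tp_limit z ll Et.
  have Ef : sub_at p (pi z) = f (pi z) by rewrite Ep; case: (pol).
  rewrite Ef in T1.
  have [q [q1 q2 q3 q4 q5]] := IH z zl Dz' (la :: s) _ _ _ hs' T1 (hf _ zpi).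
  exists q => _; rewrite -Ey; split=> //.
  - by move=> v /q3; exact: fvf.
  - by move=> A /q4[B hB <-]; exists B => //; exact: parf hB.
  move=> z' zl' Fz' Ez Ys hj; have [Dz'' _] := DL Dz zl' Fz'.
  have -> : z' = z by apply: (pi_inj hb rmu lXi alm gal hxia (Dal Dz'') (Dal Dz') Ez).
  by rewrite -q5 // T2.
(* The new conjunction is indexed by collapsed levels, so [rho] has to be inverted. *)
pose ix w := xget ozero [set y | canF b al (pi la) be y /\ rho y = w].
have ixK y : canF b al (pi la) be y -> ix (rho y) = y.
  move=> Fy; rewrite /ix; case: xgetP => [y' _ [Fy' E]|/(_ y)]; last by case.
  have dom_y w : canF b al (pi la) be w -> dom b al eta eta be w.
    exact: (dom_in hb ral leta beal gbe' heta dpi).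
  exact: (pi_inj hb ral leta beal gbe' heta (dom_y _ Fy') (dom_y _ Fy) E).
pose g w := qf (ix w).
have gE y : canF b al (pi la) be y -> g (canpi b al (pi la) be y) = qf y.
  by move=> Fy; rewrite canpi_rho // /g ixK.
have canfP w : w ∈ canf b al (pi la) be <-> exists2 y, canF b al (pi la) be y & rho y = w.
  by rewrite canf_rho // (pi_elts hb ral leta beal gbe' heta w dpi).
have Qg w : w ∈ canf b al (pi la) be -> exists2 y, canF b al (pi la) be y & rho y = w /\ Q y (g w).
  by move=> /canfP[y Fy <-]; exists y => //; split=> //; rewrite /g ixK //; exact: qfP.
have fv2g : fv2 (bigc pol (canf b al (pi la) be) g) `<=` fv2 p.
  have H w v : w ∈ canf b al (pi la) be -> fv2 (g w) v -> fv2 p v.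
    by move=> /Qg[y _ [_ [_ _ h _ _]]] /h.
  by case: (pol) => /= v [w hw hv]; exact: H hw hv.
have par2g : par2 (bigc pol (canf b al (pi la) be) g) `<=` (fun A => A `&` cumV be) @` par2 p.
  have H w A : w ∈ canf b al (pi la) be -> par2 (g w) A -> ((fun A => A `&` cumV be) @` par2 p) A.
    by move=> /Qg[y _ [_ [_ _ _ h _]]] /h.
  by case: (pol) => /= v [w hw hv]; exact: H hw hv.
have R1 y : canF b al (pi la) be y -> restr b al be y (f y) (g (canpi b al (pi la) be y)).
  by move=> Fy; rewrite gE //; case: (qfP y Fy).
have R2 y : canF b al (pi la) be y -> PiSig be pol (canpi b al (pi la) be y) (g (canpi b al (pi la) be y)).
  by move=> Fy; rewrite gE // canpi_rho //; case: (qfP y Fy).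
have lrho : is_limit (rho (pi la)) by exact: (pi_limit hb ral leta beal gbe' heta dpi lpi).
exists (bigc pol (canf b al (pi la) be) g); split=> //.
- by rewrite Ep; case: (pol) R2 => R2; [exact: restr_and|exact: restr_or].
- have f2' : finite_set (fv2 (bigc pol (rho (pi la)) g)).
    by rewrite -canf_rho //; exact: sub_finite_set fv2g f2.
  have fp' : finite_set (par2 (bigc pol (rho (pi la)) g)).
    by rewrite -canf_rho //; exact: finite_cap par2g fp.
  have hg w : w ∈ rho (pi la) -> PiSig be pol w (g w).
    by rewrite -canf_rho // => /Qg[y _ [<- [_ h _ _ _]]].
  rewrite canf_rho //; move: f2' fp' hg; case: (pol) => /= f2' fp' hg; [exact: Pi_limit|exact: Sigma_limit].
move=> Ys hj.
have key z : z ∈ la -> canF b mu la be z -> pi z ∈ pi la /\ canF b al (pi la) be (pi z) /\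
    (sat (cumV be) E1 (e (la :: s) Ys) (g (rho (pi z))) <-> G z pol (z :: la :: s) (X :: Ys)).
  move=> zl Fz; have Fy : canF b al (pi la) be (pi z) by apply/cohla; exists z.
  split; first by case: (DL Dz zl Fz).
  by split=> //; rewrite /g ixK //; have [_ _ _ _ h] := qfP _ Fy; exact: h.
case: (pol) key => key /=.
  rewrite (gmLt _ _ _ _ _ ll); split.
    move=> h z zl Fz; have [_ [Fy K]] := key z zl Fz; apply/K; apply: h.
    by apply/canfP; exists (pi z).
  move=> h w /canfP[y /cohla[z Fz <-] <-]; have zl := canF_mem Dz Fz.
  by have [_ [Fy K]] := key z zl Fz; apply/K; exact: h.
rewrite (gmLf _ _ _ _ _ ll); split.
  move=> [w /canfP[y /cohla[z Fz <-] <-]] h; have zl := canF_mem Dz Fz.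
  by exists z; split=> //; have [_ [Fy K]] := key z zl Fz; apply/K.
move=> [z [zl Fz h]]; have [_ [Fy K]] := key z zl Fz.
by exists (rho (pi z)); [apply/canfP; exists (pi z)|apply/K].
Qed.

End Restrict.

(** * From reflection of games to indescribability *)

Section Conclusion.
Variables (b : zfset -> zfset -> zfset -> zfset) (mu xi : zfset).
Hypotheses (hb : canonical_bijections b) (rmu : is_regular mu).
Let Xi := osucc xi.
Hypothesis lXi : lt_cardinal_succ mu Xi.
Notation c := (code b mu Xi).
Variable h : zfset -> zfset.
Hypothesis hgood : forall g, g ∈ mu -> clos h g -> good b mu Xi g /\ (is_regular g -> inacc g).
Let omu : is_ordinal mu. Proof. by case: rmu => _ /limit_ord. Qed.

Section Witness.
Variable al : zfset.
Hypotheses (alm : al ∈ mu) (ral : is_regular al) (hal : clos h al).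
Let lal : is_limit al. Proof. by case: ral. Qed.
Let oal : is_ordinal al. Proof. exact: limit_ord. Qed.
Let gal : good b mu Xi al. Proof. by case: (hgood alm hal). Qed.
Let ial : inacc al. Proof. by have [_] := hgood alm hal; apply. Qed.
Let hxia : dom b mu Xi Xi al xi. Proof. exact: top_dom. Qed.
Notation pi := (collapse (canF b mu xi al)).
Let eta := pi xi.
Let leta : lt_cardinal_succ al eta.
Proof. by apply: (pi_top_ltcs hb rmu lXi alm gal hxia); case: ral. Qed.
Hypothesis refl : forall X, X `<=` cumV al -> unbD al X ->
  gm_at b mu xi (fun ze => canF b mu ze al) al X -> reflects b mu xi h al X.

Section Formula.
Variable phi : formula.
Hypothesis hphi : is_Pi al eta phi.
Notation T := (tp b mu xi al phi).
Notation TR := (Tr b mu xi al phi).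
Notation E1 := (fun=> ozero : zfset).

Lemma almost_par1 : almost al (fun be => forall s ze pol p j,
  (forall z, z \in ze :: s -> dom b mu Xi xi be z) -> T (ze :: s) = (pol, p, j) ->
  PiSig al pol (pi ze) p -> pi ze ∈ al -> par1 p `<=` cumV be).
Proof.
have A : almost al (fun be => forall x, cumV be x -> forall s ze pol p j,
    (forall z, z \in ze :: s -> z ∈ Xi) -> lst (map c (ze :: s)) = x -> T (ze :: s) = (pol, p, j) ->
    PiSig al pol (pi ze) p -> pi ze ∈ al -> par1 p `<=` cumV be).
  apply: almost_diag => // x ax.
  have [[s [ze [pol [p [j [hs E Et [hp zal]]]]]]]|nx] := pselect (exists s ze pol p j,
    [/\ forall z, z \in ze :: s -> z ∈ Xi, lst (map c (ze :: s)) = x, T (ze :: s) = (pol, p, j) &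
      PiSig al pol (pi ze) p /\ pi ze ∈ al]); last first.
    by apply: almost_all => // be _ _ s ze pol p j h1 h2 h3 h4 h5; case: nx; exists s, ze, pol, p, j.
  have [g gal' hg] := PiSig_par1 ial zal hp.
  apply: almost_mono (almost_const gal') => be _ lbe gbe s' ze' pol' p' j' hs' E' Et' _ _.
  have [Ez Es] : ze' :: s' = ze :: s by apply: (path_inj hb rmu lXi hs' hs); rewrite E'.
  move: Et'; rewrite Ez Es Et => -[_ <- _] y /hg; apply: cumV_mono; first exact: limit_ord.
  by left.
have G : almost al (good b mu Xi).
  exists h; first by case: hal.
  by move=> g gal' hg; have [] := hgood (ord_trans omu gal' alm) hg.
apply: almost_mono (almostI lal A G) => be beal lbe [hA gbe] s ze pol p j hs.
have fr := frame_good hb rmu lXi (ord_trans omu beal alm) gbe.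
have hX z : z \in ze :: s -> z ∈ Xi by move=> /hs /(fr_code fr)[].
apply: (hA (lst (map c (ze :: s)))) => //.
by apply/(cumV_lst _ lbe) => a /mapP[z /hs/(fr_code fr)[_ hz] ->].
Qed.

(** The relation part is the truth of the residual formulas of [phi] at all limits [d] below [al].
    The test points are the closure points of [hh], so that wherever they are unbounded the clubs
    behind [hh] are inherited. *)
Definition Xcode (hh : zfset -> zfset) : set zfset := [set x |
  (exists d s Ys, [/\ d ∈ al, is_limit d, forall z, z \in s -> z ∈ Xi, cumV d (lst (map c s)) &
     x = pr (ztag 0) (tup d (lst (map c s)) Ys) /\ TR d s (map dec (map (capV d) Ys))]) \/
  exists e, [/\ x = pr (ztag 1) e, e ∈ al & clos hh e]].

Lemma cumV_tup k d pc Ys : is_limit k -> d ∈ k -> cumV k pc -> cumV k (tup d pc Ys).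
Proof.
move=> lk dk hp; apply/(cumV_lst _ lk) => a; rewrite !in_cons => /orP[/eqP->|/orP[/eqP->//|]].
  exact: Vz_mem.
move=> /mapP[Y _ ->]; apply: cumV_subset (Vz_mem dk) _.
by rewrite cut_elts Vz_elts => x [].
Qed.

Lemma Xcode_sub hh : Xcode hh `<=` cumV al.
Proof.
move=> x [[d [s [Ys [dal ld _ hp [-> _]]]]]|[e [-> eal _]]]; apply/(cumV_pr _ _ lal); split;
  try exact: cumV_ztag.
  by apply: cumV_tup => //; apply: cumV_mono hp => //; left.
by apply: cumV_ordW => //; exact: is_ordinal_in eal.
Qed.

(** A coded tuple determines [d], the path and the traces on V_d, and [TR d] is applied to nothing
    else. Intersecting with V_k loses no tuple whose [d] is below [k]. *)
Lemma Xcode_rel hh k d s Ys : ole k al -> is_limit k -> d ∈ k -> is_limit d ->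
  (forall z, z \in s -> z ∈ Xi) -> cumV d (lst (map c s)) ->
  (Xcode hh `&` cumV k) (pr (ztag 0) (tup d (lst (map c s)) Ys)) <->
  TR d s (map dec (map (capV d) Ys)).
Proof.
move=> kal lk dk ld hs hp; split.
  case=> -[[d' [s' [Ys' [_ ld' hs' _ [/pr_inj[_ E] hT]]]]]|[e [/pr_inj[/ztag_inj//]]]] _.
  move: E => /lst_inj[Ed Ep EY].
  have E : d = d' by apply: Vz_inj Ed; exact: limit_ord.
  subst d'; have -> : s = s' by apply: (path_inj hb rmu lXi hs hs').
  suff -> : map (capV d) Ys = map (capV d) Ys' by [].
  have H Zs : map (capV d) Zs = map elts (map (cut d) Zs).
    by rewrite -map_comp; apply: eq_map => Y /=; rewrite cut_elts.
  by rewrite !H EY.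
move=> hT; split.
  by left; exists d, s, Ys; split=> //; exact: mem_ole_trans kal.
apply/(cumV_pr _ _ lk); split; first exact: cumV_ztag.
by apply: cumV_tup => //; apply: cumV_mono hp; [exact: limit_ord|left].
Qed.

Lemma Xcode_sec hh e : sec (ztag 1) (Xcode hh) e -> e ∈ al /\ clos hh e.
Proof.
by case=> [[d [s [Ys [_ _ _ _ [/pr_inj[/ztag_inj]]]]]]|[e' [/pr_inj[_ ->]]]].
Qed.

Lemma Xcode_clos hh d : is_limit d -> unbD d (Xcode hh) -> clos hh d.
Proof.
move=> ld hd; apply: clos_limit => // x /(cumV_limit ld)[e ed ex].
have [e' [e'd ee' /Xcode_sec[_ he']]] := hd e ed; exists e'; split=> //.
by apply: cumV_mono ex => //; [apply: is_ordinal_in e'd; exact: limit_ord|left].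
Qed.

Lemma formula_reflects : models al phi ->
  exists a q, [/\ a ∈ al, is_regular a, restr b al a eta phi q, formula_over a q & models a q].
Proof.
move=> hmod.
have fr := frame_good hb rmu lXi alm gal.
have G : almost al (good b mu Xi).
  exists h; first by case: hal.
  by move=> g gal' hg; have [] := hgood (ord_trans omu gal' alm) hg.
have A1 := almost_agree al phi hb rmu lXi [::] ial fr.
have A2 := almost_code_pi hb rmu lXi alm gal hxia ral leta G.
have A3 := almost_coherent hb rmu lXi alm gal hxia ral leta G.
(* One function collects agreement for the empty play, the comparison of codes, coherence and the
   bound on parameters. *)
have [hh hhm hAL] := almostI lal A1 (almostI lal A2 (almostI lal A3 almost_par1)).
pose X := Xcode hh; have XV : X `<=` cumV al by exact: Xcode_sub.
have Xal : X `&` cumV al = X by rewrite setIidl.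
have hu : unbD al X.
  move=> e ea; have oe := is_ordinal_in oal ea.
  have [g [ga /(cumV_ord (is_ordinal_in oal ga) oe) eg hg]] := clos_unbounded ial hhm (cumV_ordW ea oe).
  by exists g; split=> //; right; exists g.
(* As no move follows [X], the test points are its own, and they are points of agreement by the
   choice of [hh]. Hence truth of [phi] yields truth of the game for [X]. *)
have hon : honest b mu Xi al (dom b mu Xi xi al) TR X [::].
  by split=> // d dal ld /(Xcode_clos ld) hd; case: (hAL d dal hd).
have inD (s : seq zfset) k : (forall z, z \in s -> dom b mu Xi xi k z) -> frame b mu Xi k (fun ze => canF b mu ze k)
    (dom b mu Xi xi k) -> forall z, z \in s -> z ∈ Xi.
  by move=> hs fr' z /hs /(fr_code fr')[].
have hs0 k z : z \in [:: xi] -> dom b mu Xi xi k z by rewrite inE => /eqP ->; left.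
have hWT : gm (fun ze => canF b mu ze al) (cumV al) (WT al TR) xi true [:: xi] [:: X].
  have Dxi : dom b mu Xi xi al xi by left.
  apply/(@sat_cap_gm b mu xi al phi al (fun ze => canF b mu ze al) (dom b mu Xi xi al) X lal _ _ _ _ _
    xi [::] true phi [::] Dxi erefl) => //.
  - exact: (dom_ordinal lXi hxia).
  - exact: pi_zero.
  - move=> d hd; split; last exact: (pi_succ hb rmu lXi alm gal hxia hd).
    by right; apply/(X_P hb rmu lXi alm gal hxia); exact: (dom_succ hb rmu lXi alm gal hxia hd).
  - by move=> la z hla ll zl Fz; exact: (dom_in hb rmu lXi alm gal hxia hla Fz).
  - move=> la hla ll; split; first exact: (pi_limit hb rmu lXi alm gal hxia hla ll).
    move=> z'; rewrite (pi_elts hb rmu lXi alm gal hxia z' hla); split.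
      move=> [z Fz E]; exists z; split=> //.
      by have [] := proj1 (dom_canF hb rmu lXi alm gal hxia z hla) Fz.
    by move=> [z [_ Fz E]]; exists z.
  - by have [] := @PiSig_over al true eta phi hphi (ltcs_ord leta).
  apply/sat_cap_id; last exact: hmod.
  by have [] := @PiSig_over al true eta phi hphi (ltcs_ord leta).
have hgm : gm_at b mu xi (fun ze => canF b mu ze al) al X.
  have agr Ys (_ : forall Y, Y \in Ys -> Y `<=` cumV al) := almost_agree al phi hb rmu lXi Ys ial fr.
  have cod d s Ys (dal : d ∈ al) (ld : is_limit d) (hs : forall z, z \in s -> dom b mu Xi xi al z)
      (hp : cumV d (lst (map c s))) : X (pr (ztag 0) (tup d (lst (map c s)) Ys)) <->
      TR d s (map dec (map (capV d) Ys)).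
    by have := @Xcode_rel hh al d s Ys (or_intror erefl) lal dal ld (inD _ _ hs fr) hp; rewrite Xal.
  have Dxi : dom b mu Xi xi al xi by left.
  have h0 : forall Y, Y \in [::] -> Y `<=` cumV al by [].
  by have [_ /(_ hon)] := gm_honest fr ial agr cod true Dxi (hs0 al) h0; apply.
have [be [beal rbe hbe hube hgmbe]] := refl XV hu hgm.
have bem := ord_trans omu beal alm.
have [_ lbe _] := rbe.
have [gbe /(_ rbe) ibe] := hgood bem hbe.
(* The test points of [X] are unbounded in [be], so [be] is a closure point of [hh]. *)
have hAbe := hAL be beal (Xcode_clos lbe hube).
have [_ [[_ hxib gbe' _] [hcoh hlow]]] := hAbe.
have frb := frame_good hb rmu lXi bem gbe.
have [] := @restr_exists b mu xi al be phi hb rmu lXi alm gal hxia ral leta beal lbe gbe gbe' hxib hcoh hlow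
  (X `&` cumV be) xi [::] true phi 0 (or_introl erefl) _ erefl hphi; first by [].
move=> q [q1 q2 _ _ q3]; exists be, q; split=> //.
  apply: (PiSig_over (pol := true) q2); apply: collapse_ordinal; last exact: ltcs_ord leta.
  move=> z; exact: (X_ord hb ral leta beal gbe' (or_introl erefl)).
apply/(q3 [::] erefl).
have agr Ys (_ : forall Y, Y \in Ys -> Y `<=` cumV be) := almost_agree al phi hb rmu lXi Ys ibe frb.
have cod d s Ys (dbe : d ∈ be) (ld : is_limit d) (hs : forall z, z \in s -> dom b mu Xi xi be z)
    (hp : cumV d (lst (map c s))) : (X `&` cumV be) (pr (ztag 0) (tup d (lst (map c s)) Ys)) <->
    TR d s (map dec (map (capV d) Ys)).
  exact: (@Xcode_rel hh be d s Ys (or_introl beal) lbe dbe ld (inD _ _ hs frb) hp).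
have Dxi : dom b mu Xi xi be xi by left.
have h0 : forall Y, Y \in [::] -> Y `<=` cumV be by [].
(* At [be] the passage is from the value of the game to truth, the direction that holds for
   dishonest moves as well. *)
by have [H _] := gm_honest frb ibe agr cod true Dxi (hs0 be) h0; exact: H.
Qed.

End Formula.

Lemma indescribable_at : indescribable b al (canf b mu xi al).
Proof.
have -> : canf b mu xi al = eta by exact: (canf_pi hb rmu lXi alm gal hxia).
by split=> //; [case: ral|move=> p hp _; exact: formula_reflects].
Qed.

End Witness.
End Conclusion.

Lemma indescribable_stationary b mu xi : canonical_bijections b -> is_regular mu ->
  lt_cardinal_succ mu (osucc xi) -> indescribable b mu (osucc xi) ->
  stationary mu [set a | a ∈ mu /\ indescribable b a (canf b mu xi a)].
Proof.
move=> hb rmu lXi ind; have imu := indescribable_inacc hb ind; have lmu := inacc_limit imu.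
split; first by move=> a [].
move=> C clubC.
have [h hm hgood] := almostI lmu (almost_good hb rmu lXi) (regular_inacc imu).
have [al [Cal ral hal hr]] := universal_reflect hb rmu lXi ind hm hgood clubC.
have alm : al ∈ mu by case: clubC => /(_ _ Cal).
by exists al; split=> //; split=> //; exact: (indescribable_at hb rmu lXi hgood alm ral hal hr).
Qed.

Theorem corollary6p19
    (b : zfset -> zfset -> zfset -> zfset) (hb : canonical_bijections b)
    (mu xi : zfset) (hmu : is_regular mu) (hxi : lt_cardinal_succ mu xi) :
  let S := [set a | a ∈ mu /\ indescribable b a (canf b mu xi a)] in
  (indescribable b mu (osucc xi) -> stationary mu S) /\
  (stationary mu S ->
   exists a : below mu, nonisolated (tau b (osucc xi)) a).
Proof.
(* All codes refer to [osucc xi], so that the top level [xi] has a code too. *)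
have lXi : lt_cardinal_succ mu (osucc xi) by apply: ltcs_succ => //; case: hmu.
move=> S; split; first exact: indescribable_stationary.
exact: stationary_nonisolated.
Qed.
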